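(* Let $n\in\mathbb{N}$ and let $(x_i)_{1\le i\le n}\in(0,1)^n$ be a solution of the algebraic system $E^n_{4,9,12}$, i.e. \[ \frac{4}{x_i}+\frac{9}{x_i-1}+\sum_{j\neq i}\frac{12}{x_j-x_i}=0,\qquad 1\le i\le n . \] Let $w_i\in\mathfrak{H}$ with $J(w_i)=x_i$, and set \[ f_n=\frac{\eta^4}{(J-1)\prod_{i=1}^n (J-x_i)^2}. \] Then $f_n$ is a weight $2$ meromorphic modular form for $\mathrm{SL}_2(\mathbb{Z})$ (with a character) which does not vanish on $\mathfrak{H}$, whose poles in $\mathfrak{H}$ are double poles located at $i$ and at each $w_i$ (and their $\mathrm{SL}_2(\mathbb{Z})$-translates), all with zero residue. Moreover, if $h_n$ is a primitive of $f_n$ on $\mathfrak{H}$ (i.e. $h_n'=f_n$), then \[ \{h_n,\tau\}=2\pi^2\,\frac{(12n+7)^2}{6^2}\,E_4(\tau). \]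
   Context: $\mathfrak{H}$ is the upper half-plane, $q=e^{2\pi i\tau}$, $\eta(\tau)=q^{1/24}\prod_{n\ge1}(1-q^n)$, $E_4=1+240\sum_{n\ge1}\sigma_3(n)q^n$, $E_6=1-504\sum_{n\ge1}\sigma_5(n)q^n$ with $\sigma_k(n)=\sum_{d\mid n}d^k$, $\Delta=\eta^{24}$, and $J=E_4^3/(1728\Delta)$. For a meromorphic function $h$ on $\mathfrak{H}$, the Schwarz derivative is $\{h,\tau\}=\left(\frac{h''}{h'}\right)'-\frac12\left(\frac{h''}{h'}\right)^2$. *)

(* Defs.v *)
(* Stdlib reals and Coquelicot. *)
From Stdlib Require Import Reals ZArith Arith List Lia.
From Coquelicot Require Import Coquelicot.

Open Scope R_scope.

Definition upper_half_plane (z : C) : Prop := 0 < Im z.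

Definition Cexp (z : C) : C :=
  (exp (Re z) * cos (Im z), exp (Re z) * sin (Im z)).

(* Total operators, meaningful only when the series (product) converges. *)
Definition CSeries (a : nat -> C) : C :=
  (Series (fun n => Re (a n)), Series (fun n => Im (a n))).

Definition Cprod_list (l : list nat) (a : nat -> C) : C :=
  fold_right Cmult (RtoC 1) (map a l).

Definition CProd (a : nat -> C) : C :=
  (real (Lim_seq (fun N => Re (Cprod_list (seq 0 N) a))),
   real (Lim_seq (fun N => Im (Cprod_list (seq 0 N) a)))).

Definition Rsum_list (l : list nat) (a : nat -> R) : R :=
  fold_right Rplus 0 (map a l).

(** * Holomorphic and meromorphic functions *)

Definition holomorphic_at (f : C -> C) (p : C) : Prop :=
  exists r : R, 0 < r /\
    forall z : C, Cmod (z - p) < r ->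
      @ex_derive C_AbsRing C_NormedModule f z.

(* On a punctured disc around [p], f(z) = sum_k a_k (z - p)^(k - m). *)
Definition has_laurent (f : C -> C) (p : C) (m : nat) (a : nat -> C) : Prop :=
  exists r : R, 0 < r /\
    forall z : C, 0 < Cmod (z - p) < r ->
      @is_series C_AbsRing C_NormedModule
        (fun k => (a k * (z - p) ^ k)%C) ((z - p) ^ m * f z)%C.

Definition pole_of_order (f : C -> C) (p : C) (m : nat) : Prop :=
  (0 < m)%nat /\ exists a, has_laurent f p m a /\ a 0%nat <> RtoC 0.

Definition is_pole (f : C -> C) (p : C) : Prop :=
  exists m, pole_of_order f p m.

Definition is_residue (f : C -> C) (p rho : C) : Prop :=
  exists m a, has_laurent f p m a /\
    rho = match m with O => RtoC 0 | S k => a k end.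

Definition meromorphic_at (f : C -> C) (p : C) : Prop :=
  holomorphic_at f p \/ is_pole f p.

(* A meromorphic function is a total function whose values at its poles are
   irrelevant: identities between meromorphic functions are stated off poles. *)
Definition meromorphic_on_H (f : C -> C) : Prop :=
  forall tau, upper_half_plane tau -> meromorphic_at f tau.

Definition is_primitive_on_H (h f : C -> C) : Prop :=
  meromorphic_on_H h /\
  forall tau, upper_half_plane tau -> ~ is_pole h tau ->
    @is_derive C_AbsRing C_NormedModule h tau (f tau).

Definition schwarzian (h : C -> C) (tau : C) : C :=
  let g := fun z => (C_derive (C_derive h) z / C_derive h z)%C in
  (C_derive g tau - / 2 * g tau ^ 2)%C.

(** * The modular group *)

Record SL2Z := mkSL2Z {
  sl_a : Z; sl_b : Z; sl_c : Z; sl_d : Z;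
  sl_det : (sl_a * sl_d - sl_b * sl_c = 1)%Z }.

Lemma SL2Z_mul_det (g h : SL2Z) :
  ((sl_a g * sl_a h + sl_b g * sl_c h) * (sl_c g * sl_b h + sl_d g * sl_d h) -
   (sl_a g * sl_b h + sl_b g * sl_d h) * (sl_c g * sl_a h + sl_d g * sl_c h)
   = 1)%Z.
Proof.
  transitivity ((sl_a g * sl_d g - sl_b g * sl_c g) *
                (sl_a h * sl_d h - sl_b h * sl_c h))%Z; [ring|].
  now rewrite !sl_det.
Qed.

Definition SL2Z_mul (g h : SL2Z) : SL2Z := mkSL2Z _ _ _ _ (SL2Z_mul_det g h).

Definition automorphy (g : SL2Z) (tau : C) : C :=
  (RtoC (IZR (sl_c g)) * tau + RtoC (IZR (sl_d g)))%C.

Definition mobius (g : SL2Z) (tau : C) : C :=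
  ((RtoC (IZR (sl_a g)) * tau + RtoC (IZR (sl_b g))) / automorphy g tau)%C.

Definition SL2Z_equiv (z z' : C) : Prop := exists g : SL2Z, z = mobius g z'.

Definition is_character (chi : SL2Z -> C) : Prop :=
  (forall g, chi g <> RtoC 0) /\
  (forall g h, chi (SL2Z_mul g h) = (chi g * chi h)%C).

(* Near i*infinity, f is a meromorphic function of q^(1/N) for some N >= 1.
   A character of SL2(Z) has finite order, so such an N is the right notion. *)
Definition meromorphic_at_cusp (f : C -> C) : Prop :=
  exists (N : nat) (g : C -> C) (Y : R),
    (0 < N)%nat /\ meromorphic_at g (RtoC 0) /\
    forall tau, 0 < Im tau -> Y < Im tau ->
      f tau = g (Cexp (2 * PI * Ci * tau / INR N)%C).

Definition meromorphic_modular_form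
    (k : nat) (chi : SL2Z -> C) (f : C -> C) : Prop :=
  meromorphic_on_H f /\
  (forall g tau, upper_half_plane tau -> ~ is_pole f tau ->
     f (mobius g tau) = (chi g * automorphy g tau ^ k * f tau)%C) /\
  meromorphic_at_cusp f.

(** * Classical modular functions *)

Definition qpar (tau : C) : C := Cexp (2 * PI * Ci * tau)%C.

Definition sigma (k n : nat) : nat :=
  list_sum (map (fun d => Nat.pow d k)
                (filter (fun d => Nat.eqb (Nat.modulo n d) 0) (seq 1 n))).

Definition E4 (tau : C) : C :=
  (1 + 240 * CSeries (fun m => INR (sigma 3 (S m)) * qpar tau ^ S m))%C.

Definition eta (tau : C) : C :=
  (Cexp (2 * PI * Ci * tau / 24) * CProd (fun m => 1 - qpar tau ^ S m))%C.

Definition Delta (tau : C) : C := (eta tau ^ 24)%C.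

Definition J (tau : C) : C := (E4 tau ^ 3 / (1728 * Delta tau))%C.

(** * The algebraic system *)

(* The system E^n_{a,b,c} in the unknowns x_0, ..., x_(n-1); being a solution
   includes that no denominator vanishes. *)
Definition algebraic_system (a b c : R) (n : nat) (x : nat -> R) : Prop :=
  (forall i, (i < n)%nat -> x i <> 0 /\ x i <> 1) /\
  (forall i j, (i < n)%nat -> (j < n)%nat -> i <> j -> x i <> x j) /\
  (forall i, (i < n)%nat ->
     a / x i + b / (x i - 1)
     + Rsum_list (remove Nat.eq_dec i (seq 0 n)) (fun j => c / (x j - x i))
     = 0).

(* Pitfall on signs.  As the system is commonly printed (c = 12, with terms
   12 / (x_j - x_i)), it has no solution in (0,1)^n once n >= 2: the equation
   at the smallest unknown forces it above 4/13, the one at the largest unknown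
   forces that below 4/13.  Vanishing of the residues of [fn] at the points
   over x_i is the system with terms 12 / (x_i - x_j), which is c = -12.  Both
   signs are admitted here; for n <= 1 they coincide. *)
Definition solves_E_4_9_12 (n : nat) (x : nat -> R) : Prop :=
  algebraic_system 4 9 12 n x \/ algebraic_system 4 9 (-12) n x.

Definition fn (n : nat) (x : nat -> R) (tau : C) : C :=
  (eta tau ^ 4 /
   ((J tau - 1) * Cprod_list (seq 0 n) (fun i => (J tau - x i) ^ 2)))%C.

(* Main.v *)
Require Import Defs.
From Stdlib Require Import Reals ZArith Arith List Lia Lra Classical ClassicalEpsilon FunctionalExtensionality.
From Coquelicot Require Import Coquelicot.

Open Scope R_scope.

(** Write [D = (1/2 i pi) d/dtau].  The lattice sums [sum_n L_k(e(z) q^n)], with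
    [L_k(u) = sum_m m^(k-1) u^m] as a rational function of [u], are doubly periodic; comparing those
    for [tau] and [-1/tau] by the duplication formula gives the behaviour of [E2] and [E4] under [S],
    hence that of [eta^4], whose logarithmic derivative is [E2 / 6].  As a holomorphic function of
    level one and weight 0 that vanishes at the cusp is zero, Ramanujan's equations and
    [E4^3 - E6^2 = 1728 Delta] hold.

    On the standard fundamental domain [|q| < 0.006], where [E4] and [E6] are injective in [q]; so their
    only zeros there are [rho] (and [rho - 1]) and [i].  By the maximum principle [Im J < 0] inside the right
    half of this domain, and [J] is at least 1 or at most 0 on its vertical sides: values in (0,1) are
    taken on the arc, where [J] is injective because its derivative does not vanish.  This locates
    the zeros of [J - 1] and [J - x_i].

    At a pole [fn = A / V^2] with [V = E6] or [V = J - x_i] vanishing simply, and the residue is zero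
    iff [DA / A = D(DV) / DV]; for [V = J - x_i] this is the i-th equation of the system.  Finally, with
    [L = D fn / fn], the Schwarz derivative is [(2 i pi)^2 (DL - L^2 / 2)]; partial fractions and the
    system reduce [DL - L^2 / 2] to [- (12 n + 7)^2 / 72 * E4]. *)

(** * Complex differentiation *)

(** Duplication has factor [2^k] for [L_k], against four half periods. So a bounded doubly periodic
    defect shrinks to zero for k = 3 and k = 4, but k = 2, the case that governs [eta], is exactly
    the one without contraction. There the derivative of the defect is the defect for [L3], hence
    zero; the remaining constant is found by integrating once more, from the increment over a period
    of the symmetric sums of [L1], whose terms tend to 1/2 and -1/2 at the two ends. This constant
    is what makes [E2] only quasi-modular. All function theory rests on Cauchy's formula for
    circles, proved by shrinking the circle, which requires a continuous derivative; this is why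
    holomorphy is defined with one. Zeros are never counted by contour integrals: linear
    approximation in the nome, with explicit constants, takes the place of the valence formula, and
    the reality of [J] on the boundary of the half domain that of a degree argument. [E6] is built
    from [E4] and [E2] so that the equation for [E4] holds by construction; the other two equations
    are vanishing statements in weights 4 and 8. *)

Lemma Cmod_sub_sym (a b : C) : Cmod (a - b) = Cmod (b - a).
Proof. rewrite <- (Cmod_opp (a - b)). f_equal. ring. Qed.

Lemma Cmod_sub_triangle (a b c : C) : Cmod (a - c) <= Cmod (a - b) + Cmod (b - c).
Proof. replace (a - c)%C with ((a - b) + (b - c))%C by ring. apply Cmod_triangle. Qed.

Lemma Cmod_minus_le (a b : C) : Cmod (a - b) <= Cmod a + Cmod b.
Proof. rewrite <- (Cmod_opp b). apply Cmod_triangle. Qed.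

Lemma Cmod_reverse_triangle (a b : C) : Cmod a - Cmod b <= Cmod (a - b).
Proof.
  generalize (Cmod_triangle (a - b) b).
  replace (a - b + b)%C with a by ring. lra.
Qed.

Lemma im_le_Cmod (c : C) : Rabs (Im c) <= Cmod c.
Proof. eapply Rle_trans; [|apply Rmax_Cmod]. apply Rmax_r. Qed.

Lemma Cmod_le_re_im (c : C) : Cmod c <= Rabs (Re c) + Rabs (Im c).
Proof.
  replace c with (RtoC (Re c) + RtoC (Im c) * Ci)%C at 1.
  - eapply Rle_trans; [apply Cmod_triangle|].
    rewrite Cmod_mult, Cmod_Ci, !Cmod_R. lra.
  - destruct c; unfold Ci, Cplus, Cmult; simpl; f_equal; ring.
Qed.

Lemma C_ext (a b : C) : Re a = Re b -> Im a = Im b -> a = b.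
Proof. destruct a, b; simpl; intros; subst; reflexivity. Qed.

Lemma re_plus (a b : C) : Re (a + b) = Re a + Re b.
Proof. reflexivity. Qed.

Lemma im_plus (a b : C) : Im (a + b) = Im a + Im b.
Proof. reflexivity. Qed.

Lemma re_minus (a b : C) : Re (a - b) = Re a - Re b.
Proof. reflexivity. Qed.

Lemma im_minus (a b : C) : Im (a - b) = Im a - Im b.
Proof. reflexivity. Qed.

Lemma re_opp (a : C) : Re (- a) = - Re a.
Proof. reflexivity. Qed.

Lemma im_opp (a : C) : Im (- a) = - Im a.
Proof. reflexivity. Qed.

(** Epsilon-delta forms with [Cmod] as the only norm keep the estimates free of filters;
    [cderiv_is_derive] leads back to the derivative used in the theorem. *)
Definition ccont (f : C -> C) (z : C) : Prop :=
  forall eps, 0 < eps -> exists delta, 0 < delta /\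
    forall w, Cmod (w - z) < delta -> Cmod (f w - f z) < eps.

Definition cderiv (f : C -> C) (z d : C) : Prop :=
  forall eps, 0 < eps -> exists delta, 0 < delta /\
    forall w, Cmod (w - z) < delta ->
      Cmod (f w - f z - d * (w - z)) <= eps * Cmod (w - z).

Lemma locally_C_ball (z : C) (P : C -> Prop) :
  (@locally (AbsRing_UniformSpace C_AbsRing) z P) <->
  exists delta, 0 < delta /\ forall w, Cmod (w - z) < delta -> P w.
Proof.
  split.
  - intros [d Hd]. exists d; split; [apply cond_pos|]. intros w Hw.
    apply Hd. exact Hw.
  - intros [d [Hd H]]. exists (mkposreal d Hd). intros w Hw. apply H. exact Hw.
Qed.

Lemma is_linear_Cmult (d : C) :
  @is_linear C_AbsRing (AbsRing_NormedModule C_AbsRing) C_NormedModule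
    (fun y : C => (y * d)%C).
Proof.
  split.
  - intros x y. change ((x + y) * d = x * d + y * d)%C. ring.
  - intros k x. change ((k * x) * d = k * (x * d))%C. ring.
  - exists (Cmod d + 1). split; [generalize (Cmod_ge_0 d); lra|].
    intros x. change (Cmod (x * d)%C <= (Cmod d + 1) * Cmod x). rewrite Cmod_mult.
    generalize (Cmod_ge_0 x). intros. nra.
Qed.

Lemma cderiv_is_derive (f : C -> C) (z d : C) :
  cderiv f z d <-> @is_derive C_AbsRing C_NormedModule f z d.
Proof.
  split.
  - intros H. split; [apply is_linear_Cmult|].
    intros x Hx.
    apply (@is_filter_lim_locally_unique C_AbsRing (AbsRing_NormedModule C_AbsRing)) in Hx.
    subst x. intros eps. apply locally_C_ball.
    destruct (H eps (cond_pos eps)) as [del [Hd Hw]].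
    exists del. split; [exact Hd|]. intros w Hwz.
    specialize (Hw w Hwz).
    change (Cmod (f w - f z - (w - z) * d) <= eps * Cmod (w - z)).
    replace (f w - f z - (w - z) * d)%C with (f w - f z - d * (w - z))%C by ring.
    exact Hw.
  - intros [_ H] eps Heps.
    specialize (H z (fun P HP => HP) (mkposreal eps Heps)).
    apply locally_C_ball in H. destruct H as [del [Hd H]].
    exists del. split; [exact Hd|]. intros w Hw. specialize (H w Hw).
    change (Cmod (f w - f z - (w - z) * d) <= eps * Cmod (w - z)) in H.
    replace (f w - f z - d * (w - z))%C with (f w - f z - (w - z) * d)%C by ring.
    exact H.
Qed.

Lemma cderiv_C_derive (f : C -> C) (z d : C) : cderiv f z d -> C_derive f z = d.
Proof. intros H. apply is_C_derive_unique, cderiv_is_derive, H. Qed.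

Lemma cderiv_unique (f : C -> C) (z d d' : C) :
  cderiv f z d -> cderiv f z d' -> d = d'.
Proof.
  intros H H'. rewrite <- (cderiv_C_derive _ _ _ H). now apply cderiv_C_derive.
Qed.

Lemma cderiv_ext_loc (f g : C -> C) (z d : C) (r : R) :
  0 < r -> (forall w, Cmod (w - z) < r -> f w = g w) ->
  cderiv f z d -> cderiv g z d.
Proof.
  intros Hr He H eps Heps. destruct (H eps Heps) as [del [Hd Hw]].
  exists (Rmin r del). split; [apply Rmin_glb_lt; lra|].
  intros w Hwz. rewrite <- !He.
  - apply Hw. eapply Rlt_le_trans; [exact Hwz|apply Rmin_r].
  - replace (z - z)%C with (RtoC 0) by ring. rewrite Cmod_0. lra.
  - eapply Rlt_le_trans; [exact Hwz|apply Rmin_l].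
Qed.

Lemma cderiv_ext (f g : C -> C) (z d : C) :
  (forall w, f w = g w) -> cderiv f z d -> cderiv g z d.
Proof. intros He. apply (cderiv_ext_loc _ _ _ _ 1); [lra|auto]. Qed.

Lemma cderiv_eq (f : C -> C) (z d d' : C) : cderiv f z d -> d = d' -> cderiv f z d'.
Proof. now intros H <-. Qed.

Lemma cderiv_cont (f : C -> C) (z d : C) : cderiv f z d -> ccont f z.
Proof.
  intros H eps Heps. destruct (H 1 Rlt_0_1) as [del [Hd Hw]].
  assert (Hm := Cmod_ge_0 d).
  exists (Rmin del (eps / (Cmod d + 2))). split.
  - apply Rmin_glb_lt; [lra|]. apply Rdiv_lt_0_compat; lra.
  - intros w Hwz.
    assert (H1 : Cmod (w - z) < del) by (eapply Rlt_le_trans; [exact Hwz|apply Rmin_l]).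
    assert (H2 : Cmod (w - z) < eps / (Cmod d + 2)) by (eapply Rlt_le_trans; [exact Hwz|apply Rmin_r]).
    specialize (Hw w H1).
    replace (f w - f z)%C with ((f w - f z - d * (w - z)) + d * (w - z))%C by ring.
    eapply Rle_lt_trans; [apply Cmod_triangle|]. rewrite Cmod_mult.
    apply (Rmult_lt_compat_r (Cmod d + 2)) in H2; [|lra].
    unfold Rdiv in H2. rewrite Rmult_assoc, Rinv_l, Rmult_1_r in H2 by lra.
    generalize (Cmod_ge_0 (w - z)). intros. nra.
Qed.

Lemma ccont_const (k z : C) : ccont (fun _ => k) z.
Proof.
  intros eps H. exists 1. split; [lra|]. intros.
  replace (k - k)%C with (RtoC 0) by ring. now rewrite Cmod_0.
Qed.

Lemma ccont_bounded (f : C -> C) (z : C) : ccont f z ->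
  exists r, 0 < r /\ forall w, Cmod (w - z) < r -> Cmod (f w) <= Cmod (f z) + 1.
Proof.
  intros H. destruct (H 1 Rlt_0_1) as [d [Hd Hw]]. exists d. split; [exact Hd|].
  intros w Hwz. specialize (Hw w Hwz).
  replace (f w) with ((f w - f z) + f z)%C by ring.
  eapply Rle_trans; [apply Cmod_triangle|]. lra.
Qed.

Lemma ccont_plus (f g : C -> C) (z : C) :
  ccont f z -> ccont g z -> ccont (fun w => f w + g w)%C z.
Proof.
  intros Hf Hg eps He.
  destruct (Hf (eps/2)) as [d1 [Hd1 H1]]; [lra|].
  destruct (Hg (eps/2)) as [d2 [Hd2 H2]]; [lra|].
  exists (Rmin d1 d2). split; [apply Rmin_glb_lt; lra|].
  intros w Hw.
  assert (Ha := Rlt_le_trans _ _ _ Hw (Rmin_l _ _)).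
  assert (Hb := Rlt_le_trans _ _ _ Hw (Rmin_r _ _)).
  specialize (H1 w Ha). specialize (H2 w Hb).
  replace (f w + g w - (f z + g z))%C with ((f w - f z) + (g w - g z))%C by ring.
  eapply Rle_lt_trans; [apply Cmod_triangle|]. lra.
Qed.

Lemma ccont_mult (f g : C -> C) (z : C) :
  ccont f z -> ccont g z -> ccont (fun w => f w * g w)%C z.
Proof.
  intros Hf Hg eps He.
  destruct (ccont_bounded g z Hg) as [d0 [Hd0 H0]].
  assert (Hm1 := Cmod_ge_0 (f z)). assert (Hm2 := Cmod_ge_0 (g z)).
  set (K := Cmod (f z) + Cmod (g z) + 1) in *.
  assert (HK : 0 < K) by (unfold K; lra).
  destruct (Hf (eps/(2*K))) as [d1 [Hd1 H1]]; [apply Rdiv_lt_0_compat; lra|].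
  destruct (Hg (eps/(2*K))) as [d2 [Hd2 H2]]; [apply Rdiv_lt_0_compat; lra|].
  exists (Rmin d0 (Rmin d1 d2)). split; [repeat apply Rmin_glb_lt; lra|].
  intros w Hw.
  assert (Ha := Rlt_le_trans _ _ _ Hw (Rmin_l _ _)).
  assert (Hb := Rlt_le_trans _ _ _ Hw (Rmin_r _ _)).
  assert (Hc := Rlt_le_trans _ _ _ Hb (Rmin_r _ _)).
  assert (Hd := Rlt_le_trans _ _ _ Hb (Rmin_l _ _)).
  specialize (H0 w Ha). specialize (H1 w Hd). specialize (H2 w Hc).
  replace (f w * g w - (f z * g z))%C
    with ((f w - f z) * g w + f z * (g w - g z))%C by ring.
  eapply Rle_lt_trans; [apply Cmod_triangle|]. rewrite !Cmod_mult.
  assert (Hx : eps / (2*K) * K = eps / 2) by (field; lra).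
  assert (Hg' : Cmod (g w) <= K) by (unfold K; lra).
  assert (Hf' : Cmod (f z) <= K) by (unfold K; lra).
  generalize (Cmod_ge_0 (f w - f z)) (Cmod_ge_0 (g w - g z)) (Cmod_ge_0 (g w)). intros.
  assert (Cmod (f w - f z) * Cmod (g w) <= Cmod (f w - f z) * K) by nra.
  assert (Cmod (f z) * Cmod (g w - g z) <= K * Cmod (g w - g z)) by nra.
  nra.
Qed.

Lemma ccont_away (f : C -> C) (z c : C) : ccont f z -> f z <> c ->
  exists r, 0 < r /\ forall w, Cmod (w - z) < r -> Cmod (f z - c) / 2 <= Cmod (f w - c).
Proof.
  intros H Hc.
  assert (Hp : 0 < Cmod (f z - c)).
  { apply Cmod_gt_0. now apply Cminus_eq_contra. }
  destruct (H (Cmod (f z - c) / 2)) as [d [Hd Hw]]; [lra|].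
  exists d. split; [exact Hd|]. intros w Hwz. specialize (Hw w Hwz).
  generalize (Cmod_sub_triangle (f z) (f w) c).
  rewrite (Cmod_sub_sym (f z) (f w)). lra.
Qed.

Lemma ccont_nonzero (f : C -> C) (z : C) : ccont f z -> f z <> 0 ->
  exists r, 0 < r /\ forall w, Cmod (w - z) < r -> Cmod (f z) / 2 <= Cmod (f w) /\ f w <> 0.
Proof.
  intros H Hz. destruct (ccont_away f z 0 H Hz) as [r [Hr Hw]].
  exists r. split; [exact Hr|]. intros w Hwz. specialize (Hw w Hwz).
  replace (f z - 0)%C with (f z) in Hw by ring.
  replace (f w - 0)%C with (f w) in Hw by ring.
  split; [exact Hw|]. apply Cmod_gt_0. apply Cmod_gt_0 in Hz. lra.
Qed.

Lemma ccont_comp (f g : C -> C) (z : C) :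
  ccont g z -> ccont f (g z) -> ccont (fun w => f (g w)) z.
Proof.
  intros Hg Hf eps He. destruct (Hf eps He) as [d [Hd H]].
  destruct (Hg d Hd) as [d' [Hd' H']]. exists d'. split; [exact Hd'|].
  intros w Hw. now apply H, H'.
Qed.

Lemma cderiv_const (k z : C) : cderiv (fun _ => k) z 0.
Proof.
  intros eps H. exists 1. split; [lra|]. intros.
  replace (k - k - 0 * (w - z))%C with (RtoC 0) by ring. rewrite Cmod_0.
  generalize (Cmod_ge_0 (w - z)). nra.
Qed.

Lemma cderiv_id (z : C) : cderiv (fun w => w) z 1.
Proof.
  intros eps H. exists 1. split; [lra|]. intros.
  replace (w - z - 1 * (w - z))%C with (RtoC 0) by ring. rewrite Cmod_0.
  generalize (Cmod_ge_0 (w - z)). nra.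
Qed.

Lemma cderiv_plus (f g : C -> C) (z a b : C) :
  cderiv f z a -> cderiv g z b -> cderiv (fun w => f w + g w)%C z (a + b)%C.
Proof.
  intros Hf Hg eps He.
  destruct (Hf (eps/2)) as [d1 [Hd1 H1]]; [lra|].
  destruct (Hg (eps/2)) as [d2 [Hd2 H2]]; [lra|].
  exists (Rmin d1 d2). split; [apply Rmin_glb_lt; lra|].
  intros w Hw.
  assert (Ha := Rlt_le_trans _ _ _ Hw (Rmin_l _ _)).
  assert (Hb := Rlt_le_trans _ _ _ Hw (Rmin_r _ _)).
  specialize (H1 w Ha). specialize (H2 w Hb).
  replace (f w + g w - (f z + g z) - (a + b) * (w - z))%C
    with ((f w - f z - a * (w - z)) + (g w - g z - b * (w - z)))%C by ring.
  eapply Rle_trans; [apply Cmod_triangle|]. lra.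
Qed.

Lemma cderiv_comp (f g : C -> C) (z a b : C) :
  cderiv g z b -> cderiv f (g z) a -> cderiv (fun w => f (g w)) z (a * b)%C.
Proof.
  intros Hg Hf eps He.
  assert (Hma := Cmod_ge_0 a). assert (Hmb := Cmod_ge_0 b).
  assert (Hk : 0 < eps / (2 * (Cmod b + 1))) by (apply Rdiv_lt_0_compat; lra).
  destruct (Hf _ Hk) as [d1 [Hd1 H1]].
  assert (Hl : 0 < eps / (2 * (Cmod a + 1))) by (apply Rdiv_lt_0_compat; lra).
  destruct (Hg _ Hl) as [d2 [Hd2 H2]].
  destruct (Hg 1 Rlt_0_1) as [d3 [Hd3 H3]].
  destruct (cderiv_cont _ _ _ Hg d1 Hd1) as [d4 [Hd4 H4]].
  exists (Rmin d2 (Rmin d3 d4)). split; [repeat apply Rmin_glb_lt; lra|].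
  intros w Hw.
  assert (Ha := Rlt_le_trans _ _ _ Hw (Rmin_l _ _)).
  assert (Hb := Rlt_le_trans _ _ _ Hw (Rmin_r _ _)).
  assert (Hc := Rlt_le_trans _ _ _ Hb (Rmin_l _ _)).
  assert (Hd := Rlt_le_trans _ _ _ Hb (Rmin_r _ _)).
  specialize (H1 (g w) (H4 w Hd)). specialize (H2 w Ha). specialize (H3 w Hc).
  replace (f (g w) - f (g z) - a * b * (w - z))%C
    with ((f (g w) - f (g z) - a * (g w - g z)) + a * (g w - g z - b * (w - z)))%C by ring.
  eapply Rle_trans; [apply Cmod_triangle|]. rewrite Cmod_mult.
  assert (Hn := Cmod_ge_0 (w - z)).
  assert (H5 : Cmod (g w - g z) <= (Cmod b + 1) * Cmod (w - z)).
  { replace (g w - g z)%C with ((g w - g z - b * (w - z)) + b * (w - z))%C by ring.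
    eapply Rle_trans; [apply Cmod_triangle|]. rewrite Cmod_mult. lra. }
  assert (H6 : eps / (2 * (Cmod b + 1)) * Cmod (g w - g z) <= eps / 2 * Cmod (w - z)).
  { replace (eps / 2 * Cmod (w - z))
      with (eps / (2 * (Cmod b + 1)) * ((Cmod b + 1) * Cmod (w - z))) by (field; lra).
    apply Rmult_le_compat_l; lra. }
  assert (H7 : Cmod a * Cmod (g w - g z - b * (w - z)) <= eps / 2 * Cmod (w - z)).
  { apply Rle_trans with ((Cmod a + 1) * (eps / (2 * (Cmod a + 1)) * Cmod (w - z))).
    - apply Rmult_le_compat; try lra. apply Cmod_ge_0.
    - right. field. lra. }
  lra.
Qed.

Lemma cderiv_mult (f g : C -> C) (z a b : C) :
  cderiv f z a -> cderiv g z b ->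
  cderiv (fun w => f w * g w)%C z (a * g z + f z * b)%C.
Proof.
  intros Hf Hg eps He.
  assert (Hma := Cmod_ge_0 a). assert (Hm1 := Cmod_ge_0 (f z)). assert (Hm2 := Cmod_ge_0 (g z)).
  set (K := Cmod (f z) + Cmod (g z) + Cmod a + 1) in *.
  assert (HK : 0 < K) by (unfold K; lra).
  assert (Hk : 0 < eps / (3 * K)) by (apply Rdiv_lt_0_compat; lra).
  destruct (Hf _ Hk) as [d1 [Hd1 H1]].
  destruct (Hg _ Hk) as [d2 [Hd2 H2]].
  destruct (cderiv_cont _ _ _ Hg _ Hk) as [d3 [Hd3 H3]].
  destruct (cderiv_cont _ _ _ Hg 1 Rlt_0_1) as [d4 [Hd4 H4]].
  exists (Rmin (Rmin d1 d2) (Rmin d3 d4)). split; [repeat apply Rmin_glb_lt; lra|].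
  intros w Hw.
  assert (Ha := Rlt_le_trans _ _ _ Hw (Rmin_l _ _)).
  assert (Hb := Rlt_le_trans _ _ _ Hw (Rmin_r _ _)).
  specialize (H1 w (Rlt_le_trans _ _ _ Ha (Rmin_l _ _))).
  specialize (H2 w (Rlt_le_trans _ _ _ Ha (Rmin_r _ _))).
  specialize (H3 w (Rlt_le_trans _ _ _ Hb (Rmin_l _ _))).
  specialize (H4 w (Rlt_le_trans _ _ _ Hb (Rmin_r _ _))).
  replace (f w * g w - f z * g z - (a * g z + f z * b) * (w - z))%C
    with ((f w - f z - a * (w - z)) * g w + (f z * (g w - g z - b * (w - z))
           + a * (w - z) * (g w - g z)))%C by ring.
  eapply Rle_trans; [apply Cmod_triangle|].
  eapply Rle_trans; [apply Rplus_le_compat_l, Cmod_triangle|].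
  rewrite !Cmod_mult.
  assert (Hn := Cmod_ge_0 (w - z)).
  assert (Hgw : Cmod (g w) <= K).
  { replace (g w) with ((g w - g z) + g z)%C by ring.
    eapply Rle_trans; [apply Cmod_triangle|]. unfold K; lra. }
  assert (E : eps / (3 * K) * K = eps / 3) by (field; lra).
  set (e' := eps / (3 * K)) in *. set (n := Cmod (w - z)) in *.
  assert (A1 : Cmod (f w - f z - a * (w - z)) * Cmod (g w) <= (e' * n) * K).
  { apply Rmult_le_compat; try apply Cmod_ge_0; assumption. }
  assert (A2 : Cmod (f z) * Cmod (g w - g z - b * (w - z)) <= K * (e' * n)).
  { apply Rmult_le_compat; try apply Cmod_ge_0; try assumption. unfold K; lra. }
  assert (A3 : Cmod a * n * Cmod (g w - g z) <= K * n * e').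
  { apply Rmult_le_compat; try apply Cmod_ge_0; try lra.
    - apply Rmult_le_pos; assumption.
    - apply Rmult_le_compat_r; [assumption|unfold K; lra]. }
  assert (E2 : e' * n * K = eps / 3 * n) by (rewrite <- E; ring).
  assert (E3 : K * n * e' = eps / 3 * n) by (rewrite <- E; ring).
  assert (E4' : K * (e' * n) = eps / 3 * n) by (rewrite <- E; ring).
  lra.
Qed.

Lemma cderiv_Cinv (z : C) : z <> 0 -> cderiv Cinv z (- / (z * z))%C.
Proof.
  intros Hz eps He.
  assert (Hp : 0 < Cmod z) by (apply Cmod_gt_0; exact Hz).
  set (m := Cmod z) in *.
  exists (Rmin (m / 2) (eps * (m * m * m) / 2)).
  assert (0 < m * m * m) by (repeat apply Rmult_lt_0_compat; lra).
  split.
  { apply Rmin_glb_lt; [lra|]. nra. }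
  intros w Hw.
  assert (Ha := Rlt_le_trans _ _ _ Hw (Rmin_l _ _)).
  assert (Hb := Rlt_le_trans _ _ _ Hw (Rmin_r _ _)).
  assert (Hwm : m / 2 <= Cmod w).
  { generalize (Cmod_reverse_triangle z w). rewrite Cmod_sub_sym. fold m. lra. }
  assert (Hw0 : w <> 0) by (apply Cmod_gt_0; lra).
  replace (/ w - / z - - / (z * z) * (w - z))%C
    with ((w - z) * (w - z) * / (z * z * w))%C by (field; split; assumption).
  rewrite !Cmod_mult, Cmod_inv by (repeat apply Cmult_neq_0; assumption).
  rewrite !Cmod_mult. fold m.
  assert (Hn := Cmod_ge_0 (w - z)).
  rewrite Rmult_assoc, (Rmult_comm eps). apply Rmult_le_compat_l; [exact Hn|].
  apply Rmult_le_reg_r with (m * m * Cmod w); [nra|].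
  rewrite Rmult_assoc, Rinv_l by nra. rewrite Rmult_1_r.
  apply Rle_trans with (eps * (m * m * (m / 2))); [nra|].
  apply Rmult_le_compat_l; [lra|]. apply Rmult_le_compat_l; nra.
Qed.

Lemma cderiv_inv (f : C -> C) (z a : C) : cderiv f z a -> f z <> 0 ->
  cderiv (fun w => / f w)%C z (- a / (f z * f z))%C.
Proof.
  intros H Hz. eapply cderiv_eq.
  - apply (cderiv_comp Cinv f); [exact H|]. apply cderiv_Cinv, Hz.
  - field. exact Hz.
Qed.

Lemma cderiv_opp (f : C -> C) (z a : C) : cderiv f z a -> cderiv (fun w => - f w)%C z (- a)%C.
Proof.
  intros H. apply cderiv_ext with (fun w => (- (1)) * f w)%C; [intros; ring|].
  eapply cderiv_eq; [apply cderiv_mult; [apply cderiv_const|exact H]|cbv beta; ring].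
Qed.

Lemma cderiv_minus (f g : C -> C) (z a b : C) :
  cderiv f z a -> cderiv g z b -> cderiv (fun w => f w - g w)%C z (a - b)%C.
Proof. intros. apply cderiv_plus; [|apply cderiv_opp]; assumption. Qed.

Lemma cderiv_div (f g : C -> C) (z a b : C) :
  cderiv f z a -> cderiv g z b -> g z <> 0 ->
  cderiv (fun w => f w / g w)%C z ((a * g z - f z * b) / (g z * g z))%C.
Proof.
  intros Hf Hg H. eapply cderiv_eq.
  - apply cderiv_mult; [exact Hf|]. apply cderiv_inv; eassumption.
  - simpl. field. exact H.
Qed.

Lemma cderiv_scal (k : C) (f : C -> C) (z a : C) :
  cderiv f z a -> cderiv (fun w => k * f w)%C z (k * a)%C.
Proof.
  intros H. eapply cderiv_eq; [apply cderiv_mult; [apply cderiv_const|exact H]|cbv beta; ring].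
Qed.

Lemma cderiv_pow (f : C -> C) (n : nat) (z a : C) : cderiv f z a ->
  cderiv (fun w => f w ^ S n)%C z (INR (S n) * f z ^ n * a)%C.
Proof.
  intros H. induction n as [|n IH].
  - apply cderiv_ext with f; [intros; simpl; ring|].
    eapply cderiv_eq; [exact H|]. simpl. ring.
  - apply cderiv_ext with (fun w => f w * f w ^ S n)%C; [reflexivity|].
    eapply cderiv_eq; [apply cderiv_mult; [exact H|exact IH]|].
    rewrite (S_INR (S n)), RtoC_plus. simpl (Cpow _ (S n)). ring.
Qed.

Lemma ccont_id (z : C) : ccont (fun w => w) z.
Proof. exact (cderiv_cont _ _ _ (cderiv_id z)). Qed.

Lemma ccont_opp (f : C -> C) (z : C) : ccont f z -> ccont (fun w => - f w)%C z.
Proof.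
  intros H. apply (ccont_comp Copp f); [exact H|].
  eapply cderiv_cont, (cderiv_opp (fun w => w)), cderiv_id.
Qed.

Lemma ccont_minus (f g : C -> C) (z : C) :
  ccont f z -> ccont g z -> ccont (fun w => f w - g w)%C z.
Proof. intros. apply ccont_plus; [|apply ccont_opp]; assumption. Qed.

Lemma ccont_inv (f : C -> C) (z : C) : ccont f z -> f z <> 0 -> ccont (fun w => / f w)%C z.
Proof.
  intros H Hz. apply (ccont_comp Cinv f); [exact H|].
  eapply cderiv_cont, cderiv_Cinv, Hz.
Qed.

Lemma ccont_ext_loc (f g : C -> C) (z : C) (r : R) :
  0 < r -> (forall w, Cmod (w - z) < r -> f w = g w) -> ccont f z -> ccont g z.
Proof.
  intros Hr He H eps Heps. destruct (H eps Heps) as [del [Hd Hw]].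
  exists (Rmin r del). split; [apply Rmin_glb_lt; lra|].
  intros w Hwz. rewrite <- !He.
  - apply Hw. eapply Rlt_le_trans; [exact Hwz|apply Rmin_r].
  - replace (z - z)%C with (RtoC 0) by ring. rewrite Cmod_0. lra.
  - eapply Rlt_le_trans; [exact Hwz|apply Rmin_l].
Qed.

Lemma ccont_pow (f : C -> C) (n : nat) (z : C) : ccont f z -> ccont (fun w => f w ^ n)%C z.
Proof.
  intros H. induction n; simpl; [apply ccont_const|]. now apply ccont_mult.
Qed.

(** * Curves and the mean value inequality *)

(** Kept by components, so that the real mean value theorem and the real integral apply to each of
    them. *)
Definition rderiv (g : R -> C) (t : R) (d : C) : Prop :=
  is_derive (fun s => Re (g s)) t (Re d) /\ is_derive (fun s => Im (g s)) t (Im d).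

Lemma is_derive_eps (f : R -> R) (t d : R) :
  is_derive f t d <->
  forall eps, 0 < eps -> exists delta, 0 < delta /\
    forall h, Rabs (h - t) < delta -> Rabs (f h - f t - d * (h - t)) <= eps * Rabs (h - t).
Proof.
  split.
  - intros [_ H] eps Heps.
    specialize (H t (fun P HP => HP) (mkposreal eps Heps)).
    destruct H as [del H].
    exists del. split; [apply cond_pos|]. intros w Hw. specialize (H w Hw).
    change (Rabs (f w - f t - (w - t) * d) <= eps * Rabs (w - t)) in H.
    replace (d * (w - t)) with ((w - t) * d) by ring. exact H.
  - intros H. split; [apply is_linear_scal_l|].
    intros x Hx.
    apply (@is_filter_lim_locally_unique R_AbsRing (AbsRing_NormedModule R_AbsRing)) in Hx.
    subst x.
    intros eps. destruct (H eps (cond_pos eps)) as [del [Hd Hw]].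
    exists (mkposreal del Hd). intros w Hwz.
    specialize (Hw w Hwz).
    change (Rabs (f w - f t - (w - t) * d) <= eps * Rabs (w - t)).
    replace ((w - t) * d) with (d * (w - t)) by ring. exact Hw.
Qed.

Lemma rderiv_eps (g : R -> C) (t : R) (d : C) :
  rderiv g t d <->
  forall eps, 0 < eps -> exists delta, 0 < delta /\
    forall h, Rabs (h - t) < delta ->
      Cmod (g h - g t - d * RtoC (h - t)) <= eps * Rabs (h - t).
Proof.
  split.
  - intros [H1 H2] eps He.
    destruct (proj1 (is_derive_eps _ _ _) H1 (eps/2)) as [d1 [Hd1 A1]]; [lra|].
    destruct (proj1 (is_derive_eps _ _ _) H2 (eps/2)) as [d2 [Hd2 A2]]; [lra|].
    exists (Rmin d1 d2). split; [apply Rmin_glb_lt; lra|]. intros h Hh.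
    specialize (A1 h (Rlt_le_trans _ _ _ Hh (Rmin_l _ _))).
    specialize (A2 h (Rlt_le_trans _ _ _ Hh (Rmin_r _ _))).
    eapply Rle_trans; [apply Cmod_le_re_im|].
    rewrite !re_minus, !im_minus, re_scal_r, im_scal_r. lra.
  - intros H. split; apply is_derive_eps; intros eps He;
      destruct (H eps He) as [del [Hd A]]; exists del; (split; [exact Hd|]);
      intros h Hh; (eapply Rle_trans; [|apply (A h Hh)]).
    + eapply Rle_trans; [|apply re_le_Cmod].
      rewrite !re_minus, re_scal_r. lra.
    + eapply Rle_trans; [|apply im_le_Cmod].
      rewrite !im_minus, im_scal_r. lra.
Qed.

Lemma rderiv_comp (f : C -> C) (g : R -> C) (t : R) (a b : C) :
  rderiv g t b -> cderiv f (g t) a -> rderiv (fun s => f (g s)) t (a * b)%C.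
Proof.
  intros Hg Hf. apply rderiv_eps. intros eps He.
  assert (Hma := Cmod_ge_0 a). assert (Hmb := Cmod_ge_0 b).
  assert (Hk : 0 < eps / (2 * (Cmod b + 1))) by (apply Rdiv_lt_0_compat; lra).
  destruct (Hf _ Hk) as [d1 [Hd1 H1]].
  assert (Hl : 0 < eps / (2 * (Cmod a + 1))) by (apply Rdiv_lt_0_compat; lra).
  rewrite rderiv_eps in Hg.
  destruct (Hg _ Hl) as [d2 [Hd2 H2]].
  destruct (Hg 1 Rlt_0_1) as [d3 [Hd3 H3]].
  exists (Rmin d2 (Rmin d3 (d1 / (Cmod b + 1)))).
  split; [repeat apply Rmin_glb_lt; try lra; apply Rdiv_lt_0_compat; lra|].
  intros w Hw.
  assert (Ha := Rlt_le_trans _ _ _ Hw (Rmin_l _ _)).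
  assert (Hb := Rlt_le_trans _ _ _ Hw (Rmin_r _ _)).
  assert (Hc := Rlt_le_trans _ _ _ Hb (Rmin_l _ _)).
  assert (Hd := Rlt_le_trans _ _ _ Hb (Rmin_r _ _)).
  specialize (H2 w Ha). specialize (H3 w Hc).
  assert (Hn := Rabs_pos (w - t)).
  assert (H5 : Cmod (g w - g t) <= (Cmod b + 1) * Rabs (w - t)).
  { replace (g w - g t)%C with ((g w - g t - b * RtoC (w - t)) + b * RtoC (w - t))%C by ring.
    eapply Rle_trans; [apply Cmod_triangle|]. rewrite Cmod_mult, Cmod_R. lra. }
  assert (H1' : Cmod (g w - g t) < d1).
  { eapply Rle_lt_trans; [exact H5|].
    apply (Rmult_lt_compat_l (Cmod b + 1)) in Hd; [|lra].
    replace ((Cmod b + 1) * (d1 / (Cmod b + 1))) with d1 in Hd by (field; lra). exact Hd. }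
  specialize (H1 (g w) H1').
  replace (f (g w) - f (g t) - a * b * RtoC (w - t))%C
    with ((f (g w) - f (g t) - a * (g w - g t)) + a * (g w - g t - b * RtoC (w - t)))%C by ring.
  eapply Rle_trans; [apply Cmod_triangle|]. rewrite Cmod_mult.
  assert (H6 : eps / (2 * (Cmod b + 1)) * Cmod (g w - g t) <= eps / 2 * Rabs (w - t)).
  { replace (eps / 2 * Rabs (w - t))
      with (eps / (2 * (Cmod b + 1)) * ((Cmod b + 1) * Rabs (w - t))) by (field; lra).
    apply Rmult_le_compat_l; lra. }
  assert (H7 : Cmod a * Cmod (g w - g t - b * RtoC (w - t)) <= eps / 2 * Rabs (w - t)).
  { apply Rle_trans with ((Cmod a + 1) * (eps / (2 * (Cmod a + 1)) * Rabs (w - t))).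
    - apply Rmult_le_compat; try lra. apply Cmod_ge_0.
    - right. field. lra. }
  lra.
Qed.

Lemma rderiv_segment (a v : C) (t : R) : rderiv (fun s => a + RtoC s * v)%C t v.
Proof.
  apply rderiv_eps. intros eps He. exists 1. split; [lra|]. intros h _.
  replace (a + RtoC h * v - (a + RtoC t * v) - v * RtoC (h - t))%C with (RtoC 0)
    by (rewrite RtoC_minus; ring).
  rewrite Cmod_0. generalize (Rabs_pos (h - t)). nra.
Qed.

Lemma rderiv_ext (g h : R -> C) (t : R) (d : C) :
  (forall s, g s = h s) -> rderiv g t d -> rderiv h t d.
Proof.
  intros He [H1 H2].
  split; (eapply is_derive_ext; [|eassumption]); intros; simpl; now rewrite He.
Qed.

Lemma rderiv_ray (v : C) (t : R) : rderiv (fun s => RtoC s * v)%C t v.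
Proof.
  apply rderiv_ext with (fun s => 0 + RtoC s * v)%C; [intros; ring|apply rderiv_segment].
Qed.

(** Complex-valued curves admit no intermediate point. Pairing [g] with the fixed vector
    [v = g b - g a] gives a real function whose increment is [|v|^2] and whose slope is at most
    [|v| M]. *)
Lemma mean_value_curve (g dg : R -> C) (M a b : R) : a <= b ->
  (forall t, a <= t <= b -> rderiv g t (dg t)) ->
  (forall t, a <= t <= b -> Cmod (dg t) <= M) ->
  Cmod (g b - g a) <= M * (b - a).
Proof.
  intros Hab Hd HM.
  set (v := (g b - g a)%C).
  destruct (Req_dec (Cmod v) 0) as [H0|H0].
  { rewrite H0. assert (0 <= M) by (apply Rle_trans with (Cmod (dg a)); [apply Cmod_ge_0|apply HM; lra]).
    nra. }
  assert (Hv : 0 < Cmod v) by (generalize (Cmod_ge_0 v); lra).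
  set (phi := fun t => Re v * Re (g t) + Im v * Im (g t)).
  destruct (MVT_gen phi a b (fun t => Re v * Re (dg t) + Im v * Im (dg t))) as [c [Hc Heq]].
  { rewrite Rmin_left, Rmax_right by lra. intros t Ht. destruct (Hd t) as [H1 H2]; [lra|].
    unfold phi. apply @is_derive_plus; apply is_derive_scal; assumption. }
  { rewrite Rmin_left, Rmax_right by lra. intros t Ht. destruct (Hd t) as [H1 H2]; [lra|].
    apply derivable_continuous_pt.
    exists (Re v * Re (dg t) + Im v * Im (dg t)). apply is_derive_Reals.
    unfold phi. apply @is_derive_plus; apply is_derive_scal; assumption. }
  rewrite Rmin_left, Rmax_right in Hc by lra.
  assert (Hs : phi b - phi a = Cmod v * Cmod v).
  { transitivity (Cmod v ^ 2); [|ring]. rewrite Cmod2_alt.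
    unfold phi. change (Re v) with (Re (g b) - Re (g a)).
    change (Im v) with (Im (g b) - Im (g a)). ring. }
  assert (Hi : Re v * Re (dg c) + Im v * Im (dg c) <= Cmod v * Cmod (dg c)).
  { rewrite <- (Cmod_conj v), <- Cmod_mult.
    eapply Rle_trans; [|eapply Rle_trans; [apply Rle_abs|apply re_le_Cmod]].
    rewrite re_mult. right. destruct v; simpl; ring. }
  specialize (HM c Hc).
  rewrite Hs in Heq.
  apply Rmult_le_reg_l with (Cmod v); [exact Hv|]. rewrite Heq.
  apply Rle_trans with ((Cmod v * Cmod (dg c)) * (b - a)).
  - apply Rmult_le_compat_r; lra.
  - rewrite Rmult_assoc. apply Rmult_le_compat_l; [lra|]. apply Rmult_le_compat_r; lra.
Qed.

Lemma mean_value_segment (f f' : C -> C) (a b : C) (M : R) :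
  (forall t, 0 <= t <= 1 -> cderiv f (a + RtoC t * (b - a))%C (f' (a + RtoC t * (b - a))%C)) ->
  (forall t, 0 <= t <= 1 -> Cmod (f' (a + RtoC t * (b - a))%C) <= M) ->
  Cmod (f b - f a) <= M * Cmod (b - a).
Proof.
  intros H HM.
  generalize (mean_value_curve (fun t => f (a + RtoC t * (b - a))%C)
    (fun t => f' (a + RtoC t * (b - a)) * (b - a))%C (M * Cmod (b - a)) 0 1).
  replace (a + 1 * (b - a))%C with b by ring.
  replace (a + 0 * (b - a))%C with a by ring.
  intros K. replace (M * Cmod (b - a)) with (M * Cmod (b - a) * (1 - 0)) by ring.
  apply K; [lra| |].
  - intros t Ht. apply (rderiv_comp f); [apply rderiv_segment|apply H, Ht].
  - intros t Ht. rewrite Cmod_mult. apply Rmult_le_compat_r; [apply Cmod_ge_0|apply HM, Ht].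
Qed.

Lemma segment_in_disc (c a b : C) (r t : R) : 0 <= t <= 1 ->
  Cmod (a - c) < r -> Cmod (b - c) < r -> Cmod (a + RtoC t * (b - a) - c) < r.
Proof.
  intros Ht Ha Hb.
  replace (a + RtoC t * (b - a) - c)%C
    with (RtoC (1 - t) * (a - c) + RtoC t * (b - c))%C
    by (rewrite RtoC_minus; ring).
  eapply Rle_lt_trans; [apply Cmod_triangle|].
  rewrite !Cmod_mult, !Cmod_R, !Rabs_pos_eq by lra.
  destruct (Req_dec t 0) as [->|]; [lra|]. nra.
Qed.

Lemma mean_value_disc (f f' : C -> C) (c a b : C) (r M : R) :
  (forall w, Cmod (w - c) < r -> cderiv f w (f' w)) ->
  (forall w, Cmod (w - c) < r -> Cmod (f' w) <= M) ->
  Cmod (a - c) < r -> Cmod (b - c) < r ->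
  Cmod (f b - f a) <= M * Cmod (b - a).
Proof.
  intros Hd HM Ha Hb. apply mean_value_segment with f'; intros t Ht;
    [apply Hd|apply HM]; now apply segment_in_disc.
Qed.

(** * Complex series *)

Fixpoint csumn (a : nat -> C) (N : nat) : C :=
  match N with O => RtoC 0 | S k => (csumn a k + a k)%C end.

Fixpoint rsumn (a : nat -> R) (N : nat) : R :=
  match N with O => 0 | S k => rsumn a k + a k end.

Definition cconv (u : nat -> C) (l : C) : Prop :=
  forall eps, 0 < eps -> exists N, forall n, (N <= n)%nat -> Cmod (u n - l) < eps.

Definition csums (a : nat -> C) (l : C) : Prop := cconv (csumn a) l.

Definition dominated (a : nat -> C) (M : nat -> R) : Prop :=
  forall n, Cmod (a n) <= M n.

Lemma cconv_unique (u : nat -> C) (l l' : C) : cconv u l -> cconv u l' -> l = l'.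
Proof.
  intros H H'. apply Ceq_minus. apply Cmod_eq_0. apply Rle_antisym; [|apply Cmod_ge_0].
  apply le_epsilon. intros eps He.
  destruct (H (eps/2)) as [N HN]; [lra|]. destruct (H' (eps/2)) as [N' HN']; [lra|].
  specialize (HN (N + N')%nat ltac:(lia)). specialize (HN' (N + N')%nat ltac:(lia)).
  eapply Rle_trans; [apply (Cmod_sub_triangle _ (u (N + N')%nat))|].
  rewrite Cmod_sub_sym. lra.
Qed.

Lemma cconv_const (l : C) : cconv (fun _ => l) l.
Proof.
  intros eps He. exists O. intros. replace (l - l)%C with (RtoC 0) by ring. now rewrite Cmod_0.
Qed.

Lemma cconv_ext (u v : nat -> C) (l : C) : (forall n, u n = v n) -> cconv u l -> cconv v l.
Proof.
  intros He H eps Heps. destruct (H eps Heps) as [N HN]. exists N. intros. rewrite <- He. auto.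
Qed.

Lemma cconv_le (u : nat -> C) (l : C) (b : nat -> R) :
  (forall n, Cmod (u n - l) <= b n) -> is_lim_seq b 0 -> cconv u l.
Proof.
  intros H Hb eps He.
  destruct (proj1 (is_lim_seq_Reals b 0) Hb eps He) as [N HN].
  exists N. intros n Hn. specialize (HN n Hn). unfold R_dist in HN.
  rewrite Rminus_0_r in HN. generalize (H n) (Rle_abs (b n)). lra.
Qed.

Lemma cconv_plus (u v : nat -> C) (l m : C) :
  cconv u l -> cconv v m -> cconv (fun n => u n + v n)%C (l + m)%C.
Proof.
  intros H H' eps He.
  destruct (H (eps/2)) as [N HN]; [lra|]. destruct (H' (eps/2)) as [N' HN']; [lra|].
  exists (N + N')%nat. intros n Hn. specialize (HN n ltac:(lia)). specialize (HN' n ltac:(lia)).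
  replace (u n + v n - (l + m))%C with ((u n - l) + (v n - m))%C by ring.
  eapply Rle_lt_trans; [apply Cmod_triangle|]. lra.
Qed.

Lemma cconv_scal (k : C) (u : nat -> C) (l : C) :
  cconv u l -> cconv (fun n => k * u n)%C (k * l)%C.
Proof.
  intros H eps He. assert (Hk := Cmod_ge_0 k).
  destruct (H (eps / (Cmod k + 1))) as [N HN]; [apply Rdiv_lt_0_compat; lra|].
  exists N. intros n Hn. specialize (HN n Hn).
  replace (k * u n - k * l)%C with (k * (u n - l))%C by ring. rewrite Cmod_mult.
  apply (Rmult_lt_compat_l (Cmod k + 1)) in HN; [|lra].
  replace ((Cmod k + 1) * (eps / (Cmod k + 1))) with eps in HN by (field; lra).
  generalize (Cmod_ge_0 (u n - l)). nra.
Qed.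

Lemma cconv_subseq (u : nat -> C) (l : C) (f : nat -> nat) :
  (forall n, (n <= f n)%nat) -> cconv u l -> cconv (fun n => u (f n)) l.
Proof.
  intros Hf H eps He. destruct (H eps He) as [N HN]. exists N. intros n Hn.
  apply HN. specialize (Hf n). lia.
Qed.

Lemma cconv_ccont (f : C -> C) (u : nat -> C) (l : C) :
  ccont f l -> cconv u l -> cconv (fun n => f (u n)) (f l).
Proof.
  intros Hf H eps He. destruct (Hf eps He) as [d [Hd Hw]].
  destruct (H d Hd) as [N HN]. exists N. intros n Hn. apply Hw, HN, Hn.
Qed.

Lemma cconv_mult (u v : nat -> C) (l m : C) :
  cconv u l -> cconv v m -> cconv (fun n => u n * v n)%C (l * m)%C.
Proof.
  intros Hu Hv.
  assert (Hb : exists K, 0 < K /\ exists N, forall n, (N <= n)%nat -> Cmod (v n) <= K).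
  { destruct (Hv 1 Rlt_0_1) as [N HN]. exists (Cmod m + 1). split.
    - generalize (Cmod_ge_0 m). lra.
    - exists N. intros n Hn. specialize (HN n Hn).
      generalize (Cmod_reverse_triangle (v n) m). lra. }
  destruct Hb as [K [HK [N0 HN0]]]. intros eps He.
  destruct (Hu (eps / (2 * K))) as [N1 H1]; [apply Rdiv_lt_0_compat; lra|].
  assert (Hl := Cmod_ge_0 l).
  destruct (Hv (eps / (2 * (Cmod l + 1)))) as [N2 H2]; [apply Rdiv_lt_0_compat; lra|].
  exists (N0 + N1 + N2)%nat. intros n Hn.
  specialize (HN0 n ltac:(lia)). specialize (H1 n ltac:(lia)). specialize (H2 n ltac:(lia)).
  replace (u n * v n - l * m)%C with ((u n - l) * v n + l * (v n - m))%C by ring.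
  eapply Rle_lt_trans; [apply Cmod_triangle|]. rewrite !Cmod_mult.
  assert (A : Cmod (u n - l) * Cmod (v n) < eps / (2 * K) * K + 0).
  { rewrite Rplus_0_r. apply Rle_lt_trans with (Cmod (u n - l) * K).
    - apply Rmult_le_compat_l; [apply Cmod_ge_0|exact HN0].
    - apply Rmult_lt_compat_r; assumption. }
  replace (eps / (2 * K) * K + 0) with (eps / 2) in A by (field; lra).
  assert (B : Cmod l * Cmod (v n - m) <= (Cmod l + 1) * (eps / (2 * (Cmod l + 1)))).
  { apply Rmult_le_compat; try apply Cmod_ge_0; lra. }
  replace ((Cmod l + 1) * (eps / (2 * (Cmod l + 1)))) with (eps / 2) in B by (field; lra).
  lra.
Qed.

Lemma Cmod_cconv_le (u : nat -> C) (l : C) (B : R) :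
  cconv u l -> (forall n, Cmod (u n) <= B) -> Cmod l <= B.
Proof.
  intros H HB. apply le_epsilon. intros eps He. destruct (H eps He) as [N HN].
  specialize (HN N (le_n N)). rewrite Cmod_sub_sym in HN.
  generalize (Cmod_reverse_triangle l (u N)) (HB N). lra.
Qed.

Lemma Cmod_cconv_ge (u : nat -> C) (l : C) (B : R) :
  cconv u l -> (forall n, B <= Cmod (u n)) -> B <= Cmod l.
Proof.
  intros H HB. apply le_epsilon. intros eps He. destruct (H eps He) as [N HN].
  specialize (HN N (le_n N)).
  generalize (Cmod_reverse_triangle (u N) l) (HB N). lra.
Qed.

Lemma csumn_ext (a b : nat -> C) (N : nat) :
  (forall n, (n < N)%nat -> a n = b n) -> csumn a N = csumn b N.
Proof.
  induction N; intros H; simpl; [reflexivity|].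
  rewrite IHN by (intros; apply H; lia). now rewrite H by lia.
Qed.

Lemma csumn_plus (a b : nat -> C) (N : nat) :
  csumn (fun n => a n + b n)%C N = (csumn a N + csumn b N)%C.
Proof. induction N; simpl; [ring|]. rewrite IHN. ring. Qed.

Lemma csumn_scal (k : C) (a : nat -> C) (N : nat) :
  csumn (fun n => k * a n)%C N = (k * csumn a N)%C.
Proof. induction N; simpl; [ring|]. rewrite IHN. ring. Qed.

Lemma csumn_shift (a : nat -> C) (N : nat) :
  csumn a (S N) = (a 0%nat + csumn (fun n => a (S n)) N)%C.
Proof.
  induction N; [simpl; ring|]. change (csumn a (S (S N))) with (csumn a (S N) + a (S N))%C.
  rewrite IHN. simpl. ring.
Qed.

Lemma rsumn_le (a b : nat -> R) (N : nat) :
  (forall n, (n < N)%nat -> a n <= b n) -> rsumn a N <= rsumn b N.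
Proof.
  induction N; intros H; simpl; [lra|].
  apply Rplus_le_compat; [apply IHN; intros; apply H; lia|apply H; lia].
Qed.

Lemma rsumn_nonneg (a : nat -> R) (N : nat) : (forall n, 0 <= a n) -> 0 <= rsumn a N.
Proof. intros H. induction N; simpl; [lra|]. specialize (H N). lra. Qed.

Lemma Cmod_csumn (a : nat -> C) (N : nat) :
  Cmod (csumn a N) <= rsumn (fun n => Cmod (a n)) N.
Proof.
  induction N; simpl; [rewrite Cmod_0; lra|].
  eapply Rle_trans; [apply Cmod_triangle|]. lra.
Qed.

Lemma Cmod_csumn_le (a : nat -> C) (M : nat -> R) (N : nat) : dominated a M ->
  Cmod (csumn a N) <= rsumn M N.
Proof.
  intros H. eapply Rle_trans; [apply Cmod_csumn|]. apply rsumn_le. intros; apply H.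
Qed.

Lemma Cmod_csumn_diff (a : nat -> C) (M : nat -> R) (N K : nat) : dominated a M ->
  Cmod (csumn a (N + K) - csumn a N) <= rsumn M (N + K) - rsumn M N.
Proof.
  intros H. induction K.
  - rewrite Nat.add_0_r. replace (csumn a N - csumn a N)%C with (RtoC 0) by ring.
    rewrite Cmod_0. lra.
  - rewrite Nat.add_succ_r. simpl.
    replace (csumn a (N + K) + a (N + K)%nat - csumn a N)%C
      with (csumn a (N + K) - csumn a N + a (N + K)%nat)%C by ring.
    eapply Rle_trans; [apply Cmod_triangle|]. specialize (H (N + K)%nat). lra.
Qed.

Lemma rsumn_sum_n (a : nat -> R) (N : nat) : sum_n a N = rsumn a (S N).
Proof.
  induction N.
  - rewrite sum_O. simpl. ring.
  - rewrite sum_Sn, IHN. reflexivity.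
Qed.

Lemma csumn_sum_n (a : nat -> C) (N : nat) :
  @sum_n C_AbelianMonoid a N = csumn a (S N).
Proof.
  induction N.
  - rewrite sum_O. simpl. ring.
  - rewrite sum_Sn, IHN. reflexivity.
Qed.

Lemma is_series_rsumn (a : nat -> R) (l : R) :
  is_series a l <-> is_lim_seq (rsumn a) l.
Proof.
  rewrite (is_lim_seq_incr_1 (rsumn a)).
  split; intros H.
  - apply is_lim_seq_ext with (sum_n a); [apply rsumn_sum_n|exact H].
  - change (is_lim_seq (sum_n a) l).
    apply is_lim_seq_ext with (fun n => rsumn a (S n)); [|exact H].
    intros; now rewrite rsumn_sum_n.
Qed.

Lemma rsumn_limit (M : nat -> R) : ex_series M -> is_lim_seq (rsumn M) (Series M).
Proof. intros H. apply is_series_rsumn. now apply Series_correct. Qed.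

Lemma rsumn_le_Series (M : nat -> R) (N : nat) :
  (forall n, 0 <= M n) -> ex_series M -> rsumn M N <= Series M.
Proof.
  intros Hp H. apply (is_lim_seq_incr_compare (rsumn M)).
  - now apply rsumn_limit.
  - intros n. simpl. specialize (Hp n). lra.
Qed.

Lemma ex_series_bounded (M : nat -> R) (B : R) :
  (forall n, 0 <= M n) -> (forall N, rsumn M N <= B) -> ex_series M /\ Series M <= B.
Proof.
  intros Hp HB.
  destruct (ex_finite_lim_seq_incr (rsumn M) B) as [l Hl].
  - intros n. simpl. specialize (Hp n). lra.
  - exact HB.
  - assert (Hs : is_series M l) by now apply is_series_rsumn.
    split; [now exists l|]. rewrite (is_series_unique _ _ Hs).
    apply (is_lim_seq_le (rsumn M) (fun _ => B) l B); [exact HB|exact Hl|apply is_lim_seq_const].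
Qed.

Lemma series_tail (M : nat -> R) : ex_series M ->
  is_lim_seq (fun N => Series M - rsumn M N) 0.
Proof.
  intros H. replace (Finite 0) with (Finite (Series M - Series M)) by (f_equal; ring).
  apply is_lim_seq_minus'; [apply is_lim_seq_const|now apply rsumn_limit].
Qed.

Lemma re_csumn (a : nat -> C) (N : nat) : Re (csumn a N) = rsumn (fun n => Re (a n)) N.
Proof. induction N; simpl; [reflexivity|]. rewrite <- IHN. reflexivity. Qed.

Lemma im_csumn (a : nat -> C) (N : nat) : Im (csumn a N) = rsumn (fun n => Im (a n)) N.
Proof. induction N; simpl; [reflexivity|]. rewrite <- IHN. reflexivity. Qed.

Lemma cconv_re_im (u : nat -> C) (l : C) :
  cconv u l <-> is_lim_seq (fun n => Re (u n)) (Re l) /\ is_lim_seq (fun n => Im (u n)) (Im l).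
Proof.
  split.
  - intros H. split; apply is_lim_seq_Reals; intros eps He; destruct (H eps He) as [N HN];
      exists N; intros n Hn; unfold R_dist; (eapply Rle_lt_trans; [|apply (HN n Hn)]).
    + rewrite <- re_minus. apply re_le_Cmod.
    + rewrite <- im_minus. apply im_le_Cmod.
  - intros [H1 H2] eps He. apply is_lim_seq_Reals in H1. apply is_lim_seq_Reals in H2.
    destruct (H1 (eps/2)) as [N1 HN1]; [lra|]. destruct (H2 (eps/2)) as [N2 HN2]; [lra|].
    exists (N1 + N2)%nat. intros n Hn.
    specialize (HN1 n ltac:(lia)). specialize (HN2 n ltac:(lia)). unfold R_dist in *.
    eapply Rle_lt_trans; [apply Cmod_le_re_im|]. rewrite re_minus, im_minus. lra.
Qed.

Lemma csums_CSeries (a : nat -> C) (l : C) : csums a l -> CSeries a = l.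
Proof.
  intros H. apply cconv_re_im in H. destruct H as [H1 H2].
  apply C_ext; unfold CSeries; simpl; apply is_series_unique, is_series_rsumn.
  - eapply is_lim_seq_ext; [|exact H1]. intros; apply re_csumn.
  - eapply is_lim_seq_ext; [|exact H2]. intros; apply im_csumn.
Qed.

Lemma csums_is_series (a : nat -> C) (l : C) :
  csums a l <-> @is_series C_AbsRing C_NormedModule a l.
Proof.
  split.
  - intros H P [eps HP]. destruct (H eps (cond_pos eps)) as [N HN].
    exists N. intros n Hn. apply HP.
    apply (C_NormedModule_mixin_compat1 l _ eps).
    change (@sum_n C_NormedModule a n) with (@sum_n C_AbelianMonoid a n).
    rewrite csumn_sum_n. apply HN. lia.
  - intros H eps He.
    assert (Hs : 0 < eps / 2) by lra.
    destruct (H (fun y => @ball C_UniformSpace l (mkposreal _ Hs) y)) as [N HN].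
    { now exists (mkposreal _ Hs). }
    exists (S N). intros n Hn. destruct n as [|n]; [lia|]. specialize (HN n ltac:(lia)).
    change (@sum_n C_NormedModule a n) with (@sum_n C_AbelianMonoid a n) in HN.
    rewrite csumn_sum_n in HN. destruct HN as [H1 H2].
    change (Rabs (Re (csumn a (S n)) - Re l) < eps / 2) in H1.
    change (Rabs (Im (csumn a (S n)) - Im l) < eps / 2) in H2.
    eapply Rle_lt_trans; [apply Cmod_le_re_im|]. rewrite re_minus, im_minus. lra.
Qed.

Lemma csums_unique (a : nat -> C) (l l' : C) : csums a l -> csums a l' -> l = l'.
Proof. apply cconv_unique. Qed.

Lemma csums_ext (a b : nat -> C) (l : C) : (forall n, a n = b n) -> csums a l -> csums b l.
Proof.
  intros He. apply cconv_ext. intros n. apply csumn_ext. intros; apply He.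
Qed.

Lemma csums_plus (a b : nat -> C) (l m : C) :
  csums a l -> csums b m -> csums (fun n => a n + b n)%C (l + m)%C.
Proof.
  intros Ha Hb. eapply cconv_ext; [|apply cconv_plus; [exact Ha|exact Hb]].
  intros; simpl; now rewrite csumn_plus.
Qed.

Lemma csums_scal (k : C) (a : nat -> C) (l : C) :
  csums a l -> csums (fun n => k * a n)%C (k * l)%C.
Proof.
  intros Ha. eapply cconv_ext; [|apply cconv_scal; exact Ha].
  intros; simpl; now rewrite csumn_scal.
Qed.

Lemma csums_minus (a b : nat -> C) (l m : C) :
  csums a l -> csums b m -> csums (fun n => a n - b n)%C (l - m)%C.
Proof.
  intros Ha Hb. apply csums_ext with (fun n => a n + - (1) * b n)%C; [intros; ring|].
  replace (l - m)%C with (l + - (1) * m)%C by ring.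
  apply csums_plus; [exact Ha|now apply csums_scal].
Qed.

Lemma csums_shift (a : nat -> C) (l : C) :
  csums (fun n => a (S n)) l -> csums a (a 0%nat + l)%C.
Proof.
  intros H eps He. destruct (H eps He) as [N HN]. exists (S N). intros n Hn.
  destruct n as [|n]; [lia|]. rewrite csumn_shift.
  replace (a 0%nat + csumn (fun n => a (S n)) n - (a 0%nat + l))%C
    with (csumn (fun n => a (S n)) n - l)%C by ring.
  apply HN. lia.
Qed.

Lemma csums_unshift (a : nat -> C) (l : C) :
  csums a l -> csums (fun n => a (S n)) (l - a 0%nat)%C.
Proof.
  intros H eps He. destruct (H eps He) as [N HN]. exists N. intros n Hn.
  specialize (HN (S n) ltac:(lia)). rewrite csumn_shift in HN.
  replace (csumn (fun n => a (S n)) n - (l - a 0%nat))%C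
    with (a 0%nat + csumn (fun n => a (S n)) n - l)%C by ring. exact HN.
Qed.

Lemma csums_tail (a : nat -> C) (l : C) (M : nat -> R) (N : nat) :
  dominated a M -> ex_series M -> csums a l ->
  Cmod (l - csumn a N) <= Series M - rsumn M N.
Proof.
  intros Hd HM H.
  assert (Hp : forall n, 0 <= M n) by (intros n; eapply Rle_trans; [apply Cmod_ge_0|apply Hd]).
  apply Cmod_cconv_le with (fun K => csumn a (N + K) - csumn a N)%C.
  - intros eps He. destruct (H eps He) as [N' HN']. exists N'. intros n Hn.
    specialize (HN' (N + n)%nat ltac:(lia)).
    replace (csumn a (N + n) - csumn a N - (l - csumn a N))%C
      with (csumn a (N + n) - l)%C by ring. exact HN'.
  - intros K. eapply Rle_trans; [apply Cmod_csumn_diff, Hd|].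
    generalize (rsumn_le_Series M (N + K) Hp HM). lra.
Qed.

Lemma csums_norm_le (a : nat -> C) (l : C) (M : nat -> R) :
  dominated a M -> ex_series M -> csums a l -> Cmod l <= Series M.
Proof.
  intros Hd HM H. generalize (csums_tail a l M 0 Hd HM H). simpl.
  replace (l - 0)%C with l by ring. lra.
Qed.

Lemma csums_exists (a : nat -> C) (M : nat -> R) :
  dominated a M -> ex_series M -> csums a (CSeries a).
Proof.
  intros Hd HM.
  assert (H1 : ex_series (fun n => Re (a n))).
  { apply (@ex_series_le R_AbsRing R_CompleteNormedModule _ M); [|exact HM].
    intros n. eapply Rle_trans; [apply re_le_Cmod|apply Hd]. }
  assert (H2 : ex_series (fun n => Im (a n))).
  { apply (@ex_series_le R_AbsRing R_CompleteNormedModule _ M); [|exact HM].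
    intros n. eapply Rle_trans; [apply im_le_Cmod|apply Hd]. }
  apply cconv_re_im. split; simpl.
  - eapply is_lim_seq_ext; [|apply rsumn_limit, H1]. intros; simpl; now rewrite re_csumn.
  - eapply is_lim_seq_ext; [|apply rsumn_limit, H2]. intros; simpl; now rewrite im_csumn.
Qed.

Lemma csumn_cconv (a : nat -> nat -> C) (l : nat -> C) (N : nat) :
  (forall i, (i < N)%nat -> cconv (fun k => a k i) (l i)) ->
  cconv (fun k => csumn (a k) N) (csumn l N).
Proof.
  induction N; intros H; simpl; [apply cconv_const|].
  apply cconv_plus; [apply IHN; intros; apply H; lia|apply H; lia].
Qed.

(** Dominated convergence for series: past an index [N] the tails are below eps/3 uniformly in [k],
    and only finitely many terms have to converge. *)
Lemma tannery (a : nat -> nat -> C) (s : nat -> C) (b : nat -> C) (l : C) (M : nat -> R) :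
  ex_series M -> (forall k, dominated (a k) M) -> dominated b M ->
  (forall i, cconv (fun k => a k i) (b i)) ->
  (forall k, csums (a k) (s k)) -> csums b l -> cconv s l.
Proof.
  intros HM Ha Hb Hc Hs Hl eps He.
  assert (Ht := series_tail M HM). apply is_lim_seq_Reals in Ht.
  destruct (Ht (eps / 3)) as [N HN]; [lra|]. specialize (HN N (le_n N)).
  unfold R_dist in HN. rewrite Rminus_0_r in HN.
  assert (HT := Rle_lt_trans _ _ _ (Rle_abs _) HN).
  destruct (csumn_cconv a b N (fun i _ => Hc i) (eps / 3)) as [K HK]; [lra|].
  exists K. intros k Hk. specialize (HK k Hk).
  assert (A := csums_tail (a k) (s k) M N (Ha k) HM (Hs k)).
  assert (B := csums_tail b l M N Hb HM Hl).
  rewrite (Cmod_sub_sym l) in B.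
  replace (s k - l)%C with ((s k - csumn (a k) N) + ((csumn (a k) N - csumn b N) + (csumn b N - l)))%C by ring.
  eapply Rle_lt_trans; [apply Cmod_triangle|].
  eapply Rle_lt_trans; [apply Rplus_le_compat_l, Cmod_triangle|]. lra.
Qed.

Lemma ex_series_le_pos (a b : nat -> R) :
  (forall n, 0 <= a n <= b n) -> ex_series b -> ex_series a.
Proof.
  intros H Hb. apply (@ex_series_le R_AbsRing R_CompleteNormedModule a b); [|exact Hb].
  intros n. specialize (H n). change (Rabs (a n) <= b n). rewrite Rabs_pos_eq; lra.
Qed.

Lemma ex_series_scal_R (c : R) (a : nat -> R) : ex_series a -> ex_series (fun n => c * a n).
Proof. intros H. apply (ex_series_scal_l c a H). Qed.

Lemma ex_series_geom_R (r : R) : 0 <= r < 1 -> ex_series (fun n => r ^ n).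
Proof. intros H. apply ex_series_geom. rewrite Rabs_pos_eq; lra. Qed.

(** Induction on [k] with [s = sqrt r]: one factor [s^n] absorbs the [k]-th power by induction, the
    other absorbs the extra factor [n + 1] by Bernoulli's inequality for [1 / s]. *)
Lemma poly_geom_bounded (k : nat) : forall r, 0 <= r < 1 ->
  exists K, 0 < K /\ forall n, INR (S n) ^ k * r ^ n <= K.
Proof.
  induction k; intros r Hr.
  - exists 1. split; [lra|]. intros n. simpl. rewrite Rmult_1_l.
    rewrite <- (pow1 n). apply pow_incr. lra.
  - set (s := sqrt r).
    assert (Hs : 0 <= s < 1).
    { split; [apply sqrt_pos|]. unfold s. rewrite <- sqrt_1. apply sqrt_lt_1; lra. }
    assert (Hss : s * s = r) by (apply sqrt_sqrt; lra).
    destruct (IHk s Hs) as [K [HK Hb]].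
    assert (Hc : exists L, 0 < L /\ forall n, INR (S n) * s ^ n <= L).
    { destruct (Req_dec s 0) as [H0|H0].
      - exists 1. split; [lra|]. intros n. rewrite H0. destruct n; [simpl; lra|].
        rewrite pow_i by lia. lra.
      - set (x := / s - 1).
        assert (Hx : 0 < x).
        { unfold x. assert (1 < / s) by (rewrite <- Rinv_1; apply Rinv_lt_contravar; lra). lra. }
        exists (1 + / x). assert (0 < / x) by (apply Rinv_0_lt_compat; lra).
        split; [lra|]. intros n.
        assert (Hp : 1 + INR n * x <= (1 + x) ^ n) by (apply poly; lra).
        assert (Hi : s ^ n = / (1 + x) ^ n).
        { unfold x. replace (1 + (/ s - 1)) with (/ s) by ring. rewrite pow_inv.
          now rewrite Rinv_inv. }
        rewrite Hi. assert (Hn := pos_INR n).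
        assert (0 < (1 + x) ^ n) by (apply pow_lt; lra).
        apply Rmult_le_reg_r with ((1 + x) ^ n); [assumption|].
        rewrite Rmult_assoc, Rinv_l, Rmult_1_r by lra.
        apply Rle_trans with ((1 + / x) * (1 + INR n * x)).
        + rewrite S_INR. assert (/ x * (INR n * x) = INR n) by (field; lra). nra.
        + apply Rmult_le_compat_l; lra. }
    destruct Hc as [L [HL Hl]].
    exists (L * K). split; [apply Rmult_lt_0_compat; assumption|]. intros n.
    rewrite <- Hss, Rpow_mult_distr.
    change (INR (S n) ^ S k) with (INR (S n) * INR (S n) ^ k).
    replace (INR (S n) * INR (S n) ^ k * (s ^ n * s ^ n))
      with ((INR (S n) * s ^ n) * (INR (S n) ^ k * s ^ n)) by ring.
    assert (0 <= s ^ n) by (apply pow_le; lra). assert (Hn := pos_INR (S n)).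
    apply Rmult_le_compat; [| |apply Hl|apply Hb].
    { apply Rmult_le_pos; [lra|]. now apply pow_le. }
    apply Rmult_le_pos; [now apply pow_le|lra].
Qed.

Lemma ex_series_poly_geom (k : nat) (r : R) : 0 <= r < 1 ->
  ex_series (fun n => INR (S n) ^ k * r ^ n).
Proof.
  intros Hr. set (s := sqrt r).
  assert (Hs : 0 <= s < 1).
  { split; [apply sqrt_pos|]. unfold s. rewrite <- sqrt_1. apply sqrt_lt_1; lra. }
  assert (Hss : s * s = r) by (apply sqrt_sqrt; lra).
  destruct (poly_geom_bounded k s Hs) as [K [HK Hb]].
  apply ex_series_le_pos with (fun n => K * s ^ n).
  - intros n. assert (0 <= s ^ n) by (apply pow_le; lra).
    assert (0 <= INR (S n) ^ k) by (apply pow_le, pos_INR).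
    rewrite <- Hss, Rpow_mult_distr. specialize (Hb n). split; [|nra].
    apply Rmult_le_pos; [assumption|]. now apply Rmult_le_pos.
  - apply ex_series_scal_R, ex_series_geom_R, Hs.
Qed.

(** * Termwise differentiation *)

(** On the convex disc the mean value inequality turns the bound on [f' n] into the bound
    [|w - z| M n] on increments, so the tail of the difference quotient is controlled uniformly in
    [w]. *)
Lemma termwise_derivative (f f' : nat -> C -> C) (F F' : C -> C) (c : C) (r : R) (M : nat -> R) :
  ex_series M ->
  (forall n w, Cmod (w - c) < r -> cderiv (f n) w (f' n w)) ->
  (forall n w, Cmod (w - c) < r -> Cmod (f' n w) <= M n) ->
  (forall w, Cmod (w - c) < r -> csums (fun n => f n w) (F w)) ->
  (forall w, Cmod (w - c) < r -> csums (fun n => f' n w) (F' w)) ->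
  forall w, Cmod (w - c) < r -> cderiv F w (F' w).
Proof.
  intros HM Hd Hb HF HF' z Hz eps He.
  assert (Ht := series_tail M HM). apply is_lim_seq_Reals in Ht.
  destruct (Ht (eps / 3)) as [N HN]; [lra|]. specialize (HN N (le_n N)).
  unfold R_dist in HN. rewrite Rminus_0_r in HN.
  assert (HT := Rle_lt_trans _ _ _ (Rle_abs _) HN).
  assert (HdN : cderiv (fun w => csumn (fun n => f n w) N) z (csumn (fun n => f' n z) N)).
  { clear HN HT. induction N; simpl; [apply cderiv_const|]. apply cderiv_plus; [exact IHN|apply Hd, Hz]. }
  destruct (HdN (eps / 3)) as [d [Hd0 Hw]]; [lra|].
  exists (Rmin d (r - Cmod (z - c))). split; [apply Rmin_glb_lt; lra|].
  intros w Hwz.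
  assert (Hwc : Cmod (w - c) < r).
  { eapply Rle_lt_trans; [apply (Cmod_sub_triangle w z c)|].
    generalize (Rlt_le_trans _ _ _ Hwz (Rmin_r _ _)). lra. }
  specialize (Hw w (Rlt_le_trans _ _ _ Hwz (Rmin_l _ _))).
  assert (Hn := Cmod_ge_0 (w - z)).
  assert (Hdom : dominated (fun n => f n w - f n z)%C (fun n => Cmod (w - z) * M n)).
  { intros n. rewrite Rmult_comm. apply (mean_value_disc (f n) (f' n) c z w r (M n)); auto. }
  assert (A := csums_tail _ _ _ N Hdom (ex_series_scal_R _ _ HM)
                 (csums_minus _ _ _ _ (HF w Hwc) (HF z Hz))).
  assert (B := csums_tail (fun n => f' n z) (F' z) M N (fun n => Hb n z Hz) HM (HF' z Hz)).
  rewrite Series_scal_l in A.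
  assert (Er : forall k, rsumn (fun n => Cmod (w - z) * M n) k = Cmod (w - z) * rsumn M k).
  { induction k; simpl; [ring|rewrite IHk; ring]. }
  rewrite Er in A.
  assert (Ec : csumn (fun n => f n w - f n z)%C N
               = (csumn (fun n => f n w) N - csumn (fun n => f n z) N)%C).
  { clear. induction N; simpl; [ring|rewrite IHN; ring]. }
  rewrite Ec in A.
  set (SN := csumn (fun n => f' n z) N) in *.
  set (Dw := (csumn (fun n => f n w) N - csumn (fun n => f n z) N)%C) in *.
  replace (F w - F z - F' z * (w - z))%C
    with ((F w - F z - Dw) + ((Dw - SN * (w - z)) - (F' z - SN) * (w - z)))%C by ring.
  eapply Rle_trans; [apply Cmod_triangle|].
  eapply Rle_trans; [apply Rplus_le_compat_l, Cmod_minus_le|]. rewrite Cmod_mult.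
  assert (A' : Cmod (w - z) * Series M - Cmod (w - z) * rsumn M N <= eps / 3 * Cmod (w - z)) by nra.
  assert (B' : Cmod (F' z - SN) * Cmod (w - z) <= eps / 3 * Cmod (w - z)) by nra.
  lra.
Qed.

Lemma uniform_series_ccont (f : nat -> C -> C) (F : C -> C) (c : C) (r : R) (M : nat -> R) :
  ex_series M ->
  (forall n w, Cmod (w - c) < r -> ccont (f n) w) ->
  (forall n w, Cmod (w - c) < r -> Cmod (f n w) <= M n) ->
  (forall w, Cmod (w - c) < r -> csums (fun n => f n w) (F w)) ->
  forall w, Cmod (w - c) < r -> ccont F w.
Proof.
  intros HM Hd Hb HF z Hz eps He.
  assert (Ht := series_tail M HM). apply is_lim_seq_Reals in Ht.
  destruct (Ht (eps / 3)) as [N HN]; [lra|]. specialize (HN N (le_n N)).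
  unfold R_dist in HN. rewrite Rminus_0_r in HN.
  assert (HT := Rle_lt_trans _ _ _ (Rle_abs _) HN).
  assert (HdN : ccont (fun w => csumn (fun n => f n w) N) z).
  { clear HN HT. induction N; simpl; [apply ccont_const|]. apply ccont_plus; [exact IHN|apply Hd, Hz]. }
  destruct (HdN (eps / 3)) as [d [Hd0 Hw]]; [lra|].
  exists (Rmin d (r - Cmod (z - c))). split; [apply Rmin_glb_lt; lra|].
  intros w Hwz.
  assert (Hwc : Cmod (w - c) < r).
  { eapply Rle_lt_trans; [apply (Cmod_sub_triangle w z c)|].
    generalize (Rlt_le_trans _ _ _ Hwz (Rmin_r _ _)). lra. }
  specialize (Hw w (Rlt_le_trans _ _ _ Hwz (Rmin_l _ _))).
  assert (A := csums_tail (fun n => f n w) (F w) M N (fun n => Hb n w Hwc) HM (HF w Hwc)).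
  assert (B := csums_tail (fun n => f n z) (F z) M N (fun n => Hb n z Hz) HM (HF z Hz)).
  rewrite (Cmod_sub_sym (F z)) in B.
  match type of Hw with Cmod (?a - ?b) < _ =>
    replace (F w - F z)%C with ((F w - a) + ((a - b) + (b - F z)))%C by ring end.
  eapply Rle_lt_trans; [apply Cmod_triangle|].
  eapply Rle_lt_trans; [apply Rplus_le_compat_l, Cmod_triangle|]. lra.
Qed.

(** * Double series *)

(** A finite sum of columns is the sum of the rows cut at [J]. Those cut rows are dominated by the
    full row majorants, so [tannery] lets [J] grow. *)
Lemma csums_swap (f : nat -> nat -> C) (M : nat -> nat -> R) (row col : nat -> C) (l : C) :
  (forall i j, Cmod (f i j) <= M i j) ->
  (forall i, ex_series (M i)) -> ex_series (fun i => Series (M i)) ->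
  (forall i, csums (f i) (row i)) -> csums row l ->
  (forall j, csums (fun i => f i j) (col j)) -> csums col l.
Proof.
  intros HfM HM HMM Hrow Hl Hcol.
  assert (Hp : forall i j, 0 <= M i j) by (intros; eapply Rle_trans; [apply Cmod_ge_0|apply HfM]).
  apply (tannery (fun J i => csumn (f i) J) (csumn col) row l (fun i => Series (M i))); auto.
  - intros J i. eapply Rle_trans; [apply Cmod_csumn_le; intros j; apply HfM|].
    apply rsumn_le_Series; auto.
  - intros i. apply (csums_norm_le (f i)); auto. intros j; apply HfM.
  - intros J. induction J; simpl.
    + eapply cconv_ext; [|apply cconv_const]. intros n. simpl. induction n; simpl; [reflexivity|].
      rewrite <- IHn. ring.
    + apply csums_plus; auto.
Qed.

(** * The exponential *)

Lemma Cexp_plus (a b : C) : Cexp (a + b) = (Cexp a * Cexp b)%C.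
Proof.
  unfold Cexp. rewrite re_plus, im_plus, exp_plus, cos_plus, sin_plus.
  unfold Cmult; simpl. f_equal; ring.
Qed.

Lemma Cexp_0 : Cexp 0 = 1.
Proof. unfold Cexp; simpl. rewrite exp_0, cos_0, sin_0. unfold RtoC. f_equal; ring. Qed.

Lemma Cmod_Cexp (z : C) : Cmod (Cexp z) = exp (Re z).
Proof.
  unfold Cmod, Cexp; simpl fst; simpl snd.
  replace ((exp (Re z) * cos (Im z)) ^ 2 + (exp (Re z) * sin (Im z)) ^ 2)
    with (Rsqr (exp (Re z)) * (Rsqr (sin (Im z)) + Rsqr (cos (Im z)))) by (unfold Rsqr; ring).
  rewrite sin2_cos2, Rmult_1_r. apply sqrt_Rsqr. left. apply exp_pos.
Qed.

Lemma Cexp_nz (z : C) : Cexp z <> 0.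
Proof. apply Cmod_gt_0. rewrite Cmod_Cexp. apply exp_pos. Qed.

Lemma Cexp_opp (z : C) : Cexp (- z) = (/ Cexp z)%C.
Proof.
  assert (H : (Cexp (- z) * Cexp z)%C = 1).
  { rewrite <- Cexp_plus. replace (- z + z)%C with (RtoC 0) by ring. apply Cexp_0. }
  rewrite <- (Cmult_1_r (Cexp (- z))), <- (Cinv_r (Cexp z)) by apply Cexp_nz.
  rewrite Cmult_assoc, H. ring.
Qed.

Lemma Cexp_conj (z : C) : Cexp (Cconj z) = Cconj (Cexp z).
Proof.
  destruct z as [x y]. unfold Cexp, Cconj; simpl. rewrite cos_neg, sin_neg. apply C_ext; simpl; ring.
Qed.

Lemma Cexp_INR_mult (n : nat) (z : C) : Cexp (INR n * z) = (Cexp z ^ n)%C.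
Proof.
  induction n.
  - simpl. replace (0 * z)%C with (RtoC 0) by ring. apply Cexp_0.
  - rewrite S_INR, RtoC_plus.
    replace ((INR n + 1) * z)%C with (z + INR n * z)%C by ring.
    rewrite Cexp_plus, IHn. reflexivity.
Qed.

Lemma rderiv_Cexp_ray (u : C) (t : R) :
  rderiv (fun s => Cexp (RtoC s * u)) t (u * Cexp (RtoC t * u))%C.
Proof.
  destruct u as [a b]. unfold rderiv, Cexp, Cmult, RtoC; simpl.
  split; auto_derive; auto; unfold Rminus; ring.
Qed.

Definition exp_poly (n : nat) (u : C) : C := csumn (fun k => u ^ k / INR (fact k))%C n.

Lemma INR_fact_nz (k : nat) : RtoC (INR (fact k)) <> 0.
Proof. intros H. apply RtoC_inj in H. revert H. apply INR_fact_neq_0. Qed.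

Lemma cderiv_exp_poly (n : nat) (u : C) : cderiv (exp_poly (S n)) u (exp_poly n u).
Proof.
  induction n.
  - apply cderiv_ext with (fun _ => RtoC 1).
    + intros w. unfold exp_poly. simpl. field.
    + unfold exp_poly. simpl. apply cderiv_const.
  - change (exp_poly (S (S n))) with (fun u => exp_poly (S n) u + u ^ S n / INR (fact (S n)))%C.
    change (exp_poly (S n) u) with (exp_poly n u + u ^ n / INR (fact n))%C.
    apply cderiv_plus; [exact IHn|].
    eapply cderiv_eq.
    + apply cderiv_mult; [apply (cderiv_pow (fun w => w)), cderiv_id|apply cderiv_const].
    + cbv beta. rewrite fact_simpl, mult_INR, RtoC_mult.
      field. split; [apply INR_fact_nz|]. intros H. apply RtoC_inj in H. revert H.
      apply not_0_INR. lia.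
Qed.

Lemma exp_poly_0 (n : nat) : exp_poly (S n) 0 = 1.
Proof.
  induction n.
  - unfold exp_poly. simpl. field.
  - change (exp_poly (S (S n)) 0) with (exp_poly (S n) 0 + 0 ^ S n / INR (fact (S n)))%C.
    rewrite IHn. simpl (Cpow _ _). field. apply INR_fact_nz.
Qed.

(** Induction on [n] along the ray [t u]: the derivative of the remainder of order [n + 1] is [u]
    times the remainder of order [n]. *)
Lemma Cexp_remainder (n : nat) (u : C) :
  Cmod (Cexp u - exp_poly n u) <= Cmod u ^ n * exp (Cmod u).
Proof.
  assert (He : forall u, Cmod (Cexp u) <= exp (Cmod u)).
  { intros v. rewrite Cmod_Cexp.
    destruct (Rle_abs (Re v)) as [H|H].
    - left. apply exp_increasing. generalize (re_le_Cmod v). lra.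
    - destruct (Rle_lt_or_eq_dec _ _ (Rle_trans _ _ _ (Rle_abs _) (re_le_Cmod v))) as [H'|H'].
      + left. now apply exp_increasing.
      + rewrite H'. lra. }
  revert u. induction n; intros u.
  - unfold exp_poly. simpl. replace (Cexp u - 0)%C with (Cexp u) by ring. rewrite Rmult_1_l. apply He.
  - generalize (mean_value_curve (fun t => Cexp (RtoC t * u) - exp_poly (S n) (RtoC t * u))%C
      (fun t => u * Cexp (RtoC t * u) - exp_poly n (RtoC t * u) * u)%C
      (Cmod u ^ S n * exp (Cmod u)) 0 1 ltac:(lra)).
    replace (1 * u)%C with u by ring. replace (0 * u)%C with (RtoC 0) by ring.
    rewrite Cexp_0, exp_poly_0. intros H.
    replace (Cexp u - exp_poly (S n) u)%C
      with (Cexp u - exp_poly (S n) u - (1 - 1))%C by ring.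
    replace (Cmod u ^ S n * exp (Cmod u)) with (Cmod u ^ S n * exp (Cmod u) * (1 - 0)) by ring.
    apply H.
    + intros t Ht.
      assert (A := rderiv_Cexp_ray u t).
      assert (B : rderiv (fun s => exp_poly (S n) (RtoC s * u)) t (exp_poly n (RtoC t * u) * u)%C).
      { apply (rderiv_comp (exp_poly (S n)) (fun s => RtoC s * u)%C t).
        - apply rderiv_ray.
        - apply cderiv_exp_poly. }
      destruct A as [A1 A2], B as [B1 B2].
      split; [apply (is_derive_minus _ _ _ _ _ A1 B1)|apply (is_derive_minus _ _ _ _ _ A2 B2)].
    + intros t Ht.
      replace (u * Cexp (RtoC t * u) - exp_poly n (RtoC t * u) * u)%C
        with (u * (Cexp (RtoC t * u) - exp_poly n (RtoC t * u)))%C by ring.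
      rewrite Cmod_mult. simpl. rewrite Rmult_assoc.
      apply Rmult_le_compat_l; [apply Cmod_ge_0|].
      eapply Rle_trans; [apply IHn|].
      assert (Hm : Cmod (RtoC t * u) <= Cmod u).
      { rewrite Cmod_mult, Cmod_R, Rabs_pos_eq by lra. generalize (Cmod_ge_0 u). nra. }
      apply Rmult_le_compat.
      * apply pow_le, Cmod_ge_0.
      * left; apply exp_pos.
      * apply pow_incr. split; [apply Cmod_ge_0|exact Hm].
      * destruct Hm as [Hm| ->]; [left; now apply exp_increasing|lra].
Qed.

Lemma exp_le_mono (a b : R) : a <= b -> exp a <= exp b.
Proof. intros [H| ->]; [left; now apply exp_increasing|lra]. Qed.

Lemma cderiv_Cexp (z : C) : cderiv Cexp z (Cexp z).
Proof.
  intros eps He.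
  set (K := Cmod (Cexp z) * exp 1).
  assert (HK : 0 < K).
  { apply Rmult_lt_0_compat; [apply Cmod_gt_0, Cexp_nz|apply exp_pos]. }
  exists (Rmin 1 (eps / K)). split; [apply Rmin_glb_lt; [lra|now apply Rdiv_lt_0_compat]|].
  intros w Hw.
  assert (H1 := Rlt_le_trans _ _ _ Hw (Rmin_l _ _)).
  assert (H2 := Rlt_le_trans _ _ _ Hw (Rmin_r _ _)).
  replace (Cexp w) with (Cexp z * Cexp (w - z))%C
    by (rewrite <- Cexp_plus; f_equal; ring).
  assert (A := Cexp_remainder 2 (w - z)).
  replace (exp_poly 2 (w - z)) with (1 + (w - z))%C in A
    by (unfold exp_poly; simpl; field).
  replace (Cexp z * Cexp (w - z) - Cexp z - Cexp z * (w - z))%C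
    with (Cexp z * (Cexp (w - z) - (1 + (w - z))))%C by ring.
  rewrite Cmod_mult.
  assert (Hn := Cmod_ge_0 (w - z)). assert (Hz := Cmod_ge_0 (Cexp z)).
  set (n := Cmod (w - z)) in *.
  apply Rle_trans with (Cmod (Cexp z) * (n ^ 2 * exp n)); [now apply Rmult_le_compat_l|].
  assert (exp n <= exp 1) by (apply exp_le_mono; lra).
  assert (0 < exp n) by apply exp_pos.
  apply Rle_trans with (K * n * n).
  - unfold K. replace (Cmod (Cexp z) * exp 1 * n * n) with (Cmod (Cexp z) * (n ^ 2 * exp 1)) by ring.
    apply Rmult_le_compat_l; [assumption|]. apply Rmult_le_compat_l; [|assumption]. apply pow2_ge_0.
  - apply Rmult_le_compat_r; [assumption|].
    apply (Rmult_lt_compat_l K) in H2; [|assumption].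
    replace (K * (eps / K)) with eps in H2 by (field; lra). lra.
Qed.

Lemma Cexp_2PI_eq_1 (z : C) : Cexp (2 * PI * Ci * z) = 1 -> exists k : Z, z = IZR k.
Proof.
  intros H. destruct z as [x y].
  assert (Hm : exp (- (2 * PI * y)) = 1).
  { rewrite <- Cmod_1, <- H, Cmod_Cexp. f_equal. unfold Ci, Cmult, RtoC; simpl. ring. }
  assert (Hy : y = 0).
  { rewrite <- exp_0 in Hm. apply exp_inv in Hm. generalize PI_RGT_0. intros. nra. }
  subst y.
  assert (Hc : cos (2 * PI * x) = 1).
  { apply (f_equal Re) in H. unfold Cexp in H. simpl in H.
    replace ((2 * 0 + 0 * PI) * 0 + (2 * PI - 0 * 0) * 1) with (2 * PI) in H by ring.
    match type of H with exp ?a * cos ?b = 1 =>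
      replace a with 0 in H by ring; replace b with (2 * PI * x) in H by ring end.
    rewrite exp_0 in H. lra. }
  replace (2 * PI * x) with (2 * (PI * x)) in Hc by ring.
  rewrite cos_2a_sin in Hc.
  assert (Hs : sin (PI * x) = 0) by nra.
  apply sin_eq_0_0 in Hs. destruct Hs as [k Hk]. exists k.
  assert (x = IZR k) by (generalize PI_RGT_0; intros; nra).
  subst x. reflexivity.
Qed.

Lemma Cexp_2PI_Z (k : Z) : Cexp (2 * PI * Ci * IZR k) = 1.
Proof.
  unfold Cexp, Ci, Cmult, RtoC; simpl.
  match goal with |- (exp ?a * cos ?b, exp ?a * sin ?b) = _ =>
    replace a with 0 by ring; replace b with (0 + 2 * IZR k * PI) by ring end.
  rewrite exp_0.
  rewrite Rplus_0_l.
  assert (Hs : sin (IZR k * PI) = 0) by (apply sin_eq_0_1; now exists k).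
  replace (2 * IZR k * PI) with (2 * (IZR k * PI)) by ring.
  rewrite cos_2a_sin, sin_2a, Hs. f_equal; ring.
Qed.

(** * Power series *)

(** A Cauchy estimate at radius [r] stands in for the radius of convergence: it gives convergence on
    the open disc and passes to the derived series at every smaller radius. *)
Definition coef_bound (a : nat -> C) (r K : R) : Prop := forall k, Cmod (a k) * r ^ k <= K.

Definition pseries (a : nat -> C) (z : C) : C := CSeries (fun k => a k * z ^ k)%C.

Definition pderiv (a : nat -> C) (k : nat) : C := (INR (S k) * a (S k))%C.

Lemma coef_bound_ratio (a : nat -> C) (r K s : R) : 0 < r -> coef_bound a r K -> 0 <= s ->
  forall k, Cmod (a k) * s ^ k <= K * (s / r) ^ k.
Proof.
  intros Hr H Hs k.
  replace (s ^ k) with (r ^ k * (s / r) ^ k).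
  - rewrite <- Rmult_assoc. apply Rmult_le_compat_r; [|apply H].
    apply pow_le. apply Rdiv_le_0_compat; assumption.
  - rewrite <- Rpow_mult_distr. f_equal. field. lra.
Qed.

Lemma pseries_csums (a : nat -> C) (r K : R) (z : C) : 0 < r -> coef_bound a r K ->
  Cmod z < r -> csums (fun k => a k * z ^ k)%C (pseries a z).
Proof.
  intros Hr H Hz.
  apply csums_exists with (fun k => K * (Cmod z / r) ^ k).
  - intros k. rewrite Cmod_mult, Cmod_pow. apply coef_bound_ratio; auto. apply Cmod_ge_0.
  - apply ex_series_scal_R, ex_series_geom_R. split.
    + apply Rdiv_le_0_compat; [apply Cmod_ge_0|assumption].
    + apply Rmult_lt_reg_r with r; [assumption|]. unfold Rdiv. rewrite Rmult_assoc, Rinv_l; lra.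
Qed.

Lemma pderiv_bound (a : nat -> C) (r K s : R) : 0 < r -> coef_bound a r K -> 0 < s < r ->
  exists K', coef_bound (pderiv a) s K'.
Proof.
  intros Hr H Hs.
  assert (Hq : 0 <= s / r < 1).
  { split; [apply Rdiv_le_0_compat; lra|].
    apply Rmult_lt_reg_r with r; [assumption|]. unfold Rdiv. rewrite Rmult_assoc, Rinv_l; lra. }
  destruct (poly_geom_bounded 1 (s / r) Hq) as [L [HL Hb]].
  assert (HK : 0 <= K).
  { eapply Rle_trans; [|apply (H O)]. apply Rmult_le_pos; [apply Cmod_ge_0|simpl; lra]. }
  exists (K / r * L). intros k. unfold pderiv. rewrite Cmod_mult, Cmod_R, Rabs_pos_eq by apply pos_INR.
  specialize (Hb k). rewrite pow_1 in Hb.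
  assert (A := coef_bound_ratio a r K s Hr H ltac:(lra) (S k)).
  assert (Hk := pos_INR (S k)).
  apply Rmult_le_reg_l with s; [lra|].
  replace (s * (INR (S k) * Cmod (a (S k)) * s ^ k)) with (INR (S k) * (Cmod (a (S k)) * s ^ S k))
    by (simpl (s ^ S k); ring).
  apply Rle_trans with (INR (S k) * (K * (s / r) ^ S k)); [now apply Rmult_le_compat_l|].
  replace (s * (K / r * L)) with (K * (s / r) * L) by (field; lra).
  replace (INR (S k) * (K * (s / r) ^ S k)) with (K * (s / r) * (INR (S k) * (s / r) ^ k))
    by (change ((s / r) ^ S k) with (s / r * (s / r) ^ k); ring).
  apply Rmult_le_compat_l; [|exact Hb]. apply Rmult_le_pos; lra.
Qed.

Lemma pseries_deriv (a : nat -> C) (r K : R) (z : C) : 0 < r -> coef_bound a r K ->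
  Cmod z < r -> cderiv (pseries a) z (pseries (pderiv a) z).
Proof.
  intros Hr H Hz.
  (* Two intermediate radii: the derived coefficients are bounded at [s'], and on the disc of radius
     [s < s'] they are dominated geometrically. *)
  set (s := (Cmod z + r) / 2). set (s' := (s + r) / 2).
  assert (Hz0 := Cmod_ge_0 z).
  assert (Hs : 0 < s < r) by (unfold s; lra).
  assert (Hs' : s < s' < r) by (unfold s'; lra).
  destruct (pderiv_bound a r K s' Hr H ltac:(lra)) as [K' HK'].
  assert (E : forall w, csums (fun k => match k with O => RtoC 0 | S j => pderiv a j * w ^ j end)%C
                (pseries (pderiv a) w) <-> csums (fun k => pderiv a k * w ^ k)%C (pseries (pderiv a) w)).
  { intros w; split; intros A.
    - apply csums_unshift in A. eapply cconv_ext; [intros; reflexivity|].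
      replace (pseries (pderiv a) w) with (pseries (pderiv a) w - 0)%C by ring. exact A.
    - apply (csums_shift (fun k => match k with O => RtoC 0 | S j => (pderiv a j * w ^ j)%C end)) in A.
      replace (pseries (pderiv a) w) with (0 + pseries (pderiv a) w)%C by ring. exact A. }
  apply (termwise_derivative (fun k w => a k * w ^ k)%C
    (fun k w => match k with O => RtoC 0 | S j => (pderiv a j * w ^ j)%C end)
    (pseries a) (pseries (pderiv a)) 0 s
    (fun k => match k with O => 0 | S j => K' * (s / s') ^ j end)).
  - apply ex_series_incr_1. apply ex_series_scal_R, ex_series_geom_R. split.
    + apply Rdiv_le_0_compat; lra.
    + apply Rmult_lt_reg_r with s'; [lra|]. unfold Rdiv. rewrite Rmult_assoc, Rinv_l; lra.
  - intros [|k] w Hw.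
    + apply cderiv_ext with (fun _ => a 0%nat); [intros; simpl; ring|apply cderiv_const].
    + eapply cderiv_eq; [apply cderiv_scal, (cderiv_pow (fun w => w)), cderiv_id|].
      unfold pderiv. ring.
  - intros [|k] w Hw; [rewrite Cmod_0; lra|].
    replace (w - 0)%C with w in Hw by ring. rewrite Cmod_mult, Cmod_pow.
    eapply Rle_trans; [|apply (coef_bound_ratio (pderiv a) s' K' s); [lra|exact HK'|lra]].
    apply Rmult_le_compat_l; [apply Cmod_ge_0|]. apply pow_incr. split; [apply Cmod_ge_0|lra].
  - intros w Hw. replace (w - 0)%C with w in Hw by ring.
    apply pseries_csums with r K; auto; lra.
  - intros w Hw. replace (w - 0)%C with w in Hw by ring.
    apply E. apply pseries_csums with s' K'; auto; lra.
  - replace (z - 0)%C with z by ring. unfold s. lra.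
Qed.

Lemma pseries_ccont (a : nat -> C) (r K : R) (z : C) : 0 < r -> coef_bound a r K ->
  Cmod z < r -> ccont (pseries a) z.
Proof. intros Hr H Hz. eapply cderiv_cont, pseries_deriv; eassumption. Qed.

Lemma pseries_deriv_ccont (a : nat -> C) (r K : R) (z : C) : 0 < r -> coef_bound a r K ->
  Cmod z < r -> ccont (pseries (pderiv a)) z.
Proof.
  intros Hr H Hz. assert (Hz0 := Cmod_ge_0 z).
  destruct (pderiv_bound a r K ((Cmod z + r) / 2) Hr H ltac:(lra)) as [K' HK'].
  apply pseries_ccont with ((Cmod z + r) / 2) K'; auto; lra.
Qed.

Lemma pseries_0 (a : nat -> C) : pseries a 0 = a 0%nat.
Proof.
  apply csums_CSeries. intros eps He. exists 1%nat. intros n Hn. destruct n as [|n]; [lia|].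
  assert (E : csumn (fun k => a k * 0 ^ k)%C (S n) = a 0%nat).
  { clear. induction n; [simpl; ring|].
    change (csumn (fun k => a k * 0 ^ k)%C (S (S n)))
      with (csumn (fun k => a k * 0 ^ k)%C (S n) + a (S n) * (0 * 0 ^ n))%C.
    rewrite IHn. ring. }
  rewrite E. replace (a 0%nat - a 0%nat)%C with (RtoC 0) by ring. now rewrite Cmod_0.
Qed.

Lemma poly_coef_bound (a : nat -> C) (C0 : R) (m : nat) (r : R) :
  0 <= r < 1 -> (forall k, Cmod (a k) <= C0 * INR (S k) ^ m) ->
  exists K, coef_bound a r K.
Proof.
  intros Hr H. destruct (poly_geom_bounded m r Hr) as [K [HK Hb]].
  assert (HC : 0 <= C0).
  { specialize (H O). rewrite INR_1, pow1 in H. generalize (Cmod_ge_0 (a O)). lra. }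
  exists (C0 * K). intros k.
  apply Rle_trans with (C0 * INR (S k) ^ m * r ^ k).
  - apply Rmult_le_compat_r; [apply pow_le; lra|apply H].
  - rewrite Rmult_assoc. apply Rmult_le_compat_l; auto.
Qed.

(** * Cauchy's formula on circles and Taylor expansion *)

(** Integrands are functions on C restricted to a real parameter, so that the rules for [ccont] and
    [cderiv] apply to them unchanged. *)
Definition cont_on_R (F : C -> C) : Prop := forall t : R, ccont F (RtoC t).

Definition cint (F : C -> C) : C :=
  (RInt (fun t => Re (F (RtoC t))) 0 (2 * PI), RInt (fun t => Im (F (RtoC t))) 0 (2 * PI)).

Lemma cont_on_R_re (F : C -> C) (t : R) : ccont F (RtoC t) ->
  continuous (fun s => Re (F (RtoC s))) t.
Proof.
  intros H. apply filterlim_locally. intros eps.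
  destruct (H eps (cond_pos eps)) as [d [Hd Hw]]. exists (mkposreal d Hd). intros s Hs.
  change (Rabs (Re (F (RtoC s)) - Re (F (RtoC t))) < eps). rewrite <- re_minus.
  eapply Rle_lt_trans; [apply re_le_Cmod|]. apply Hw.
  rewrite <- RtoC_minus, Cmod_R. exact Hs.
Qed.

Lemma cont_on_R_im (F : C -> C) (t : R) : ccont F (RtoC t) ->
  continuous (fun s => Im (F (RtoC s))) t.
Proof.
  intros H. apply filterlim_locally. intros eps.
  destruct (H eps (cond_pos eps)) as [d [Hd Hw]]. exists (mkposreal d Hd). intros s Hs.
  change (Rabs (Im (F (RtoC s)) - Im (F (RtoC t))) < eps). rewrite <- im_minus.
  eapply Rle_lt_trans; [apply im_le_Cmod|]. apply Hw.
  rewrite <- RtoC_minus, Cmod_R. exact Hs.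
Qed.

Lemma ex_RInt_re (F : C -> C) (a b : R) : cont_on_R F -> ex_RInt (fun s => Re (F (RtoC s))) a b.
Proof.
  intros H. apply (@ex_RInt_continuous R_CompleteNormedModule).
  intros z _. apply cont_on_R_re, H.
Qed.

Lemma ex_RInt_im (F : C -> C) (a b : R) : cont_on_R F -> ex_RInt (fun s => Im (F (RtoC s))) a b.
Proof.
  intros H. apply (@ex_RInt_continuous R_CompleteNormedModule).
  intros z _. apply cont_on_R_im, H.
Qed.

Lemma cint_ext (F G : C -> C) : (forall t : R, F (RtoC t) = G (RtoC t)) -> cint F = cint G.
Proof.
  intros H. unfold cint. f_equal; apply RInt_ext; intros; now rewrite H.
Qed.

Lemma cint_plus (F G : C -> C) : cont_on_R F -> cont_on_R G ->
  cint (fun t => F t + G t)%C = (cint F + cint G)%C.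
Proof.
  intros HF HG. apply C_ext; simpl.
  - apply (@RInt_plus R_CompleteNormedModule); now apply ex_RInt_re.
  - apply (@RInt_plus R_CompleteNormedModule); now apply ex_RInt_im.
Qed.

Lemma cint_scal (k : C) (F : C -> C) : cont_on_R F -> cint (fun t => k * F t)%C = (k * cint F)%C.
Proof.
  intros HF. destruct k as [a b]. assert (H1 := ex_RInt_re F 0 (2 * PI) HF).
  assert (H2 := ex_RInt_im F 0 (2 * PI) HF).
  apply C_ext; simpl.
  - rewrite (RInt_ext _ (fun t => minus (scal a (Re (F (RtoC t)))) (scal b (Im (F (RtoC t)))))).
    + rewrite (@RInt_minus R_CompleteNormedModule), !(@RInt_scal R_CompleteNormedModule); auto;
        now apply (@ex_RInt_scal R_NormedModule).
    + intros; reflexivity.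
  - rewrite (RInt_ext _ (fun t => plus (scal a (Im (F (RtoC t)))) (scal b (Re (F (RtoC t)))))).
    + rewrite (@RInt_plus R_CompleteNormedModule), !(@RInt_scal R_CompleteNormedModule); auto;
        now apply (@ex_RInt_scal R_NormedModule).
    + intros; reflexivity.
Qed.

Lemma cint_const (k : C) : cint (fun _ => k) = (2 * PI * k)%C.
Proof.
  destruct k as [a b]. apply C_ext; simpl; rewrite (@RInt_const R_CompleteNormedModule);
    unfold scal; simpl; unfold mult; simpl; ring.
Qed.

Lemma cint_bound (F : C -> C) (M : R) : cont_on_R F ->
  (forall t : R, 0 <= t <= 2 * PI -> Cmod (F (RtoC t)) <= M) -> Cmod (cint F) <= 2 * PI * M.
Proof.
  intros HF HM. assert (Hpi := PI_RGT_0).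
  destruct (Req_dec (Cmod (cint F)) 0) as [H0|H0].
  { rewrite H0. assert (0 <= M) by (eapply Rle_trans; [apply Cmod_ge_0|apply (HM 0); lra]). nra. }
  assert (Hv : 0 < Cmod (cint F)) by (generalize (Cmod_ge_0 (cint F)); lra).
  set (v := cint F) in *.
  assert (E : Cmod v * Cmod v = Re (cint (fun t => Cconj v * F t)%C)).
  { rewrite cint_scal by assumption. fold v. rewrite Cmult_comm, <- Cmod2_conj.
    simpl. ring. }
  assert (Hc : cont_on_R (fun t => Cconj v * F t)%C).
  { intros t. apply ccont_mult; [apply ccont_const|apply HF]. }
  assert (L : Re (cint (fun t => Cconj v * F t)%C) <= RInt (fun _ => Cmod v * M) 0 (2 * PI)).
  { simpl. apply RInt_le; [lra|now apply (ex_RInt_re (fun t => Cconj v * F t)%C)|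
      apply (@ex_RInt_const R_NormedModule)|].
    intros t Ht.
    match goal with |- ?a <= _ => change a with (Re (Cconj v * F (RtoC t))) end.
    eapply Rle_trans; [apply Rle_abs|]. eapply Rle_trans; [apply re_le_Cmod|].
    rewrite Cmod_mult, Cmod_conj. apply Rmult_le_compat_l; [lra|apply HM; lra]. }
  rewrite (@RInt_const R_CompleteNormedModule) in L. unfold scal in L; simpl in L.
  unfold mult in L; simpl in L.
  apply Rmult_le_reg_l with (Cmod v); [exact Hv|]. rewrite E. simpl in E.
  eapply Rle_trans; [exact L|]. right. ring.
Qed.

Lemma cint_ftc (F F' : C -> C) :
  (forall t : R, cderiv F (RtoC t) (F' (RtoC t))) -> cont_on_R F' ->
  cint F' = (F (RtoC (2 * PI)) - F 0)%C.
Proof.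
  intros H Hc.
  assert (HR : forall t : R, rderiv (fun s => F (RtoC s)) t (F' (RtoC t))).
  { intros t. rewrite <- (Cmult_1_r (F' (RtoC t))).
    apply (rderiv_comp F (fun s => RtoC s)); [|apply H].
    apply rderiv_ext with (fun s => RtoC s * 1)%C; [intros; ring|apply rderiv_ray]. }
  apply C_ext; simpl.
  - apply (@is_RInt_unique R_CompleteNormedModule).
    apply (@is_RInt_derive R_CompleteNormedModule (fun t => Re (F (RtoC t)))).
    + intros t _. apply (HR t).
    + intros t _. apply cont_on_R_re, Hc.
  - apply (@is_RInt_unique R_CompleteNormedModule).
    apply (@is_RInt_derive R_CompleteNormedModule (fun t => Im (F (RtoC t)))).
    + intros t _. apply (HR t).
    + intros t _. apply cont_on_R_im, Hc.
Qed.

(** Differentiation under the integral sign; the last hypothesis is the joint continuity of the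
    derivative at the points of the line [s = s0]. *)
Lemma cint_param (G G' : R -> C -> C) (s0 d : R) : 0 < d ->
  (forall s, Rabs (s - s0) < d -> cont_on_R (G s) /\
     forall t : R, rderiv (fun s => G s (RtoC t)) s (G' s (RtoC t))) ->
  (forall t eps, 0 < eps -> exists e, 0 < e /\ forall s' t', Rabs (s' - s0) < e ->
     Rabs (t' - t) < e -> Cmod (G' s' (RtoC t') - G' s0 (RtoC t)) < eps) ->
  rderiv (fun s => cint (G s)) s0 (cint (G' s0)).
Proof.
  intros Hd H Hc. split; simpl.
  - rewrite <- (RInt_ext (fun t => Derive (fun u => Re (G u (RtoC t))) s0)).
    2:{ intros t _. apply is_derive_unique. refine (proj1 (proj2 (H s0 _) t)). rewrite Rminus_diag, Rabs_R0. lra. }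
    apply (is_derive_RInt_param (fun s t => Re (G s (RtoC t)))).
    + exists (mkposreal d Hd). intros s Hs t _. exists (Re (G' s (RtoC t))). exact (proj1 (proj2 (H s Hs) t)).
    + intros t _. apply continuity_2d_pt_ext_loc with (fun u v => Re (G' u (RtoC v))).
      * exists (mkposreal d Hd). intros u v Hu _. symmetry. apply is_derive_unique. exact (proj1 (proj2 (H u Hu) v)).
      * intros eps. destruct (Hc t eps (cond_pos eps)) as [e [He Hw]].
        exists (mkposreal e He). intros u v Hu Hv. rewrite <- re_minus.
        eapply Rle_lt_trans; [apply re_le_Cmod|]. now apply Hw.
    + exists (mkposreal d Hd). intros s Hs. apply ex_RInt_re. exact (proj1 (H s Hs)).
  - rewrite <- (RInt_ext (fun t => Derive (fun u => Im (G u (RtoC t))) s0)).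
    2:{ intros t _. apply is_derive_unique. refine (proj2 (proj2 (H s0 _) t)). rewrite Rminus_diag, Rabs_R0. lra. }
    apply (is_derive_RInt_param (fun s t => Im (G s (RtoC t)))).
    + exists (mkposreal d Hd). intros s Hs t _. exists (Im (G' s (RtoC t))). exact (proj2 (proj2 (H s Hs) t)).
    + intros t _. apply continuity_2d_pt_ext_loc with (fun u v => Im (G' u (RtoC v))).
      * exists (mkposreal d Hd). intros u v Hu _. symmetry. apply is_derive_unique. exact (proj2 (proj2 (H u Hu) v)).
      * intros eps. destruct (Hc t eps (cond_pos eps)) as [e [He Hw]].
        exists (mkposreal e He). intros u v Hu Hv. rewrite <- im_minus.
        eapply Rle_lt_trans; [apply im_le_Cmod|]. now apply Hw.
    + exists (mkposreal d Hd). intros s Hs. apply ex_RInt_im. exact (proj1 (H s Hs)).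
Qed.

Definition cis (t : C) : C := Cexp (Ci * t).

Lemma Cmod_cis (t : R) : Cmod (cis (RtoC t)) = 1.
Proof.
  unfold cis. rewrite Cmod_Cexp. unfold Ci, Cmult, RtoC; simpl.
  replace (0 * t - 1 * 0) with 0 by ring. apply exp_0.
Qed.

Lemma cis_nz (t : C) : cis t <> 0.
Proof. apply Cexp_nz. Qed.

Lemma cderiv_cis (t : C) : cderiv cis t (Ci * cis t)%C.
Proof.
  eapply cderiv_eq.
  - apply (cderiv_comp Cexp (fun t => Ci * t)%C); [|apply cderiv_Cexp].
    apply cderiv_scal, cderiv_id.
  - unfold cis. ring.
Qed.

Lemma cis_0 : cis 0 = 1.
Proof. unfold cis. replace (Ci * 0)%C with (RtoC 0) by ring. apply Cexp_0. Qed.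

Lemma cis_2PI : cis (RtoC (2 * PI)) = 1.
Proof.
  unfold cis. rewrite <- (Cexp_2PI_Z 1). f_equal. rewrite RtoC_mult. ring.
Qed.

Lemma cis_periodic_power (k : nat) : (cis (RtoC (2 * PI)) ^ k)%C = (cis 0 ^ k)%C.
Proof. now rewrite cis_2PI, cis_0. Qed.

Lemma cint_cis_inv_pow (k : nat) : cint (fun t => / cis t ^ S k)%C = 0.
Proof.
  rewrite (cint_ftc (fun t => (Ci / INR (S k)) * / cis t ^ S k)%C).
  - rewrite cis_periodic_power. ring.
  - intros t. eapply cderiv_eq.
    + apply cderiv_scal, cderiv_inv; [apply cderiv_pow, cderiv_cis|]. apply Cpow_nz, cis_nz.
    + assert (RtoC (INR (S k)) <> 0).
      { intros H. apply RtoC_inj in H. revert H. apply not_0_INR. lia. }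
      assert (Hi : (Ci * Ci)%C = (- (1))%C) by (apply C_ext; simpl; ring).
      assert (Hc := cis_nz (RtoC t)). assert (Hp := Cpow_nz _ k Hc).
      simpl (Cpow _ (S k)).
      transitivity (- (Ci * Ci) / (cis (RtoC t) * cis (RtoC t) ^ k))%C.
      * field. auto.
      * rewrite Hi. field. auto.
  - intros t. apply ccont_inv; [|apply Cpow_nz, cis_nz].
    apply ccont_pow. eapply cderiv_cont, cderiv_cis.
Qed.

Section Cauchy.

Variables (rho : R) (w : C).
Hypotheses (Hrho : 0 < rho) (Hw : Cmod w < rho).

(** Cauchy's kernel [dz / (i (z - w))] on the circle [z = rho cis t]. *)
Let ker (t : C) : C := (RtoC rho * cis t / (RtoC rho * cis t - w))%C.

Lemma Cauchy_denominator (t : R) : rho - Cmod w <= Cmod (RtoC rho * cis (RtoC t) - w).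
Proof.
  eapply Rle_trans; [|apply Cmod_reverse_triangle].
  rewrite Cmod_mult, Cmod_cis, Cmod_R, Rabs_pos_eq; lra.
Qed.

Lemma Cauchy_denominator_nz (t : R) : (RtoC rho * cis (RtoC t) - w)%C <> 0.
Proof. apply Cmod_gt_0. generalize (Cauchy_denominator t). lra. Qed.

Lemma ccont_rho_cis (t : C) : ccont (fun t => RtoC rho * cis t)%C t.
Proof. eapply cderiv_cont, cderiv_scal, cderiv_cis. Qed.

Lemma ker_cont : cont_on_R ker.
Proof.
  intros t. apply ccont_mult; [apply ccont_rho_cis|]. apply ccont_inv.
  - apply ccont_minus; [apply ccont_rho_cis|apply ccont_const].
  - apply Cauchy_denominator_nz.
Qed.

Lemma ker_bound (t : R) : Cmod (ker (RtoC t)) <= rho / (rho - Cmod w).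
Proof.
  unfold ker. rewrite Cmod_div by apply Cauchy_denominator_nz.
  rewrite Cmod_mult, Cmod_cis, Cmod_R, Rabs_pos_eq, Rmult_1_r by lra.
  apply Rmult_le_compat_l; [lra|]. apply Rinv_le_contravar; [lra|apply Cauchy_denominator].
Qed.

(** Iterating [ker = 1 + w / (rho cis) * ker] leaves an exact remainder, [w^K] times an integral,
    which decays like [(|w| / rho)^K]. Only finite sums are ever integrated. *)
Lemma Cauchy_kernel_series (F : C -> C) (M : R) : cont_on_R F ->
  (forall t : R, 0 <= t <= 2 * PI -> Cmod (F (RtoC t)) <= M) ->
  csums (fun k => cint (fun t => F t * / (RtoC rho * cis t) ^ k) * w ^ k)%C
        (cint (fun t => F t * ker t)%C).
Proof.
  intros HF HM.
  assert (HM0 : 0 <= M) by (eapply Rle_trans; [apply Cmod_ge_0|apply (HM 0); generalize PI_RGT_0; lra]).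
  assert (Hr0 : RtoC rho <> 0) by (intros E; apply RtoC_inj in E; lra).
  assert (Hrc : forall t, (RtoC rho * cis t)%C <> 0)
    by (intros; apply Cmult_neq_0; [exact Hr0|apply cis_nz]).
  assert (Hci : forall k, cont_on_R (fun t => F t * / (RtoC rho * cis t) ^ k)%C).
  { intros k t. apply ccont_mult; [apply HF|]. apply ccont_inv; [|apply Cpow_nz, Hrc].
    apply ccont_pow, ccont_rho_cis. }
  assert (E : forall K, cint (fun t => F t * ker t)%C =
    (csumn (fun k => cint (fun t => F t * / (RtoC rho * cis t) ^ k) * w ^ k)%C K
     + w ^ K * cint (fun t => (F t * / (RtoC rho * cis t) ^ K) * ker t))%C).
  { induction K.
    - simpl. rewrite Cplus_0_l, Cmult_1_l. apply cint_ext. intros t. field.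
    - rewrite IHK. simpl csumn. rewrite <- Cplus_assoc. f_equal.
      rewrite (cint_ext (fun t => F t * / (RtoC rho * cis t) ^ K * ker t)%C
        (fun t => F t * / (RtoC rho * cis t) ^ K + w * (F t * / (RtoC rho * cis t) ^ S K * ker t))%C).
      + rewrite cint_plus, cint_scal.
        * simpl (Cpow w (S K)). ring.
        * intros t. apply ccont_mult; [apply Hci|apply ker_cont].
        * apply Hci.
        * intros t. apply ccont_mult; [apply ccont_const|].
          apply ccont_mult; [apply Hci|apply ker_cont].
      + intros t. unfold ker. simpl (Cpow _ (S K)). field.
        split; [apply Cauchy_denominator_nz|]. split; [apply Cpow_nz, Hrc|]. split; [apply cis_nz|exact Hr0]. }
  set (q := Cmod w / rho).
  assert (Hq : 0 <= q < 1).
  { unfold q. split; [apply Rdiv_le_0_compat; [apply Cmod_ge_0|lra]|].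
    apply Rmult_lt_reg_r with rho; [lra|]. unfold Rdiv. rewrite Rmult_assoc, Rinv_l; lra. }
  apply cconv_le with (fun K => (2 * PI * (M * (rho / (rho - Cmod w)))) * q ^ K).
  - intros K. rewrite (E K).
    match goal with |- Cmod (?a - (?b + ?c)) <= _ =>
      replace (a - (b + c))%C with (- c)%C by (unfold Cminus; ring) end.
    rewrite Cmod_opp, <- cint_scal by (intros t; apply ccont_mult; [apply Hci|apply ker_cont]).
    rewrite Rmult_assoc. apply cint_bound.
    + intros t. apply ccont_mult; [apply ccont_const|]. apply ccont_mult; [apply Hci|apply ker_cont].
    + intros t Ht. rewrite !Cmod_mult, Cmod_inv by apply Cpow_nz, Hrc.
      rewrite !Cmod_pow, Cmod_mult, Cmod_cis, Cmod_R, Rabs_pos_eq, Rmult_1_r by lra.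
      replace (q ^ K) with (Cmod w ^ K * / rho ^ K)
        by (unfold q, Rdiv; rewrite Rpow_mult_distr, pow_inv; reflexivity).
      assert (A := ker_bound t). assert (B := HM t Ht).
      assert (P : 0 <= Cmod w ^ K * / rho ^ K).
      { apply Rmult_le_pos; [apply pow_le, Cmod_ge_0|]. left. apply Rinv_0_lt_compat, pow_lt, Hrho. }
      replace (Cmod w ^ K * (Cmod (F (RtoC t)) * / rho ^ K * Cmod (ker (RtoC t))))
        with ((Cmod (F (RtoC t)) * Cmod (ker (RtoC t))) * (Cmod w ^ K * / rho ^ K)) by ring.
      apply Rmult_le_compat_r; [exact P|]. apply Rmult_le_compat; try apply Cmod_ge_0; assumption.
  - replace (Finite 0) with (Rbar_mult (2 * PI * (M * (rho / (rho - Cmod w)))) 0)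
      by (simpl; f_equal; ring).
    apply is_lim_seq_scal_l, is_lim_seq_geom. rewrite Rabs_pos_eq; lra.
Qed.

(** The kernel series for [F = 1]: over a full turn every negative power of [cis] integrates to
    zero, and only the term of index 0 survives. *)
Lemma cint_ker : cint ker = (2 * PI)%C.
Proof.
  assert (Hr0 : RtoC rho <> 0) by (intros E; apply RtoC_inj in E; lra).
  apply csums_unique with (fun k => cint (fun t => 1 * / (RtoC rho * cis t) ^ k) * w ^ k)%C.
  - rewrite (cint_ext ker (fun t => 1 * ker t)%C) by (intros; ring).
    apply (Cauchy_kernel_series (fun _ => RtoC 1) 1).
    + intros t. apply ccont_const.
    + intros t _. rewrite Cmod_1. lra.
  - intros eps He. exists 1%nat. intros n Hn. destruct n as [|n]; [lia|]. clear Hn.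
    assert (E : csumn (fun k => cint (fun t => 1 * / (RtoC rho * cis t) ^ k) * w ^ k)%C (S n) = (2 * PI)%C).
    { induction n.
      - simpl. rewrite (cint_ext _ (fun _ => RtoC 1)), cint_const; [ring|].
        intros; field.
      - remember (S n) as m. simpl. rewrite IHn. subst m.
        rewrite (cint_ext _ (fun t => / RtoC rho ^ S n * / cis t ^ S n)%C).
        + rewrite cint_scal, cint_cis_inv_pow; [ring|].
          intros t. apply ccont_inv; [|apply Cpow_nz, cis_nz].
          apply ccont_pow. eapply cderiv_cont, cderiv_cis.
        + intros t. rewrite Cpow_mult_l. field. split; apply Cpow_nz; [apply cis_nz|exact Hr0]. }
    rewrite E. replace (2 * PI - 2 * PI)%C with (RtoC 0) by ring. now rewrite Cmod_0.
Qed.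

(** The circle is shrunk along [ga] to the point [c + w]. The derivative in [s] of the integral is
    the integral of an exact derivative over a closed curve, hence zero, so the values at [s = 1]
    and [s = 0] agree. *)
Lemma Cauchy_formula (f f' : C -> C) (c : C) (R0 : R) : rho < R0 ->
  (forall z, Cmod (z - c) < R0 -> cderiv f z (f' z) /\ ccont f' z) ->
  cint (fun t => f (c + RtoC rho * cis t) * ker t)%C = (2 * PI * f (c + w))%C.
Proof.
  intros HR Hf.
  set (ga := fun (s : R) (t : C) => (c + w + RtoC s * (RtoC rho * cis t - w))%C).
  (* The margin by which [s] may leave [0,1] while the curve stays in the disc of radius [R0];
     differentiability at the end points is two-sided. *)
  set (d := (R0 - rho) / (4 * rho)).
  assert (Hd : 0 < d) by (apply Rdiv_lt_0_compat; lra).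
  assert (Hdr : d * rho = (R0 - rho) / 4) by (unfold d; field; lra).
  assert (Hm := Cmod_ge_0 w).
  assert (Hga : forall s t, - d < s < 1 + d -> Cmod (ga s (RtoC t) - c) < R0).
  { intros s t Hs. unfold ga.
    replace (c + w + RtoC s * (RtoC rho * cis (RtoC t) - w) - c)%C
      with (RtoC (1 - s) * w + RtoC s * (RtoC rho * cis (RtoC t)))%C by (rewrite RtoC_minus; ring).
    eapply Rle_lt_trans; [apply Cmod_triangle|]. rewrite !Cmod_mult, Cmod_cis, !Cmod_R.
    rewrite (Rabs_pos_eq rho) by lra. unfold Rabs.
    destruct (Rcase_abs (1 - s)), (Rcase_abs s); nra. }
  set (Phi := fun s => cint (fun t => f (ga s t) * ker t)%C).
  set (dPhi := fun s => cint (fun t => f' (ga s t) * (RtoC rho * cis t))%C).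
  assert (Hgd : forall s t, cderiv (ga s) t (RtoC s * (RtoC rho * (Ci * cis t)))%C).
  { intros s t. unfold ga. eapply cderiv_eq.
    - apply cderiv_plus; [apply cderiv_const|]. apply cderiv_scal.
      apply cderiv_minus; [apply cderiv_scal, cderiv_cis|apply cderiv_const].
    - ring. }
  assert (Hgc : forall s t, ccont (ga s) t) by (intros; eapply cderiv_cont, Hgd).
  assert (Hder : forall s, 0 <= s <= 1 -> rderiv Phi s (dPhi s)).
  { intros s Hs. apply (cint_param (fun s t => f (ga s t) * ker t)%C
      (fun s t => f' (ga s t) * (RtoC rho * cis t))%C s d Hd).
    - intros u Hu. apply Rabs_def2 in Hu. assert (Hu' : - d < u < 1 + d) by lra. split.
      + intros t. apply ccont_mult; [|apply ker_cont]. apply ccont_comp; [apply Hgc|].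
        eapply cderiv_cont, Hf, Hga, Hu'.
      + intros t.
        assert (A : rderiv (fun s => f (ga s (RtoC t))) u
                      (f' (ga u (RtoC t)) * (RtoC rho * cis (RtoC t) - w))%C).
        { apply (rderiv_comp f (fun s => ga s (RtoC t))); [apply rderiv_segment|].
          apply Hf, Hga, Hu'. }
        generalize (rderiv_comp (fun z => z * ker (RtoC t))%C (fun s => f (ga s (RtoC t))) u
          (1 * ker (RtoC t) + f (ga u (RtoC t)) * 0)%C _ A
          (cderiv_mult (fun z => z) (fun _ => ker (RtoC t)) _ _ _ (cderiv_id _) (cderiv_const _ _))).
        intros B. cbv beta in B.
        replace (f' (ga u (RtoC t)) * (RtoC rho * cis (RtoC t)))%C
          with ((1 * ker (RtoC t) + f (ga u (RtoC t)) * 0) *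
                (f' (ga u (RtoC t)) * (RtoC rho * cis (RtoC t) - w)))%C; [exact B|].
        unfold ker. field. apply Cauchy_denominator_nz.
    - intros t eps He.
      assert (Hin : Cmod (ga s (RtoC t) - c) < R0) by (apply Hga; lra).
      assert (HK : ccont (fun z => f' z) (ga s (RtoC t))) by apply Hf, Hin.
      set (A := Cmod (f' (ga s (RtoC t))) + 1).
      assert (HA : 0 < A) by (unfold A; generalize (Cmod_ge_0 (f' (ga s (RtoC t)))); lra).
      destruct (HK 1 Rlt_0_1) as [d1 [Hd1 K1]].
      destruct (HK (eps / (2 * rho))) as [d2 [Hd2 K2]]; [apply Rdiv_lt_0_compat; lra|].
      set (d3 := Rmin d1 d2). assert (Hd3 : 0 < d3) by (unfold d3; apply Rmin_glb_lt; lra).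
      destruct (ccont_rho_cis (RtoC t) (Rmin (d3 / 2) (eps / (2 * A)))) as [e1 [He1 L1]].
      { apply Rmin_glb_lt; [lra|]. apply Rdiv_lt_0_compat; lra. }
      exists (Rmin e1 (d3 / (4 * rho))). split.
      { apply Rmin_glb_lt; [lra|]. apply Rdiv_lt_0_compat; lra. }
      intros s' t' Hs' Ht'.
      assert (L : Cmod (RtoC rho * cis (RtoC t') - RtoC rho * cis (RtoC t)) < Rmin (d3 / 2) (eps / (2 * A))).
      { apply L1. rewrite <- RtoC_minus, Cmod_R. exact (Rlt_le_trans _ _ _ Ht' (Rmin_l _ _)). }
      assert (Ls := Rlt_le_trans _ _ _ Hs' (Rmin_r _ _)).
      assert (La := Rlt_le_trans _ _ _ L (Rmin_l _ _)).
      assert (Lb := Rlt_le_trans _ _ _ L (Rmin_r _ _)).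
      assert (Hdist : Cmod (ga s' (RtoC t') - ga s (RtoC t)) < d3).
      { unfold ga.
        replace (c + w + RtoC s' * (RtoC rho * cis (RtoC t') - w) -
                 (c + w + RtoC s * (RtoC rho * cis (RtoC t) - w)))%C
          with (RtoC (s' - s) * (RtoC rho * cis (RtoC t') - w)
                + RtoC s * (RtoC rho * cis (RtoC t') - RtoC rho * cis (RtoC t)))%C
          by (rewrite RtoC_minus; ring).
        eapply Rle_lt_trans; [apply Cmod_triangle|]. rewrite !(Cmod_mult (RtoC _)), !Cmod_R.
        assert (B1 : Cmod (RtoC rho * cis (RtoC t') - w) <= 2 * rho).
        { eapply Rle_trans; [apply Cmod_minus_le|].
          rewrite Cmod_mult, Cmod_cis, Cmod_R, Rabs_pos_eq; lra. }
        assert (B2 : Rabs (s' - s) * Cmod (RtoC rho * cis (RtoC t') - w) <= d3 / (4 * rho) * (2 * rho)).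
        { apply Rmult_le_compat; [apply Rabs_pos|apply Cmod_ge_0|lra|exact B1]. }
        replace (d3 / (4 * rho) * (2 * rho)) with (d3 / 2) in B2 by (field; lra).
        rewrite (Rabs_pos_eq s) by lra.
        assert (B3 := Cmod_ge_0 (RtoC rho * cis (RtoC t') - RtoC rho * cis (RtoC t))).
        nra. }
      specialize (K1 _ (Rlt_le_trans _ _ _ Hdist (Rmin_l _ _))).
      specialize (K2 _ (Rlt_le_trans _ _ _ Hdist (Rmin_r _ _))).
      replace (f' (ga s' (RtoC t')) * (RtoC rho * cis (RtoC t')) - f' (ga s (RtoC t)) * (RtoC rho * cis (RtoC t)))%C
        with ((f' (ga s' (RtoC t')) - f' (ga s (RtoC t))) * (RtoC rho * cis (RtoC t'))
              + f' (ga s (RtoC t)) * (RtoC rho * cis (RtoC t') - RtoC rho * cis (RtoC t)))%C by ring.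
      eapply Rle_lt_trans; [apply Cmod_triangle|].
      rewrite (Cmod_mult (_ - _)), (Cmod_mult (f' _)), (Cmod_mult (RtoC rho)), Cmod_cis, Cmod_R,
        Rabs_pos_eq, Rmult_1_r by lra.
      apply (Rmult_lt_compat_r rho) in K2; [|lra].
      replace (eps / (2 * rho) * rho) with (eps / 2) in K2 by (field; lra).
      assert (B4 : Cmod (f' (ga s (RtoC t))) * Cmod (RtoC rho * cis (RtoC t') - RtoC rho * cis (RtoC t))
                   <= A * (eps / (2 * A))).
      { apply Rmult_le_compat; try apply Cmod_ge_0; [unfold A|]; lra. }
      replace (A * (eps / (2 * A))) with (eps / 2) in B4 by (field; lra).
      lra. }
  assert (Hzero : forall s, 0 <= s <= 1 -> dPhi s = 0).
  { intros s Hs. unfold dPhi.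
    (* The antiderivative [- Ci / s * f (ga s t)] requires [s <> 0]; at [s = 0] the integrand is a
       constant multiple of [cis]. *)
    destruct (Req_dec s 0) as [->|Hs0].
    - rewrite (cint_ext _ (fun t => f' (c + w) * RtoC rho * (cis t))%C).
      + rewrite cint_scal by (intros t; eapply cderiv_cont, cderiv_cis).
        rewrite (cint_ftc (fun t => - Ci * cis t)%C cis).
        * rewrite cis_2PI, cis_0. ring.
        * intros t. eapply cderiv_eq; [apply cderiv_scal, cderiv_cis|].
          rewrite Cmult_assoc. replace (- Ci * Ci)%C with (RtoC 1) by (apply C_ext; simpl; ring). ring.
        * intros t; eapply cderiv_cont, cderiv_cis.
      + intros t. unfold ga. replace (c + w + 0 * (RtoC rho * cis (RtoC t) - w))%C with (c + w)%C by ring.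
        ring.
    - assert (Hsc : RtoC s <> 0) by (intros E; now apply RtoC_inj in E).
      rewrite (cint_ftc (fun t => (- Ci / RtoC s) * f (ga s t))%C).
      + unfold ga. rewrite cis_2PI, cis_0. ring.
      + intros t. eapply cderiv_eq.
        * apply cderiv_scal, (cderiv_comp f (ga s)); [apply Hgd|]. apply Hf, Hga. lra.
        * transitivity ((- Ci * Ci) * (f' (ga s (RtoC t)) * (RtoC rho * cis (RtoC t))))%C; [field; exact Hsc|].
          replace (- Ci * Ci)%C with (RtoC 1) by (apply C_ext; simpl; ring). ring.
      + intros t. apply ccont_mult; [|apply ccont_rho_cis]. apply ccont_comp; [apply Hgc|].
        apply Hf, Hga. lra. }
  assert (Heq : Phi 1 = Phi 0).
  { apply Ceq_minus, Cmod_eq_0, Rle_antisym; [|apply Cmod_ge_0].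
    apply Rle_trans with (0 * (1 - 0)); [|lra].
    apply mean_value_curve with dPhi; [lra|exact Hder|].
    intros t Ht. rewrite Hzero, Cmod_0; lra. }
  unfold Phi in Heq.
  rewrite (cint_ext _ (fun t => f (c + RtoC rho * cis t) * ker t)%C) in Heq.
  2:{ intros t. unfold ga. do 2 f_equal. ring. }
  rewrite Heq.
  rewrite (cint_ext _ (fun t => f (c + w) * ker t)%C).
  2:{ intros t. unfold ga. do 2 f_equal. ring. }
  rewrite cint_scal, cint_ker; [ring|apply ker_cont].
Qed.

End Cauchy.

Lemma cont_on_R_bounded (F : C -> C) : cont_on_R F ->
  exists M, forall t : R, 0 <= t <= 2 * PI -> Cmod (F (RtoC t)) <= M.
Proof.
  intros H.
  destruct (ex_RInt_ub _ _ _ (ex_RInt_re F 0 (2 * PI) H)) as [M1 H1].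
  destruct (ex_RInt_ub _ _ _ (ex_RInt_im F 0 (2 * PI) H)) as [M2 H2].
  assert (Hpi := PI_RGT_0). rewrite Rmin_left, Rmax_right in H1, H2 by lra.
  exists (M1 + M2). intros t Ht. eapply Rle_trans; [apply Cmod_le_re_im|].
  apply Rplus_le_compat; [apply (H1 t Ht)|apply (H2 t Ht)].
Qed.

(** The coefficients are Fourier integrals over the circle of radius [rho]. A bound [M] for [f] on
    this circle is therefore also a [coef_bound] at that radius. *)
Lemma Taylor_expansion (f f' : C -> C) (c : C) (R0 rho : R) : 0 < rho < R0 ->
  (forall z, Cmod (z - c) < R0 -> cderiv f z (f' z) /\ ccont f' z) ->
  exists a K, coef_bound a rho K /\
    forall z, Cmod (z - c) < rho -> f z = pseries a (z - c).
Proof.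
  intros Hrho Hf. assert (Hpi := PI_RGT_0).
  assert (Hpc : RtoC PI <> 0) by (intros E; apply RtoC_inj in E; lra).
  assert (Hcirc : forall t : R, Cmod (c + RtoC rho * cis (RtoC t) - c) < R0).
  { intros t. replace (c + RtoC rho * cis (RtoC t) - c)%C with (RtoC rho * cis (RtoC t))%C by ring.
    rewrite Cmod_mult, Cmod_cis, Cmod_R, Rabs_pos_eq; lra. }
  assert (HF : cont_on_R (fun t => f (c + RtoC rho * cis t))%C).
  { intros t. apply (ccont_comp f (fun t => c + RtoC rho * cis t)%C).
    - apply ccont_plus; [apply ccont_const|apply ccont_rho_cis].
    - eapply cderiv_cont, Hf, Hcirc. }
  destruct (cont_on_R_bounded _ HF) as [M HM].
  exists (fun k => / (2 * PI) * cint (fun t => f (c + RtoC rho * cis t) * / (RtoC rho * cis t) ^ k))%C, M.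
  assert (Hr0 : RtoC rho <> 0) by (intros E; apply RtoC_inj in E; lra).
  assert (Hrc : forall t, (RtoC rho * cis t)%C <> 0)
    by (intros; apply Cmult_neq_0; [exact Hr0|apply cis_nz]).
  split.
  - intros k. rewrite <- RtoC_mult, <- RtoC_inv, Cmod_mult, Cmod_R by lra.
    rewrite Rabs_pos_eq by (left; apply Rinv_0_lt_compat; lra).
    assert (B : Cmod (cint (fun t => f (c + RtoC rho * cis t) * / (RtoC rho * cis t) ^ k)%C)
                <= 2 * PI * (M * / rho ^ k)).
    { apply cint_bound.
      - intros t. apply ccont_mult; [apply HF|]. apply ccont_inv; [|apply Cpow_nz, Hrc].
        apply ccont_pow, ccont_rho_cis.
      - intros t Ht. rewrite Cmod_mult, Cmod_inv by apply Cpow_nz, Hrc.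
        rewrite Cmod_pow, Cmod_mult, Cmod_cis, Cmod_R, Rabs_pos_eq, Rmult_1_r by lra.
        apply Rmult_le_compat_r; [|apply HM, Ht]. left. apply Rinv_0_lt_compat, pow_lt. lra. }
    assert (Hp : 0 < rho ^ k) by (apply pow_lt; lra).
    apply Rle_trans with (/ (2 * PI) * (2 * PI * (M * / rho ^ k)) * rho ^ k).
    + apply Rmult_le_compat_r; [lra|]. apply Rmult_le_compat_l; [|exact B].
      left; apply Rinv_0_lt_compat; lra.
    + right. field. lra.
  - intros z Hz. symmetry. apply csums_CSeries.
    assert (A := Cauchy_kernel_series rho (z - c) (proj1 Hrho) Hz _ M HF HM).
    cbv beta in A. rewrite (Cauchy_formula rho (z - c) (proj1 Hrho) Hz f f' c R0 (proj2 Hrho) Hf) in A.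
    replace (c + (z - c))%C with z in A by ring.
    apply (csums_scal (/ (2 * PI))) in A.
    replace (/ (2 * PI) * (2 * PI * f z))%C with (f z) in A
      by (field; intros E; apply Hpc; exact E).
    eapply csums_ext; [|exact A]. intros k. cbv beta. ring.
Qed.

(** With [u = f c] and [M = |u|], the function [M^2 - Re (conj u f)] is nonnegative on the circle
    and has mean zero, so by continuity it vanishes there. It is read off at the top of the circle,
    the point from which one climbs towards the cusp. *)
Lemma max_modulus_circle (f f' : C -> C) (c : C) (R0 rho : R) : 0 < rho < R0 ->
  (forall z, Cmod (z - c) < R0 -> cderiv f z (f' z) /\ ccont f' z) ->
  (forall z, Cmod (z - c) < R0 -> Cmod (f z) <= Cmod (f c)) ->
  Cmod (f (c + RtoC rho * Ci)%C) = Cmod (f c).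
Proof.
  intros Hrho Hf Hmax. assert (Hpi := PI_RGT_0).
  assert (Hcirc : forall t : R, Cmod (c + RtoC rho * cis (RtoC t) - c) < R0).
  { intros t. replace (c + RtoC rho * cis (RtoC t) - c)%C with (RtoC rho * cis (RtoC t))%C by ring.
    rewrite Cmod_mult, Cmod_cis, Cmod_R, Rabs_pos_eq; lra. }
  assert (HF : cont_on_R (fun t => f (c + RtoC rho * cis t))%C).
  { intros t. apply (ccont_comp f (fun t => c + RtoC rho * cis t)%C).
    - apply ccont_plus; [apply ccont_const|apply ccont_rho_cis].
    - eapply cderiv_cont, Hf, Hcirc. }
  assert (Hmean : cint (fun t => f (c + RtoC rho * cis t))%C = (2 * PI * f c)%C).
  { assert (H0 : Cmod 0 < rho) by (rewrite Cmod_0; lra).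
    assert (A := Cauchy_formula rho 0 (proj1 Hrho) H0 f f' c R0 (proj2 Hrho) Hf).
    rewrite Cplus_0_r in A. rewrite <- A. apply cint_ext. intros t. field.
    split; [apply cis_nz|]. intros E; apply RtoC_inj in E; lra. }
  assert (Hcis : cis (RtoC (PI / 2)) = Ci).
  { unfold cis, Cexp, Ci, Cmult, RtoC; simpl.
    replace (0 * (PI / 2) - 1 * 0) with 0 by ring. replace (0 * 0 + 1 * (PI / 2)) with (PI / 2) by ring.
    rewrite exp_0, cos_PI2, sin_PI2. f_equal; ring. }
  assert (Hle : Cmod (f (c + RtoC rho * Ci)%C) <= Cmod (f c)).
  { apply Hmax. rewrite <- Hcis. apply Hcirc. }
  apply Rle_antisym; [exact Hle|].
  set (u := f c) in *. set (M := Cmod u) in *.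
  destruct (Req_dec M 0) as [HM0|HM0]; [rewrite HM0; apply Cmod_ge_0|].
  assert (HM : 0 < M) by (generalize (Cmod_ge_0 u); fold M; lra).
  set (G := fun t : C => (RtoC (M ^ 2) - Cconj u * f (c + RtoC rho * cis t))%C).
  assert (HG : cont_on_R G).
  { intros t. apply ccont_minus; [apply ccont_const|]. apply ccont_mult; [apply ccont_const|apply HF]. }
  assert (HGre : forall t : R, 0 <= Re (G (RtoC t))).
  { intros t. unfold G. rewrite re_minus, re_RtoC.
    assert (A := re_le_Cmod (Cconj u * f (c + RtoC rho * cis (RtoC t)))%C).
    rewrite Cmod_mult, Cmod_conj in A. fold M in A.
    assert (B := Hmax _ (Hcirc t)). fold M in B.
    generalize (Rle_abs (Re (Cconj u * f (c + RtoC rho * cis (RtoC t)))%C)). intros. nra. }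
  assert (HGint : RInt (fun t => Re (G (RtoC t))) 0 (2 * PI) = 0).
  { change (Re (cint G) = 0). unfold G.
    rewrite (cint_ext _ (fun t => RtoC (M ^ 2) + (- Cconj u) * f (c + RtoC rho * cis t))%C) by (intros; ring).
    rewrite cint_plus, cint_scal, cint_const, Hmean; auto.
    - unfold M. rewrite Cmod2_conj. replace (2 * PI * (u * Cconj u) + - Cconj u * (2 * PI * u))%C with (RtoC 0) by ring.
      reflexivity.
    - intros t; apply ccont_const.
    - intros t. apply ccont_mult; [apply ccont_const|apply HF]. }
  assert (Hz : Re (G (RtoC (PI / 2))) = 0).
  { destruct (Req_dec (Re (G (RtoC (PI / 2)))) 0) as [E|E]; [exact E|exfalso].
    assert (Hp : 0 < Re (G (RtoC (PI / 2)))) by (generalize (HGre (PI / 2)); lra).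
    destruct (HG (PI / 2) _ Hp) as [d [Hd Hw]].
    (* A window around pi/2, inside [0, 2 pi], on which the integrand would be positive; then so
       would the whole integral. *)
    set (e := Rmin (d / 2) (PI / 4)).
    assert (He : 0 < e <= PI / 4 /\ e < d).
    { unfold e. split; [split; [apply Rmin_glb_lt; lra|apply Rmin_r]|].
      eapply Rle_lt_trans; [apply Rmin_l|lra]. }
    assert (HI : forall a b, ex_RInt (fun t => Re (G (RtoC t))) a b) by (intros; now apply ex_RInt_re).
    assert (P1 : 0 < RInt (fun t => Re (G (RtoC t))) (PI / 2 - e) (PI / 2 + e)).
    { apply RInt_gt_0; [lra| |].
      - intros s Hs. assert (A : Cmod (RtoC s - RtoC (PI / 2)) < d).
        { rewrite <- RtoC_minus, Cmod_R. apply Rabs_def1; lra. }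
        specialize (Hw _ A). assert (B := re_le_Cmod (G (RtoC s) - G (RtoC (PI / 2)))).
        rewrite re_minus in B. generalize (Rabs_def2 _ _ (Rle_lt_trans _ _ _ B Hw)). lra.
      - intros s _. apply cont_on_R_re, HG. }
    assert (P2 : 0 <= RInt (fun t => Re (G (RtoC t))) 0 (PI / 2 - e)).
    { apply RInt_ge_0; auto. lra. }
    assert (P3 : 0 <= RInt (fun t => Re (G (RtoC t))) (PI / 2 + e) (2 * PI)).
    { apply RInt_ge_0; auto. lra. }
    assert (Ch : forall a b c, RInt (fun t => Re (G (RtoC t))) a b + RInt (fun t => Re (G (RtoC t))) b c
                              = RInt (fun t => Re (G (RtoC t))) a c)
      by (intros; now apply (@RInt_Chasles R_CompleteNormedModule)).
    rewrite <- (Ch 0 (PI / 2 + e) (2 * PI)), <- (Ch 0 (PI / 2 - e) (PI / 2 + e)) in HGint. lra. }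
  unfold G in Hz. rewrite Hcis, re_minus, re_RtoC in Hz.
  assert (A := re_le_Cmod (Cconj u * f (c + RtoC rho * Ci))%C).
  rewrite Cmod_mult, Cmod_conj in A. fold M in A.
  assert (B := Rle_abs (Re (Cconj u * f (c + RtoC rho * Ci))%C)).
  apply Rmult_le_reg_l with M; [exact HM|]. replace (M * M) with (M ^ 2) by ring. lra.
Qed.

(** * Holomorphic germs *)

(** Continuity of the derivative is included because Cauchy's formula was proved under it;
    [hol_C_derive] then shows the notion to be closed under differentiation. *)
Definition hol (f : C -> C) (z : C) : Prop :=
  exists r, 0 < r /\ exists f', forall w, Cmod (w - z) < r -> cderiv f w (f' w) /\ ccont f' w.

Lemma Cmod_sub_self (z : C) : Cmod (z - z) = 0.
Proof. replace (z - z)%C with (RtoC 0) by ring. apply Cmod_0. Qed.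

Lemma near_trans (c z w : C) (r : R) : Cmod (w - z) < r - Cmod (z - c) -> Cmod (w - c) < r.
Proof. intros H. eapply Rle_lt_trans; [apply (Cmod_sub_triangle w z c)|]. lra. Qed.

Lemma hol_open (f : C -> C) (z : C) : hol f z ->
  exists r, 0 < r /\ forall w, Cmod (w - z) < r -> hol f w.
Proof.
  intros [r [Hr [f' H]]]. exists r. split; [exact Hr|]. intros w Hw.
  exists (r - Cmod (w - z)). split; [lra|]. exists f'. intros v Hv. apply H.
  now apply near_trans with w.
Qed.

Lemma hol_cderiv (f : C -> C) (z : C) : hol f z -> cderiv f z (C_derive f z).
Proof.
  intros [r [Hr [f' H]]]. destruct (H z) as [Hd _]; [rewrite Cmod_sub_self; exact Hr|].
  now rewrite (cderiv_C_derive _ _ _ Hd).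
Qed.

Lemma hol_ccont (f : C -> C) (z : C) : hol f z -> ccont f z.
Proof. intros H. eapply cderiv_cont, hol_cderiv, H. Qed.

Lemma hol_disc (f : C -> C) (c : C) (r : R) : (forall z, Cmod (z - c) < r -> hol f z) ->
  forall z, Cmod (z - c) < r -> cderiv f z (C_derive f z) /\ ccont (C_derive f) z.
Proof.
  intros H z Hz. split; [apply hol_cderiv, H, Hz|].
  destruct (H z Hz) as [s [Hs [f' Hf]]].
  apply (ccont_ext_loc f' (C_derive f) z s Hs).
  - intros w Hw. symmetry. apply cderiv_C_derive, Hf, Hw.
  - apply Hf. rewrite Cmod_sub_self. exact Hs.
Qed.

Lemma hol_ext_loc (f g : C -> C) (z : C) (r : R) :
  0 < r -> (forall w, Cmod (w - z) < r -> f w = g w) -> hol f z -> hol g z.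
Proof.
  intros Hr He [s [Hs [f' H]]].
  exists (Rmin r s). split; [apply Rmin_glb_lt; lra|]. exists f'. intros w Hw.
  assert (H1 := Rlt_le_trans _ _ _ Hw (Rmin_l _ _)).
  assert (H2 := Rlt_le_trans _ _ _ Hw (Rmin_r _ _)).
  split; [|apply H, H2].
  apply (cderiv_ext_loc f g w _ (r - Cmod (w - z))); [lra| |apply H, H2].
  intros v Hv. apply He. now apply near_trans with w.
Qed.

Lemma hol_ext (f g : C -> C) (z : C) : (forall w, f w = g w) -> hol f z -> hol g z.
Proof. intros He. apply (hol_ext_loc _ _ _ 1); [lra|auto]. Qed.

Lemma hol_Taylor (f : C -> C) (c : C) (R0 rho : R) : 0 < rho < R0 ->
  (forall z, Cmod (z - c) < R0 -> hol f z) ->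
  exists a K, coef_bound a rho K /\
    forall z, Cmod (z - c) < rho -> f z = pseries a (z - c).
Proof. intros H Hf. apply Taylor_expansion with (C_derive f) R0; [exact H|]. now apply hol_disc. Qed.

Lemma pseries_cderiv_at (a : nat -> C) (r K : R) (c z : C) : 0 < r -> coef_bound a r K ->
  Cmod (z - c) < r -> cderiv (fun z => pseries a (z - c)) z (pseries (pderiv a) (z - c)).
Proof.
  intros Hr H Hz. eapply cderiv_eq.
  - apply (cderiv_comp (pseries a) (fun z => z - c)%C).
    + apply cderiv_minus; [apply cderiv_id|apply cderiv_const].
    + now apply pseries_deriv with r K.
  - ring.
Qed.

Lemma pseries_hol (a : nat -> C) (r K : R) (c z : C) : 0 < r -> coef_bound a r K ->
  Cmod (z - c) < r -> hol (fun z => pseries a (z - c)) z.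
Proof.
  intros Hr H Hz. exists (r - Cmod (z - c)). split; [lra|].
  exists (fun z => pseries (pderiv a) (z - c)). intros w Hw.
  assert (Hwc : Cmod (w - c) < r) by now apply near_trans with z.
  split; [now apply pseries_cderiv_at with r K|].
  apply (ccont_comp (pseries (pderiv a)) (fun z => z - c)%C).
  - apply ccont_minus; [apply ccont_id|apply ccont_const].
  - now apply pseries_deriv_ccont with r K.
Qed.

Lemma hol_C_derive (f : C -> C) (z : C) : hol f z -> hol (C_derive f) z.
Proof.
  intros H. destruct (hol_open f z H) as [r [Hr Hf]].
  destruct (hol_Taylor f z r (r / 2)) as [a [K [HK Ha]]]; [lra|exact Hf|].
  destruct (pderiv_bound a (r / 2) K (r / 4)) as [K' HK']; [lra|exact HK|lra|].
  apply (hol_ext_loc (fun w => pseries (pderiv a) (w - z)) _ z (r / 4)); [lra| |].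
  - intros w Hw. symmetry. apply cderiv_C_derive.
    apply (cderiv_ext_loc (fun w => pseries a (w - z)) _ _ _ (r / 2 - Cmod (w - z))); [lra| |].
    + intros v Hv. symmetry. apply Ha. now apply near_trans with w.
    + apply pseries_cderiv_at with (r / 2) K; [lra|exact HK|lra].
  - apply pseries_hol with (r / 4) K'; [lra|exact HK'|]. rewrite Cmod_sub_self; lra.
Qed.

Lemma hol_intro (f f' : C -> C) (z : C) (r : R) : 0 < r ->
  (forall w, Cmod (w - z) < r -> cderiv f w (f' w) /\ ccont f' w) -> hol f z.
Proof. intros. exists r. split; [assumption|]. now exists f'. Qed.

Lemma hol_const (k z : C) : hol (fun _ => k) z.
Proof.
  apply (hol_intro _ (fun _ => RtoC 0) _ 1); [lra|]. intros; split; [apply cderiv_const|apply ccont_const].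
Qed.

Lemma hol_id (z : C) : hol (fun w => w) z.
Proof.
  apply (hol_intro _ (fun _ => RtoC 1) _ 1); [lra|]. intros; split; [apply cderiv_id|apply ccont_const].
Qed.

Lemma hol_Cexp (z : C) : hol Cexp z.
Proof.
  apply (hol_intro _ Cexp _ 1); [lra|]. intros; split; [apply cderiv_Cexp|].
  eapply cderiv_cont, cderiv_Cexp.
Qed.

Lemma hol_Cinv (z : C) : z <> 0 -> hol Cinv z.
Proof.
  intros Hz. destruct (ccont_nonzero _ _ (ccont_id z) Hz) as [r [Hr H]].
  apply (hol_intro _ (fun w => - / (w * w))%C _ r Hr). intros w Hw.
  destruct (H w Hw) as [_ Hw0].
  split; [now apply cderiv_Cinv|]. apply ccont_opp, ccont_inv.
  - apply ccont_mult; apply ccont_id.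
  - now apply Cmult_neq_0.
Qed.

Lemma hol_plus (f g : C -> C) (z : C) : hol f z -> hol g z -> hol (fun w => f w + g w)%C z.
Proof.
  intros [r [Hr [f' Hf]]] [s [Hs [g' Hg]]].
  apply (hol_intro _ (fun w => f' w + g' w)%C _ (Rmin r s)); [apply Rmin_glb_lt; lra|].
  intros w Hw.
  destruct (Hf w (Rlt_le_trans _ _ _ Hw (Rmin_l _ _))), (Hg w (Rlt_le_trans _ _ _ Hw (Rmin_r _ _))).
  split; [now apply cderiv_plus|now apply ccont_plus].
Qed.

Lemma hol_mult (f g : C -> C) (z : C) : hol f z -> hol g z -> hol (fun w => f w * g w)%C z.
Proof.
  intros [r [Hr [f' Hf]]] [s [Hs [g' Hg]]].
  apply (hol_intro _ (fun w => f' w * g w + f w * g' w)%C _ (Rmin r s)); [apply Rmin_glb_lt; lra|].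
  intros w Hw.
  destruct (Hf w (Rlt_le_trans _ _ _ Hw (Rmin_l _ _))) as [A B],
    (Hg w (Rlt_le_trans _ _ _ Hw (Rmin_r _ _))) as [A' B'].
  split; [now apply cderiv_mult|].
  apply ccont_plus; apply ccont_mult; auto; eapply cderiv_cont; eassumption.
Qed.

Lemma hol_comp (f g : C -> C) (z : C) : hol g z -> hol f (g z) -> hol (fun w => f (g w)) z.
Proof.
  intros Hg Hf.
  destruct (hol_open _ _ Hf) as [s [Hs Hf1]].
  destruct (hol_ccont _ _ Hg s Hs) as [d [Hd Hgd]].
  destruct Hg as [r [Hr [g' Hg]]].
  apply (hol_intro _ (fun w => C_derive f (g w) * g' w)%C _ (Rmin r d)); [apply Rmin_glb_lt; lra|].
  intros w Hw.
  destruct (Hg w (Rlt_le_trans _ _ _ Hw (Rmin_l _ _))) as [A B].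
  assert (Hfw : hol f (g w)) by (apply Hf1, Hgd, (Rlt_le_trans _ _ _ Hw (Rmin_r _ _))).
  split; [apply cderiv_comp; [exact A|now apply hol_cderiv]|].
  apply ccont_mult; [|exact B].
  apply (ccont_comp (C_derive f) g); [eapply cderiv_cont, A|]. apply hol_ccont, hol_C_derive, Hfw.
Qed.

Lemma hol_opp (f : C -> C) (z : C) : hol f z -> hol (fun w => - f w)%C z.
Proof.
  intros H. apply hol_ext with (fun w => - (1) * f w)%C; [intros; ring|].
  apply hol_mult; [apply hol_const|exact H].
Qed.

Lemma hol_minus (f g : C -> C) (z : C) : hol f z -> hol g z -> hol (fun w => f w - g w)%C z.
Proof. intros. apply hol_plus; [|apply hol_opp]; assumption. Qed.

Lemma hol_inv (f : C -> C) (z : C) : hol f z -> f z <> 0 -> hol (fun w => / f w)%C z.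
Proof. intros H Hz. apply (hol_comp Cinv f); [exact H|now apply hol_Cinv]. Qed.

Lemma hol_div (f g : C -> C) (z : C) : hol f z -> hol g z -> g z <> 0 -> hol (fun w => f w / g w)%C z.
Proof. intros. apply hol_mult; [assumption|now apply hol_inv]. Qed.

Lemma hol_pow (f : C -> C) (n : nat) (z : C) : hol f z -> hol (fun w => f w ^ n)%C z.
Proof. intros H. induction n; simpl; [apply hol_const|now apply hol_mult]. Qed.

Lemma hol_scal (k : C) (f : C -> C) (z : C) : hol f z -> hol (fun w => k * f w)%C z.
Proof. intros. apply hol_mult; [apply hol_const|assumption]. Qed.

(** * Compactness of rectangles *)

Lemma Rle_inv_swap (m K : R) : 0 < m -> 0 < K -> m <= / K -> K <= / m.
Proof.
  intros Hm HK H. rewrite <- (Rinv_inv K). apply Rinv_le_contravar; assumption.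
Qed.

(** Compactness: local bounds give a global one. [P] removes points at which nothing is claimed. One
    positive number per point serves as radius and, inverted, as bound, the form that
    [compactness_value_2d] can bound below. *)
Lemma rectangle_bounded (a b a' b' : R) (P : R -> R -> Prop) (f : R -> R -> R) :
  (forall x y, a <= x <= b -> a' <= y <= b' -> exists d M, 0 < d /\
     forall u v, Rabs (u - x) < d -> Rabs (v - y) < d -> P u v -> f u v <= M) ->
  exists M, forall x y, a <= x <= b -> a' <= y <= b' -> P x y -> f x y <= M.
Proof.
  intros H.
  assert (H' : forall p : R * R, exists d : posreal,
    a <= fst p <= b -> a' <= snd p <= b' ->
    forall u v, Rabs (u - fst p) < d -> Rabs (v - snd p) < d -> P u v -> f u v <= / d).
  { intros [x y]; simpl.
    destruct (classic (a <= x <= b /\ a' <= y <= b')) as [[Hx Hy]|Hn].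
    - destruct (H x y Hx Hy) as [d [M [Hd Hw]]].
      assert (HM : 0 < Rabs M + 1) by (generalize (Rabs_pos M); lra).
      assert (Hm : 0 < Rmin d (/ (Rabs M + 1))) by (apply Rmin_glb_lt; [lra|now apply Rinv_0_lt_compat]).
      exists (mkposreal _ Hm). simpl. intros _ _ u v Hu Hv HP.
      apply Rle_trans with M.
      + apply Hw; auto; eapply Rlt_le_trans; try eassumption; apply Rmin_l.
      + apply Rle_trans with (Rabs M + 1); [generalize (Rle_abs M); lra|].
        apply Rle_inv_swap; [exact Hm|exact HM|apply Rmin_r].
    - exists (mkposreal 1 Rlt_0_1). intros; exfalso; tauto. }
  set (delta := fun x y => proj1_sig (constructive_indefinite_description _ (H' (x, y)))).
  destruct (compactness_value_2d a b a' b' delta) as [d Hd].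
  exists (/ d). intros x y Hx Hy HP. apply NNPP. intros Hn.
  apply (Hd x y Hx Hy). intros [u [v [Hu [Hv [Hxu [Hyv Hdd]]]]]]. apply Hn.
  apply Rle_trans with (/ delta u v).
  - unfold delta in *. destruct (constructive_indefinite_description _ (H' (u, v))) as [e He].
    simpl in *. now apply (He Hu Hv).
  - apply Rinv_le_contravar; [apply cond_pos|exact Hdd].
Qed.

(** If the supremum [S] were not attained, [1 / (S - f)] would be locally bounded, hence bounded,
    and [S] could be lowered. *)
Lemma rectangle_max (a b a' b' : R) (f : R -> R -> R) : a <= b -> a' <= b' ->
  (forall x y, a <= x <= b -> a' <= y <= b' -> forall eps, 0 < eps -> exists d, 0 < d /\
     forall u v, a <= u <= b -> a' <= v <= b' ->
       Rabs (u - x) < d -> Rabs (v - y) < d -> Rabs (f u v - f x y) < eps) ->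
  exists x y, a <= x <= b /\ a' <= y <= b' /\
    forall u v, a <= u <= b -> a' <= v <= b' -> f u v <= f x y.
Proof.
  intros Hab Hab' Hc.
  destruct (rectangle_bounded a b a' b' (fun u v => a <= u <= b /\ a' <= v <= b') f) as [M0 HM0].
  { intros x y Hx Hy. destruct (Hc x y Hx Hy 1 Rlt_0_1) as [d [Hd Hw]].
    exists d, (f x y + 1). split; [exact Hd|]. intros u v Hu Hv [Pu Pv].
    generalize (Rabs_def2 _ _ (Hw u v Pu Pv Hu Hv)). lra. }
  set (E := fun r => exists x y, a <= x <= b /\ a' <= y <= b' /\ r = f x y).
  destruct (completeness E) as [S [HS1 HS2]].
  { exists M0. intros r [x [y [Hx [Hy ->]]]]. apply HM0; auto. }
  { exists (f a a'), a, a'. repeat split; lra. }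
  apply NNPP. intros Hn.
  assert (Hlt : forall x y, a <= x <= b -> a' <= y <= b' -> f x y < S).
  { intros x y Hx Hy.
    assert (Hle : f x y <= S) by (apply HS1; now exists x, y).
    destruct Hle as [Hl|He]; [exact Hl|exfalso]. apply Hn.
    exists x, y. repeat split; try lra. intros u v Hu Hv. rewrite He.
    apply HS1. now exists u, v. }
  destruct (rectangle_bounded a b a' b' (fun u v => a <= u <= b /\ a' <= v <= b')
              (fun u v => / (S - f u v))) as [M HM].
  { intros x y Hx Hy. assert (Hp := Hlt x y Hx Hy).
    destruct (Hc x y Hx Hy ((S - f x y) / 2)) as [d [Hd Hw]]; [lra|].
    exists d, (/ ((S - f x y) / 2)). split; [exact Hd|]. intros u v Hu Hv [Pu Pv].
    apply Rinv_le_contravar; [lra|].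
    generalize (Rabs_def2 _ _ (Hw u v Pu Pv Hu Hv)). lra. }
  assert (HMp : 0 < M).
  { eapply Rlt_le_trans; [|apply (HM a a')]; try lra.
    apply Rinv_0_lt_compat. generalize (Hlt a a'). lra. }
  assert (Hub : S <= S - / M).
  { apply HS2. intros r [x [y [Hx [Hy ->]]]].
    assert (Hp := Hlt x y Hx Hy). assert (A := HM x y Hx Hy (conj Hx Hy)).
    assert (/ M <= S - f x y).
    { rewrite <- (Rinv_inv (S - f x y)). apply Rinv_le_contravar; [|exact A].
      apply Rinv_0_lt_compat; lra. }
    lra. }
  assert (0 < / M) by now apply Rinv_0_lt_compat. lra.
Qed.

(** * The nome *)

Lemma qpar_plus (a b : C) : qpar (a + b) = (qpar a * qpar b)%C.
Proof. unfold qpar. rewrite <- Cexp_plus. f_equal. ring. Qed.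

Lemma qpar_nz (z : C) : qpar z <> 0.
Proof. apply Cexp_nz. Qed.

Lemma qpar_opp (z : C) : qpar (- z) = (/ qpar z)%C.
Proof. unfold qpar. rewrite <- Cexp_opp. f_equal. ring. Qed.

Lemma qpar_Z (k : Z) : qpar (IZR k) = 1.
Proof. apply Cexp_2PI_Z. Qed.

Lemma qpar_1 : qpar 1 = 1.
Proof. apply (qpar_Z 1). Qed.

Lemma qpar_eq_1 (z : C) : qpar z = 1 -> exists k : Z, z = IZR k.
Proof. apply Cexp_2PI_eq_1. Qed.

Lemma Cmod_qpar (z : C) : Cmod (qpar z) = exp (- (2 * PI * Im z)).
Proof.
  unfold qpar. rewrite Cmod_Cexp. f_equal. destruct z; unfold Ci, Cmult, RtoC; simpl. ring.
Qed.

Lemma qpar_INR_mult (n : nat) (z : C) : qpar (INR n * z) = (qpar z ^ n)%C.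
Proof. unfold qpar. rewrite <- Cexp_INR_mult. f_equal. ring. Qed.

Lemma Cmod_qpar_lt_1 (z : C) : 0 < Im z -> 0 < Cmod (qpar z) < 1.
Proof.
  intros H. rewrite Cmod_qpar. split; [apply exp_pos|].
  rewrite <- exp_0. apply exp_increasing. generalize PI_RGT_0. nra.
Qed.

Lemma cderiv_qpar (z : C) : cderiv qpar z (2 * PI * Ci * qpar z)%C.
Proof.
  unfold qpar. eapply cderiv_eq.
  - apply (cderiv_comp Cexp (fun t => 2 * PI * Ci * t)%C); [|apply cderiv_Cexp].
    apply cderiv_scal, cderiv_id.
  - ring.
Qed.

Lemma hol_qpar (z : C) : hol qpar z.
Proof. apply (hol_comp Cexp); [apply hol_scal, hol_id|apply hol_Cexp]. Qed.

(** * The rational functions [sum_m m^(k-1) u^m] *)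

(** [L1] is [1/2 + sum u^m]: the added 1/2 makes it odd under inversion of [u], as [L3] is, while
    [L2] and [L4] are even. *)
Definition L1 (u : C) : C := ((1 + u) / (1 - u) / 2)%C.
Definition L2 (u : C) : C := (u / (1 - u) ^ 2)%C.
Definition L3 (u : C) : C := (u * (1 + u) / (1 - u) ^ 3)%C.
Definition L4 (u : C) : C := (u * (1 + 4 * u + u ^ 2) / (1 - u) ^ 4)%C.

Lemma one_minus_nz (u : C) : u <> 1 -> (1 - u)%C <> 0.
Proof. intros H. apply Cminus_eq_contra. congruence. Qed.

Lemma one_minus_Cinv_nz (u : C) : u <> 0 -> u <> 1 -> (u - 1)%C <> 0.
Proof. intros _ H. apply Cminus_eq_contra. congruence. Qed.

Lemma L1_inv (u : C) : u <> 0 -> u <> 1 -> L1 (/ u) = (- L1 u)%C.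
Proof.
  intros H0 H1. unfold L1. field. repeat split; auto using one_minus_nz, one_minus_Cinv_nz.
Qed.

Lemma L2_inv (u : C) : u <> 0 -> u <> 1 -> L2 (/ u) = L2 u.
Proof.
  intros H0 H1. unfold L2. field. repeat split; auto using one_minus_nz, one_minus_Cinv_nz.
Qed.

Lemma L3_inv (u : C) : u <> 0 -> u <> 1 -> L3 (/ u) = (- L3 u)%C.
Proof.
  intros H0 H1. unfold L3. field. repeat split; auto using one_minus_nz, one_minus_Cinv_nz.
Qed.

Lemma L4_inv (u : C) : u <> 0 -> u <> 1 -> L4 (/ u) = L4 u.
Proof.
  intros H0 H1. unfold L4. field. repeat split; auto using one_minus_nz, one_minus_Cinv_nz.
Qed.

Lemma square_neq_1 (v : C) : (v * v)%C <> 1 ->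
  (1 - v)%C <> 0 /\ (1 - - v)%C <> 0 /\ (1 - v * v)%C <> 0 /\ (1 + v)%C <> 0.
Proof.
  intros H. assert (A : (1 - v * v)%C <> 0) by now apply one_minus_nz.
  assert (B : (1 - v)%C <> 0).
  { intros E. apply A. replace (1 - v * v)%C with ((1 - v) * (1 + v))%C by ring. rewrite E. ring. }
  assert (D : (1 + v)%C <> 0).
  { intros E. apply A. replace (1 - v * v)%C with ((1 - v) * (1 + v))%C by ring. rewrite E. ring. }
  repeat split; auto. intros E. apply D. rewrite <- E. ring.
Qed.

Lemma L3_dup (v : C) : (v * v)%C <> 1 -> (L3 v + L3 (- v))%C = (8 * L3 (v * v))%C.
Proof.
  intros H. destruct (square_neq_1 v H) as [A [B [D E]]]. unfold L3. field. auto.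
Qed.

Lemma L4_dup (v : C) : (v * v)%C <> 1 -> (L4 v + L4 (- v))%C = (16 * L4 (v * v))%C.
Proof.
  intros H. destruct (square_neq_1 v H) as [A [B [D E]]]. unfold L4. field. auto.
Qed.

Lemma one_minus_bound (v : C) (n : nat) : Cmod v <= / 2 ->
  (1 - v)%C <> 0 /\ Cmod (/ (1 - v) ^ n) <= 2 ^ n.
Proof.
  intros H.
  assert (A : / 2 <= Cmod (1 - v)).
  { generalize (Cmod_reverse_triangle 1 v). rewrite Cmod_1. lra. }
  assert (B : (1 - v)%C <> 0) by (apply Cmod_gt_0; lra).
  split; [exact B|]. rewrite Cmod_inv by now apply Cpow_nz.
  rewrite Cmod_pow, <- pow_inv. apply pow_incr. split.
  - left. apply Rinv_0_lt_compat. lra.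
  - rewrite <- (Rinv_inv 2). apply Rinv_le_contravar; lra.
Qed.

(** The decay at 0 that makes lattice sums converge. The constant serves [L2], [L3] and [L4] at
    once; the worst case is [L4], with [4 * 2^4 = 64]. *)
Definition small_bound (L : C -> C) : Prop := forall v, Cmod v <= / 2 -> Cmod (L v) <= 64 * Cmod v.

Lemma small_bound_div (P : C -> C) (n : nat) (B : R) : B * 2 ^ n <= 64 ->
  (forall v, Cmod v <= / 2 -> Cmod (P v) <= B) ->
  small_bound (fun v => v * P v / (1 - v) ^ n)%C.
Proof.
  intros HB HP v Hv. destruct (one_minus_bound v n Hv) as [A D].
  unfold Cdiv. rewrite !Cmod_mult. specialize (HP v Hv).
  assert (Cmod (P v) * Cmod (/ (1 - v) ^ n) <= B * 2 ^ n)
    by (apply Rmult_le_compat; try apply Cmod_ge_0; assumption).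
  generalize (Cmod_ge_0 v). intros. nra.
Qed.

Lemma L2_small : small_bound L2.
Proof.
  intros v Hv. unfold L2. replace (v / (1 - v) ^ 2)%C with (v * 1 / (1 - v) ^ 2)%C by (f_equal; ring).
  apply (small_bound_div (fun _ => RtoC 1) 2 1); [lra| |exact Hv].
  intros. rewrite Cmod_1. lra.
Qed.

Lemma L3_small : small_bound L3.
Proof.
  apply (small_bound_div (fun v => 1 + v)%C 3 2); [lra|].
  intros v Hv. eapply Rle_trans; [apply Cmod_triangle|]. rewrite Cmod_1. lra.
Qed.

Lemma L4_small : small_bound L4.
Proof.
  apply (small_bound_div (fun v => 1 + 4 * v + v ^ 2)%C 4 4); [lra|].
  intros v Hv. eapply Rle_trans; [apply Cmod_triangle|].
  eapply Rle_trans; [apply Rplus_le_compat_r, Cmod_triangle|].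
  rewrite Cmod_pow, Cmod_mult, Cmod_1, Cmod_R, Rabs_pos_eq by lra.
  assert (0 <= Cmod v) by apply Cmod_ge_0. nra.
Qed.

Lemma L3_ccont (u : C) : u <> 1 -> ccont L3 u.
Proof.
  intros H. apply ccont_mult.
  - apply ccont_mult; [apply ccont_id|]. apply ccont_plus; [apply ccont_const|apply ccont_id].
  - apply ccont_inv; [|now apply Cpow_nz, one_minus_nz]. apply ccont_pow.
    apply ccont_minus; [apply ccont_const|apply ccont_id].
Qed.

Lemma L2_ccont (u : C) : u <> 1 -> ccont L2 u.
Proof.
  intros H. apply ccont_mult; [apply ccont_id|].
  apply ccont_inv; [|now apply Cpow_nz, one_minus_nz]. apply ccont_pow.
  apply ccont_minus; [apply ccont_const|apply ccont_id].
Qed.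

Lemma L4_ccont (u : C) : u <> 1 -> ccont L4 u.
Proof.
  intros H. apply ccont_mult.
  - apply ccont_mult; [apply ccont_id|]. apply ccont_plus; [|apply ccont_pow, ccont_id].
    apply ccont_plus; [apply ccont_const|]. apply ccont_mult; [apply ccont_const|apply ccont_id].
  - apply ccont_inv; [|now apply Cpow_nz, one_minus_nz]. apply ccont_pow.
    apply ccont_minus; [apply ccont_const|apply ccont_id].
Qed.

Lemma cderiv_L1_qpar (z c : C) : qpar (z + c) <> 1 ->
  cderiv (fun z => L1 (qpar (z + c))) z (2 * PI * Ci * L2 (qpar (z + c)))%C.
Proof.
  intros H. assert (H' := one_minus_nz _ H).
  eapply cderiv_eq.
  - apply (cderiv_comp L1 (fun z => qpar (z + c))).
    + apply (cderiv_comp qpar (fun z => z + c)%C); [|apply cderiv_qpar].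
      apply cderiv_plus; [apply cderiv_id|apply cderiv_const].
    + unfold L1, Cdiv at 1. apply cderiv_mult; [|apply cderiv_const].
      apply cderiv_div; [apply cderiv_plus; [apply cderiv_const|apply cderiv_id]|
        apply cderiv_minus; [apply cderiv_const|apply cderiv_id]|exact H'].
  - cbv beta. unfold L2. field. exact H'.
Qed.

Lemma cderiv_L2_qpar (z c : C) : qpar (z + c) <> 1 ->
  cderiv (fun z => L2 (qpar (z + c))) z (2 * PI * Ci * L3 (qpar (z + c)))%C.
Proof.
  intros H. assert (H' := one_minus_nz _ H).
  eapply cderiv_eq.
  - apply (cderiv_comp L2 (fun z => qpar (z + c))).
    + apply (cderiv_comp qpar (fun z => z + c)%C); [|apply cderiv_qpar].
      apply cderiv_plus; [apply cderiv_id|apply cderiv_const].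
    + unfold L2. apply cderiv_div; [apply cderiv_id| |now apply Cpow_nz].
      apply (cderiv_pow (fun u => 1 - u)%C 1).
      apply cderiv_minus; [apply cderiv_const|apply cderiv_id].
  - cbv beta. unfold L3. replace (INR 2) with 2 by (simpl; ring). field. exact H'.
Qed.

(** * Laurent expansion at the origin *)

Definition sinhC (w : C) : C := ((Cexp w - Cexp (- w)) / 2)%C.
Definition coshC (w : C) : C := ((Cexp w + Cexp (- w)) / 2)%C.

(* [sinh w = w (1 + w^2 (1/6 + w^2/120 + w^2 sinh_tail w))] *)
Definition sinh_tail (w : C) : C := ((sinhC w - w - w ^ 3 / 6 - w ^ 5 / 120) / w ^ 5)%C.
Definition sinh_sigma (w : C) : C := (1 / 6 + w ^ 2 / 120 + w ^ 2 * sinh_tail w)%C.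
Definition cosh_tail (w : C) : C := ((coshC w - 1 - w ^ 2 / 2) / w ^ 4)%C.

Lemma Cexp_pm_remainder (n : nat) (w : C) : Cmod w <= 1 ->
  Cmod (Cexp w - exp_poly n w) <= 3 * Cmod w ^ n /\
  Cmod (Cexp (- w) - exp_poly n (- w)) <= 3 * Cmod w ^ n.
Proof.
  intros H.
  assert (E : exp (Cmod w) <= 3) by (eapply Rle_trans; [apply exp_le_mono, H|apply exp_le_3]).
  assert (P : 0 <= Cmod w ^ n) by apply pow_le, Cmod_ge_0.
  split; (eapply Rle_trans; [apply Cexp_remainder|]); rewrite ?Cmod_opp, (Rmult_comm 3);
    now apply Rmult_le_compat_l.
Qed.

Lemma Cmod_half_sub (a b : C) (B : R) : Cmod a <= B -> Cmod b <= B ->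
  Cmod ((a - b) / 2) <= B /\ Cmod ((a + b) / 2) <= B.
Proof.
  intros Ha Hb. assert (H2 : RtoC 2 <> 0) by (intros E; apply RtoC_inj in E; lra).
  assert (E2 : Cmod 2 = 2) by (rewrite Cmod_R, Rabs_pos_eq; lra).
  split; rewrite Cmod_div, E2 by exact H2.
  - generalize (Cmod_minus_le a b). lra.
  - generalize (Cmod_triangle a b). lra.
Qed.

Lemma sinh_tail_bound (w : C) : Cmod w <= 1 -> Cmod (sinh_tail w) <= 3 * Cmod w ^ 2.
Proof.
  intros H. destruct (classic (w = 0)) as [->|Hw].
  - unfold sinh_tail. replace (sinhC 0) with (RtoC 0) by (unfold sinhC; rewrite Copp_0; field).
    replace ((0 - 0 - 0 ^ 3 / 6 - 0 ^ 5 / 120) / 0 ^ 5)%C with (RtoC 0).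
    + rewrite Cmod_0. simpl. lra.
    + symmetry. unfold Cdiv at 1. replace (0 - 0 - 0 ^ 3 / 6 - 0 ^ 5 / 120)%C with (RtoC 0) by field. ring.
  - unfold sinh_tail. rewrite Cmod_div by now apply Cpow_nz.
    (* Order 7, because the odd part of [exp_poly 7] ends at [w^5]: the remainder divided by [w^5]
       is then of order [w^2]. *)
    destruct (Cexp_pm_remainder 7 w H) as [A B].
    destruct (Cmod_half_sub _ _ _ A B) as [D _].
    replace ((Cexp w - exp_poly 7 w - (Cexp (- w) - exp_poly 7 (- w))) / 2)%C
      with (sinhC w - w - w ^ 3 / 6 - w ^ 5 / 120)%C in D.
    + rewrite Cmod_pow. assert (P : 0 < Cmod w ^ 5) by (apply pow_lt, Cmod_gt_0, Hw).
      apply Rmult_le_reg_r with (Cmod w ^ 5); [exact P|].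
      unfold Rdiv. rewrite Rmult_assoc, Rinv_l, Rmult_1_r by lra.
      eapply Rle_trans; [exact D|]. right. ring.
    + unfold sinhC, exp_poly. cbn [csumn]. rewrite !INR_IZR_INZ.
      cbv [fact Nat.mul Nat.add Z.of_nat Pos.of_succ_nat Pos.succ]. field.
Qed.

Lemma cosh_tail_bound (w : C) : Cmod w <= 1 -> Cmod (cosh_tail w) <= 3.
Proof.
  intros H. destruct (classic (w = 0)) as [->|Hw].
  - unfold cosh_tail. replace (coshC 0) with (RtoC 1)
      by (unfold coshC; rewrite Copp_0, Cexp_0; field).
    unfold Cdiv at 1. replace (1 - 1 - 0 ^ 2 / 2)%C with (RtoC 0) by field.
    rewrite Cmult_0_l, Cmod_0. lra.
  - unfold cosh_tail. rewrite Cmod_div by now apply Cpow_nz.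
    destruct (Cexp_pm_remainder 4 w H) as [A B].
    destruct (Cmod_half_sub _ _ _ A B) as [_ D].
    replace ((Cexp w - exp_poly 4 w + (Cexp (- w) - exp_poly 4 (- w))) / 2)%C
      with (coshC w - 1 - w ^ 2 / 2)%C in D.
    + rewrite Cmod_pow. assert (P : 0 < Cmod w ^ 4) by (apply pow_lt, Cmod_gt_0, Hw).
      apply Rmult_le_reg_r with (Cmod w ^ 4); [exact P|].
      unfold Rdiv. rewrite Rmult_assoc, Rinv_l, Rmult_1_r by lra. exact D.
    + unfold coshC, exp_poly. cbn [csumn]. rewrite !INR_IZR_INZ.
      cbv [fact Nat.mul Nat.add Z.of_nat Pos.of_succ_nat Pos.succ]. field.
Qed.

Lemma ccont_sinh_tail : ccont sinh_tail 0.
Proof.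
  assert (H0 : sinh_tail 0 = 0).
  { apply Cmod_eq_0, Rle_antisym; [|apply Cmod_ge_0].
    eapply Rle_trans; [apply sinh_tail_bound; rewrite Cmod_0; lra|]. rewrite Cmod_0. simpl. lra. }
  intros eps He. rewrite H0. exists (Rmin 1 (eps / 4)). split; [apply Rmin_glb_lt; lra|].
  intros w Hw. replace (w - 0)%C with w in Hw by ring.
  replace (sinh_tail w - 0)%C with (sinh_tail w) by ring.
  assert (A := Rlt_le_trans _ _ _ Hw (Rmin_l _ _)). assert (B := Rlt_le_trans _ _ _ Hw (Rmin_r _ _)).
  eapply Rle_lt_trans; [apply sinh_tail_bound; lra|].
  assert (0 <= Cmod w) by apply Cmod_ge_0. nra.
Qed.

Lemma sinh_tail_0 : sinh_tail 0 = 0.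
Proof.
  apply Cmod_eq_0, Rle_antisym; [|apply Cmod_ge_0].
  eapply Rle_trans; [apply sinh_tail_bound; rewrite Cmod_0; lra|]. rewrite Cmod_0. simpl. lra.
Qed.

Lemma ccont_sinh_sigma : ccont sinh_sigma 0.
Proof.
  apply ccont_plus; [apply ccont_plus; [apply ccont_const|]|].
  - apply ccont_mult; [apply ccont_pow, ccont_id|apply ccont_const].
  - apply ccont_mult; [apply ccont_pow, ccont_id|apply ccont_sinh_tail].
Qed.

Lemma sinhC_sigma (w : C) : sinhC w = (w * (1 + w ^ 2 * sinh_sigma w))%C.
Proof.
  destruct (classic (w = 0)) as [->|Hw].
  - unfold sinhC. rewrite Copp_0. field.
  - unfold sinh_sigma, sinh_tail. field. exact Hw.
Qed.

Lemma ccont_sinh_denominator (n : nat) :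
  ccont (fun w => / (1 + w ^ 2 * sinh_sigma w) ^ n)%C 0 /\
  (1 + 0 ^ 2 * sinh_sigma 0)%C = 1.
Proof.
  assert (E : (1 + 0 ^ 2 * sinh_sigma 0)%C = 1) by ring. split; [|exact E].
  apply ccont_inv.
  - apply ccont_pow, ccont_plus; [apply ccont_const|].
    apply ccont_mult; [apply ccont_pow, ccont_id|apply ccont_sinh_sigma].
  - rewrite E. apply Cpow_nz, C1_nz.
Qed.

(** With [w = i pi z] one has [qpar z = e^(2 w)], and the [L_k] become, up to constants,
    [1 / sinh^2 w] and its derivatives. *)
Definition half_arg (z : C) : C := (PI * Ci * z)%C.

Lemma half_arg_nz (z : C) : z <> 0 -> half_arg z <> 0.
Proof.
  intros H. apply Cmult_neq_0; [|exact H]. apply Cmult_neq_0; [|apply Ci_nz].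
  intros E. apply RtoC_inj in E. generalize PI_RGT_0; lra.
Qed.

Lemma ccont_half_arg (z : C) : ccont half_arg z.
Proof. apply ccont_mult; [apply ccont_const|apply ccont_id]. Qed.

Lemma qpar_half_arg (z : C) : qpar z = (Cexp (half_arg z) * Cexp (half_arg z))%C.
Proof. unfold qpar, half_arg. rewrite <- Cexp_plus. f_equal. ring. Qed.

Lemma L_half_arg (z : C) : sinhC (half_arg z) <> 0 ->
  L2 (qpar z) = (/ (4 * sinhC (half_arg z) ^ 2))%C /\
  L3 (qpar z) = (- coshC (half_arg z) / (4 * sinhC (half_arg z) ^ 3))%C /\
  L4 (qpar z) = ((6 + 4 * sinhC (half_arg z) ^ 2) / (16 * sinhC (half_arg z) ^ 4))%C.
Proof.
  rewrite qpar_half_arg. unfold L2, L3, L4, sinhC, coshC. rewrite Cexp_opp.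
  assert (He := Cexp_nz (half_arg z)). set (e := Cexp (half_arg z)) in *. intros Hs.
  assert (H2 : (e * e - 1)%C <> 0).
  { intros E. apply Hs. replace ((e - / e) / 2)%C with ((e * e - 1) / (2 * e))%C by (field; exact He).
    rewrite E. field. exact He. }
  assert (H3 : (1 - e * e)%C <> 0).
  { intros E. apply H2. replace (e * e - 1)%C with (- (1 - e * e))%C by ring. rewrite E. ring. }
  repeat split; field; repeat split; auto.
Qed.

(** These are [L2], [L3], [L4] after removal of the pole, written with [sinh_sigma] and the tails so
    that nothing is divided by [w] outside the tails and the limit at 0 can be taken. *)
Definition L2_regular (w : C) : C :=
  (- (2 * sinh_sigma w + w ^ 2 * sinh_sigma w ^ 2) / 4 * / (1 + w ^ 2 * sinh_sigma w) ^ 2)%C.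

Definition L3_regular (w : C) : C :=
  (w * (1 / 40 + 3 * sinh_tail w + 3 * sinh_sigma w ^ 2 + w ^ 2 * sinh_sigma w ^ 3 - cosh_tail w) / 4
   * / (1 + w ^ 2 * sinh_sigma w) ^ 3)%C.

Definition L4_regular (w : C) : C :=
  ((- 1 / 5 - 24 * sinh_tail w + 8 * sinh_sigma w + 4 * w ^ 2 * sinh_sigma w ^ 2 - 36 * sinh_sigma w ^ 2
    - 24 * w ^ 2 * sinh_sigma w ^ 3 - 6 * w ^ 4 * sinh_sigma w ^ 4) / 16
   * / (1 + w ^ 2 * sinh_sigma w) ^ 4)%C.

Lemma sinhC_near_0 : exists r, 0 < r <= 1 /\ forall z, Cmod z < r ->
  (1 + half_arg z ^ 2 * sinh_sigma (half_arg z))%C <> 0 /\ Cmod (half_arg z) <= 1.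
Proof.
  assert (Hc : ccont (fun w => 1 + w ^ 2 * sinh_sigma w)%C 0).
  { apply ccont_plus; [apply ccont_const|].
    apply ccont_mult; [apply ccont_pow, ccont_id|apply ccont_sinh_sigma]. }
  assert (H0 : half_arg 0 = 0) by (unfold half_arg; ring).
  assert (Hc' : ccont (fun z => 1 + half_arg z ^ 2 * sinh_sigma (half_arg z))%C 0).
  { apply (ccont_comp (fun w => 1 + w ^ 2 * sinh_sigma w)%C half_arg); [apply ccont_half_arg|].
    rewrite H0. exact Hc. }
  destruct (ccont_nonzero _ _ Hc') as [r [Hr H]].
  { rewrite H0. rewrite (proj2 (ccont_sinh_denominator 1)). apply C1_nz. }
  destruct (ccont_half_arg 0 1 Rlt_0_1) as [s [Hs H']].
  exists (Rmin 1 (Rmin r s)). split; [split; [repeat apply Rmin_glb_lt; lra|apply Rmin_l]|].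
  intros z Hz. assert (Hz' := Rlt_le_trans _ _ _ Hz (Rmin_r _ _)).
  split.
  - apply H. replace (z - 0)%C with z by ring. exact (Rlt_le_trans _ _ _ Hz' (Rmin_l _ _)).
  - assert (A : Cmod (half_arg z - half_arg 0) < 1).
    { apply H'. replace (z - 0)%C with z by ring. exact (Rlt_le_trans _ _ _ Hz' (Rmin_r _ _)). }
    rewrite H0 in A. replace (half_arg z - 0)%C with (half_arg z) in A by ring. lra.
Qed.

Lemma L_regular : exists r, 0 < r <= 1 /\ forall z : C, z <> 0 -> Cmod z < r ->
  L2 (qpar z) = (/ (4 * half_arg z ^ 2) + L2_regular (half_arg z))%C /\
  L3 (qpar z) = (- / (4 * half_arg z ^ 3) + L3_regular (half_arg z))%C /\
  L4 (qpar z) = (6 / (16 * half_arg z ^ 4) + L4_regular (half_arg z))%C.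
Proof.
  destruct sinhC_near_0 as [r [Hr H]]. exists r. split; [exact Hr|]. intros z Hz Hzr.
  destruct (H z Hzr) as [Hd _]. assert (Hw := half_arg_nz z Hz).
  assert (Hs : sinhC (half_arg z) <> 0) by (rewrite sinhC_sigma; now apply Cmult_neq_0).
  destruct (L_half_arg z Hs) as [E2 [E3 E4']].
  rewrite E2, E3, E4'. clear E2 E3 E4'.
  assert (Hch : coshC (half_arg z) = (1 + half_arg z ^ 2 / 2 + half_arg z ^ 4 * cosh_tail (half_arg z))%C).
  { unfold cosh_tail. field. exact Hw. }
  rewrite Hch, sinhC_sigma. unfold L2_regular, L3_regular, L4_regular.
  set (w := half_arg z) in *. set (k := cosh_tail w).
  assert (Ht : sinh_tail w = ((sinh_sigma w - 1 / 6 - w ^ 2 / 120) / w ^ 2)%C).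
  { unfold sinh_sigma. field. exact Hw. }
  rewrite Ht. clear Ht. set (s := sinh_sigma w) in *.
  split; [|split]; field; auto.
Qed.

(** * Bilateral sums *)

Lemma pow_antitone (r : R) (m n : nat) : 0 <= r <= 1 -> (m <= n)%nat -> r ^ n <= r ^ m.
Proof.
  intros Hr H. replace n with (m + (n - m))%nat by lia. rewrite pow_add.
  rewrite <- (Rmult_1_r (r ^ m)) at 2. apply Rmult_le_compat_l; [apply pow_le; lra|].
  rewrite <- (pow1 (n - m)). apply pow_incr. lra.
Qed.

Lemma csums_shift_n (a : nat -> C) (l : C) (N : nat) :
  csums (fun n => a (N + n)%nat) l -> csums a (csumn a N + l)%C.
Proof.
  revert a l. induction N; intros a l H.
  - simpl. rewrite Cplus_0_l. exact H.
  - rewrite csumn_shift.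
    replace (a 0%nat + csumn (fun n => a (S n)) N + l)%C
      with (a 0%nat + (csumn (fun n => a (S n)) N + l))%C by ring.
    apply csums_shift, IHN. exact H.
Qed.

(** The tail bound depends on [a] only through [N0], [K] and [r], which makes the convergence of the
    lattice sums uniform in [z]. *)
Lemma geometric_dominated (a : nat -> C) (N0 : nat) (K r : R) : 0 <= K -> 0 <= r < 1 ->
  (forall n, (N0 <= n)%nat -> Cmod (a n) <= K * r ^ n) ->
  csums a (CSeries a) /\
  forall N, (N0 <= N)%nat -> Cmod (CSeries a - csumn a N) <= K * r ^ N / (1 - r).
Proof.
  intros HK Hr H.
  assert (Hs : csums a (CSeries a)).
  { assert (A : csums (fun n => a (N0 + n)%nat) (CSeries (fun n => a (N0 + n)%nat))).
    { apply csums_exists with (fun n => K * r ^ n).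
      - intros n. eapply Rle_trans; [apply H; lia|]. apply Rmult_le_compat_l; [exact HK|].
        apply pow_antitone; [lra|lia].
      - apply ex_series_scal_R, ex_series_geom_R, Hr. }
    apply csums_shift_n in A. now rewrite (csums_CSeries _ _ A). }
  split; [exact Hs|]. intros N HN.
  apply Cmod_cconv_le with (fun k => csumn a (N + k) - csumn a N)%C.
  - intros eps He. destruct (Hs eps He) as [N' HN']. exists N'. intros n Hn.
    specialize (HN' (N + n)%nat ltac:(lia)).
    replace (csumn a (N + n) - csumn a N - (CSeries a - csumn a N))%C
      with (csumn a (N + n) - CSeries a)%C by ring. exact HN'.
  - intros k. apply Rle_trans with (K * r ^ N * (1 - r ^ k) / (1 - r)).
    + induction k.
      * rewrite Nat.add_0_r. replace (csumn a N - csumn a N)%C with (RtoC 0) by ring.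
        rewrite Cmod_0. simpl. right. field. lra.
      * rewrite Nat.add_succ_r. simpl csumn.
        replace (csumn a (N + k) + a (N + k)%nat - csumn a N)%C
          with ((csumn a (N + k) - csumn a N) + a (N + k)%nat)%C by ring.
        eapply Rle_trans; [apply Cmod_triangle|].
        specialize (H (N + k)%nat ltac:(lia)). rewrite pow_add in H.
        apply Rle_trans with (K * r ^ N * (1 - r ^ k) / (1 - r) + K * (r ^ N * r ^ k)); [lra|].
        right. simpl. field. lra.
    + unfold Rdiv. apply Rmult_le_compat_r; [left; apply Rinv_0_lt_compat; lra|].
      rewrite <- (Rmult_1_r (K * r ^ N)) at 2. apply Rmult_le_compat_l.
      * apply Rmult_le_pos; [exact HK|apply pow_le; lra].
      * assert (0 <= r ^ k) by (apply pow_le; lra). lra.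
Qed.

(** Symmetric partial sums: pairing [n] with [-n] compensates the limits 1/2 and -1/2 of the terms
    of [L1], and a translation by [tau] costs only two boundary terms. *)
Definition bil (T : Z -> C) (N : nat) : C :=
  (T 0%Z + csumn (fun j => T (Z.of_nat (S j)) + T (- Z.of_nat (S j))%Z) N)%C.

Lemma bil_S (T : Z -> C) (N : nat) :
  bil T (S N) = (bil T N + (T (Z.of_nat (S N)) + T (- Z.of_nat (S N))%Z))%C.
Proof. unfold bil. cbn [csumn]. ring. Qed.

Lemma bil_shift (T : Z -> C) (N : nat) :
  bil (fun n => T (n + 1)%Z) N = (bil T N + T (Z.of_nat N + 1)%Z - T (- Z.of_nat N)%Z)%C.
Proof.
  induction N.
  - unfold bil. simpl. ring.
  - rewrite !bil_S, IHN.
    replace (Z.of_nat N + 1)%Z with (Z.of_nat (S N)) by lia.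
    replace (- Z.of_nat (S N) + 1)%Z with (- Z.of_nat N)%Z by lia. ring.
Qed.

Lemma bil_even_odd (T : Z -> C) (N : nat) :
  (bil (fun n => T (2 * n)%Z) N + bil (fun n => T (2 * n + 1)%Z) N)%C
  = (bil T (2 * N) + T (Z.of_nat (2 * N) + 1)%Z)%C.
Proof.
  induction N.
  - unfold bil. simpl. ring.
  - replace (2 * S N)%nat with (S (S (2 * N))) by lia. rewrite !bil_S.
    replace (Z.of_nat (S (S (2 * N))) + 1)%Z with (2 * Z.of_nat (S N) + 1)%Z by lia.
    replace (- Z.of_nat (S (2 * N)))%Z with (2 * - Z.of_nat (S N) + 1)%Z by lia.
    replace (Z.of_nat (S (2 * N)))%Z with (Z.of_nat (2 * N) + 1)%Z by lia.
    replace (- Z.of_nat (S (S (2 * N))))%Z with (2 * - Z.of_nat (S N))%Z by lia.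
    replace (Z.of_nat (S (S (2 * N))))%Z with (2 * Z.of_nat (S N))%Z by lia.
    match goal with |- (?a + ?b + (?c + ?d))%C = _ =>
      transitivity ((a + c) + (b + d))%C; [ring|] end.
    rewrite IHN. ring.
Qed.

Lemma bil_ext (T T' : Z -> C) (N : nat) : (forall n, T n = T' n) -> bil T N = bil T' N.
Proof.
  intros H. unfold bil. rewrite H. f_equal. apply csumn_ext. intros. now rewrite !H.
Qed.

Lemma bil_plus (T T' : Z -> C) (N : nat) :
  bil (fun n => T n + T' n)%C N = (bil T N + bil T' N)%C.
Proof. induction N; [unfold bil; simpl; ring|]. rewrite !bil_S, IHN. ring. Qed.

Lemma bil_scal (k : C) (T : Z -> C) (N : nat) : bil (fun n => k * T n)%C N = (k * bil T N)%C.
Proof. induction N; [unfold bil; simpl; ring|]. rewrite !bil_S, IHN. ring. Qed.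

Lemma cconv_pow_0 (K r : R) (u : nat -> C) : 0 <= r < 1 ->
  (exists N0, forall n, (N0 <= n)%nat -> Cmod (u n) <= K * r ^ n) -> cconv u 0.
Proof.
  intros Hr [N0 H] eps He.
  assert (A : is_lim_seq (fun n => K * r ^ n) 0).
  { replace (Finite 0) with (Rbar_mult K 0) by (simpl; f_equal; ring).
    apply is_lim_seq_scal_l, is_lim_seq_geom. rewrite Rabs_pos_eq; lra. }
  apply is_lim_seq_Reals in A. destruct (A eps He) as [N1 H1].
  exists (N0 + N1)%nat. intros n Hn. specialize (H n ltac:(lia)). specialize (H1 n ltac:(lia)).
  unfold R_dist in H1. rewrite Rminus_0_r in H1.
  replace (u n - 0)%C with (u n) by ring. generalize (Rle_abs (K * r ^ n)). lra.
Qed.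

Lemma qpar_half : qpar (/ 2) = (- (1))%C.
Proof.
  unfold qpar, Cexp, Ci, Cmult, Cinv, RtoC, Copp; simpl.
  match goal with |- (exp ?a * cos ?b, exp ?a * sin ?b) = _ =>
    replace a with 0 by field; replace b with PI by field end.
  rewrite exp_0, cos_PI, sin_PI. f_equal; ring.
Qed.

(** * Doubly periodic lattice sums *)

Section EllipticSum.

Variables (L : C -> C) (s : C).
Hypotheses (Hs : Cmod s = 1)
  (L_inv : forall u : C, u <> 0 -> u <> 1 -> L (/ u)%C = (s * L u)%C)
  (L_small : small_bound L) (L_cont : forall u : C, u <> 1 -> ccont L u).

Definition eterm (tau z : C) (n : Z) : C := L (qpar (z + IZR n * tau)).

Definition etail (tau z : C) : C :=
  CSeries (fun j => eterm tau z (Z.of_nat (S j)) + eterm tau z (- Z.of_nat (S j)))%C.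

Definition esum (tau z : C) : C := (L (qpar z) + etail tau z)%C.

Variable (tau : C).
Hypothesis (Htau : 0 < Im tau).

Lemma Cmod_qpar_shift (z : C) (n : nat) (Y : R) : Rabs (Im z) <= Y ->
  Cmod (qpar (z + IZR (Z.of_nat n) * tau)) <= exp (2 * PI * Y) * Cmod (qpar tau) ^ n.
Proof.
  intros HY. rewrite qpar_plus, Cmod_mult.
  replace (qpar (IZR (Z.of_nat n) * tau)) with (qpar tau ^ n)%C
    by (rewrite <- INR_IZR_INZ, qpar_INR_mult; reflexivity).
  rewrite Cmod_pow. apply Rmult_le_compat_r; [apply pow_le, Cmod_ge_0|].
  rewrite Cmod_qpar. apply exp_le_mono. generalize PI_RGT_0 (Rabs_def2 (Im z) (Y + 1)).
  intros Hp _. assert (A := Rle_abs (- Im z)). rewrite Rabs_Ropp in A. nra.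
Qed.

Lemma qpar_pow_small (A : R) : 0 < A ->
  exists N0, forall n, (N0 <= n)%nat -> A * Cmod (qpar tau) ^ n <= / 2.
Proof.
  intros HA. assert (Hr := Cmod_qpar_lt_1 tau Htau).
  assert (Hl : is_lim_seq (fun n => A * Cmod (qpar tau) ^ n) 0).
  { replace (Finite 0) with (Rbar_mult A 0) by (simpl; f_equal; ring).
    apply is_lim_seq_scal_l, is_lim_seq_geom. rewrite Rabs_pos_eq; lra. }
  apply is_lim_seq_Reals in Hl. destruct (Hl (/ 2)) as [N0 H]; [lra|].
  exists N0. intros n Hn. specialize (H n Hn). unfold R_dist in H. rewrite Rminus_0_r in H.
  generalize (Rle_abs (A * Cmod (qpar tau) ^ n)). lra.
Qed.

(** For large [n] both [e(z) q^n] and [e(-z) q^n] are small; the term of index [-n] is reduced to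
    the second one by the inversion symmetry of [L]. *)
Lemma eterm_bound (Y : R) : exists N0 K, 0 <= K /\ forall n z, (N0 <= n)%nat -> Rabs (Im z) <= Y ->
  qpar (z + IZR (Z.of_nat n) * tau) <> 1 /\ qpar (z + IZR (- Z.of_nat n) * tau) <> 1 /\
  Cmod (eterm tau z (Z.of_nat n)) <= K * Cmod (qpar tau) ^ n /\
  Cmod (eterm tau z (- Z.of_nat n)) <= K * Cmod (qpar tau) ^ n.
Proof.
  destruct (qpar_pow_small (exp (2 * PI * Y)) (exp_pos _)) as [N0 HN0].
  assert (He := exp_pos (2 * PI * Y)).
  exists N0, (64 * exp (2 * PI * Y)). split; [lra|]. intros n z Hn HY.
  assert (A := Cmod_qpar_shift z n Y HY).
  assert (HY' : Rabs (Im (- z)) <= Y) by (rewrite im_opp, Rabs_Ropp; exact HY).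
  assert (B := Cmod_qpar_shift (- z) n Y HY').
  specialize (HN0 n Hn).
  assert (E : qpar (z + IZR (- Z.of_nat n) * tau) = (/ qpar (- z + IZR (Z.of_nat n) * tau))%C).
  { rewrite <- qpar_opp. f_equal. rewrite opp_IZR, RtoC_opp. ring. }
  assert (N1 : forall v, Cmod v <= / 2 -> v <> 1) by (intros v Hv ->; rewrite Cmod_1 in Hv; lra).
  assert (D1 : qpar (z + IZR (Z.of_nat n) * tau) <> 1) by (apply N1; lra).
  assert (D2 : qpar (- z + IZR (Z.of_nat n) * tau) <> 1) by (apply N1; lra).
  split; [exact D1|]. split; [|split].
  - rewrite E. intros F. apply D2.
    set (v := qpar (- z + IZR (Z.of_nat n) * tau)) in *.
    transitivity (v * / v)%C; [rewrite F; ring|apply Cinv_r, qpar_nz].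
  - unfold eterm. eapply Rle_trans; [apply L_small; lra|]. rewrite Rmult_assoc.
    apply Rmult_le_compat_l; lra.
  - unfold eterm. rewrite E, L_inv, Cmod_mult, Hs, Rmult_1_l by (auto; apply qpar_nz).
    eapply Rle_trans; [apply L_small; lra|]. rewrite Rmult_assoc.
    apply Rmult_le_compat_l; lra.
Qed.

Lemma etail_csums (Y : R) : exists N0 K, 0 <= K /\ forall z, Rabs (Im z) <= Y ->
  csums (fun j => eterm tau z (Z.of_nat (S j)) + eterm tau z (- Z.of_nat (S j)))%C (etail tau z) /\
  forall N, (N0 <= N)%nat -> Cmod (esum tau z - bil (eterm tau z) N) <= K * Cmod (qpar tau) ^ N.
Proof.
  destruct (eterm_bound Y) as [N0 [K [HK H]]].
  assert (Hr := Cmod_qpar_lt_1 tau Htau). set (r := Cmod (qpar tau)) in *.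
  exists N0, (2 * K / (1 - r)). split.
  { apply Rmult_le_pos; [lra|]. left; apply Rinv_0_lt_compat; lra. }
  intros z HY.
  destruct (geometric_dominated
    (fun j => eterm tau z (Z.of_nat (S j)) + eterm tau z (- Z.of_nat (S j)))%C N0 (2 * K) r)
    as [A B]; [lra|lra| |].
  - intros n Hn. eapply Rle_trans; [apply Cmod_triangle|].
    destruct (H (S n) z ltac:(lia) HY) as [_ [_ [C1 C2]]].
    assert (r ^ S n <= r ^ n) by (apply pow_antitone; [lra|lia]).
    nra.
  - split; [exact A|]. intros N HN. specialize (B N HN).
    replace (esum tau z - bil (eterm tau z) N)%C
      with (etail tau z - csumn (fun j => eterm tau z (Z.of_nat (S j)) + eterm tau z (- Z.of_nat (S j))) N)%C.
    + eapply Rle_trans; [exact B|]. right. field. lra.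
    + unfold esum, bil, eterm at 3. rewrite Cmult_0_l, Cplus_0_r. ring.
Qed.

Lemma esum_cconv (z : C) : cconv (bil (eterm tau z)) (esum tau z).
Proof.
  destruct (etail_csums (Rabs (Im z))) as [N0 [K [HK H]]].
  destruct (H z (Rle_refl _)) as [A _].
  unfold esum. eapply cconv_ext; [|apply cconv_plus; [apply cconv_const|exact A]].
  intros n. unfold bil, eterm at 3. now rewrite Cmult_0_l, Cplus_0_r.
Qed.

Lemma eterm_cconv_0 (z : C) :
  cconv (fun n => eterm tau z (Z.of_nat n)) 0 /\ cconv (fun n => eterm tau z (- Z.of_nat n)) 0.
Proof.
  destruct (eterm_bound (Rabs (Im z))) as [N0 [K [HK H]]].
  assert (Hr := Cmod_qpar_lt_1 tau Htau).
  split; (apply cconv_pow_0 with K (Cmod (qpar tau)); [lra|]); exists N0; intros n Hn;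
    apply (H n z Hn (Rle_refl _)).
Qed.

Lemma eterm_shift_tau (z : C) (n : Z) : eterm tau (z + tau) n = eterm tau z (n + 1)%Z.
Proof. unfold eterm. do 2 f_equal. rewrite plus_IZR, RtoC_plus. ring. Qed.

Lemma esum_period_tau (z : C) : esum tau (z + tau) = esum tau z.
Proof.
  apply cconv_unique with (bil (eterm tau (z + tau))); [apply esum_cconv|].
  destruct (eterm_cconv_0 z) as [A B].
  apply cconv_ext with (fun N => bil (eterm tau z) N + (eterm tau z (Z.of_nat (S N))
                                  + - (1) * eterm tau z (- Z.of_nat N)))%C.
  - intros N. rewrite (bil_ext (eterm tau (z + tau)) (fun n => eterm tau z (n + 1)%Z)) by (intros; apply eterm_shift_tau).
    rewrite bil_shift. replace (Z.of_nat (S N)) with (Z.of_nat N + 1)%Z by lia. ring.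
  - replace (esum tau z) with (esum tau z + (0 + - (1) * 0))%C by ring.
    apply cconv_plus; [apply esum_cconv|]. apply cconv_plus.
    + apply (cconv_subseq _ _ S) in A; [exact A|lia].
    + apply cconv_scal, B.
Qed.

Lemma eterm_period_1 (z : C) (n : Z) : eterm tau (z + 1) n = eterm tau z n.
Proof.
  unfold eterm. f_equal. replace (z + 1 + IZR n * tau)%C with ((z + IZR n * tau) + 1)%C by ring.
  rewrite qpar_plus, qpar_1. ring.
Qed.

Lemma esum_period_1 (z : C) : esum tau (z + 1) = esum tau z.
Proof.
  apply cconv_unique with (bil (eterm tau (z + 1))); [apply esum_cconv|].
  eapply cconv_ext; [|apply esum_cconv]. intros N. apply bil_ext.
  intros; symmetry; apply eterm_period_1.
Qed.

Definition in_lattice (tau z : C) : Prop := exists m n : Z, z = (IZR m + IZR n * tau)%C.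

Lemma qpar_not_in_lattice (t z : C) (n : Z) : ~ in_lattice t z -> qpar (z + IZR n * t) <> 1.
Proof.
  intros H E. apply H. apply qpar_eq_1 in E. destruct E as [m E]. exists m, (- n)%Z.
  rewrite <- E, opp_IZR, RtoC_opp. ring.
Qed.

(* The points [z/2 + w], [w] a half period, run through the square roots of the
   points [q^n e(z)]. *)
Lemma esum_dup (c z : C) :
  (forall v : C, (v * v)%C <> 1 -> (L v + L (- v))%C = (c * L (v * v))%C) ->
  ~ in_lattice tau z ->
  (esum tau (z / 2) + esum tau (z / 2 + / 2) + (esum tau (z / 2 + tau / 2)
   + esum tau (z / 2 + / 2 + tau / 2)))%C = (c * esum tau z)%C.
Proof.
  intros Hdup Hz.
  set (T := fun n : Z => (L (qpar ((z + IZR n * tau) / 2)) + L (- qpar ((z + IZR n * tau) / 2)))%C).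
  assert (HT : forall n, T n = (c * eterm tau z n)%C).
  { intros n. unfold T, eterm.
    assert (E : (qpar ((z + IZR n * tau) / 2) * qpar ((z + IZR n * tau) / 2))%C = qpar (z + IZR n * tau)).
    { rewrite <- qpar_plus. f_equal. field. }
    rewrite Hdup, E; [reflexivity|]. rewrite E. now apply qpar_not_in_lattice. }
  apply cconv_unique with (fun N => bil (fun n => T (2 * n)%Z) N + bil (fun n => T (2 * n + 1)%Z) N)%C.
  - apply cconv_plus.
    + eapply cconv_ext; [|apply cconv_plus; apply esum_cconv].
      intros N. cbv beta. rewrite <- bil_plus. apply bil_ext. intros n. unfold T, eterm.
      f_equal; f_equal.
      * f_equal. rewrite mult_IZR, RtoC_mult. field.
      * rewrite <- Cplus_assoc, (Cplus_comm (/ 2)), Cplus_assoc, qpar_plus, qpar_half.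
        replace ((z + IZR (2 * n) * tau) / 2)%C with (z / 2 + IZR n * tau)%C
          by (rewrite mult_IZR, RtoC_mult; field). ring.
    + eapply cconv_ext; [|apply cconv_plus; apply esum_cconv].
      intros N. cbv beta. rewrite <- bil_plus. apply bil_ext. intros n. unfold T, eterm.
      f_equal; f_equal.
      * f_equal. rewrite plus_IZR, mult_IZR, RtoC_plus, RtoC_mult. field.
      * replace (z / 2 + / 2 + tau / 2 + IZR n * tau)%C
          with ((z + IZR (2 * n + 1) * tau) / 2 + / 2)%C
          by (rewrite plus_IZR, mult_IZR, RtoC_plus, RtoC_mult; field).
        rewrite qpar_plus, qpar_half. ring.
  - apply cconv_ext with (fun N => c * (bil (eterm tau z) (2 * N) + eterm tau z (Z.of_nat (S (2 * N)))))%C.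
    + intros N. rewrite bil_even_odd, (bil_ext T (fun n => c * eterm tau z n)%C), bil_scal, HT by exact HT.
      replace (Z.of_nat (S (2 * N))) with (Z.of_nat (2 * N) + 1)%Z by lia. ring.
    + apply cconv_scal. replace (esum tau z) with (esum tau z + 0)%C by ring. apply cconv_plus.
      * apply (cconv_subseq (bil (eterm tau z)) _ (fun N => (2 * N)%nat)); [lia|apply esum_cconv].
      * apply (cconv_subseq (fun n => eterm tau z (Z.of_nat n)) _ (fun N => S (2 * N))); [lia|].
        exact (proj1 (eterm_cconv_0 z)).
Qed.

Lemma eterm_ccont (z : C) (n : Z) : qpar (z + IZR n * tau) <> 1 -> ccont (fun z => eterm tau z n) z.
Proof.
  intros H. apply (ccont_comp L (fun z => qpar (z + IZR n * tau))); [|now apply L_cont].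
  apply (ccont_comp qpar (fun z => z + IZR n * tau)%C).
  - apply ccont_plus; [apply ccont_id|apply ccont_const].
  - eapply cderiv_cont, cderiv_qpar.
Qed.

(** Early terms are continuous one by one and the rest converge uniformly on a disc. The index 0 is
    excluded, so the lemma applies at [z0 = 0], where only that term is singular. *)
Lemma etail_ccont (z0 : C) : (forall n : Z, n <> 0%Z -> qpar (z0 + IZR n * tau) <> 1) ->
  ccont (etail tau) z0.
Proof.
  intros Hz0.
  assert (HY : forall w, Cmod (w - z0) < 1 -> Rabs (Im w) <= Rabs (Im z0) + 1).
  { intros w Hw. replace w with (z0 + (w - z0))%C by ring. rewrite im_plus.
    eapply Rle_trans; [apply Rabs_triang|]. generalize (im_le_Cmod (w - z0)). lra. }
  destruct (eterm_bound (Rabs (Im z0) + 1)) as [N0 [K [HK H]]].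
  destruct (etail_csums (Rabs (Im z0) + 1)) as [N1 [K1 [HK1 Hsum]]].
  assert (Hr := Cmod_qpar_lt_1 tau Htau). set (r := Cmod (qpar tau)) in *.
  set (a := fun w j => (eterm tau w (Z.of_nat (S j)) + eterm tau w (- Z.of_nat (S j)))%C).
  apply (ccont_ext_loc (fun w => csumn (a w) N0 + CSeries (fun j => a w (N0 + j)%nat))%C _ z0 1); [lra| |].
  - intros w Hw. symmetry. destruct (Hsum w (HY w Hw)) as [A _].
    apply (csums_unique _ _ _ A). apply csums_shift_n.
    apply csums_exists with (fun j => 2 * K * r ^ j).
    + intros j. unfold a. eapply Rle_trans; [apply Cmod_triangle|].
      destruct (H (S (N0 + j)) w ltac:(lia) (HY w Hw)) as [_ [_ [B1 B2]]].
      assert (r ^ S (N0 + j) <= r ^ j) by (apply pow_antitone; [lra|lia]).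
      nra.
    + apply ex_series_scal_R, ex_series_geom_R. lra.
  - apply ccont_plus.
    + assert (A : forall M, ccont (fun w => csumn (a w) M) z0); [|apply A].
      induction M; simpl; [apply ccont_const|]. apply ccont_plus; [exact IHM|].
      apply ccont_plus; apply eterm_ccont, Hz0; lia.
    + apply (uniform_series_ccont (fun j w => a w (N0 + j)%nat) _ z0 1 (fun j => 2 * K * r ^ j)).
      * apply ex_series_scal_R, ex_series_geom_R. lra.
      * intros j w Hw. destruct (H (S (N0 + j)) w ltac:(lia) (HY w Hw)) as [D1 [D2 _]].
        apply ccont_plus; now apply eterm_ccont.
      * intros j w Hw. unfold a. eapply Rle_trans; [apply Cmod_triangle|].
        destruct (H (S (N0 + j)) w ltac:(lia) (HY w Hw)) as [_ [_ [B1 B2]]].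
        assert (r ^ S (N0 + j) <= r ^ j) by (apply pow_antitone; [lra|lia]).
      nra.
      * intros w Hw. apply csums_exists with (fun j => 2 * K * r ^ j).
        -- intros j. unfold a. eapply Rle_trans; [apply Cmod_triangle|].
           destruct (H (S (N0 + j)) w ltac:(lia) (HY w Hw)) as [_ [_ [B1 B2]]].
           assert (r ^ S (N0 + j) <= r ^ j) by (apply pow_antitone; [lra|lia]).
      nra.
        -- apply ex_series_scal_R, ex_series_geom_R. lra.
      * rewrite Cmod_sub_self. lra.
Qed.

Lemma esum_ccont (z0 : C) : ~ in_lattice tau z0 -> ccont (esum tau) z0.
Proof.
  intros H. apply ccont_plus.
  - apply (ccont_comp L qpar); [eapply cderiv_cont, cderiv_qpar|]. apply L_cont.
    generalize (qpar_not_in_lattice tau z0 0 H). now rewrite Cmult_0_l, Cplus_0_r.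
  - apply etail_ccont. intros n _. now apply qpar_not_in_lattice.
Qed.

End EllipticSum.

Lemma etail_ccont_0 (L : C -> C) (s tau : C) : Cmod s = 1 ->
  (forall u : C, u <> 0 -> u <> 1 -> L (/ u)%C = (s * L u)%C) -> small_bound L ->
  (forall u : C, u <> 1 -> ccont L u) -> 0 < Im tau -> ccont (etail L tau) 0.
Proof.
  intros Hs Hi Hb Hc Ht. apply (etail_ccont L s); auto.
  intros n Hn E. apply qpar_eq_1 in E. destruct E as [k E].
  apply (f_equal Im) in E. rewrite Cplus_0_l, im_scal_l, im_RtoC in E.
  apply Rmult_integral in E. destruct E as [E|E]; [|lra]. apply eq_IZR in E. contradiction.
Qed.

Lemma Im_nz (z : C) : Im z <> 0 -> z <> 0.
Proof. intros H E. apply H. rewrite E. reflexivity. Qed.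

Lemma Im_S (tau : C) : 0 < Im tau -> 0 < Im (- / tau).
Proof.
  intros H. destruct tau as [x y]. simpl in *.
  apply Ropp_0_gt_lt_contravar. unfold Rdiv.
  rewrite Ropp_mult_distr_l_reverse. apply Ropp_lt_gt_0_contravar.
  apply Rmult_lt_0_compat; [exact H|]. apply Rinv_0_lt_compat. nra.
Qed.

Lemma lattice_S (tau z : C) : tau <> 0 -> in_lattice (- / tau) (z / tau) -> in_lattice tau z.
Proof.
  intros Ht [m [n E]]. exists (- n)%Z, m.
  replace z with (z / tau * tau)%C by (field; exact Ht). rewrite E, opp_IZR, RtoC_opp.
  field. exact Ht.
Qed.

Lemma lattice_basis (tau : C) (x y : R) (m n : Z) : 0 < Im tau ->
  (RtoC x + RtoC y * tau)%C = (IZR m + IZR n * tau)%C -> x = IZR m /\ y = IZR n.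
Proof.
  intros Ht E.
  assert (Ei := f_equal Im E). rewrite !im_plus, !im_scal_l, !im_RtoC in Ei.
  assert (Hy : y = IZR n) by nra.
  assert (Er := f_equal Re E). rewrite !re_plus, !re_scal_l, !re_RtoC in Er. subst y.
  split; [lra|reflexivity].
Qed.

Lemma nearest_integer (x : R) : exists m : Z, - / 2 <= x - IZR m <= / 2.
Proof.
  exists (Int_part (x + / 2)). destruct (base_Int_part (x + / 2)). lra.
Qed.

Lemma period_Z (f : C -> C) (p : C) : (forall z, f (z + p)%C = f z) ->
  forall (m : Z) z, f (z + IZR m * p)%C = f z.
Proof.
  intros H.
  assert (Hn : forall (n : nat) z, f (z + IZR (Z.of_nat n) * p)%C = f z).
  { induction n; intros z.
    - f_equal. simpl. ring.
    - rewrite Nat2Z.inj_succ, succ_IZR, RtoC_plus.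
      replace (z + (IZR (Z.of_nat n) + 1) * p)%C with ((z + IZR (Z.of_nat n) * p) + p)%C by ring.
      rewrite H. apply IHn. }
  intros m z. destruct (Z_le_dec 0 m) as [Hm|Hm].
  - rewrite <- (Z2Nat.id m Hm). apply Hn.
  - rewrite <- (Hn (Z.to_nat (- m)) (z + IZR m * p)%C). f_equal.
    rewrite Z2Nat.id, opp_IZR, RtoC_opp by lia. ring.
Qed.

(** * The defect of a lattice sum under S, and its vanishing by contraction *)

Section Contraction.

Variables (L : C -> C) (s : C) (c : R) (k : nat) (c0 : C) (reg : C -> C) (r0 B0 : R).
Hypotheses (Hs : Cmod s = 1)
  (L_inv : forall u : C, u <> 0 -> u <> 1 -> L (/ u)%C = (s * L u)%C)
  (L_small : small_bound L) (L_cont : forall u : C, u <> 1 -> ccont L u)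
  (L_dup : forall v : C, (v * v)%C <> 1 -> (L v + L (- v))%C = (RtoC c * L (v * v))%C)
  (Hc : 4 < c) (Hr0 : 0 < r0)
  (L_pole : forall z : C, z <> 0 -> Cmod z < r0 ->
     L (qpar z) = (c0 / z ^ k + reg z)%C /\ Cmod (reg z) <= B0).

Variable (tau : C).
Hypothesis (Htau : 0 < Im tau).

(** The argument is divided by [tau] because this carries the lattice of [tau] to that of
    [-1 / tau]; both sums then have their poles at the same points. *)
Definition S_defect (L : C -> C) (k : nat) (tau z : C) : C :=
  (esum L tau z - / tau ^ k * esum L (- / tau) (z / tau))%C.

Let F := S_defect L k tau.
Let Htau0 : tau <> 0 := Im_nz tau (Rgt_not_eq _ _ Htau).
Let Htau' := Im_S tau Htau.

Lemma S_defect_period_1 (z : C) : F (z + 1) = F z.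
Proof.
  unfold F, S_defect. rewrite (esum_period_1 L s) by assumption. do 2 f_equal.
  rewrite <- (esum_period_tau L s Hs L_inv L_small (- / tau) Htau').
  f_equal. field. exact Htau0.
Qed.

Lemma S_defect_period_tau (z : C) : F (z + tau) = F z.
Proof.
  unfold F, S_defect. rewrite (esum_period_tau L s) by assumption. do 2 f_equal.
  rewrite <- (esum_period_1 L s Hs L_inv L_small (- / tau) Htau' (z / tau)).
  f_equal. field. exact Htau0.
Qed.

(** Division by [tau] maps the half periods of [tau] to those of [-1 / tau], up to lattice
    translations, so both sums are duplicated over the same four points. *)
Lemma S_defect_dup (z : C) : ~ in_lattice tau z ->
  (F (z / 2) + F (z / 2 + / 2) + (F (z / 2 + tau / 2) + F (z / 2 + / 2 + tau / 2)))%C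
  = (RtoC c * F z)%C.
Proof.
  intros Hz. unfold F, S_defect.
  assert (A := esum_dup L s Hs L_inv L_small tau Htau c z L_dup Hz).
  assert (B := esum_dup L s Hs L_inv L_small (- / tau) Htau' c (z / tau) L_dup
                 (fun H => Hz (lattice_S tau z Htau0 H))).
  assert (E : forall w, esum L (- / tau) (w - - / tau) = esum L (- / tau) w).
  { intros w. rewrite <- (esum_period_tau L s Hs L_inv L_small (- / tau) Htau' (w - - / tau)).
    f_equal. ring. }
  replace (z / 2 / tau)%C with (z / tau / 2)%C by (field; exact Htau0).
  replace ((z / 2 + / 2) / tau)%C with (z / tau / 2 + (- / tau) / 2 - - / tau)%C by (field; exact Htau0).
  replace ((z / 2 + tau / 2) / tau)%C with (z / tau / 2 + / 2)%C by (field; exact Htau0).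
  replace ((z / 2 + / 2 + tau / 2) / tau)%C
    with (z / tau / 2 + / 2 + (- / tau) / 2 - - / tau)%C by (field; exact Htau0).
  rewrite !E.
  match goal with |- ?lhs = _ => set (l := lhs) end.
  transitivity (RtoC c * esum L tau z - / tau ^ k * (RtoC c * esum L (- / tau) (z / tau)))%C; [|ring].
  rewrite <- A, <- B. unfold l. ring.
Qed.

Lemma ccont_div_tau (z : C) : ccont (fun z => z / tau)%C z.
Proof. apply ccont_mult; [apply ccont_id|apply ccont_const]. Qed.

Lemma S_defect_ccont (z : C) : ~ in_lattice tau z -> ccont F z.
Proof.
  intros H. apply ccont_minus; [now apply (esum_ccont L s)|].
  apply ccont_mult; [apply ccont_const|].
  apply (ccont_comp (esum L (- / tau)) (fun z => z / tau)%C); [apply ccont_div_tau|].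
  apply (esum_ccont L s); auto. intros A. now apply H, lattice_S.
Qed.

(** The poles cancel, since [(c0 / (z / tau)^k) / tau^k = c0 / z^k]. *)
Lemma S_defect_near_0 : exists d, 0 < d /\ forall z : C, z <> 0 -> Cmod z < d ->
  F z = (etail L tau z - / tau ^ k * etail L (- / tau) (z / tau)
         + (reg z - / tau ^ k * reg (z / tau)))%C /\
  Cmod (reg z) <= B0 /\ Cmod (reg (z / tau)) <= B0.
Proof.
  assert (Ht : 0 < Cmod tau) by (apply Cmod_gt_0, Htau0).
  exists (Rmin r0 (r0 * Cmod tau)). split; [apply Rmin_glb_lt; [lra|nra]|].
  intros z Hz Hzd.
  assert (H1 := Rlt_le_trans _ _ _ Hzd (Rmin_l _ _)). assert (H2 := Rlt_le_trans _ _ _ Hzd (Rmin_r _ _)).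
  assert (Hzt : (z / tau)%C <> 0).
  { intros E. apply Hz. replace z with (z / tau * tau)%C by (field; exact Htau0). rewrite E. ring. }
  destruct (L_pole z Hz H1) as [A1 B1].
  destruct (L_pole (z / tau) Hzt) as [A2 B2].
  { rewrite Cmod_div by exact Htau0. apply Rmult_lt_reg_r with (Cmod tau); [exact Ht|].
    unfold Rdiv. rewrite Rmult_assoc, Rinv_l, Rmult_1_r by lra. exact H2. }
  split; [|split; assumption].
  unfold F, S_defect, esum. rewrite A1, A2. unfold Cdiv at 2.
  replace ((z / tau) ^ k)%C with (z ^ k / tau ^ k)%C.
  - field. repeat split; try (apply Cpow_nz; assumption); assumption.
  - unfold Cdiv. rewrite Cpow_mult_l, Cpow_inv; [reflexivity|exact Htau0].
Qed.

(** By periodicity it is enough to treat the points with coordinates in [-1/2, 1/2]. This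
    parallelogram is compact and contains a single lattice point, 0, where the poles cancel. *)
Lemma S_defect_bounded : exists M, forall z, ~ in_lattice tau z -> Cmod (F z) <= M.
Proof.
  destruct (rectangle_bounded (- / 2) (/ 2) (- / 2) (/ 2)
    (fun x y => ~ in_lattice tau (RtoC x + RtoC y * tau))
    (fun x y => Cmod (F (RtoC x + RtoC y * tau)))) as [M HM].
  { intros x y Hx Hy.
    assert (Hloc : exists d M, 0 < d /\ forall z, Cmod (z - (RtoC x + RtoC y * tau)) < d ->
              ~ in_lattice tau z -> Cmod (F z) <= M).
    { destruct (classic (in_lattice tau (RtoC x + RtoC y * tau))) as [[m [n E]]|Hn].
      - destruct (lattice_basis tau x y m n Htau E) as [Em En].
        assert (m = 0%Z) by (rewrite Em in Hx; apply eq_IZR, Rle_antisym; apply IZR_le;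
          assert (-1 < m < 1)%Z by (split; apply lt_IZR; simpl; lra); lia).
        assert (n = 0%Z) by (rewrite En in Hy; apply eq_IZR, Rle_antisym; apply IZR_le;
          assert (-1 < n < 1)%Z by (split; apply lt_IZR; simpl; lra); lia).
        subst. simpl. destruct S_defect_near_0 as [d [Hd H]].
        assert (C1 := etail_ccont_0 L s tau Hs L_inv L_small L_cont Htau).
        assert (C2 : ccont (fun z => etail L (- / tau) (z / tau)) 0).
        { apply (ccont_comp (etail L (- / tau)) (fun z => z / tau)%C); [apply ccont_div_tau|].
          replace (0 / tau)%C with (RtoC 0) by (unfold Cdiv; ring).
          exact (etail_ccont_0 L s (- / tau) Hs L_inv L_small L_cont Htau'). }
        destruct (ccont_bounded _ _ C1) as [d1 [Hd1 H1]]. destruct (ccont_bounded _ _ C2) as [d2 [Hd2 H2]].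
        eexists (Rmin d (Rmin d1 d2)), _. split; [repeat apply Rmin_glb_lt; lra|].
        intros z Hz Hnz. replace (z - (0 + 0 * tau))%C with (z - 0)%C in Hz by ring.
        assert (K1 := Rlt_le_trans _ _ _ Hz (Rmin_l _ _)).
        assert (K2 := Rlt_le_trans _ _ _ Hz (Rmin_r _ _)).
        assert (Hz0 : z <> 0) by (intros ->; apply Hnz; exists 0%Z, 0%Z; ring).
        replace (z - 0)%C with z in K1 by ring.
        destruct (H z Hz0 K1) as [E1 [E2 E3]]. rewrite E1.
        specialize (H1 z (Rlt_le_trans _ _ _ K2 (Rmin_l _ _))).
        specialize (H2 z (Rlt_le_trans _ _ _ K2 (Rmin_r _ _))).
        eapply Rle_trans; [apply Cmod_triangle|].
        apply Rplus_le_compat; (eapply Rle_trans; [apply Cmod_minus_le|]); apply Rplus_le_compat.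
        + exact H1.
        + rewrite Cmod_mult. apply Rmult_le_compat_l; [apply Cmod_ge_0|exact H2].
        + exact E2.
        + rewrite Cmod_mult. apply Rmult_le_compat_l; [apply Cmod_ge_0|exact E3].
      - destruct (ccont_bounded _ _ (S_defect_ccont _ Hn)) as [d [Hd H]].
        exists d. eexists. split; [exact Hd|]. intros z Hz _. apply H, Hz. }
    destruct Hloc as [d [M [Hd H]]].
    assert (Ht := Cmod_ge_0 tau).
    exists (d / (2 + Cmod tau)), M. split; [apply Rdiv_lt_0_compat; lra|].
    intros u v Hu Hv Hn. apply H; [|exact Hn].
    replace (RtoC u + RtoC v * tau - (RtoC x + RtoC y * tau))%C
      with (RtoC (u - x) + RtoC (v - y) * tau)%C by (rewrite !RtoC_minus; ring).
    eapply Rle_lt_trans; [apply Cmod_triangle|]. rewrite Cmod_mult, !Cmod_R.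
    apply Rlt_le_trans with (d / (2 + Cmod tau) * (2 + Cmod tau)); [|right; field; lra].
    assert (0 < d / (2 + Cmod tau)) by (apply Rdiv_lt_0_compat; lra).
    generalize (Rabs_pos (u - x)) (Rabs_pos (v - y)). intros. nra. }
  exists M. intros z Hz.
  set (y := Im z / Im tau). set (x := Re z - y * Re tau).
  assert (E : z = (RtoC x + RtoC y * tau)%C).
  { apply C_ext; rewrite ?re_plus, ?im_plus, ?re_scal_l, ?im_scal_l, ?re_RtoC, ?im_RtoC; unfold x, y.
    - ring.
    - field. lra. }
  destruct (nearest_integer x) as [m Hm]. destruct (nearest_integer y) as [n Hn].
  assert (E2 : z = (RtoC (x - IZR m) + RtoC (y - IZR n) * tau + IZR m * 1 + IZR n * tau)%C).
  { rewrite E, !RtoC_minus. ring. }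
  assert (EF : F z = F (RtoC (x - IZR m) + RtoC (y - IZR n) * tau)).
  { rewrite E2. rewrite (period_Z F tau S_defect_period_tau n).
    apply (period_Z F 1 S_defect_period_1 m). }
  rewrite EF. apply HM; auto.
  intros [m' [n' E']]. apply Hz. exists (m' + m)%Z, (n' + n)%Z. rewrite E2, E', !plus_IZR, !RtoC_plus. ring.
Qed.

(** Duplication bounds [c |F z|] by a sum of four values of [|F|]; a bound [M] thus improves to
    [M (4 / c)^n] for every [n]. *)
Lemma S_defect_zero (z : C) : ~ in_lattice tau z -> F z = 0.
Proof.
  destruct S_defect_bounded as [M HM].
  assert (H : forall n z, ~ in_lattice tau z -> Cmod (F z) <= M * (4 / c) ^ n).
  { induction n; intros w Hw; [simpl; rewrite Rmult_1_r; now apply HM|].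
    assert (E := S_defect_dup w Hw). apply (f_equal Cmod) in E.
    rewrite Cmod_mult, Cmod_R, Rabs_pos_eq in E by lra.
    assert (Hh : forall m n : Z, ~ in_lattice tau (w / 2 + IZR m / 2 + IZR n * tau / 2)).
    { intros m p [m' [n' E']]. apply Hw. exists (2 * m' - m)%Z, (2 * n' - p)%Z.
      replace w with (2 * (w / 2 + IZR m / 2 + IZR p * tau / 2) - IZR m - IZR p * tau)%C by field.
      rewrite E', !minus_IZR, !mult_IZR, !RtoC_minus, !RtoC_mult. ring. }
    assert (A0 := IHn _ (Hh 0%Z 0%Z)). assert (A1 := IHn _ (Hh 1%Z 0%Z)).
    assert (A2 := IHn _ (Hh 0%Z 1%Z)). assert (A3 := IHn _ (Hh 1%Z 1%Z)).
    replace (w / 2 + 0 / 2 + 0 * tau / 2)%C with (w / 2)%C in A0 by field.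
    replace (w / 2 + 1 / 2 + 0 * tau / 2)%C with (w / 2 + / 2)%C in A1 by field.
    replace (w / 2 + 0 / 2 + 1 * tau / 2)%C with (w / 2 + tau / 2)%C in A2 by field.
    replace (w / 2 + 1 / 2 + 1 * tau / 2)%C with (w / 2 + / 2 + tau / 2)%C in A3 by field.
    assert (T1 := Cmod_triangle (F (w / 2) + F (w / 2 + / 2)) (F (w / 2 + tau / 2) + F (w / 2 + / 2 + tau / 2))).
    assert (T2 := Cmod_triangle (F (w / 2)) (F (w / 2 + / 2))).
    assert (T3 := Cmod_triangle (F (w / 2 + tau / 2)) (F (w / 2 + / 2 + tau / 2))).
    apply Rmult_le_reg_l with c; [lra|].
    replace (c * (M * (4 / c) ^ S n)) with (4 * (M * (4 / c) ^ n)) by (simpl; field; lra).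
    rewrite <- E. lra. }
  intros Hz. apply Cmod_eq_0, Rle_antisym; [|apply Cmod_ge_0].
  assert (Hq : 0 <= 4 / c < 1).
  { split; [apply Rdiv_le_0_compat; lra|].
    apply Rmult_lt_reg_r with c; [lra|]. unfold Rdiv. rewrite Rmult_assoc, Rinv_l; lra. }
  assert (HL : is_lim_seq (fun n => M * (4 / c) ^ n) 0).
  { replace (Finite 0) with (Rbar_mult M 0) by (simpl; f_equal; ring).
    apply is_lim_seq_scal_l, is_lim_seq_geom. rewrite Rabs_pos_eq; lra. }
  apply (is_lim_seq_le (fun _ => Cmod (F z)) (fun n => M * (4 / c) ^ n) (Cmod (F z)) 0);
    [intros n; now apply H|apply is_lim_seq_const|exact HL].
Qed.

End Contraction.

(** * Limit at the origin and the transformation in weight four *)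

Lemma half_arg_div (z : C) (m : C) (k : nat) : z <> 0 ->
  (m / half_arg z ^ k)%C = (m / (PI * Ci) ^ k / z ^ k)%C.
Proof.
  intros Hz. assert (Hp : RtoC PI <> 0) by (intros E; apply RtoC_inj in E; generalize PI_RGT_0; lra).
  unfold half_arg. rewrite Cpow_mult_l. field.
  split; apply Cpow_nz; [|exact Hz]. apply Cmult_neq_0; [exact Hp|apply Ci_nz].
Qed.

(** The values -1/12 and 1/120 are the constants that complete the divisor sums [2 sum sigma_1 q^n]
    and [2 sum sigma_3 q^n] to [- E2 / 12] and [E4 / 120]. *)
Lemma ccont_regular :
  ccont (fun z => L2_regular (half_arg z)) 0 /\ ccont (fun z => L4_regular (half_arg z)) 0 /\
  L2_regular (half_arg 0) = (- (1) / 12)%C /\ L4_regular (half_arg 0) = (1 / 120)%C.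
Proof.
  assert (H0 : half_arg 0 = 0) by (unfold half_arg; ring).
  assert (Ht := ccont_sinh_tail). assert (Hsg := ccont_sinh_sigma).
  assert (Hw := fun n => ccont_pow (fun w => w) n 0 (ccont_id 0)). cbv beta in Hw.
  split; [|split; [|split]].
  - apply (ccont_comp L2_regular half_arg); [apply ccont_half_arg|]. rewrite H0.
    apply ccont_mult; [|apply ccont_sinh_denominator].
    apply ccont_mult; [|apply ccont_const]. apply ccont_opp, ccont_plus.
    + apply ccont_mult; [apply ccont_const|exact Hsg].
    + apply ccont_mult; [apply Hw|now apply ccont_pow].
  - apply (ccont_comp L4_regular half_arg); [apply ccont_half_arg|]. rewrite H0.
    apply ccont_mult; [|apply ccont_sinh_denominator].
    apply ccont_mult; [|apply ccont_const].
    assert (Hp := fun n => ccont_pow sinh_sigma n 0 Hsg). cbv beta in Hp.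
    repeat first [exact Ht | exact Hsg | apply Hp | apply Hw | apply ccont_const
      | apply ccont_minus | apply ccont_plus | apply ccont_mult].
  - rewrite H0. unfold L2_regular. rewrite (proj2 (ccont_sinh_denominator 1)).
    unfold sinh_sigma. rewrite sinh_tail_0. field.
  - rewrite H0. unfold L4_regular. rewrite (proj2 (ccont_sinh_denominator 1)).
    unfold sinh_sigma. rewrite sinh_tail_0. field.
Qed.

Lemma sinh_sigma_bounded : exists r B, 0 < r <= 1 /\ 0 <= B /\ forall w, Cmod w < r ->
  Cmod (sinh_sigma w) <= B /\ Cmod (/ (1 + w ^ 2 * sinh_sigma w) ^ 3) <= B.
Proof.
  destruct (ccont_bounded _ _ ccont_sinh_sigma) as [r1 [Hr1 H1]].
  destruct (ccont_bounded _ _ (proj1 (ccont_sinh_denominator 3))) as [r2 [Hr2 H2]].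
  set (B1 := Cmod (sinh_sigma 0) + 1) in *.
  set (B2 := Cmod (/ (1 + 0 ^ 2 * sinh_sigma 0) ^ 3) + 1) in *.
  assert (0 <= B1) by (unfold B1; generalize (Cmod_ge_0 (sinh_sigma 0)); lra).
  assert (0 <= B2) by (unfold B2; generalize (Cmod_ge_0 (/ (1 + 0 ^ 2 * sinh_sigma 0) ^ 3)); lra).
  exists (Rmin 1 (Rmin r1 r2)), (B1 + B2).
  split; [split; [repeat apply Rmin_glb_lt; lra|apply Rmin_l]|]. split; [lra|]. intros w Hw.
  assert (Hw' := Rlt_le_trans _ _ _ Hw (Rmin_r _ _)).
  assert (Ha := Rlt_le_trans _ _ _ Hw' (Rmin_l _ _)). assert (Hb := Rlt_le_trans _ _ _ Hw' (Rmin_r _ _)).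
  replace w with (w - 0)%C in Ha, Hb by ring. specialize (H1 w Ha). specialize (H2 w Hb).
  cbv beta in H2. lra.
Qed.

Lemma L3_regular_bounded : exists r B, 0 < r /\ forall z, Cmod z < r ->
  Cmod (L3_regular (half_arg z)) <= B.
Proof.
  destruct sinh_sigma_bounded as [r [B [Hr [HB H]]]].
  destruct (ccont_half_arg 0 r (proj1 Hr)) as [d [Hd Hw]].
  exists d, ((1 + 9 + 3 * B ^ 2 + B ^ 3 + 3) * B). split; [exact Hd|]. intros z Hz.
  assert (Hh : Cmod (half_arg z) < r).
  { replace (half_arg z) with (half_arg z - half_arg 0)%C by (unfold half_arg; ring).
    apply Hw. replace (z - 0)%C with z by ring. exact Hz. }
  set (w := half_arg z) in *. destruct (H w Hh) as [A1 A2].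
  assert (Hw1 : Cmod w <= 1) by lra. assert (Hw0 := Cmod_ge_0 w).
  assert (A3 := cosh_tail_bound w Hw1). assert (A4 := sinh_tail_bound w Hw1).
  assert (E2 : Cmod w ^ 2 <= 1) by (rewrite <- (pow1 2); apply pow_incr; lra).
  unfold L3_regular. rewrite Cmod_mult. apply Rmult_le_compat; [apply Cmod_ge_0|apply Cmod_ge_0| |exact A2].
  unfold Cdiv. rewrite !Cmod_mult, Cmod_inv by (intros E; apply RtoC_inj in E; lra).
  rewrite Cmod_R, Rabs_pos_eq by lra.
  match goal with |- _ * Cmod ?e * _ <= ?R => assert (HX : Cmod e <= R) end.
  { eapply Rle_trans; [apply Cmod_minus_le|]. apply Rplus_le_compat; [|exact A3].
    eapply Rle_trans; [apply Cmod_triangle|]. apply Rplus_le_compat.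
    - eapply Rle_trans; [apply Cmod_triangle|]. apply Rplus_le_compat.
      + eapply Rle_trans; [apply Cmod_triangle|]. apply Rplus_le_compat.
        * rewrite <- RtoC_inv, <- RtoC_mult, Cmod_R, Rabs_pos_eq by lra. lra.
        * rewrite Cmod_mult, Cmod_R, Rabs_pos_eq by lra. lra.
      + rewrite Cmod_mult, Cmod_R, Rabs_pos_eq, Cmod_pow by lra.
        apply Rmult_le_compat_l; [lra|]. apply pow_incr. split; [apply Cmod_ge_0|exact A1].
    - rewrite Cmod_mult, !Cmod_pow. rewrite <- (Rmult_1_l (B ^ 3)).
      apply Rmult_le_compat; [apply pow_le, Cmod_ge_0|apply pow_le, Cmod_ge_0|exact E2|].
      apply pow_incr. split; [apply Cmod_ge_0|exact A1]. }
  match goal with |- _ * ?X * _ <= ?R => assert (0 <= X) by apply Cmod_ge_0; assert (0 <= R) by lra;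
    assert (Cmod w * X <= 1 * R) by (apply Rmult_le_compat; lra) end.
  lra.
Qed.

(** A defect known to equal [K] on the points [t tau], which avoid the lattice, is followed to
    [z = 0]: the poles cancel and the tails and regular parts remain. *)
Lemma S_defect_limit (L : C -> C) (s : C) (k : nat) (c0 : C) (reg : C -> C) (r0 : R) (tau K : C) :
  Cmod s = 1 -> (forall u : C, u <> 0 -> u <> 1 -> L (/ u)%C = (s * L u)%C) ->
  small_bound L -> (forall u : C, u <> 1 -> ccont L u) -> 0 < r0 ->
  (forall z : C, z <> 0 -> Cmod z < r0 -> L (qpar z) = (c0 / z ^ k + reg z)%C) ->
  ccont reg 0 -> 0 < Im tau ->
  (forall t, 0 < t <= / 2 -> S_defect L k tau (RtoC t * tau) = K) ->
  (etail L tau 0 + reg 0 - / tau ^ k * (etail L (- / tau) 0 + reg 0))%C = K.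
Proof.
  intros Hs Hi Hb Hc Hr0 Hp Hreg Ht HK.
  destruct (ccont_bounded _ _ Hreg) as [r1 [Hr1 Hrb]].
  assert (Hp' : forall z : C, z <> 0 -> Cmod z < Rmin r0 r1 ->
     L (qpar z) = (c0 / z ^ k + reg z)%C /\ Cmod (reg z) <= Cmod (reg 0) + 1).
  { intros z Hz Hzr. split; [apply Hp; [exact Hz|exact (Rlt_le_trans _ _ _ Hzr (Rmin_l _ _))]|].
    apply Hrb. replace (z - 0)%C with z by ring. exact (Rlt_le_trans _ _ _ Hzr (Rmin_r _ _)). }
  destruct (S_defect_near_0 L k c0 reg (Rmin r0 r1) _ ltac:(apply Rmin_glb_lt; lra) Hp' tau Ht)
    as [d [Hd H]].
  set (G := fun z => (etail L tau z - / tau ^ k * etail L (- / tau) (z / tau)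
         + (reg z - / tau ^ k * reg (z / tau)))%C) in *.
  assert (Ht' := Im_S tau Ht).
  assert (Hdiv : forall f, ccont f 0 -> ccont (fun z => f (z / tau)%C) 0).
  { intros f Hf. apply (ccont_comp f (fun z => z / tau)%C); [apply ccont_div_tau|].
    replace (0 / tau)%C with (RtoC 0) by (unfold Cdiv; ring). exact Hf. }
  assert (HG : ccont G 0).
  { apply ccont_plus; apply ccont_minus.
    - now apply (etail_ccont_0 L s).
    - apply ccont_mult; [apply ccont_const|]. apply Hdiv. now apply (etail_ccont_0 L s).
    - exact Hreg.
    - apply ccont_mult; [apply ccont_const|]. now apply Hdiv. }
  transitivity (G 0).
  { unfold G. replace (0 / tau)%C with (RtoC 0) by (unfold Cdiv; ring). ring. }
  apply Ceq_minus, Cmod_eq_0, Rle_antisym; [|apply Cmod_ge_0].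
  apply le_epsilon. intros eps He. rewrite Rplus_0_l.
  destruct (HG eps He) as [e [He0 HGe]].
  assert (Hm : 0 < Cmod tau) by (apply Cmod_gt_0, Im_nz; lra).
  set (t := Rmin (/ 2) (Rmin d e / (2 * Cmod tau))).
  assert (Hde : 0 < Rmin d e) by (apply Rmin_glb_lt; lra).
  assert (Htp : 0 < t <= / 2).
  { split; [|apply Rmin_l]. apply Rmin_glb_lt; [lra|]. apply Rdiv_lt_0_compat; lra. }
  assert (Hz : Cmod (RtoC t * tau) < Rmin d e).
  { rewrite Cmod_mult, Cmod_R, Rabs_pos_eq by lra.
    apply Rle_lt_trans with (Rmin d e / (2 * Cmod tau) * Cmod tau).
    - apply Rmult_le_compat_r; [lra|apply Rmin_r].
    - replace (Rmin d e / (2 * Cmod tau) * Cmod tau) with (Rmin d e / 2) by (field; lra). lra. }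
  assert (Hz0 : (RtoC t * tau)%C <> 0).
  { apply Cmod_gt_0. rewrite Cmod_mult, Cmod_R, Rabs_pos_eq by lra. nra. }
  destruct (H _ Hz0 (Rlt_le_trans _ _ _ Hz (Rmin_l _ _))) as [E _].
  rewrite HK in E by exact Htp. fold (G (RtoC t * tau)%C) in E.
  left. rewrite Cmod_sub_sym. rewrite E. apply HGe.
  replace (RtoC t * tau - 0)%C with (RtoC t * tau)%C by ring.
  exact (Rlt_le_trans _ _ _ Hz (Rmin_r _ _)).
Qed.

Lemma not_in_lattice_coord (tau : C) (x y : R) : 0 < Im tau -> 0 < y < 1 ->
  ~ in_lattice tau (RtoC x + RtoC y * tau).
Proof.
  intros Ht Hy [m [n E]]. destruct (lattice_basis tau x y m n Ht E) as [_ En].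
  subst y. assert (0 < n < 1)%Z by (split; apply lt_IZR; simpl; lra). lia.
Qed.

Lemma etail_L4_S (tau : C) : 0 < Im tau ->
  (etail L4 tau 0 + 1 / 120)%C = (/ tau ^ 4 * (etail L4 (- / tau) 0 + 1 / 120))%C.
Proof.
  intros Ht. destruct L_regular as [r [Hr H]].
  destruct ccont_regular as [_ [Hreg [_ Hv]]].
  assert (Hi : forall u : C, u <> 0 -> u <> 1 -> L4 (/ u)%C = (1 * L4 u)%C)
    by (intros; rewrite L4_inv by assumption; ring).
  assert (Hp : forall z : C, z <> 0 -> Cmod z < r ->
     L4 (qpar z) = (6 / 16 / (PI * Ci) ^ 4 / z ^ 4 + L4_regular (half_arg z))%C).
  { intros z Hz Hzr. destruct (H z Hz Hzr) as [_ [_ E]]. rewrite E. f_equal.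
    rewrite <- half_arg_div by exact Hz. field. now apply half_arg_nz. }
  rewrite <- Hv. apply Ceq_minus.
  apply (S_defect_limit L4 1 4 (6 / 16 / (PI * Ci) ^ 4) (fun z => L4_regular (half_arg z)) r); auto using Cmod_1, L4_small, L4_ccont;
    [lra|].
  intros t Htt. destruct (ccont_bounded _ _ Hreg) as [r1 [Hr1 Hrb]].
  apply (S_defect_zero L4 1 16 4 (6 / 16 / (PI * Ci) ^ 4) (fun z => L4_regular (half_arg z)) (Rmin r r1)
    (Cmod (L4_regular (half_arg 0)) + 1)); auto using Cmod_1, L4_small, L4_ccont, L4_dup; try lra.
  - apply Rmin_glb_lt; lra.
  - intros z Hz Hzr. split; [apply Hp; [exact Hz|exact (Rlt_le_trans _ _ _ Hzr (Rmin_l _ _))]|].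
    apply (Hrb z). replace (z - 0)%C with z by ring. exact (Rlt_le_trans _ _ _ Hzr (Rmin_r _ _)).
  - replace (RtoC t * tau)%C with (RtoC 0 + RtoC t * tau)%C by ring.
    apply not_in_lattice_coord; [exact Ht|lra].
Qed.

(** * Weight two, by integration from weight three *)

Lemma S_defect_L3 (tau z : C) : 0 < Im tau -> ~ in_lattice tau z -> S_defect L3 3 tau z = 0.
Proof.
  intros Ht Hz. destruct L_regular as [r [Hr H]].
  destruct L3_regular_bounded as [r1 [B [Hr1 HB]]].
  apply (S_defect_zero L3 (- (1)) 8 3 (- (/ 4) / (PI * Ci) ^ 3) (fun z => L3_regular (half_arg z)) (Rmin r r1) B);
    auto using L3_small, L3_ccont, L3_dup, Cmod_m1; try lra.
  - intros u H0 H1. rewrite L3_inv by assumption. ring.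
  - apply Rmin_glb_lt; lra.
  - intros v Hv Hvr. split; [|apply HB; exact (Rlt_le_trans _ _ _ Hvr (Rmin_r _ _))].
    destruct (H v Hv (Rlt_le_trans _ _ _ Hvr (Rmin_l _ _))) as [_ [E _]]. rewrite E. f_equal.
    rewrite <- half_arg_div by exact Hv. field. now apply half_arg_nz.
Qed.

(** Finite sums can be differentiated in [z] term by term, and they are available for [L1], which
    does not satisfy [small_bound]. *)
Definition partial_defect (L : C -> C) (k : nat) (tau : C) (N : nat) (z : C) : C :=
  (bil (eterm L tau z) N - / tau ^ k * bil (eterm L (- / tau) (z / tau)) N)%C.

Lemma partial_defect_uniform (L : C -> C) (s : C) (k : nat) (tau : C) (Y : R) :
  Cmod s = 1 -> (forall u : C, u <> 0 -> u <> 1 -> L (/ u)%C = (s * L u)%C) ->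
  small_bound L -> 0 < Im tau ->
  exists b : nat -> R, is_lim_seq b 0 /\ exists N0, forall N z, (N0 <= N)%nat -> Cmod z <= Y ->
    Cmod (partial_defect L k tau N z - S_defect L k tau z) <= b N.
Proof.
  intros Hs Hi Hb Ht. assert (Ht' := Im_S tau Ht). assert (Ht0 : tau <> 0) by (apply Im_nz; lra).
  destruct (etail_csums L s Hs Hi Hb tau Ht Y) as [N1 [K1 [HK1 H1]]].
  destruct (etail_csums L s Hs Hi Hb (- / tau) Ht' (Y / Cmod tau)) as [N2 [K2 [HK2 H2]]].
  exists (fun N => K1 * Cmod (qpar tau) ^ N + (Cmod (/ tau ^ k) * K2) * Cmod (qpar (- / tau)) ^ N).
  split.
  - replace (Finite 0) with (Finite (K1 * 0 + Cmod (/ tau ^ k) * K2 * 0)) by (f_equal; ring).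
    apply is_lim_seq_plus'; apply (is_lim_seq_scal_l (fun N => _ ^ N) _ 0); apply is_lim_seq_geom;
      rewrite Rabs_pos_eq by apply Cmod_ge_0; now apply Cmod_qpar_lt_1.
  - exists (N1 + N2)%nat. intros N z HN HY.
    assert (Hz : Rabs (Im z) <= Y) by (eapply Rle_trans; [apply im_le_Cmod|exact HY]).
    assert (Hz' : Rabs (Im (z / tau)) <= Y / Cmod tau).
    { eapply Rle_trans; [apply im_le_Cmod|]. rewrite Cmod_div by exact Ht0.
      apply Rmult_le_compat_r; [|exact HY]. left. apply Rinv_0_lt_compat, Cmod_gt_0, Ht0. }
    destruct (H1 z Hz) as [_ A]. destruct (H2 (z / tau)%C Hz') as [_ B].
    specialize (A N ltac:(lia)). specialize (B N ltac:(lia)).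
    unfold partial_defect, S_defect. rewrite Cmod_sub_sym.
    match goal with |- Cmod (?a - ?t * ?b - (?c - ?t * ?d)) <= _ =>
      replace (a - t * b - (c - t * d))%C with ((a - c) - t * (b - d))%C by ring end.
    eapply Rle_trans; [apply Cmod_minus_le|]. rewrite Cmod_mult, Rmult_assoc.
    apply Rplus_le_compat; [exact A|]. apply Rmult_le_compat_l; [apply Cmod_ge_0|exact B].
Qed.

Lemma bil_cderiv (T : C -> Z -> C) (T' : Z -> C) (z : C) (N : nat) :
  (forall n, cderiv (fun z => T z n) z (T' n)) -> cderiv (fun z => bil (T z) N) z (bil T' N).
Proof.
  intros H. induction N.
  - apply cderiv_ext with (fun z => T z 0%Z); [intros; unfold bil; simpl; ring|].
    eapply cderiv_eq; [apply H|]. unfold bil; simpl; ring.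
  - apply cderiv_ext with (fun z => bil (T z) N + (T z (Z.of_nat (S N)) + T z (- Z.of_nat (S N))%Z))%C.
    + intros w. now rewrite bil_S.
    + rewrite bil_S. apply cderiv_plus; [exact IHN|]. now apply cderiv_plus.
Qed.

(** The exponent rises from [k] to [k + 1] because the inner function [z / tau] contributes a factor
    [1 / tau]. *)
Lemma partial_defect_cderiv (L L' : C -> C) (k : nat) (tau z : C) (N : nat) :
  (forall z c : C, qpar (z + c) <> 1 ->
     cderiv (fun z => L (qpar (z + c))) z (2 * PI * Ci * L' (qpar (z + c)))%C) ->
  0 < Im tau -> ~ in_lattice tau z ->
  cderiv (partial_defect L k tau N) z (2 * PI * Ci * partial_defect L' (S k) tau N z)%C.
Proof.
  intros HL Ht Hz. assert (Ht0 : tau <> 0) by (apply Im_nz; lra).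
  eapply cderiv_eq.
  - apply cderiv_minus.
    + apply (bil_cderiv (fun z => eterm L tau z) (fun n => 2 * PI * Ci * eterm L' tau z n)%C).
      intros n. apply HL. now apply qpar_not_in_lattice.
    + apply cderiv_scal.
      apply (bil_cderiv (fun z => eterm L (- / tau) (z / tau))
        (fun n => (2 * PI * Ci * / tau) * eterm L' (- / tau) (z / tau) n)%C).
      intros n.
      apply (cderiv_eq _ _ (2 * PI * Ci * eterm L' (- / tau) (z / tau) n * / tau)%C); [|ring].
      apply (cderiv_comp (fun z => L (qpar (z + IZR n * (- / tau)))) (fun z => z / tau)%C).
      * eapply cderiv_eq; [apply cderiv_mult; [apply cderiv_id|apply cderiv_const]|]. cbv beta. ring.
      * apply HL. apply qpar_not_in_lattice. intros A. now apply Hz, lattice_S.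
  - rewrite !bil_scal. unfold partial_defect. simpl (tau ^ S k)%C. field.
    split; [now apply Cpow_nz|exact Ht0].
Qed.

Lemma is_lim_seq_squeeze_0 (x M : R) (b : nat -> R) (N0 : nat) : is_lim_seq b 0 ->
  (forall N, (N0 <= N)%nat -> x <= M * b N) -> x <= 0.
Proof.
  intros Hb H.
  assert (A : is_lim_seq (fun N => M * b N) 0).
  { replace (Finite 0) with (Rbar_mult M 0) by (simpl; f_equal; ring). now apply is_lim_seq_scal_l. }
  apply le_epsilon. intros eps He. apply is_lim_seq_Reals in A. destruct (A eps He) as [N1 H1].
  specialize (H1 (N0 + N1)%nat ltac:(lia)). specialize (H (N0 + N1)%nat ltac:(lia)).
  unfold R_dist in H1. rewrite Rminus_0_r in H1. generalize (Rle_abs (M * b (N0 + N1)%nat)). lra.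
Qed.

Lemma L2_inv1 (u : C) : u <> 0 -> u <> 1 -> L2 (/ u) = (1 * L2 u)%C.
Proof. intros. rewrite L2_inv by assumption. ring. Qed.

Lemma Cmod_2PICi : Cmod (2 * PI * Ci) = 2 * PI.
Proof.
  rewrite !Cmod_mult, Cmod_Ci, !Cmod_R, !Rabs_pos_eq; generalize PI_RGT_0; lra.
Qed.

Lemma segment_bound (a b : C) (t : R) : 0 <= t <= 1 ->
  Cmod (a + RtoC t * (b - a)) <= Cmod a + Cmod b.
Proof.
  intros Ht. replace (a + RtoC t * (b - a))%C with (RtoC (1 - t) * a + RtoC t * b)%C
    by (rewrite RtoC_minus; ring).
  eapply Rle_trans; [apply Cmod_triangle|]. rewrite !Cmod_mult, !Cmod_R, !Rabs_pos_eq by lra.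
  generalize (Cmod_ge_0 a) (Cmod_ge_0 b). nra.
Qed.

(** Duplication for [L2] has factor 4 and does not contract. Instead, the partial [L2] defect has
    derivative [2 i pi] times the partial [L3] defect, which tends to 0 uniformly on the segment. *)
Lemma S_defect_L2_const (tau a b : C) : 0 < Im tau ->
  (forall t, 0 <= t <= 1 -> ~ in_lattice tau (a + RtoC t * (b - a))) ->
  S_defect L2 2 tau b = S_defect L2 2 tau a.
Proof.
  intros Ht Hl. set (Y := Cmod a + Cmod b).
  assert (Hab : Cmod a <= Y /\ Cmod b <= Y).
  { unfold Y. generalize (Cmod_ge_0 a) (Cmod_ge_0 b). lra. }
  assert (Hi3 : forall u : C, u <> 0 -> u <> 1 -> L3 (/ u) = (- (1) * L3 u)%C)
    by (intros; rewrite L3_inv by assumption; ring).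
  destruct (partial_defect_uniform L2 1 2 tau Y Cmod_1 L2_inv1 L2_small Ht) as [b2 [Hb2 [N2 H2]]].
  destruct (partial_defect_uniform L3 (- (1)) 3 tau Y Cmod_m1 Hi3 L3_small Ht) as [b3 [Hb3 [N3 H3]]].
  apply Ceq_minus, Cmod_eq_0, Rle_antisym; [|apply Cmod_ge_0].
  apply (is_lim_seq_squeeze_0 _ 1 (fun N => 2 * b2 N + (2 * PI * Cmod (b - a)) * b3 N) (N2 + N3)).
  { replace (Finite 0) with (Finite (2 * 0 + 2 * PI * Cmod (b - a) * 0)) by (f_equal; ring).
    apply is_lim_seq_plus'; [apply (is_lim_seq_scal_l b2 2 0)|apply (is_lim_seq_scal_l b3 _ 0)]; assumption. }
  intros N HN. rewrite Rmult_1_l.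
  assert (A : Cmod (partial_defect L2 2 tau N b - partial_defect L2 2 tau N a)
              <= (2 * PI * b3 N) * Cmod (b - a)).
  { apply mean_value_segment with (fun z => 2 * PI * Ci * partial_defect L3 3 tau N z)%C.
    - intros t Htt. apply partial_defect_cderiv; auto using cderiv_L2_qpar.
    - intros t Htt. rewrite Cmod_mult, Cmod_2PICi.
      apply Rmult_le_compat_l; [generalize PI_RGT_0; lra|].
      specialize (H3 N _ ltac:(lia) (segment_bound a b t Htt)).
      rewrite S_defect_L3 in H3 by auto.
      unfold Cminus in H3. rewrite Copp_0, Cplus_0_r in H3. exact H3. }
  assert (Ba := H2 N a ltac:(lia) (proj1 Hab)). assert (Bb := H2 N b ltac:(lia) (proj2 Hab)).
  rewrite Cmod_sub_sym in Bb.
  set (Fa := S_defect L2 2 tau a) in *. set (Fb := S_defect L2 2 tau b) in *.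
  set (Pa := partial_defect L2 2 tau N a) in *. set (Pb := partial_defect L2 2 tau N b) in *.
  replace (Fb - Fa)%C with ((Fb - Pb) + ((Pb - Pa) + (Pa - Fa)))%C by ring.
  eapply Rle_trans; [apply Cmod_triangle|].
  eapply Rle_trans; [apply Rplus_le_compat_l, Cmod_triangle|]. lra.
Qed.

Lemma L1_cconv (u : nat -> C) : cconv u 0 -> cconv (fun n => L1 (u n)) (/ 2)%C.
Proof.
  intros H. replace (/ 2)%C with (L1 0) by (unfold L1; field).
  apply cconv_ccont; [|exact H].
  apply ccont_mult; [|apply ccont_const].
  apply ccont_mult; [apply ccont_plus; [apply ccont_const|apply ccont_id]|].
  apply ccont_inv; [apply ccont_minus; [apply ccont_const|apply ccont_id]|].
  replace (1 - 0)%C with (RtoC 1) by ring. apply C1_nz.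
Qed.

Lemma qpar_shift_cconv (tau z : C) : 0 < Im tau ->
  cconv (fun n => qpar (z + IZR (Z.of_nat n) * tau)) 0.
Proof.
  intros Ht. apply cconv_pow_0 with (exp (2 * PI * Rabs (Im z))) (Cmod (qpar tau)).
  - generalize (Cmod_qpar_lt_1 tau Ht). lra.
  - exists O. intros n _. apply (Cmod_qpar_shift tau z n). lra.
Qed.

(* Legendre's relation, for the sum over [L1]. *)
Lemma partial_defect_L1_period (tau a : C) : 0 < Im tau -> ~ in_lattice tau a ->
  cconv (fun N => partial_defect L1 1 tau N (a + 1) - partial_defect L1 1 tau N a)%C (/ tau)%C.
Proof.
  intros Ht Ha. assert (Ht' := Im_S tau Ht). assert (Ht0 : tau <> 0) by (apply Im_nz; lra).
  assert (Ha' : ~ in_lattice (- / tau) (a / tau)) by (intros A; now apply Ha, lattice_S).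
  set (T := eterm L1 (- / tau) (a / tau)).
  apply cconv_ext with (fun N => - / tau * (- (1) * L1 (qpar (- (a / tau) + IZR (Z.of_nat (S N)) * (- / tau)))
                                  - L1 (qpar (a / tau + IZR (Z.of_nat N) * (- / tau)))))%C.
  - intros N. unfold partial_defect.
    rewrite (bil_ext (eterm L1 tau (a + 1)) (eterm L1 tau a)) by (intros; apply eterm_period_1).
    rewrite (bil_ext (eterm L1 (- / tau) ((a + 1) / tau)) (fun n => T (n - 1)%Z)).
    2:{ intros n. unfold T, eterm. do 2 f_equal. rewrite minus_IZR, RtoC_minus. field. exact Ht0. }
    assert (E := bil_shift (fun n => T (n - 1)%Z) N).
    cbv beta in E. rewrite (bil_ext _ T) in E by (intros n; f_equal; lia).
    replace (Z.of_nat N + 1 - 1)%Z with (Z.of_nat N) in E by lia.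
    assert (E' : T (- Z.of_nat N - 1)%Z =
      (- L1 (qpar (- (a / tau) + IZR (Z.of_nat (S N)) * - / tau)))%C).
    { unfold T, eterm. rewrite <- L1_inv; [|apply qpar_nz|].
      - rewrite <- qpar_opp. do 2 f_equal.
        replace (- Z.of_nat N - 1)%Z with (- Z.of_nat (S N))%Z by lia.
        rewrite opp_IZR, RtoC_opp. ring.
      - intros A. apply (qpar_not_in_lattice (- / tau) (a / tau) (- Z.of_nat (S N)) Ha').
        rewrite opp_IZR, RtoC_opp.
        replace (a / tau + - IZR (Z.of_nat (S N)) * - / tau)%C
          with (- (- (a / tau) + IZR (Z.of_nat (S N)) * - / tau))%C by ring.
        rewrite qpar_opp, A. field. }
    rewrite E' in E. rewrite Cpow_1_r. fold T.
    change (eterm L1 (- / tau) (a / tau) (Z.of_nat N)) with (T (Z.of_nat N)) in *.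
    change (L1 (qpar (a / tau + IZR (Z.of_nat N) * - / tau))) with (T (Z.of_nat N)).
    rewrite E. ring.
  - assert (E : (- / tau * (- (1) * / 2 + - (1) * / 2))%C = (/ tau)%C) by (field; exact Ht0).
    refine (eq_ind _ (cconv _) _ _ E).
    apply cconv_scal. apply cconv_plus.
    + apply cconv_scal, L1_cconv.
      apply (cconv_subseq (fun n => qpar (- (a / tau) + IZR (Z.of_nat n) * - / tau)) 0 S); [lia|].
      now apply qpar_shift_cconv.
    + eapply cconv_ext; [|apply (cconv_scal (- (1))), L1_cconv, (qpar_shift_cconv (- / tau) (a / tau) Ht')].
      intros n. simpl. ring.
Qed.

(** If the defect is the constant [K], integrating it over a unit segment gives [2 i pi K], which is
    the increment of the [L1] defect over a period; Legendre's relation gives that increment as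
    [1 / tau]. *)
Lemma S_defect_L2_value (tau a : C) : 0 < Im tau ->
  (forall t, 0 <= t <= 1 -> ~ in_lattice tau (a + RtoC t)) ->
  S_defect L2 2 tau a = (/ (2 * PI * Ci * tau))%C.
Proof.
  intros Ht Hl. assert (Ht0 : tau <> 0) by (apply Im_nz; lra).
  set (K := S_defect L2 2 tau a).
  assert (Hconst : forall t, 0 <= t <= 1 -> S_defect L2 2 tau (a + RtoC t) = K).
  { intros t Htt. apply S_defect_L2_const; [exact Ht|]. intros s Hs.
    replace (a + RtoC s * (a + RtoC t - a))%C with (a + RtoC (s * t))%C by (rewrite RtoC_mult; ring).
    apply Hl. nra. }
  destruct (partial_defect_uniform L2 1 2 tau (Cmod a + Cmod (a + 1)) Cmod_1 L2_inv1 L2_small Ht)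
    as [b2 [Hb2 [N2 H2]]].
  assert (Ha0 : ~ in_lattice tau a).
  { intros A. apply (Hl 0); [lra|]. rewrite Cplus_0_r. exact A. }
  assert (Hlim := partial_defect_L1_period tau a Ht Ha0).
  assert (Hpi : RtoC PI <> 0) by (intros E; apply RtoC_inj in E; generalize PI_RGT_0; lra).
  enough (E : (/ tau)%C = (2 * PI * Ci * K)%C).
  { replace (/ (2 * PI * Ci * tau))%C with (/ (2 * PI * Ci) * / tau)%C
      by (field; repeat split; [exact Ht0|apply Ci_nz|exact Hpi]).
    rewrite E. field. split; [apply Ci_nz|exact Hpi]. }
  apply cconv_unique with (1 := Hlim).
  (* [cconv_le] asks for a bound at every [N]; below [N2] the quantity is taken as its own bound. *)
  apply cconv_le with (fun N => if le_dec N2 N then 2 * PI * b2 N else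
    Cmod (partial_defect L1 1 tau N (a + 1) - partial_defect L1 1 tau N a - 2 * PI * Ci * K)).
  - intros N. destruct (le_dec N2 N) as [HN|HN]; [|lra].
    assert (A := mean_value_segment (fun z => partial_defect L1 1 tau N z - 2 * PI * Ci * K * z)%C
      (fun z => 2 * PI * Ci * partial_defect L2 2 tau N z - 2 * PI * Ci * K)%C a (a + 1) (2 * PI * b2 N)).
    replace (a + 1 - a)%C with (RtoC 1) in A by ring. rewrite Cmod_1, Rmult_1_r in A.
    replace (partial_defect L1 1 tau N (a + 1) - partial_defect L1 1 tau N a - 2 * PI * Ci * K)%C
      with (partial_defect L1 1 tau N (a + 1) - 2 * PI * Ci * K * (a + 1) -
            (partial_defect L1 1 tau N a - 2 * PI * Ci * K * a))%C by ring.
    apply A.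
    + intros t Htt. rewrite Cmult_1_r. eapply cderiv_eq.
      * apply cderiv_minus; [|apply cderiv_scal, cderiv_id].
        apply partial_defect_cderiv; [apply cderiv_L1_qpar|exact Ht|now apply Hl].
      * ring.
    + intros t Htt. rewrite Cmult_1_r.
      assert (B := H2 N (a + RtoC t)%C HN).
      replace (a + RtoC t)%C with (a + RtoC t * (a + 1 - a))%C in B at 1 by ring.
      specialize (B (segment_bound a (a + 1) t Htt)). rewrite Hconst in B by exact Htt.
      match goal with |- Cmod (?u * ?p - ?u * ?k) <= _ =>
        replace (u * p - u * k)%C with (u * (p - k))%C by ring end.
      rewrite Cmod_mult, Cmod_2PICi. apply Rmult_le_compat_l; [generalize PI_RGT_0; lra|exact B].
  - apply is_lim_seq_ext_loc with (fun N => 2 * PI * b2 N).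
    + exists N2. intros N HN. destruct (le_dec N2 N); [reflexivity|contradiction].
    + replace (Finite 0) with (Rbar_mult (2 * PI) 0) by (simpl; f_equal; ring).
      now apply is_lim_seq_scal_l.
Qed.

Lemma etail_L2_S (tau : C) : 0 < Im tau ->
  (etail L2 tau 0 - 1 / 12 - / tau ^ 2 * (etail L2 (- / tau) 0 - 1 / 12))%C = (/ (2 * PI * Ci * tau))%C.
Proof.
  intros Ht. destruct L_regular as [r [Hr H]].
  destruct ccont_regular as [Hreg [_ [Hv _]]].
  assert (A := S_defect_limit L2 1 2 (1 / 4 / (PI * Ci) ^ 2) (fun z => L2_regular (half_arg z)) r tau
    (/ (2 * PI * Ci * tau)) Cmod_1 L2_inv1 L2_small L2_ccont (proj1 Hr)).
  cbv beta in A. rewrite Hv in A. rewrite <- A; auto.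
  - unfold Cdiv. ring.
  - intros z Hz Hzr. destruct (H z Hz Hzr) as [E _]. rewrite E. f_equal.
    rewrite <- half_arg_div by exact Hz. field. now apply half_arg_nz.
  (* The value at [t tau] is moved to [tau / 2], where the horizontal unit segment is seen to avoid
     the lattice. *)
  - intros t Htt. rewrite <- (S_defect_L2_value tau (RtoC (/ 2) * tau)); [|exact Ht|].
    + apply S_defect_L2_const; [exact Ht|]. intros s Hs.
      replace (RtoC (/ 2) * tau + RtoC s * (RtoC t * tau - RtoC (/ 2) * tau))%C
        with (RtoC 0 + RtoC (/ 2 + s * (t - / 2)) * tau)%C
        by (rewrite RtoC_plus, RtoC_mult, RtoC_minus; ring).
      apply not_in_lattice_coord; [exact Ht|nra].
    + intros s Hs. rewrite Cplus_comm. apply not_in_lattice_coord; [exact Ht|lra].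
Qed.

(** * Divisor sums and Lambert series *)

Definition sigma_coef (k m : nat) : C := match m with O => RtoC 0 | S _ => RtoC (INR (Defs.sigma k m)) end.

Lemma list_sum_filter_seq (p : nat -> bool) (g : nat -> nat) (n : nat) :
  RtoC (INR (list_sum (map g (filter p (seq 1 n))))) =
  csumn (fun i => if p (S i) then RtoC (INR (g (S i))) else RtoC 0) n.
Proof.
  induction n; [reflexivity|].
  rewrite seq_S, filter_app, map_app, list_sum_app, plus_INR, RtoC_plus, IHn. cbn [csumn]. f_equal.
  simpl. destruct (p (S n)); simpl; [rewrite Nat.add_0_r|]; reflexivity.
Qed.

Lemma sigma_csumn (k n : nat) : RtoC (INR (Defs.sigma k n)) =
  csumn (fun i => if Nat.eqb (n mod S i) 0 then RtoC (INR (S i ^ k)) else RtoC 0) n.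
Proof. unfold Defs.sigma. apply (list_sum_filter_seq (fun d => Nat.eqb (n mod d) 0)). Qed.

Lemma sigma_bound (k n : nat) : INR (Defs.sigma k n) <= INR n ^ S k.
Proof.
  rewrite <- (Rabs_pos_eq (INR (Defs.sigma k n))) by apply pos_INR.
  rewrite <- Cmod_R, sigma_csumn.
  eapply Rle_trans; [apply Cmod_csumn|].
  assert (H : forall m, (m <= n)%nat -> rsumn (fun i => Cmod (if Nat.eqb (n mod S i) 0 then RtoC (INR (S i ^ k)) else RtoC 0)) m
     <= INR m * INR n ^ k).
  { induction m; intros Hm; [simpl; lra|].
    cbn [rsumn]. rewrite (S_INR m). specialize (IHm ltac:(lia)).
    assert (A : Cmod (if Nat.eqb (n mod S m) 0 then RtoC (INR (S m ^ k)) else RtoC 0) <= INR n ^ k).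
    { destruct (Nat.eqb (n mod S m) 0).
      - rewrite Cmod_R, Rabs_pos_eq, pow_INR by apply pos_INR. apply pow_incr.
        split; [apply pos_INR|apply le_INR; lia].
      - rewrite Cmod_0. apply pow_le, pos_INR. }
    lra. }
  apply (H n (le_n n)).
Qed.

Lemma sigma_coef_bound (k : nat) (r : R) : 0 <= r < 1 -> exists K, coef_bound (sigma_coef k) r K.
Proof.
  intros Hr. apply (poly_coef_bound _ 1 (S k) r Hr). intros [|m].
  - simpl sigma_coef. rewrite Cmod_0, INR_1, pow1. lra.
  - unfold sigma_coef. rewrite Cmod_R, Rabs_pos_eq, Rmult_1_l by apply pos_INR.
    eapply Rle_trans; [apply sigma_bound|]. apply pow_incr.
    split; [apply pos_INR|apply le_INR; lia].
Qed.

Lemma div_succ (d K : nat) : (0 < d)%nat ->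
  (S K / d = K / d + if Nat.eqb (S K mod d) 0 then 1 else 0)%nat.
Proof.
  intros Hd. assert (A := Nat.div_mod_eq K d). assert (B := Nat.mod_upper_bound K d ltac:(lia)).
  assert (A' := Nat.div_mod_eq (S K) d). assert (B' := Nat.mod_upper_bound (S K) d ltac:(lia)).
  destruct (Nat.eqb_spec (S K mod d) 0) as [E|E]; nia.
Qed.

Definition lambert_term (k : nat) (q : C) (i j : nat) : C :=
  (INR (S i ^ k) * q ^ (S i * S j))%C.

(** Both sides run over the pairs of positive integers with product at most [K]: a first factor
    [i + 1] allows [K / (i + 1)] second factors. From [K] to [K + 1] exactly the divisors of [K + 1]
    gain a term. *)
Lemma lambert_divisor_sum (k : nat) (q : C) (K : nat) :
  csumn (fun i => csumn (lambert_term k q i) (K / S i)) K =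
  csumn (fun N => INR (Defs.sigma k (S N)) * q ^ S N)%C K.
Proof.
  induction K; [reflexivity|].
  assert (E : csumn (fun i => csumn (lambert_term k q i) (S K / S i)) (S K) =
    csumn (fun i => csumn (lambert_term k q i) (K / S i) +
      q ^ S K * (if Nat.eqb (S K mod S i) 0 then RtoC (INR (S i ^ k)) else RtoC 0))%C (S K)).
  { apply csumn_ext. intros i Hi. rewrite div_succ by lia.
    destruct (Nat.eqb_spec (S K mod S i) 0) as [Em|Em].
    - rewrite Nat.add_1_r. cbn [csumn]. f_equal. unfold lambert_term.
      assert (A := Nat.div_mod_eq (S K) (S i)). rewrite (div_succ (S i) K) in A by lia.
      rewrite Em in A. simpl Nat.eqb in A. cbv iota in A.
      replace (S i * S (K / S i))%nat with (S K) by lia. ring.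
    - rewrite Nat.add_0_r. ring. }
  rewrite E, csumn_plus, csumn_scal, <- sigma_csumn.
  cbn [csumn]. rewrite (Nat.div_small K (S K)) by lia. rewrite IHK. cbn [csumn]. ring.
Qed.

Lemma csums_finite (a : nat -> C) (K : nat) : (forall i, (K <= i)%nat -> a i = 0) -> csums a (csumn a K).
Proof.
  intros H eps He. exists K. intros n Hn.
  replace (csumn a n) with (csumn a K).
  - rewrite Cmod_sub_self. exact He.
  - induction Hn; [reflexivity|]. simpl. rewrite <- IHHn, H by exact Hn. ring.
Qed.

Lemma pow_mul_bound (r : R) (i j : nat) : 0 <= r <= 1 -> r ^ (S i * S j) <= r ^ S i * r ^ j.
Proof. intros Hr. rewrite <- pow_add. apply pow_antitone; [exact Hr|nia]. Qed.

Lemma lambert_term_bound (k : nat) (q : C) (i j : nat) : Cmod q < 1 ->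
  Cmod (lambert_term k q i j) <= INR (S i) ^ k * Cmod q ^ S i * Cmod q ^ j.
Proof.
  intros Hq. assert (H0 := Cmod_ge_0 q). unfold lambert_term.
  rewrite Cmod_mult, Cmod_R, Cmod_pow, pow_INR, Rabs_pos_eq by apply pow_le, pos_INR.
  rewrite Rmult_assoc. apply Rmult_le_compat_l; [apply pow_le, pos_INR|].
  apply pow_mul_bound. lra.
Qed.

Lemma cpow_neq_1 (q : C) (n : nat) : Cmod q < 1 -> (1 - q ^ S n)%C <> 0.
Proof.
  intros Hq E. assert (A : (q ^ S n)%C = 1) by (symmetry; apply Ceq_minus; exact E).
  apply (f_equal Cmod) in A. rewrite Cmod_pow, Cmod_1 in A.
  assert (B : Cmod q ^ S n < 1); [|lra].
  simpl. assert (Cmod q ^ n <= 1) by (rewrite <- (pow1 n); apply pow_incr; split; [apply Cmod_ge_0|lra]).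
  assert (0 <= Cmod q ^ n) by apply pow_le, Cmod_ge_0. assert (A0 := Cmod_ge_0 q). nra.
Qed.

Lemma geometric_csums (v : C) : Cmod v < 1 -> csums (fun j => v ^ j)%C (/ (1 - v))%C.
Proof.
  intros Hv. assert (H0 := Cmod_ge_0 v).
  assert (Hd : (1 - v)%C <> 0) by (generalize (cpow_neq_1 v 0 Hv); rewrite Cpow_1_r; auto).
  assert (E : forall n, csumn (fun j => v ^ j)%C n = ((1 - v ^ n) * / (1 - v))%C).
  { induction n; simpl; [ring|]. rewrite IHn. field. exact Hd. }
  apply cconv_ext with (fun n => (1 + - (1) * v ^ n) * / (1 - v))%C.
  { intros n. rewrite E. f_equal. ring. }
  assert (El : ((1 + - (1) * 0) * / (1 - v))%C = (/ (1 - v))%C) by (field; exact Hd).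
  refine (eq_ind _ (cconv _) _ _ El).
  apply cconv_mult; [|apply cconv_const]. apply cconv_plus; [apply cconv_const|]. apply cconv_scal.
  apply cconv_pow_0 with 1 (Cmod v); [lra|]. exists O. intros n _. rewrite Cmod_pow. lra.
Qed.

Lemma lambert_rows (k : nat) (q : C) (i : nat) : Cmod q < 1 ->
  csums (lambert_term k q i) (INR (S i ^ k) * (q ^ S i / (1 - q ^ S i)))%C.
Proof.
  intros Hq.
  apply csums_ext with (fun j => (INR (S i ^ k) * q ^ S i) * (q ^ S i) ^ j)%C.
  - intros j. unfold lambert_term. rewrite <- Cpow_mult_r, <- Cmult_assoc. f_equal.
    rewrite <- Cpow_add_r. f_equal. lia.
  - replace (INR (S i ^ k) * (q ^ S i / (1 - q ^ S i)))%C
      with ((INR (S i ^ k) * q ^ S i) * / (1 - q ^ S i))%C by (unfold Cdiv; ring).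
    apply csums_scal, geometric_csums.
    generalize (cpow_neq_1 q i Hq). intros _. rewrite Cmod_pow. simpl.
    assert (Cmod q ^ i <= 1) by (rewrite <- (pow1 i); apply pow_incr; split; [apply Cmod_ge_0|lra]).
    assert (0 <= Cmod q ^ i) by apply pow_le, Cmod_ge_0. assert (A0 := Cmod_ge_0 q). nra.
Qed.

Lemma lambert_majorant (k : nat) (r : R) : 0 <= r < 1 ->
  (forall i, ex_series (fun j => INR (S i) ^ k * r ^ S i * r ^ j)) /\
  ex_series (fun i => Series (fun j => INR (S i) ^ k * r ^ S i * r ^ j)).
Proof.
  intros Hr. split.
  - intros i. apply ex_series_scal_R, ex_series_geom_R, Hr.
  - apply ex_series_ext with (fun i => (Series (pow r) * r) * (INR (S i) ^ k * r ^ i)).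
    + intros i. rewrite Series_scal_l. change (r ^ S i) with (r * r ^ i).
      match goal with |- @eq _ ?a ?b => change (@eq R a b) end. ring.
    + apply ex_series_scal_R, ex_series_poly_geom, Hr.
Qed.

Lemma sigma_pseries_csums (k : nat) (q : C) : Cmod q < 1 ->
  csums (fun N => INR (Defs.sigma k (S N)) * q ^ S N)%C (pseries (sigma_coef k) q).
Proof.
  intros Hq. assert (H0 := Cmod_ge_0 q).
  destruct (sigma_coef_bound k ((1 + Cmod q) / 2) ltac:(lra)) as [K HK].
  assert (A := pseries_csums (sigma_coef k) ((1 + Cmod q) / 2) K q ltac:(lra) HK ltac:(lra)).
  apply csums_unshift in A. simpl in A.
  replace (pseries (sigma_coef k) q) with (pseries (sigma_coef k) q - 0 * 1)%C by ring. exact A.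
Qed.

(** The partial sums of [lambert_divisor_sum], cut along a hyperbola, exhaust every row as [K]
    grows, so [tannery] identifies their limit with the sum of the rows. *)
Lemma lambert_sigma (k : nat) (q : C) : Cmod q < 1 ->
  csums (fun i => INR (S i ^ k) * (q ^ S i / (1 - q ^ S i)))%C (pseries (sigma_coef k) q).
Proof.
  intros Hq. assert (H0 := Cmod_ge_0 q).
  destruct (lambert_majorant k (Cmod q) ltac:(lra)) as [M1 M2].
  set (row := fun i => (INR (S i ^ k) * (q ^ S i / (1 - q ^ S i)))%C).
  assert (Hrow : dominated row (fun i => Series (fun j => INR (S i) ^ k * Cmod q ^ S i * Cmod q ^ j))).
  { intros i. apply (csums_norm_le (lambert_term k q i)); [|apply M1|now apply lambert_rows].
    intros j. now apply lambert_term_bound. }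
  assert (Hs := csums_exists row _ Hrow M2).
  replace (pseries (sigma_coef k) q) with (CSeries row); [exact Hs|].
  apply cconv_unique with (csumn (fun N => INR (Defs.sigma k (S N)) * q ^ S N)%C); [|now apply sigma_pseries_csums].
  apply (tannery (fun K i => csumn (lambert_term k q i) (K / S i)) _ row _ _ M2).
  - intros K i. eapply Rle_trans; [apply Cmod_csumn_le; intros j; now apply lambert_term_bound|].
    apply rsumn_le_Series; [|apply M1]. intros j.
    apply Rmult_le_pos; [apply Rmult_le_pos|]; apply pow_le; try apply pos_INR; exact H0.
  - exact Hrow.
  - intros i eps He. destruct (lambert_rows k q i Hq eps He) as [N HN].
    exists (S i * N)%nat. intros n Hn. apply HN.
    apply Nat.div_le_lower_bound; lia.
  - intros K. rewrite <- lambert_divisor_sum. apply csums_finite.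
    intros i Hi. rewrite Nat.div_small by lia. reflexivity.
  - exact Hs.
Qed.

Definition power_coef (k m : nat) : C := RtoC (INR m ^ k).

Lemma power_coef_bound (k : nat) (r : R) : 0 <= r < 1 -> exists K, coef_bound (power_coef k) r K.
Proof.
  intros Hr. apply (poly_coef_bound _ 1 k r Hr). intros m. unfold power_coef.
  rewrite Cmod_R, Rabs_pos_eq, Rmult_1_l by apply pow_le, pos_INR.
  apply pow_incr. split; [apply pos_INR|apply le_INR; lia].
Qed.

(** The operator [v d/dv] multiplies the coefficient of [v^m] by [m]. *)
Lemma power_pseries_succ (k : nat) (f f' : C -> C) :
  (forall v, Cmod v < 1 -> pseries (power_coef k) v = f v) ->
  (forall v, Cmod v < 1 -> cderiv f v (f' v)) ->
  forall v, Cmod v < 1 -> pseries (power_coef (S k)) v = (v * f' v)%C.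
Proof.
  intros Hf Hf' v Hv. assert (H0 := Cmod_ge_0 v). set (r := (1 + Cmod v) / 2).
  destruct (power_coef_bound k r ltac:(unfold r; lra)) as [K HK].
  destruct (power_coef_bound (S k) r ltac:(unfold r; lra)) as [K' HK'].
  assert (A : pseries (pderiv (power_coef k)) v = f' v).
  { apply (cderiv_unique f v); [|now apply Hf'].
    apply (cderiv_ext_loc (pseries (power_coef k)) f v _ (1 - Cmod v)); [lra| |].
    - intros w Hw. apply Hf. replace w with ((w - v) + v)%C by ring.
      eapply Rle_lt_trans; [apply Cmod_triangle|]. lra.
    - apply pseries_deriv with r K; unfold r in *; auto; lra. }
  rewrite <- A. symmetry.
  assert (B := pseries_csums (power_coef (S k)) r K' v ltac:(unfold r; lra) HK' ltac:(unfold r; lra)).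
  apply csums_unshift in B.
  destruct (pderiv_bound (power_coef k) r K ((r + Cmod v) / 2) ltac:(unfold r; lra) HK ltac:(unfold r; lra)) as [K2 HK2].
  assert (D := pseries_csums (pderiv (power_coef k)) ((r + Cmod v) / 2) K2 v
    ltac:(unfold r; lra) HK2 ltac:(unfold r; lra)).
  apply (csums_scal v) in D.
  replace (pseries (power_coef (S k)) v) with (pseries (power_coef (S k)) v - power_coef (S k) 0 * v ^ 0)%C.
  - apply (csums_unique (fun n => power_coef (S k) (S n) * v ^ S n)%C); [|exact B].
    eapply csums_ext; [|exact D]. intros n. unfold pderiv, power_coef.
    change (INR (S n) ^ S k) with (INR (S n) * INR (S n) ^ k). rewrite RtoC_mult. simpl (v ^ S n)%C. ring.
  - unfold power_coef. simpl (INR 0 ^ S k). rewrite Rmult_0_l. ring.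
Qed.

Lemma power_pseries_L (v : C) : Cmod v < 1 ->
  pseries (power_coef 1) v = L2 v /\ pseries (power_coef 3) v = L4 v.
Proof.
  assert (Hd : forall v, Cmod v < 1 -> (1 - v)%C <> 0).
  { intros u Hu. generalize (cpow_neq_1 u 0 Hu). now rewrite Cpow_1_r. }
  assert (H0 : forall v, Cmod v < 1 -> pseries (power_coef 0) v = (/ (1 - v))%C).
  { intros u Hu. apply csums_CSeries. eapply csums_ext; [|now apply geometric_csums].
    intros n. unfold power_coef. simpl. ring. }
  assert (Hm : forall v, cderiv (fun v => 1 - v)%C v (0 - 1)%C)
    by (intros; apply cderiv_minus; [apply cderiv_const|apply cderiv_id]).
  assert (H1 : forall v, Cmod v < 1 -> pseries (power_coef 1) v = L2 v).
  { intros u Hu. rewrite (power_pseries_succ 0 _ (fun v => / (1 - v) ^ 2)%C H0); auto.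
    intros w Hw. eapply cderiv_eq; [apply cderiv_inv; [apply Hm|auto]|]. cbv beta. field. auto. }
  assert (H2 : forall v, Cmod v < 1 -> pseries (power_coef 2) v = L3 v).
  { intros u Hu. rewrite (power_pseries_succ 1 _ (fun v => (1 + v) / (1 - v) ^ 3)%C H1); auto.
    - unfold L3. field. auto.
    - intros w Hw. eapply cderiv_eq.
      + apply cderiv_div; [apply cderiv_id|apply (cderiv_pow _ 1), Hm|apply Cpow_nz; auto].
      + cbv beta. replace (INR 2) with 2 by (simpl; ring). field. auto. }
  intros Hv. split; [now apply H1|].
  rewrite (power_pseries_succ 2 _ (fun v => (1 + 4 * v + v ^ 2) / (1 - v) ^ 4)%C H2); auto.
  - unfold L4. field. auto.
  - intros w Hw. eapply cderiv_eq.
    + apply cderiv_div; [|apply (cderiv_pow _ 2), Hm|apply Cpow_nz; auto].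
      apply cderiv_mult; [apply cderiv_id|apply cderiv_plus; [apply cderiv_const|apply cderiv_id]].
    + cbv beta. replace (INR 3) with 3 by (simpl; ring). field. auto.
Qed.

Lemma Cmod_pow_lt_1 (q : C) (n : nat) : Cmod q < 1 -> Cmod (q ^ S n) < 1.
Proof.
  intros Hq. rewrite Cmod_pow. simpl.
  assert (Cmod q ^ n <= 1) by (rewrite <- (pow1 n); apply pow_incr; split; [apply Cmod_ge_0|lra]).
  assert (0 <= Cmod q ^ n) by apply pow_le, Cmod_ge_0. assert (A0 := Cmod_ge_0 q). nra.
Qed.

(** The same double series summed by columns: column [j] is [sum_m m^k (q^(j+1))^m], a value of [L].
    This links lattice sums at [z = 0] to divisor sums. *)
Lemma lambert_columns (k : nat) (q : C) (L : C -> C) : Cmod q < 1 ->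
  (forall v, Cmod v < 1 -> pseries (power_coef k) v = L v) -> L 0 = 0 ->
  csums (fun j => L (q ^ S j)%C) (pseries (sigma_coef k) q).
Proof.
  intros Hq HL HL0. assert (H0 := Cmod_ge_0 q).
  destruct (lambert_majorant k (Cmod q) ltac:(lra)) as [M1 M2].
  apply (csums_swap (lambert_term k q) (fun i j => INR (S i) ^ k * Cmod q ^ S i * Cmod q ^ j)
    (fun i => INR (S i ^ k) * (q ^ S i / (1 - q ^ S i)))%C); auto.
  - intros. now apply lambert_term_bound.
  - intros. now apply lambert_rows.
  - now apply lambert_sigma.
  - intros j. set (v := (q ^ S j)%C). assert (Hv : Cmod v < 1) by now apply Cmod_pow_lt_1.
    assert (Hv0 := Cmod_ge_0 v).
    destruct (power_coef_bound k ((1 + Cmod v) / 2) ltac:(lra)) as [K HK].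
    assert (B := pseries_csums (power_coef k) ((1 + Cmod v) / 2) K v ltac:(lra) HK ltac:(lra)).
    apply csums_unshift in B. rewrite HL in B by exact Hv.
    assert (E : (power_coef k 0 * v ^ 0)%C = 0).
    { rewrite <- (Cmult_1_r (power_coef k 0)) in *. rewrite <- HL0, <- (HL 0), pseries_0 by (rewrite Cmod_0; lra).
      simpl. ring. }
    rewrite E in B. unfold Cminus in B. rewrite Copp_0, Cplus_0_r in B.
    eapply csums_ext; [|exact B]. intros i. unfold lambert_term, power_coef, v.
    rewrite pow_INR, <- Cpow_mult_r. do 2 f_equal. lia.
Qed.

Lemma etail_sigma (k : nat) (L : C -> C) (tau : C) : 0 < Im tau ->
  (forall v, Cmod v < 1 -> pseries (power_coef k) v = L v) -> L 0 = 0 ->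
  (forall u : C, u <> 0 -> u <> 1 -> L (/ u)%C = L u) ->
  etail L tau 0 = (2 * pseries (sigma_coef k) (qpar tau))%C.
Proof.
  intros Ht HL HL0 Hi. assert (Hq := Cmod_qpar_lt_1 tau Ht).
  unfold etail. apply csums_CSeries.
  eapply csums_ext; [|apply (csums_scal 2), (lambert_columns k (qpar tau) L); auto; lra].
  intros j. cbv beta. unfold eterm.
  assert (E : qpar (0 + IZR (Z.of_nat (S j)) * tau) = (qpar tau ^ S j)%C).
  { rewrite Cplus_0_l, <- INR_IZR_INZ. apply qpar_INR_mult. }
  rewrite E.
  replace (0 + IZR (- Z.of_nat (S j)) * tau)%C with (- (0 + IZR (Z.of_nat (S j)) * tau))%C
    by (rewrite opp_IZR, RtoC_opp; ring).
  rewrite qpar_opp, E, Hi; [ring|apply Cpow_nz, qpar_nz|].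
  intros A. apply (cpow_neq_1 (qpar tau) j); [lra|]. rewrite A. ring.
Qed.

(** * The functions [e2], [e4] of the nome and their [S]-transformations *)

(** As functions of the nome these are defined at [q = 0] too, so that the cusp becomes an interior
    point of the unit disc. *)
Definition e2 (q : C) : C := (1 - 24 * pseries (sigma_coef 1) q)%C.
Definition e4 (q : C) : C := (1 + 240 * pseries (sigma_coef 3) q)%C.
Definition E2 (tau : C) : C := e2 (qpar tau).

Lemma E4_e4 (tau : C) : 0 < Im tau -> E4 tau = e4 (qpar tau).
Proof.
  intros Ht. unfold E4, e4. do 2 f_equal. apply csums_CSeries, sigma_pseries_csums.
  apply Cmod_qpar_lt_1, Ht.
Qed.

Lemma E4_S (tau : C) : 0 < Im tau -> E4 (- / tau) = (tau ^ 4 * E4 tau)%C.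
Proof.
  intros Ht. assert (Ht' := Im_S tau Ht). assert (Ht0 : tau <> 0) by (apply Im_nz; lra).
  assert (A := etail_L4_S tau Ht).
  assert (HL0 : L4 0 = 0) by (unfold L4; field; apply C1_nz).
  assert (HL := fun v Hv => proj2 (power_pseries_L v Hv)).
  rewrite (etail_sigma 3 L4 tau Ht HL HL0 L4_inv), (etail_sigma 3 L4 (- / tau) Ht' HL HL0 L4_inv) in A.
  rewrite !E4_e4 by assumption. unfold e4.
  set (X := pseries (sigma_coef 3) (qpar tau)) in *. set (Y := pseries (sigma_coef 3) (qpar (- / tau))) in *.
  replace (1 + 240 * Y)%C with (tau ^ 4 * (120 * (/ tau ^ 4 * (2 * Y + 1 / 120))))%C
    by (field; exact Ht0).
  rewrite <- A. field.
Qed.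

Lemma E2_S (tau : C) : 0 < Im tau -> E2 (- / tau) = (tau ^ 2 * E2 tau + 12 * tau / (2 * PI * Ci))%C.
Proof.
  intros Ht. assert (Ht' := Im_S tau Ht). assert (Ht0 : tau <> 0) by (apply Im_nz; lra).
  assert (Hpi : RtoC PI <> 0) by (intros E; apply RtoC_inj in E; generalize PI_RGT_0; lra).
  assert (A := etail_L2_S tau Ht).
  assert (HL0 : L2 0 = 0) by (unfold L2; field; apply C1_nz).
  assert (HL := fun v Hv => proj1 (power_pseries_L v Hv)).
  rewrite (etail_sigma 1 L2 tau Ht HL HL0 L2_inv), (etail_sigma 1 L2 (- / tau) Ht' HL HL0 L2_inv) in A.
  unfold E2, e2.
  set (X := pseries (sigma_coef 1) (qpar tau)) in *. set (Y := pseries (sigma_coef 1) (qpar (- / tau))) in *.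
  transitivity (tau ^ 2 * ((1 - 24 * X) + 12 * (2 * X - 1 / 12 - / tau ^ 2 * (2 * Y - 1 / 12))))%C.
  - field. exact Ht0.
  - rewrite A. field. repeat split; assumption || apply Ci_nz.
Qed.

(** * The Euler product and [eta] *)

Fixpoint euler_partial (N : nat) (q : C) : C :=
  match N with O => RtoC 1 | S k => (euler_partial k q * (1 - q ^ S k))%C end.

Definition euler (q : C) : C := CProd (fun m => 1 - q ^ S m)%C.

Lemma Cprod_list_app (l l' : list nat) (a : nat -> C) :
  Cprod_list (l ++ l') a = (Cprod_list l a * Cprod_list l' a)%C.
Proof.
  unfold Cprod_list. induction l; simpl; [ring|]. rewrite IHl. ring.
Qed.

Lemma Cprod_list_euler (q : C) (N : nat) :
  Cprod_list (seq 0 N) (fun m => 1 - q ^ S m)%C = euler_partial N q.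
Proof.
  induction N; [reflexivity|]. rewrite seq_S, Cprod_list_app, IHN.
  unfold Cprod_list. cbn [map fold_right euler_partial Nat.add]. ring.
Qed.

Lemma rsumn_geom_bound (r : R) (N : nat) : 0 <= r < 1 ->
  rsumn (fun m => r ^ S m) N <= r / (1 - r).
Proof.
  intros Hr. assert (E : rsumn (fun m => r ^ S m) N = r * (1 - r ^ N) / (1 - r)).
  { induction N; cbn [rsumn]; [simpl; field; lra|]. rewrite IHN. simpl. field. lra. }
  rewrite E. unfold Rdiv. apply Rmult_le_compat_r; [left; apply Rinv_0_lt_compat; lra|].
  assert (0 <= r ^ N) by (apply pow_le; lra). nra.
Qed.

Lemma exp_ge_inv (x : R) : 0 <= x < 1 -> exp (- (x / (1 - x))) <= 1 - x.
Proof.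
  intros Hx. rewrite exp_Ropp.
  apply Rle_trans with (/ (1 + x / (1 - x))).
  - apply Rinv_le_contravar.
    + assert (0 <= x / (1 - x)) by (apply Rdiv_le_0_compat; lra). lra.
    + apply exp_ineq1_le.
  - right. field. lra.
Qed.

(** The lower bound, uniform in [N], comes from [1 - x >= exp (- x / (1 - x))]; it keeps the
    infinite product away from 0. *)
Lemma euler_partial_bounds (q : C) (r : R) (N : nat) : Cmod q <= r < 1 ->
  exp (- (r / (1 - r) / (1 - r))) <= Cmod (euler_partial N q) <= exp (r / (1 - r)).
Proof.
  intros Hr. assert (H0 := Cmod_ge_0 q).
  assert (A : exp (- (rsumn (fun m => r ^ S m) N / (1 - r))) <= Cmod (euler_partial N q)
              <= exp (rsumn (fun m => r ^ S m) N)).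
  { induction N; cbn [rsumn euler_partial].
    - unfold Rdiv. rewrite Rmult_0_l, Ropp_0, exp_0, Cmod_1. lra.
    - rewrite Cmod_mult.
      assert (Hp : Cmod (q ^ S N) <= r ^ S N).
      { rewrite Cmod_pow. apply pow_incr. lra. }
      assert (Hp1 : 0 <= r ^ S N <= r).
      { split; [apply pow_le; lra|]. replace r with (r ^ 1) at 2 by ring. apply pow_antitone; [lra|lia]. }
      set (x := r ^ S N) in *.
      assert (Hu : Cmod (1 - q ^ S N) <= exp x).
      { eapply Rle_trans; [apply Cmod_minus_le|]. rewrite Cmod_1.
        eapply Rle_trans; [apply Rplus_le_compat_l, Hp|]. apply exp_ineq1_le. }
      assert (Hl : exp (- (x / (1 - r))) <= Cmod (1 - q ^ S N)).
      { apply Rle_trans with (exp (- (x / (1 - x)))).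
        - apply exp_le_mono, Ropp_le_contravar. unfold Rdiv.
          apply Rmult_le_compat_l; [lra|]. apply Rinv_le_contravar; lra.
        - eapply Rle_trans; [apply exp_ge_inv; lra|].
          generalize (Cmod_reverse_triangle 1 (q ^ S N)). rewrite Cmod_1. lra. }
      rewrite exp_plus. unfold Rdiv at 1. rewrite Rmult_plus_distr_r, Ropp_plus_distr, exp_plus.
      unfold Rdiv in IHN, Hl.
      split; apply Rmult_le_compat; try apply Cmod_ge_0; try (left; apply exp_pos); tauto. }
  assert (B := rsumn_geom_bound r N ltac:(lra)).
  split.
  - eapply Rle_trans; [|apply A]. apply exp_le_mono, Ropp_le_contravar.
    unfold Rdiv in *. apply Rmult_le_compat_r; [left; apply Rinv_0_lt_compat; lra|exact B].
  - eapply Rle_trans; [apply A|]. now apply exp_le_mono.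
Qed.

Lemma euler_increment_bound (q : C) (r : R) (N : nat) : Cmod q <= r < 1 ->
  Cmod (euler_partial (S N) q - euler_partial N q) <= exp (r / (1 - r)) * r ^ N.
Proof.
  intros Hr. assert (H0 := Cmod_ge_0 q). cbn [euler_partial].
  replace (euler_partial N q * (1 - q ^ S N) - euler_partial N q)%C
    with (- (euler_partial N q * q ^ S N))%C by ring.
  rewrite Cmod_opp, Cmod_mult, Cmod_pow.
  apply Rmult_le_compat; [apply Cmod_ge_0|apply pow_le, H0|now apply euler_partial_bounds|].
  apply Rle_trans with (r ^ S N); [apply pow_incr; lra|]. apply pow_antitone; [lra|lia].
Qed.

Lemma csumn_telescope (u : nat -> C) (N : nat) :
  csumn (fun n => u (S n) - u n)%C N = (u N - u 0%nat)%C.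
Proof. induction N; simpl; [ring|]. rewrite IHN. ring. Qed.

Lemma euler_cconv (q : C) : Cmod q < 1 -> cconv (fun N => euler_partial N q) (euler q).
Proof.
  intros Hq. assert (H0 := Cmod_ge_0 q).
  assert (A := csums_exists (fun N => euler_partial (S N) q - euler_partial N q)%C
    (fun N => exp (Cmod q / (1 - Cmod q)) * Cmod q ^ N)
    (fun N => euler_increment_bound q (Cmod q) N ltac:(lra))
    (ex_series_scal_R _ _ (ex_series_geom_R (Cmod q) ltac:(lra)))).
  set (l := CSeries _) in A.
  assert (B : cconv (fun N => euler_partial N q) (1 + l)%C).
  { eapply cconv_ext; [|apply cconv_plus; [apply (cconv_const 1)|exact A]].
    intros N. cbv beta. rewrite (csumn_telescope (fun N => euler_partial N q)). simpl. ring. }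
  replace (euler q) with (1 + l)%C; [exact B|].
  apply cconv_re_im in B. destruct B as [B1 B2]. symmetry.
  apply C_ext; unfold euler, CProd; cbn [Re Im fst snd].
  - rewrite (Lim_seq_ext _ (fun N => Re (euler_partial N q)))
      by (intros; now rewrite Cprod_list_euler).
    now rewrite (is_lim_seq_unique _ _ B1).
  - rewrite (Lim_seq_ext _ (fun N => Im (euler_partial N q)))
      by (intros; now rewrite Cprod_list_euler).
    now rewrite (is_lim_seq_unique _ _ B2).
Qed.

Lemma euler_nz (q : C) : Cmod q < 1 -> euler q <> 0.
Proof.
  intros Hq. apply Cmod_gt_0.
  eapply Rlt_le_trans; [apply (exp_pos (- (Cmod q / (1 - Cmod q) / (1 - Cmod q))))|].
  apply (Cmod_cconv_ge _ _ _ (euler_cconv q Hq)). intros N. apply euler_partial_bounds. lra.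
Qed.

(* [pseries (sigma_coef 1) q = q * sigma1_shift q] *)
Definition sigma1_shift (q : C) : C := pseries (fun m => sigma_coef 1 (S m)) q.

Lemma sigma1_shift_bound (r : R) : 0 < r < 1 ->
  exists K, coef_bound (fun m => sigma_coef 1 (S m)) r K.
Proof.
  intros Hr. destruct (sigma_coef_bound 1 r ltac:(lra)) as [K HK].
  exists (K / r). intros m. apply Rmult_le_reg_r with r; [lra|].
  unfold Rdiv. rewrite (Rmult_assoc K), Rinv_l, Rmult_1_r by lra.
  specialize (HK (S m)). simpl in HK. simpl. lra.
Qed.

Lemma sigma1_shift_correct (q : C) : Cmod q < 1 ->
  pseries (sigma_coef 1) q = (q * sigma1_shift q)%C.
Proof.
  intros Hq. assert (H0 := Cmod_ge_0 q).
  destruct (sigma1_shift_bound ((1 + Cmod q) / 2) ltac:(lra)) as [K HK].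
  assert (A := csums_scal q _ _ (pseries_csums _ ((1 + Cmod q) / 2) K q ltac:(lra) HK ltac:(lra))).
  apply (csums_unique _ _ _ (sigma_pseries_csums 1 q Hq)).
  eapply csums_ext; [|exact A]. intros n. simpl. ring.
Qed.

(** The logarithmic derivative in [q] of the factor [1 - q^(m+1)]. *)
Definition euler_log_term (q : C) (m : nat) : C := (- (INR (S m) * q ^ m / (1 - q ^ S m)))%C.

Lemma euler_partial_cderiv (q : C) (N : nat) : Cmod q < 1 ->
  cderiv (euler_partial N) q (euler_partial N q * csumn (euler_log_term q) N)%C.
Proof.
  intros Hq. induction N.
  - eapply cderiv_eq; [apply cderiv_const|]. simpl. ring.
  - eapply cderiv_eq.
    + apply cderiv_mult; [exact IHN|].
      apply cderiv_minus; [apply cderiv_const|apply (cderiv_pow (fun q => q)), cderiv_id].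
    + cbn [euler_partial csumn]. set (l := csumn _ N). unfold euler_log_term. simpl (q ^ S N)%C. fold (euler_partial N). field.
      now apply (cpow_neq_1 q N).
Qed.

Lemma euler_log_term_bound (q : C) (r : R) (m : nat) : Cmod q <= r < 1 ->
  Cmod (euler_log_term q m) <= / (1 - r) * (INR (S m) ^ 1 * r ^ m).
Proof.
  intros Hr. assert (H0 := Cmod_ge_0 q). unfold euler_log_term.
  rewrite Cmod_opp, Cmod_div by (apply cpow_neq_1; lra).
  rewrite Cmod_mult, Cmod_R, Rabs_pos_eq, Cmod_pow, pow_1 by apply pos_INR.
  unfold Rdiv. rewrite Rmult_comm. apply Rmult_le_compat.
  - left. apply Rinv_0_lt_compat, Cmod_gt_0, cpow_neq_1. lra.
  - apply Rmult_le_pos; [apply pos_INR|apply pow_le, H0].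
  - apply Rinv_le_contravar; [lra|].
    assert (Hp : Cmod (q ^ S m) <= r).
    { rewrite Cmod_pow. apply Rle_trans with (r ^ S m); [apply pow_incr; lra|].
      replace r with (r ^ 1) at 2 by ring. apply pow_antitone; [lra|lia]. }
    generalize (Cmod_reverse_triangle 1 (q ^ S m)). rewrite Cmod_1. lra.
  - apply Rmult_le_compat_l; [apply pos_INR|]. apply pow_incr. lra.
Qed.

Lemma euler_log_csums (q : C) : Cmod q < 1 -> csums (euler_log_term q) (- sigma1_shift q)%C.
Proof.
  intros Hq. assert (H0 := Cmod_ge_0 q).
  destruct (classic (q = 0)) as [->|Hq0].
  - replace (- sigma1_shift 0)%C with (csumn (euler_log_term 0) 1).
    + apply csums_finite. intros [|i] Hi; [lia|]. unfold euler_log_term. simpl (0 ^ S i)%C.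
      unfold Cdiv. ring.
    + unfold sigma1_shift. rewrite pseries_0. unfold euler_log_term. cbn [csumn]. simpl. field.

  - assert (Hs := csums_exists (euler_log_term q) _
      (fun m => euler_log_term_bound q (Cmod q) m ltac:(lra))
      (ex_series_scal_R _ _ (ex_series_poly_geom 1 (Cmod q) ltac:(lra)))).
    replace (- sigma1_shift q)%C with (CSeries (euler_log_term q)); [exact Hs|].
    assert (A := csums_scal (- q) _ _ Hs).
    assert (B := lambert_sigma 1 q Hq). rewrite sigma1_shift_correct in B by exact Hq.
    assert (E : (- q * CSeries (euler_log_term q))%C = (q * sigma1_shift q)%C).
    { apply (csums_unique _ _ _ A). eapply csums_ext; [|exact B].
      intros m. unfold euler_log_term. rewrite pow_INR. rewrite pow_1. simpl (q ^ S m)%C. unfold Cdiv. ring. }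
    replace (CSeries (euler_log_term q)) with (- / q * (- q * CSeries (euler_log_term q)))%C
      by (field; exact Hq0).
    rewrite E. field. exact Hq0.
Qed.

(** The product is treated as the series of differences of its partial products. Their derivatives
    are dominated by a geometric and a polynomial-geometric series, and telescope to the product
    times its logarithmic derivative. *)
Lemma euler_cderiv (q : C) : Cmod q < 1 -> cderiv euler q (- (euler q * sigma1_shift q))%C.
Proof.
  intros Hq. assert (H0 := Cmod_ge_0 q). set (r := (1 + Cmod q) / 2).
  assert (Hr : Cmod q < r < 1) by (unfold r; lra).
  (* The telescoping series starts from the empty product, so its sum is [euler - 1]. *)
  apply cderiv_ext_loc with (fun q => 1 + (euler q - 1))%C r; [lra|intros; ring|].
  eapply cderiv_eq; [apply cderiv_plus; [apply cderiv_const|]|].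
  2: { instantiate (1 := (euler q * - sigma1_shift q)%C). ring. }
  destruct (ex_series_bounded (fun m => / (1 - r) * (INR (S m) ^ 1 * r ^ m))
    (Series (fun m => / (1 - r) * (INR (S m) ^ 1 * r ^ m)))) as [Hex _].
  { intros m. apply Rmult_le_pos; [left; apply Rinv_0_lt_compat; lra|].
    apply Rmult_le_pos; apply pow_le; [apply pos_INR|lra]. }
  { intros N. apply rsumn_le_Series; [|apply ex_series_scal_R, ex_series_poly_geom; lra].
    intros m. apply Rmult_le_pos; [left; apply Rinv_0_lt_compat; lra|].
    apply Rmult_le_pos; apply pow_le; [apply pos_INR|lra]. }
  set (Cl := Series (fun m => / (1 - r) * (INR (S m) ^ 1 * r ^ m))) in *.
  set (B := exp (r / (1 - r))).
  set (f' := fun N q => (euler_partial (S N) q * csumn (euler_log_term q) (S N)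
                         - euler_partial N q * csumn (euler_log_term q) N)%C).
  apply (termwise_derivative (fun N q => euler_partial (S N) q - euler_partial N q)%C f'
    (fun q => euler q - 1)%C (fun q => euler q * - sigma1_shift q)%C 0 r
    (fun N => (B * Cl) * r ^ N + (B * / (1 - r)) * (INR (S N) ^ 1 * r ^ N))).
  - apply (ex_series_plus (fun N => B * Cl * r ^ N)); apply ex_series_scal_R;
      [apply ex_series_geom_R|apply ex_series_poly_geom]; lra.
  - intros N w Hw. replace (w - 0)%C with w in Hw by ring.
    apply cderiv_minus; apply euler_partial_cderiv; lra.
  - intros N w Hw. replace (w - 0)%C with w in Hw by ring. unfold f'.
    replace (euler_partial (S N) w * csumn (euler_log_term w) (S N) - euler_partial N w * csumn (euler_log_term w) N)%C
      with ((euler_partial (S N) w - euler_partial N w) * csumn (euler_log_term w) N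
            + euler_partial (S N) w * euler_log_term w N)%C by (cbn [csumn]; ring).
    eapply Rle_trans; [apply Cmod_triangle|]. rewrite !Cmod_mult. apply Rplus_le_compat.
    + rewrite (Rmult_assoc B), (Rmult_comm Cl), <- Rmult_assoc.
      apply Rmult_le_compat; try apply Cmod_ge_0; [apply euler_increment_bound; lra|].
      eapply Rle_trans; [apply Cmod_csumn_le; intros m; apply (euler_log_term_bound w r m); lra|].
      apply rsumn_le_Series; [|exact Hex].
      intros m. apply Rmult_le_pos; [left; apply Rinv_0_lt_compat; lra|].
      apply Rmult_le_pos; apply pow_le; [apply pos_INR|lra].
    + rewrite Rmult_assoc. apply Rmult_le_compat; try apply Cmod_ge_0.
      * apply euler_partial_bounds; lra.
      * apply euler_log_term_bound; lra.
  - intros w Hw. replace (w - 0)%C with w in Hw by ring.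
    apply cconv_ext with (fun N => euler_partial N w + - (1))%C.
    + intros N. rewrite (csumn_telescope (fun N => euler_partial N w)). simpl. ring.
    + apply cconv_plus; [apply euler_cconv; lra|apply cconv_const].
  - intros w Hw. replace (w - 0)%C with w in Hw by ring.
    apply cconv_ext with (fun N => euler_partial N w * csumn (euler_log_term w) N)%C.
    + intros N. unfold f'. rewrite (csumn_telescope (fun N => euler_partial N w * csumn (euler_log_term w) N)%C).
      simpl. ring.
    + apply cconv_mult; [apply euler_cconv; lra|apply euler_log_csums; lra].
  - replace (q - 0)%C with q by ring. lra.
Qed.

Lemma pseries_hol_0 (a : nat -> C) (q : C) :
  (forall r, 0 < r < 1 -> exists K, coef_bound a r K) -> Cmod q < 1 -> hol (pseries a) q.
Proof.
  intros Ha Hq. assert (H0 := Cmod_ge_0 q).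
  destruct (Ha ((1 + Cmod q) / 2) ltac:(lra)) as [K HK].
  apply hol_ext with (fun z => pseries a (z - 0)); [intros; f_equal; ring|].
  apply (pseries_hol a ((1 + Cmod q) / 2) K); [lra|exact HK|].
  replace (q - 0)%C with q by ring. lra.
Qed.

Lemma sigma_pseries_hol (k : nat) (q : C) : Cmod q < 1 -> hol (pseries (sigma_coef k)) q.
Proof. apply pseries_hol_0. intros r Hr. apply sigma_coef_bound. lra. Qed.

Lemma sigma1_shift_hol (q : C) : Cmod q < 1 -> hol sigma1_shift q.
Proof. apply pseries_hol_0. apply sigma1_shift_bound. Qed.

Lemma e2_hol (q : C) : Cmod q < 1 -> hol e2 q.
Proof. intros. apply hol_minus; [apply hol_const|]. now apply hol_scal, sigma_pseries_hol. Qed.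

Lemma e4_hol (q : C) : Cmod q < 1 -> hol e4 q.
Proof. intros. apply hol_plus; [apply hol_const|]. now apply hol_scal, sigma_pseries_hol. Qed.

Lemma euler_hol (q : C) : Cmod q < 1 -> hol euler q.
Proof.
  intros Hq. apply (hol_intro _ (fun q => - (euler q * sigma1_shift q))%C _ (1 - Cmod q)); [lra|].
  intros w Hw. assert (Hw1 : Cmod w < 1).
  { replace w with ((w - q) + q)%C by ring. eapply Rle_lt_trans; [apply Cmod_triangle|]. lra. }
  split; [now apply euler_cderiv|]. apply ccont_opp, ccont_mult.
  - eapply cderiv_cont, euler_cderiv, Hw1.
  - now apply hol_ccont, sigma1_shift_hol.
Qed.

Definition eta_root (tau : C) : C := Cexp (2 * PI * Ci * tau / 24).

Lemma eta_euler (tau : C) : eta tau = (eta_root tau * euler (qpar tau))%C.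
Proof. reflexivity. Qed.

Lemma eta_nz (tau : C) : 0 < Im tau -> eta tau <> 0.
Proof.
  intros H. rewrite eta_euler. apply Cmult_neq_0; [apply Cexp_nz|].
  apply euler_nz, Cmod_qpar_lt_1, H.
Qed.

Lemma eta_cderiv (tau : C) : 0 < Im tau -> cderiv eta tau (2 * PI * Ci / 24 * (eta tau * E2 tau))%C.
Proof.
  intros H. assert (Hq := Cmod_qpar_lt_1 tau H).
  apply cderiv_ext with (fun tau => eta_root tau * euler (qpar tau))%C; [intros; symmetry; apply eta_euler|].
  rewrite eta_euler. eapply cderiv_eq.
  - apply cderiv_mult.
    + unfold eta_root. apply (cderiv_comp Cexp (fun t => 2 * PI * Ci * t / 24)%C); [|apply cderiv_Cexp].
      apply (cderiv_mult (fun t => 2 * PI * Ci * t)%C (fun _ => / 24)%C);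
        [apply cderiv_scal, cderiv_id|apply cderiv_const].
    + apply (cderiv_comp euler qpar); [apply cderiv_qpar|apply euler_cderiv; lra].
  - cbv beta. unfold E2, e2, eta_root. rewrite sigma1_shift_correct by lra. field.
Qed.

Lemma eta_hol (tau : C) : 0 < Im tau -> hol eta tau.
Proof.
  intros H. apply hol_ext with (fun tau => eta_root tau * euler (qpar tau))%C;
    [intros; symmetry; apply eta_euler|].
  apply hol_mult.
  - apply (hol_comp Cexp); [|apply hol_Cexp].
    apply (hol_mult (fun t => 2 * PI * Ci * t)%C (fun _ => / 24)%C); [apply hol_scal, hol_id|apply hol_const].
  - apply (hol_comp euler); [apply hol_qpar|]. apply euler_hol, Cmod_qpar_lt_1, H.
Qed.

Lemma E2_hol (tau : C) : 0 < Im tau -> hol E2 tau.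
Proof. intros H. apply (hol_comp e2); [apply hol_qpar|]. apply e2_hol, Cmod_qpar_lt_1, H. Qed.

(** * Transformation of eta and Delta under S and T *)

Lemma upper_near (tau : C) : 0 < Im tau ->
  forall w, Cmod (w - tau) < Im tau -> 0 < Im w.
Proof.
  intros H w Hw. assert (A := Rle_lt_trans _ _ _ (im_le_Cmod _) Hw).
  rewrite im_minus in A. apply Rabs_def2 in A. lra.
Qed.

Lemma E4_hol (tau : C) : 0 < Im tau -> hol E4 tau.
Proof.
  intros H. apply (hol_ext_loc (fun tau => e4 (qpar tau)) _ _ (Im tau) H).
  - intros w Hw. symmetry. apply E4_e4. now apply (upper_near tau).
  - apply (hol_comp e4); [apply hol_qpar|]. apply e4_hol, Cmod_qpar_lt_1, H.
Qed.

Lemma upper_segment (a b : C) (t : R) : 0 < Im a -> 0 < Im b -> 0 <= t <= 1 ->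
  0 < Im (a + RtoC t * (b - a)).
Proof. intros. rewrite im_plus, im_scal_l, im_minus. nra. Qed.

Lemma upper_constant (f : C -> C) (a b : C) : (forall z, 0 < Im z -> cderiv f z 0) ->
  0 < Im a -> 0 < Im b -> f a = f b.
Proof.
  intros H Ha Hb. apply Ceq_minus, Cmod_eq_0, Rle_antisym; [|apply Cmod_ge_0].
  rewrite Cmod_sub_sym. apply Rle_trans with (0 * Cmod (b - a)); [|lra].
  apply mean_value_segment with (fun _ => RtoC 0).
  - intros t Ht. apply H. now apply upper_segment.
  - intros. rewrite Cmod_0. lra.
Qed.

Lemma cderiv_S (tau : C) : tau <> 0 -> cderiv (fun t => - / t)%C tau (/ tau ^ 2)%C.
Proof.
  intros H. eapply cderiv_eq; [apply cderiv_opp, cderiv_inv; [apply cderiv_id|exact H]|].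
  cbv beta. field. exact H.
Qed.

(** The quotient [G] is constant: the additive term of [E2_S] is matched by the logarithmic
    derivative of [t^2]. At [i], which [S] fixes, its value is [1 / i^2 = -1]. The fourth power
    avoids choosing a square root of [tau]. *)
Lemma eta_S (tau : C) : 0 < Im tau -> (eta (- / tau) ^ 4)%C = (- tau ^ 2 * eta tau ^ 4)%C.
Proof.
  intros H.
  assert (Hpi : RtoC PI <> 0) by (intros E; apply RtoC_inj in E; generalize PI_RGT_0; lra).
  set (G := fun t => (eta (- / t) ^ 4 / (t ^ 2 * eta t ^ 4))%C).
  assert (HG : forall z, 0 < Im z -> cderiv G z 0).
  { intros z Hz. assert (Hz' := Im_S z Hz). assert (Hz0 : z <> 0) by (apply Im_nz; lra).
    assert (N1 := eta_nz z Hz). assert (N2 := eta_nz _ Hz').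
    eapply cderiv_eq.
    - apply cderiv_div.
      + apply (cderiv_pow (fun t => eta (- / t)) 3).
        apply (cderiv_comp eta (fun t => - / t)%C); [now apply cderiv_S|now apply eta_cderiv].
      + apply cderiv_mult; [apply (cderiv_pow (fun t => t) 1), cderiv_id|].
        apply (cderiv_pow eta 3), eta_cderiv, Hz.
      + apply Cmult_neq_0; now apply Cpow_nz.
    - cbv beta. rewrite (E2_S z Hz).
      replace (INR 4) with 4 by (simpl; ring). replace (INR 2) with 2 by (simpl; ring).
      field. repeat split; assumption || apply Ci_nz. }
  assert (Hi : 0 < Im Ci) by (simpl; lra).
  assert (E := upper_constant G tau Ci HG H Hi). unfold G in E.
  assert (Hi2 : (- / Ci)%C = Ci) by (rewrite Ci_inv; ring).
  rewrite Hi2 in E.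
  assert (Hz0 : tau <> 0) by (apply Im_nz; lra). assert (N1 := eta_nz tau H).
  assert (Hii : (Ci ^ 2)%C = (- (1))%C) by (apply C_ext; simpl; ring).
  rewrite Hii in E.
  replace (eta (- / tau) ^ 4)%C with (eta (- / tau) ^ 4 / (tau ^ 2 * eta tau ^ 4) * (tau ^ 2 * eta tau ^ 4))%C
    by (field; split; assumption).
  rewrite E. field. apply eta_nz, Hi.
Qed.

Lemma qpar_T (tau : C) : qpar (tau + 1) = qpar tau.
Proof. rewrite qpar_plus, qpar_1. ring. Qed.

Lemma E2_T (tau : C) : E2 (tau + 1) = E2 tau.
Proof. unfold E2. now rewrite qpar_T. Qed.

Lemma im_T (tau : C) : Im (tau + 1) = Im tau.
Proof. rewrite im_plus, im_RtoC. ring. Qed.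

Lemma E4_T (tau : C) : 0 < Im tau -> E4 (tau + 1) = E4 tau.
Proof. intros H. rewrite !E4_e4, qpar_T; auto. now rewrite im_T. Qed.

Lemma eta_T (tau : C) : eta (tau + 1) = (Cexp (2 * PI * Ci / 24) * eta tau)%C.
Proof.
  rewrite !eta_euler, qpar_T. unfold eta_root.
  replace (2 * PI * Ci * (tau + 1) / 24)%C with (2 * PI * Ci / 24 + 2 * PI * Ci * tau / 24)%C by field.
  rewrite Cexp_plus. ring.
Qed.

Lemma Delta_T (tau : C) : Defs.Delta (tau + 1) = Defs.Delta tau.
Proof.
  unfold Defs.Delta. rewrite eta_T, Cpow_mult_l, <- Cexp_INR_mult.
  replace (INR 24 * (2 * PI * Ci / 24))%C with (2 * PI * Ci * 1)%C.
  - rewrite (Cexp_2PI_Z 1). ring.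
  - rewrite INR_IZR_INZ. simpl Z.of_nat. field.
Qed.

Lemma Delta_S (tau : C) : 0 < Im tau -> Defs.Delta (- / tau) = (tau ^ 12 * Defs.Delta tau)%C.
Proof.
  intros H. unfold Defs.Delta. replace 24%nat with (4 * 6)%nat by reflexivity.
  rewrite !Cpow_mult_r, (eta_S tau H). ring.
Qed.

Lemma Delta_nz (tau : C) : 0 < Im tau -> Defs.Delta tau <> 0.
Proof. intros. now apply Cpow_nz, eta_nz. Qed.

Lemma Delta_cderiv (tau : C) : 0 < Im tau -> cderiv Defs.Delta tau (2 * PI * Ci * (Defs.Delta tau * E2 tau))%C.
Proof.
  intros H. eapply cderiv_eq; [apply (cderiv_pow eta 23), eta_cderiv, H|].
  unfold Defs.Delta. rewrite INR_IZR_INZ. simpl Z.of_nat. simpl (eta tau ^ 24)%C. simpl (eta tau ^ 23)%C. field.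
Qed.

Lemma Delta_euler (tau : C) : Defs.Delta tau = (qpar tau * euler (qpar tau) ^ 24)%C.
Proof.
  unfold Defs.Delta. rewrite eta_euler, Cpow_mult_l. f_equal.
  unfold eta_root. rewrite <- Cexp_INR_mult. unfold qpar. f_equal.
  rewrite INR_IZR_INZ. simpl Z.of_nat. field.
Qed.

Lemma Delta_hol (tau : C) : 0 < Im tau -> hol Defs.Delta tau.
Proof. intros. now apply (hol_pow eta), eta_hol. Qed.

(** * The modular group and its fundamental domain *)

(** Equality on Z is decidable, so any two proofs of the determinant equation coincide. *)
Lemma SL2Z_ext (g h : SL2Z) : sl_a g = sl_a h -> sl_b g = sl_b h -> sl_c g = sl_c h ->
  sl_d g = sl_d h -> g = h.
Proof.
  destruct g as [a b c d e], h as [a' b' c' d' e']; simpl. intros -> -> -> ->.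
  f_equal. apply Eqdep_dec.UIP_dec, Z.eq_dec.
Qed.

Lemma SL2Z_1_det : (1 * 1 - 0 * 0 = 1)%Z.
Proof. reflexivity. Qed.
Lemma SL2Z_T_det (k : Z) : (1 * 1 - k * 0 = 1)%Z.
Proof. ring. Qed.
Lemma SL2Z_S_det : (0 * 0 - (-1) * 1 = 1)%Z.
Proof. reflexivity. Qed.

Definition SL2Z_1 : SL2Z := mkSL2Z 1 0 0 1 SL2Z_1_det.
Definition SL2Z_T (k : Z) : SL2Z := mkSL2Z 1 k 0 1 (SL2Z_T_det k).
Definition SL2Z_S : SL2Z := mkSL2Z 0 (-1) 1 0 SL2Z_S_det.

Lemma SL2Z_inv_det (g : SL2Z) : (sl_d g * sl_a g - (- sl_b g) * (- sl_c g) = 1)%Z.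
Proof. rewrite <- (sl_det g). ring. Qed.

Definition SL2Z_inv (g : SL2Z) : SL2Z := mkSL2Z _ _ _ _ (SL2Z_inv_det g).

(** Euclid's algorithm on the first column: a power of [T] reduces [a] modulo [c] and [S] exchanges
    the rows, until [c = 0]. The sign that may remain is [S^2]. *)
Lemma SL2Z_generated (P : SL2Z -> Prop) : P SL2Z_1 ->
  (forall g, P g -> P (SL2Z_mul (SL2Z_T 1) g)) ->
  (forall g, P g -> P (SL2Z_mul (SL2Z_T (-1)) g)) ->
  (forall g, P g -> P (SL2Z_mul SL2Z_S g)) -> forall g, P g.
Proof.
  intros H1 HT HT' HS.
  assert (HTn : forall (n : nat) g, P g -> P (SL2Z_mul (SL2Z_T (Z.of_nat n)) g) /\ P (SL2Z_mul (SL2Z_T (- Z.of_nat n)) g)).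
  { induction n; intros g Hg.
    - split; [replace (SL2Z_mul (SL2Z_T (Z.of_nat 0)) g) with g|replace (SL2Z_mul (SL2Z_T (- Z.of_nat 0)) g) with g];
        auto; apply SL2Z_ext; cbn [SL2Z_mul SL2Z_T sl_a sl_b sl_c sl_d]; lia.
    - destruct (IHn g Hg) as [A B]. apply HT in A. apply HT' in B. rewrite Nat2Z.inj_succ. split.
      + replace (SL2Z_mul (SL2Z_T (Z.succ (Z.of_nat n))) g)
          with (SL2Z_mul (SL2Z_T 1) (SL2Z_mul (SL2Z_T (Z.of_nat n)) g)); auto.
        apply SL2Z_ext; cbn [SL2Z_mul SL2Z_T sl_a sl_b sl_c sl_d]; ring.
      + replace (SL2Z_mul (SL2Z_T (- Z.succ (Z.of_nat n))) g)
          with (SL2Z_mul (SL2Z_T (-1)) (SL2Z_mul (SL2Z_T (- Z.of_nat n)) g)); auto.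
        apply SL2Z_ext; cbn [SL2Z_mul SL2Z_T sl_a sl_b sl_c sl_d]; ring. }
  assert (HTk : forall k g, P g -> P (SL2Z_mul (SL2Z_T k) g)).
  { intros k g Hg. destruct (Z_le_dec 0 k).
    - rewrite <- (Z2Nat.id k) by assumption. now apply HTn.
    - replace k with (- Z.of_nat (Z.to_nat (- k)))%Z by (rewrite Z2Nat.id; lia). now apply HTn. }
  assert (H : forall n g, (Z.abs_nat (sl_c g) < n)%nat -> P g).
  { induction n; intros g Hn; [lia|].
    destruct (Z.eq_dec (sl_c g) 0) as [Hc|Hc].
    - assert (Hdet := sl_det g). rewrite Hc in Hdet.
      assert (Had : (sl_a g = 1 /\ sl_d g = 1 \/ sl_a g = -1 /\ sl_d g = -1)%Z).
      { assert (sl_a g * sl_d g = 1)%Z by lia.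
        destruct (Z.mul_eq_1 (sl_a g) (sl_d g)) as [E|E]; [assumption|left|right]; rewrite E in *; lia. }
      destruct Had as [[Ea Ed]|[Ea Ed]].
      + replace g with (SL2Z_mul (SL2Z_T (sl_b g)) SL2Z_1); [now apply HTk|].
        apply SL2Z_ext; cbn [SL2Z_mul SL2Z_T SL2Z_1 sl_a sl_b sl_c sl_d]; lia.
      + replace g with (SL2Z_mul (SL2Z_T (- sl_b g)) (SL2Z_mul SL2Z_S (SL2Z_mul SL2Z_S SL2Z_1)));
          [now apply HTk, HS, HS|].
        apply SL2Z_ext; cbn [SL2Z_mul SL2Z_T SL2Z_S SL2Z_1 sl_a sl_b sl_c sl_d]; lia.
    - set (k := (sl_a g / sl_c g)%Z). set (g' := SL2Z_mul (SL2Z_T (- k)) g).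
      set (g'' := SL2Z_mul SL2Z_S g').
      assert (Hg'' : P g'').
      { apply IHn. unfold g'', g'. cbn [SL2Z_mul SL2Z_T SL2Z_S sl_a sl_b sl_c sl_d].
        assert (E := Z_div_mod_eq_full (sl_a g) (sl_c g)). fold k in E.
        assert (B := Z.mod_bound_abs (sl_a g) (sl_c g) Hc).
        replace (1 * (1 * sl_a g + - k * sl_c g) + 0 * (0 * sl_a g + 1 * sl_c g))%Z
          with (sl_a g mod sl_c g)%Z by lia. lia. }
      (* [S^3] is the inverse of [S], so [g] is recovered with the generators alone. *)
      replace g with (SL2Z_mul (SL2Z_T k) (SL2Z_mul SL2Z_S (SL2Z_mul SL2Z_S (SL2Z_mul SL2Z_S g'')))).
      + now apply HTk, HS, HS, HS.
      + apply SL2Z_ext; unfold g'', g'; cbn [SL2Z_mul SL2Z_T SL2Z_S sl_a sl_b sl_c sl_d]; lia. }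
  intros g. apply (H (S (Z.abs_nat (sl_c g)))). lia.
Qed.

Lemma automorphy_nz (g : SL2Z) (tau : C) : 0 < Im tau -> automorphy g tau <> 0.
Proof.
  intros H E. unfold automorphy in E.
  replace 0 with (IZR 0) in E by reflexivity.
  assert (Ei := f_equal Im E). rewrite im_plus, im_scal_l, !im_RtoC in Ei.
  assert (Hc : IZR (sl_c g) = 0) by nra. apply eq_IZR in Hc.
  rewrite Hc in E. assert (Er := f_equal Re E). rewrite re_plus, re_scal_l, !re_RtoC in Er.
  assert (Hd : IZR (sl_d g) = 0) by nra. apply eq_IZR in Hd.
  assert (D := sl_det g). rewrite Hc, Hd in D. lia.
Qed.

Lemma Im_mobius (g : SL2Z) (tau : C) : 0 < Im tau ->
  Im (mobius g tau) = Im tau / Cmod (automorphy g tau) ^ 2.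
Proof.
  intros H. assert (Hn := automorphy_nz g tau H). unfold mobius.
  assert (Hp : 0 < Cmod (automorphy g tau) ^ 2) by (apply pow_lt, Cmod_gt_0, Hn).
  set (j := automorphy g tau) in *.
  assert (E : ((IZR (sl_a g) * tau + IZR (sl_b g)) / j)%C =
    ((IZR (sl_a g) * tau + IZR (sl_b g)) * Cconj j * RtoC (/ (Cmod j ^ 2)))%C).
  { rewrite RtoC_inv, Cmod2_conj by lra.
    assert (Cconj j <> 0) by (apply Cmod_gt_0; rewrite Cmod_conj; now apply Cmod_gt_0).
    field. split; assumption. }
  rewrite E, im_scal_r. unfold Rdiv. f_equal.
  unfold j, automorphy. rewrite im_mult.
  unfold Cconj. destruct tau as [x y]. simpl.
  assert (D := f_equal IZR (sl_det g)). rewrite minus_IZR, !mult_IZR in D. simpl in D.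
  transitivity ((IZR (sl_a g) * IZR (sl_d g) - IZR (sl_b g) * IZR (sl_c g)) * y); [ring|rewrite D; ring].
Qed.

Lemma Im_mobius_pos (g : SL2Z) (tau : C) : 0 < Im tau -> 0 < Im (mobius g tau).
Proof.
  intros H. rewrite Im_mobius by assumption. apply Rdiv_lt_0_compat; [exact H|].
  apply pow_lt, Cmod_gt_0, automorphy_nz, H.
Qed.

Lemma automorphy_mul (g h : SL2Z) (tau : C) : 0 < Im tau ->
  automorphy (SL2Z_mul g h) tau = (automorphy g (mobius h tau) * automorphy h tau)%C.
Proof.
  intros H. assert (Hn := automorphy_nz h tau H). unfold mobius.
  set (j := automorphy h tau) in *. unfold automorphy at 1 2.
  cbn [SL2Z_mul sl_a sl_b sl_c sl_d]. rewrite !plus_IZR, !mult_IZR, !RtoC_plus, !RtoC_mult.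
  transitivity (IZR (sl_c g) * (IZR (sl_a h) * tau + IZR (sl_b h)) + IZR (sl_d g) * j)%C.
  - unfold j, automorphy. ring.
  - field. exact Hn.
Qed.

Lemma mobius_mul (g h : SL2Z) (tau : C) : 0 < Im tau ->
  mobius (SL2Z_mul g h) tau = mobius g (mobius h tau).
Proof.
  intros H. assert (Hn := automorphy_nz h tau H).
  assert (Hgh := automorphy_nz (SL2Z_mul g h) tau H).
  unfold mobius at 1 2. rewrite automorphy_mul in * by assumption.
  assert (Hg : automorphy g (mobius h tau) <> 0) by (intros E; apply Hgh; rewrite E; ring).
  set (jg := automorphy g (mobius h tau)) in *. unfold mobius.
  set (j := automorphy h tau) in *.
  cbn [SL2Z_mul sl_a sl_b sl_c sl_d]. rewrite !plus_IZR, !mult_IZR, !RtoC_plus, !RtoC_mult.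
  transitivity ((IZR (sl_a g) * (IZR (sl_a h) * tau + IZR (sl_b h)) + IZR (sl_b g) * j) / (jg * j))%C.
  - unfold j, automorphy. unfold Cdiv. f_equal. ring.
  - field. split; assumption.
Qed.

Lemma mobius_1 (tau : C) : mobius SL2Z_1 tau = tau.
Proof. unfold mobius, automorphy, SL2Z_1. simpl. field. Qed.

Lemma automorphy_1 (tau : C) : automorphy SL2Z_1 tau = 1.
Proof. unfold automorphy, SL2Z_1. simpl. ring. Qed.

Lemma mobius_T (k : Z) (tau : C) : mobius (SL2Z_T k) tau = (tau + IZR k)%C.
Proof. unfold mobius, automorphy, SL2Z_T. simpl. field. Qed.

Lemma automorphy_T (k : Z) (tau : C) : automorphy (SL2Z_T k) tau = 1.
Proof. unfold automorphy, SL2Z_T. simpl. ring. Qed.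

Lemma mobius_S (tau : C) : tau <> 0 -> mobius SL2Z_S tau = (- / tau)%C.
Proof. intros H. unfold mobius, automorphy, SL2Z_S. simpl. field. exact H. Qed.

Lemma automorphy_S (tau : C) : automorphy SL2Z_S tau = tau.
Proof. unfold automorphy, SL2Z_S. simpl. ring. Qed.

Lemma SL2Z_inv_l (g : SL2Z) : SL2Z_mul (SL2Z_inv g) g = SL2Z_1.
Proof.
  assert (D := sl_det g).
  apply SL2Z_ext; cbn [SL2Z_mul SL2Z_inv SL2Z_1 sl_a sl_b sl_c sl_d]; lia.
Qed.

Lemma SL2Z_equiv_trans (x y z : C) : 0 < Im z -> SL2Z_equiv x y -> SL2Z_equiv y z -> SL2Z_equiv x z.
Proof.
  intros H [g ->] [h ->]. exists (SL2Z_mul g h). now rewrite mobius_mul.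
Qed.

Lemma SL2Z_equiv_sym (x y : C) : 0 < Im y -> SL2Z_equiv x y -> SL2Z_equiv y x.
Proof.
  intros H [g ->]. exists (SL2Z_inv g). now rewrite <- mobius_mul, SL2Z_inv_l, mobius_1.
Qed.

(** A multiplier is only asserted to exist for each [g]; that these form a character is deduced
    later, in [eta4_character], from the absence of zeros. *)
Lemma modular_of_generators (f : C -> C) (w : nat) (chiT chiS : C) :
  chiT <> 0 -> chiS <> 0 ->
  (forall tau, 0 < Im tau -> f (tau + 1)%C = (chiT * f tau)%C) ->
  (forall tau, 0 < Im tau -> f (- / tau)%C = (chiS * tau ^ w * f tau)%C) ->
  forall g, exists c : C, c <> 0 /\
    forall tau, 0 < Im tau -> f (mobius g tau) = (c * automorphy g tau ^ w * f tau)%C.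
Proof.
  intros HcT HcS HT HS.
  assert (HT' : forall tau, 0 < Im tau -> f (tau + IZR (-1))%C = (/ chiT * f tau)%C).
  { intros tau H. assert (A := HT (tau + IZR (-1))%C).
    replace (tau + IZR (-1) + 1)%C with tau in A by ring.
    rewrite A; [field; exact HcT|]. rewrite im_plus, im_RtoC. lra. }
  apply SL2Z_generated.
  - exists 1. split; [apply C1_nz|]. intros tau H. rewrite mobius_1, automorphy_1, Cpow_1_l. ring.
  - intros g [c [Hc A]]. exists (chiT * c)%C. split; [now apply Cmult_neq_0|]. intros tau H.
    rewrite mobius_mul, automorphy_mul, mobius_T, automorphy_T by assumption.
    rewrite HT, A by (try apply Im_mobius_pos; assumption). rewrite Cmult_1_l. ring.
  - intros g [c [Hc A]]. exists (/ chiT * c)%C.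
    split; [apply Cmult_neq_0; [|exact Hc]; intros E; apply C1_nz; rewrite <- (Cinv_r chiT HcT), E; ring|].
    intros tau H.
    rewrite mobius_mul, automorphy_mul, mobius_T, automorphy_T by assumption.
    rewrite HT', A by (try apply Im_mobius_pos; assumption). rewrite Cmult_1_l. ring.
  - intros g [c [Hc A]]. exists (chiS * c)%C. split; [now apply Cmult_neq_0|]. intros tau H.
    assert (Hm := Im_mobius_pos g tau H).
    rewrite mobius_mul, automorphy_mul, mobius_S, automorphy_S by (try (apply Im_nz; lra); assumption).
    rewrite HS, A, Cpow_mult_l by assumption. ring.
Qed.

Lemma modular_of_generators_1 (f : C -> C) (w : nat) :
  (forall tau, 0 < Im tau -> f (tau + 1)%C = f tau) ->
  (forall tau, 0 < Im tau -> f (- / tau)%C = (tau ^ w * f tau)%C) ->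
  forall g tau, 0 < Im tau -> f (mobius g tau) = (automorphy g tau ^ w * f tau)%C.
Proof.
  intros HT HS. apply (SL2Z_generated (fun g => forall tau, 0 < Im tau ->
    f (mobius g tau) = (automorphy g tau ^ w * f tau)%C)).
  - intros tau H. rewrite mobius_1, automorphy_1, Cpow_1_l. ring.
  - intros g A tau H.
    rewrite mobius_mul, automorphy_mul, mobius_T, automorphy_T by assumption.
    rewrite HT, A, Cmult_1_l by (try apply Im_mobius_pos; assumption). reflexivity.
  - intros g A tau H.
    rewrite mobius_mul, automorphy_mul, mobius_T, automorphy_T by assumption.
    rewrite <- HT.
    + replace (mobius g tau + IZR (-1) + 1)%C with (mobius g tau) by ring.
      rewrite A, Cmult_1_l by assumption. reflexivity.
    + rewrite im_plus, im_RtoC. generalize (Im_mobius_pos g tau H). lra.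
  - intros g A tau H.
    assert (Hm := Im_mobius_pos g tau H).
    rewrite mobius_mul, automorphy_mul, mobius_S, automorphy_S by (try (apply Im_nz; lra); assumption).
    rewrite HS, A, Cpow_mult_l by assumption. ring.
Qed.

(** * Reduction to the fundamental domain *)

Definition fund_dom (tau : C) : Prop := 0 < Im tau /\ - / 2 <= Re tau <= / 2 /\ 1 <= Cmod tau.

Lemma list_argmin {A : Type} (l : list A) (f : A -> R) : l <> nil ->
  exists x, In x l /\ forall y, In y l -> f x <= f y.
Proof.
  induction l as [|a l IH]; intros H; [congruence|].
  destruct l as [|b l].
  - exists a. split; [now left|]. intros y [<-|[]]. lra.
  - destruct IH as [x [Hx Hm]]; [discriminate|].
    destruct (Rle_dec (f a) (f x)) as [Hle|Hle].
    + exists a. split; [now left|]. intros y [<-|Hy]; [lra|]. specialize (Hm y Hy). lra.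
    + exists x. split; [now right|]. intros y [<-|Hy]; [lra|auto].
Qed.

Definition lattice_norm (tau : C) (p : Z * Z) : R := Cmod (IZR (fst p) * tau + IZR (snd p)).

(** The vector [(0, 1)] has norm 1, and all vectors of norm at most 1 lie in a finite box, so a
    minimum over the box is a minimum over the lattice. *)
Lemma lattice_min (tau : C) : 0 < Im tau -> exists p, p <> (0, 0)%Z /\
  forall p', p' <> (0, 0)%Z -> lattice_norm tau p <= lattice_norm tau p'.
Proof.
  intros H.
  (* For norm at most 1, the imaginary part gives [|c| <= 1 / Im tau], and then the real part gives
     [|d| <= 1 + |Re tau| / Im tau]. *)
  set (K := up (/ Im tau + 1 + Rabs (Re tau) / Im tau)).
  assert (HK := archimed (/ Im tau + 1 + Rabs (Re tau) / Im tau)). fold K in HK.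
  assert (Hi : 0 < / Im tau) by now apply Rinv_0_lt_compat.
  assert (Hre := Rabs_pos (Re tau)).
  assert (Hrd : 0 <= Rabs (Re tau) / Im tau) by (apply Rdiv_le_0_compat; lra).
  assert (HK1 : (1 <= K)%Z) by (apply le_IZR; simpl; lra).
  set (range := map (fun n => (Z.of_nat n - K)%Z) (seq 0 (Z.to_nat (2 * K + 1)))).
  assert (Hr : forall z, (- K <= z <= K)%Z -> In z range).
  { intros z Hz. unfold range. apply in_map_iff. exists (Z.to_nat (z + K)). split; [lia|].
    apply in_seq. lia. }
  set (box := filter (fun p => negb (Z.eqb (fst p) 0 && Z.eqb (snd p) 0)) (list_prod range range)).
  assert (Hbox : forall p, p <> (0, 0)%Z -> (- K <= fst p <= K)%Z -> (- K <= snd p <= K)%Z -> In p box).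
  { intros [c d] Hp Hc Hd. apply filter_In. split; [apply in_prod; now apply Hr|]. simpl in *.
    destruct (Z.eqb_spec c 0), (Z.eqb_spec d 0); subst; auto. }
  assert (H01 : In (0, 1)%Z box) by (apply Hbox; simpl; [congruence|lia|lia]).
  destruct (list_argmin box (lattice_norm tau)) as [p [Hp Hm]].
  { intros E. rewrite E in H01. contradiction. }
  exists p. split.
  { intros ->. apply filter_In in Hp. destruct Hp as [_ Hp]. discriminate. }
  intros [c d] Hp'.
  destruct (Rle_dec (lattice_norm tau (c, d)) 1) as [Hle|Hgt].
  - apply Hm, Hbox; [exact Hp'| |]; simpl; unfold lattice_norm in Hle; simpl in Hle.
    + assert (A := Rle_trans _ _ _ (im_le_Cmod _) Hle). rewrite im_plus, im_scal_l, !im_RtoC, Rplus_0_r in A.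
      rewrite Rabs_mult, (Rabs_pos_eq (Im tau)) in A by lra.
      assert (B : Rabs (IZR c) <= / Im tau).
      { apply Rmult_le_reg_r with (Im tau); [lra|]. rewrite Rinv_l; lra. }
      apply Rabs_le_between in B. split; apply le_IZR; rewrite ?opp_IZR; lra.
    + assert (A := Rle_trans _ _ _ (im_le_Cmod _) Hle). rewrite im_plus, im_scal_l, !im_RtoC, Rplus_0_r in A.
      rewrite Rabs_mult, (Rabs_pos_eq (Im tau)) in A by lra.
      assert (B : Rabs (IZR c) <= / Im tau).
      { apply Rmult_le_reg_r with (Im tau); [lra|]. rewrite Rinv_l; lra. }
      assert (D := Rle_trans _ _ _ (re_le_Cmod _) Hle). rewrite re_plus, re_scal_l, !re_RtoC in D.
      assert (E : Rabs (IZR c * Re tau) <= Rabs (Re tau) / Im tau).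
      { rewrite Rabs_mult. unfold Rdiv. rewrite Rmult_comm. apply Rmult_le_compat_l; assumption. }
      apply Rabs_le_between in D. apply Rabs_le_between in E.
      split; apply le_IZR; rewrite ?opp_IZR; lra.
  - apply Rle_trans with 1; [|lra].
    eapply Rle_trans; [apply (Hm _ H01)|]. unfold lattice_norm. simpl.
    replace (0 * tau + 1)%C with (RtoC 1) by ring. rewrite Cmod_1. lra.
Qed.

(** A shortest vector [(c, d)] is primitive, hence the bottom row of some [g]. After a translation
    [|g tau|] is the quotient of the norm of the top row by the shortest norm, hence at least 1. *)
Lemma reduce_to_fund_dom (tau : C) : 0 < Im tau -> exists g, fund_dom (mobius g tau).
Proof.
  intros H. destruct (lattice_min tau H) as [[c d] [Hp Hm]].
  assert (Hcop : Z.gcd c d = 1%Z).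
  { assert (Hg0 := Z.gcd_nonneg c d). set (g := Z.gcd c d) in *.
    destruct (Z.gcd_divide_l c d) as [c' Ec]. destruct (Z.gcd_divide_r c d) as [d' Ed]. fold g in Ec, Ed.
    assert (Hg : g <> 0%Z) by (intros E; rewrite E in *; apply Hp; f_equal; lia).
    assert (Hp' : (c', d') <> (0, 0)%Z) by (intros E; injection E as -> ->; apply Hp; f_equal; lia).
    specialize (Hm _ Hp'). unfold lattice_norm in Hm. simpl in Hm.
    rewrite Ec, Ed in Hm.
    replace (IZR (c' * g) * tau + IZR (d' * g))%C with (IZR g * (IZR c' * tau + IZR d'))%C in Hm
      by (rewrite !mult_IZR, !RtoC_mult; ring).
    rewrite Cmod_mult, Cmod_R, Rabs_pos_eq in Hm by (apply IZR_le; lia).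
    assert (Hpos : 0 < Cmod (IZR c' * tau + IZR d')).
    { apply Cmod_gt_0. intros E. apply Hp'.
      assert (E' : (RtoC (IZR d') + RtoC (IZR c') * tau)%C = (IZR 0 + IZR 0 * tau)%C).
      { replace (IZR d' + IZR c' * tau)%C with (IZR c' * tau + IZR d')%C by ring. rewrite E. simpl. ring. }
      destruct (lattice_basis tau _ _ _ _ H E') as [A B]. apply eq_IZR in A, B. now rewrite A, B. }
    assert (Hg1 : IZR g <= 1) by nra. apply le_IZR in Hg1. lia. }
  destruct (Znumtheory.rel_prime_bezout c d) as [u v Huv].
  { unfold Znumtheory.rel_prime. rewrite <- Hcop. apply Znumtheory.Zgcd_is_gcd. }
  assert (Hdet : (v * d - (- u) * c = 1)%Z) by lia.
  set (g := mkSL2Z v (- u) c d Hdet).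
  destruct (nearest_integer (Re (mobius g tau))) as [m Hmr].
  exists (SL2Z_mul (SL2Z_T (- m)) g).
  assert (Hg := Im_mobius_pos g tau H).
  split; [now apply Im_mobius_pos|]. split.
  - rewrite mobius_mul, mobius_T, re_plus, re_RtoC, opp_IZR by exact H. lra.
  - set (g2 := SL2Z_mul (SL2Z_T (- m)) g).
    assert (Hj := automorphy_nz g2 tau H).
    unfold mobius. rewrite Cmod_div by exact Hj.
    apply Rmult_le_reg_r with (Cmod (automorphy g2 tau)); [now apply Cmod_gt_0|].
    unfold Rdiv. rewrite Rmult_assoc, Rinv_l, Rmult_1_r, Rmult_1_l
      by (apply Rgt_not_eq; now apply Cmod_gt_0).
    replace (Cmod (automorphy g2 tau)) with (lattice_norm tau (c, d)).
    + apply (Hm (sl_a g2, sl_b g2)). intros E.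
      assert (E1 : sl_a g2 = 0%Z) by exact (f_equal fst E).
      assert (E2 : sl_b g2 = 0%Z) by exact (f_equal snd E).
      assert (D := sl_det g2). rewrite E1, E2 in D. lia.
    + unfold lattice_norm, automorphy, g2, g. cbn [SL2Z_mul SL2Z_T sl_a sl_b sl_c sl_d fst snd].
      f_equal. f_equal; [f_equal|]; do 2 f_equal; lia.
Qed.

(** * Level one functions vanishing at the cusp *)

Definition cusp_zero (phi : C -> C) : Prop :=
  forall eps, 0 < eps -> exists Y, 0 < Y /\ forall tau, Y < Im tau -> Cmod (phi tau) < eps.

Lemma fund_dom_Im (tau : C) : fund_dom tau -> / 2 < Im tau.
Proof.
  intros [H [Hr Hm]]. assert (A := Cmod2_alt tau).
  assert (B : 1 <= Cmod tau ^ 2) by (rewrite <- (pow1 2); apply pow_incr; lra). nra.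
Qed.

(** Near the cusp [phi] is smaller than at [t0], so its modulus has a global maximum, attained in a
    rectangle. The maximal value then propagates from [z] to [z + (Im z / 2) i], until it
    contradicts the decay at the cusp. *)
Lemma level_one_zero (phi : C -> C) :
  (forall tau, 0 < Im tau -> hol phi tau) ->
  (forall tau, 0 < Im tau -> phi (tau + 1)%C = phi tau) ->
  (forall tau, 0 < Im tau -> phi (- / tau)%C = phi tau) ->
  cusp_zero phi -> forall tau, 0 < Im tau -> phi tau = 0.
Proof.
  intros Hh HT HS Hcusp.
  assert (Hinv : forall g tau, 0 < Im tau -> phi (mobius g tau) = phi tau).
  { intros g tau H. rewrite (modular_of_generators_1 phi 0 HT); [simpl; ring| |exact H].
    intros t Ht. rewrite HS by exact Ht. simpl. ring. }
  intros tau0 Htau0. apply NNPP. intros Hne.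
  destruct (reduce_to_fund_dom tau0 Htau0) as [g0 Hg0]. rewrite <- (Hinv g0 tau0 Htau0) in Hne.
  set (t0 := mobius g0 tau0) in *.
  assert (Heps : 0 < Cmod (phi t0)) by now apply Cmod_gt_0.
  destruct (Hcusp _ Heps) as [Y [HY Hsmall]].
  assert (Ht0 := fund_dom_Im t0 Hg0).
  assert (Ht0Y : Im t0 <= Y).
  { destruct (Rle_dec (Im t0) Y) as [Hle|Hgt]; [exact Hle|].
    assert (Hlt : Y < Im t0) by lra. specialize (Hsmall t0 Hlt). lra. }
  destruct (rectangle_max (- / 2) (/ 2) (/ 2) Y (fun x y => Cmod (phi (x, y)))) as [x1 [y1 [Hx1 [Hy1 Hmax]]]];
    [lra|lra| |].
  { intros x y Hx Hy eps He. destruct (hol_ccont phi (x, y) (Hh (x, y) ltac:(simpl; lra)) eps He) as [d [Hd Hw]].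
    exists (d / 2). split; [lra|]. intros u v Hu Hv Hux Hvy.
    assert (A : Cmod ((u, v) - (x, y)) < d).
    { eapply Rle_lt_trans; [apply Cmod_le_re_im|]. simpl. fold (u - x) (v - y). lra. }
    specialize (Hw _ A). apply Rabs_def1.
    - generalize (Cmod_reverse_triangle (phi (u, v)) (phi (x, y))). lra.
    - generalize (Cmod_reverse_triangle (phi (x, y)) (phi (u, v))). rewrite Cmod_sub_sym. lra. }
  set (M := Cmod (phi (x1, y1))) in *.
  assert (HM0 : Cmod (phi t0) <= M).
  { rewrite (surjective_pairing t0). apply Hmax; [apply Hg0|]. change (snd t0) with (Im t0). lra. }
  assert (Hglob : forall tau, 0 < Im tau -> Cmod (phi tau) <= M).
  { intros tau H. destruct (reduce_to_fund_dom tau H) as [g Hg]. rewrite <- (Hinv g tau H).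
    assert (Hg2 := fund_dom_Im _ Hg).
    destruct (Rle_dec (Im (mobius g tau)) Y) as [Hle|Hgt].
    - rewrite (surjective_pairing (mobius g tau)). apply Hmax; [apply Hg|].
      change (snd (mobius g tau)) with (Im (mobius g tau)). lra.
    - left. eapply Rlt_le_trans; [apply Hsmall; lra|exact HM0]. }
  (* The height is multiplied by 3/2 each time; growth by [y1 / 2] per step is enough. *)
  assert (Hclimb : forall n : nat, exists z, y1 * (1 + INR n / 2) <= Im z /\ Cmod (phi z) = M).
  { induction n.
    - exists (x1, y1). simpl. split; [lra|reflexivity].
    - destruct IHn as [z [Hz HzM]].
      assert (Hn := pos_INR n). assert (Hzp : 0 < Im z) by nra.
      exists (z + RtoC (Im z / 2) * Ci)%C. split.
      + rewrite im_plus, im_scal_l. simpl (Im Ci). rewrite S_INR. nra.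
      + rewrite <- HzM. apply (max_modulus_circle phi (C_derive phi) z (Im z)); [lra| |].
        * apply hol_disc. intros w Hw. apply Hh. now apply (upper_near z).
        * intros w Hw. rewrite HzM. apply Hglob. now apply (upper_near z). }
  destruct (INR_unbounded (2 * Y / y1)) as [n Hn].
  destruct (Hclimb n) as [z [Hz HzM]].
  assert (A : Y < Im z).
  { eapply Rlt_le_trans; [|exact Hz].
    apply (Rmult_lt_compat_r (y1 / 2)) in Hn; [|lra].
    replace (2 * Y / y1 * (y1 / 2)) with Y in Hn by (field; lra). nra. }
  specialize (Hsmall z A). lra.
Qed.

Lemma cusp_zero_of_nome (phi : C -> C) (d K : R) : 0 < d ->
  (forall tau, 0 < Im tau -> Cmod (qpar tau) < d -> Cmod (phi tau) <= K * Cmod (qpar tau)) ->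
  cusp_zero phi.
Proof.
  intros Hd H eps He.
  set (K' := Rabs K + 1). assert (HK : 0 < K') by (unfold K'; generalize (Rabs_pos K); lra).
  set (m := Rmin d (eps / K')).
  assert (Hm : 0 < m) by (apply Rmin_glb_lt; [lra|now apply Rdiv_lt_0_compat]).
  assert (Hpi := PI_RGT_0).
  exists (/ m / (2 * PI)). assert (Him : 0 < / m) by now apply Rinv_0_lt_compat.
  split; [apply Rdiv_lt_0_compat; lra|]. intros tau Ht.
  assert (Htau : 0 < Im tau).
  { eapply Rlt_trans; [|exact Ht]. apply Rdiv_lt_0_compat; lra. }
  assert (Hq : Cmod (qpar tau) < m).
  { rewrite Cmod_qpar, exp_Ropp. rewrite <- (Rinv_inv m).
    apply (Rmult_lt_compat_l (2 * PI)) in Ht; [|lra].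
    replace (2 * PI * (/ m / (2 * PI))) with (/ m) in Ht by (field; lra).
    apply Rinv_lt_contravar.
    - apply Rmult_lt_0_compat; [lra|apply exp_pos].
    - eapply Rlt_le_trans; [exact Ht|]. generalize (exp_ineq1_le (2 * PI * Im tau)). lra. }
  assert (H1 := Rlt_le_trans _ _ _ Hq (Rmin_l _ _)). assert (H2 := Rlt_le_trans _ _ _ Hq (Rmin_r _ _)).
  eapply Rle_lt_trans; [apply H; assumption|].
  apply (Rmult_lt_compat_l K') in H2; [|exact HK].
  replace (K' * (eps / K')) with eps in H2 by (field; lra).
  assert (K <= K') by (unfold K'; generalize (Rle_abs K); lra).
  generalize (Cmod_ge_0 (qpar tau)). nra.
Qed.

Lemma zero_linear_bound (g : C -> C) : hol g 0 -> g 0 = 0 ->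
  exists d K, 0 < d /\ 0 < K /\ forall q, Cmod q < d -> Cmod (g q) <= K * Cmod q.
Proof.
  intros Hh H0. assert (Hc := hol_cderiv g 0 Hh). destruct (Hc 1 Rlt_0_1) as [d [Hd H]].
  exists d, (Cmod (C_derive g 0) + 1). split; [exact Hd|].
  split; [generalize (Cmod_ge_0 (C_derive g 0)); lra|]. intros q Hq.
  specialize (H q). replace (q - 0)%C with q in H by ring. specialize (H Hq).
  rewrite H0 in H.
  replace (g q) with ((g q - 0 - C_derive g 0 * q) + C_derive g 0 * q)%C by ring.
  eapply Rle_trans; [apply Cmod_triangle|]. rewrite Cmod_mult. lra.
Qed.

Lemma euler_0 : euler 0 = 1.
Proof.
  assert (H : Cmod 0 < 1) by (rewrite Cmod_0; lra).
  apply (cconv_unique _ _ _ (euler_cconv 0 H)).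
  eapply cconv_ext; [|apply cconv_const]. intros n. simpl. induction n; [reflexivity|].
  cbn [euler_partial]. rewrite <- IHn. simpl. ring.
Qed.

Lemma Cmod_0_lt_1 : Cmod 0 < 1.
Proof. rewrite Cmod_0. lra. Qed.

(** * Ramanujan's differential equations *)

Definition c2pi : C := (2 * PI * Ci)%C.

Lemma c2pi_nz : c2pi <> 0.
Proof.
  assert (RtoC PI <> 0) by (intros E; apply RtoC_inj in E; generalize PI_RGT_0; lra).
  unfold c2pi. repeat apply Cmult_neq_0; auto using Ci_nz. intros E; apply RtoC_inj in E; lra.
Qed.

Definition qderiv (f : C -> C) (tau : C) : C := (C_derive f tau / c2pi)%C.

Lemma qderiv_cderiv (f : C -> C) (tau : C) : hol f tau -> cderiv f tau (c2pi * qderiv f tau)%C.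
Proof.
  intros H. eapply cderiv_eq; [now apply hol_cderiv|]. unfold qderiv. field. apply c2pi_nz.
Qed.

Lemma qderiv_eq (f : C -> C) (tau d : C) : cderiv f tau (c2pi * d)%C -> qderiv f tau = d.
Proof.
  intros H. unfold qderiv. rewrite (cderiv_C_derive _ _ _ H). field. apply c2pi_nz.
Qed.

Lemma qderiv_hol (f : C -> C) (tau : C) : hol f tau -> hol (qderiv f) tau.
Proof. intros H. apply hol_mult; [now apply hol_C_derive|apply hol_const]. Qed.

Lemma qderiv_T (f : C -> C) (tau : C) : (forall t, 0 < Im t -> hol f t) ->
  (forall t, 0 < Im t -> f (t + 1)%C = f t) -> 0 < Im tau -> qderiv f (tau + 1) = qderiv f tau.
Proof.
  intros Hh HT H. symmetry. apply qderiv_eq.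
  apply (cderiv_ext_loc (fun t => f (t + 1)%C) f tau _ (Im tau) H).
  - intros w Hw. apply HT. now apply (upper_near tau).
  - eapply cderiv_eq; [apply (cderiv_comp f (fun t => t + 1)%C)|].
    + apply cderiv_plus; [apply cderiv_id|apply cderiv_const].
    + apply qderiv_cderiv, Hh. now rewrite im_T.
    + ring.
Qed.

Lemma qderiv_S (f G : C -> C) (g tau : C) : (forall t, 0 < Im t -> hol f t) ->
  (forall t, 0 < Im t -> f (- / t)%C = G t) -> 0 < Im tau ->
  cderiv G tau (c2pi * g)%C -> qderiv f (- / tau) = (tau ^ 2 * g)%C.
Proof.
  intros Hh HS H Hg. assert (Ht0 : tau <> 0) by (apply Im_nz; lra).
  assert (A : cderiv G tau ((c2pi * qderiv f (- / tau)) * / tau ^ 2)%C).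
  { apply (cderiv_ext_loc (fun t => f (- / t)%C) G tau _ (Im tau) H).
    - intros w Hw. apply HS. now apply (upper_near tau).
    - apply (cderiv_comp f (fun t => - / t)%C); [now apply cderiv_S|].
      apply qderiv_cderiv, Hh. now apply Im_S. }
  assert (B := cderiv_unique _ _ _ _ A Hg).
  replace (qderiv f (- / tau)) with (/ c2pi * tau ^ 2 * (c2pi * qderiv f (- / tau) * / tau ^ 2))%C
    by (field; split; [exact Ht0|apply c2pi_nz]).
  rewrite B. field. apply c2pi_nz.
Qed.

(** This is -3 times the Serre derivative [D E4 - E2 E4 / 3], written in the nome: it has weight 6
    and constant term 1. *)
Definition e6 (q : C) : C := (e2 q * e4 q - 3 * (q * C_derive e4 q))%C.
Definition E6 (tau : C) : C := e6 (qpar tau).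

Lemma hol_q_derive (f : C -> C) (q : C) : hol f q -> hol (fun q => q * C_derive f q)%C q.
Proof. intros. apply hol_mult; [apply hol_id|now apply hol_C_derive]. Qed.

Lemma e6_hol (q : C) : Cmod q < 1 -> hol e6 q.
Proof.
  intros H. apply hol_minus; [apply hol_mult; [now apply e2_hol|now apply e4_hol]|].
  apply hol_scal, hol_q_derive, e4_hol, H.
Qed.

Lemma E6_hol (tau : C) : 0 < Im tau -> hol E6 tau.
Proof. intros H. apply (hol_comp e6); [apply hol_qpar|]. apply e6_hol, Cmod_qpar_lt_1, H. Qed.

Lemma qderiv_nome (F f : C -> C) (tau : C) : 0 < Im tau ->
  (forall t, 0 < Im t -> F t = f (qpar t)) -> hol f (qpar tau) ->
  qderiv F tau = (qpar tau * C_derive f (qpar tau))%C.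
Proof.
  intros H HF Hf. apply qderiv_eq.
  apply (cderiv_ext_loc (fun t => f (qpar t)) F tau _ (Im tau) H).
  - intros w Hw. symmetry. apply HF. now apply (upper_near tau).
  - eapply cderiv_eq; [apply (cderiv_comp f qpar); [apply cderiv_qpar|now apply hol_cderiv]|].
    unfold c2pi. ring.
Qed.

Lemma qderiv_E2_nome (tau : C) : 0 < Im tau -> qderiv E2 tau = (qpar tau * C_derive e2 (qpar tau))%C.
Proof. intros H. apply qderiv_nome; auto. apply e2_hol, Cmod_qpar_lt_1, H. Qed.

Lemma qderiv_E4_nome (tau : C) : 0 < Im tau -> qderiv E4 tau = (qpar tau * C_derive e4 (qpar tau))%C.
Proof. intros H. apply qderiv_nome; auto using E4_e4. apply e4_hol, Cmod_qpar_lt_1, H. Qed.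

Lemma qderiv_E6_nome (tau : C) : 0 < Im tau -> qderiv E6 tau = (qpar tau * C_derive e6 (qpar tau))%C.
Proof. intros H. apply qderiv_nome; auto. apply e6_hol, Cmod_qpar_lt_1, H. Qed.

Lemma E6_eq (tau : C) : 0 < Im tau -> E6 tau = (E2 tau * E4 tau - 3 * qderiv E4 tau)%C.
Proof. intros H. now rewrite qderiv_E4_nome, E4_e4. Qed.

Lemma qderiv_E2_S (tau : C) : 0 < Im tau ->
  qderiv E2 (- / tau) = (tau ^ 2 * (2 * tau * E2 tau / c2pi + tau ^ 2 * qderiv E2 tau + 12 / c2pi ^ 2))%C.
Proof.
  intros H. apply (qderiv_S E2 (fun t => t ^ 2 * E2 t + 12 * t / c2pi)%C); auto using E2_hol.
  - intros t Ht. apply E2_S, Ht.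
  - eapply cderiv_eq.
    + apply cderiv_plus; [apply cderiv_mult; [apply (cderiv_pow (fun t => t) 1), cderiv_id|
        now apply qderiv_cderiv, E2_hol]|].
      apply cderiv_mult; [apply cderiv_scal, cderiv_id|apply cderiv_const].
    + cbv beta. replace (INR 2) with 2 by (simpl; ring). field. apply c2pi_nz.
Qed.

Lemma qderiv_weight_S (f : C -> C) (w : nat) (tau : C) : (forall t, 0 < Im t -> hol f t) ->
  (forall t, 0 < Im t -> f (- / t)%C = (t ^ S w * f t)%C) -> 0 < Im tau ->
  qderiv f (- / tau) = (tau ^ 2 * (INR (S w) * tau ^ w * f tau / c2pi + tau ^ S w * qderiv f tau))%C.
Proof.
  intros Hh HS H. apply (qderiv_S f (fun t => t ^ S w * f t)%C); auto.
  eapply cderiv_eq.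
  - apply cderiv_mult; [apply (cderiv_pow (fun t => t) w), cderiv_id|now apply qderiv_cderiv, Hh].
  - cbv beta. field. apply c2pi_nz.
Qed.

Lemma E6_S (tau : C) : 0 < Im tau -> E6 (- / tau) = (tau ^ 6 * E6 tau)%C.
Proof.
  intros H. rewrite !E6_eq by (try apply Im_S; assumption).
  rewrite E2_S, E4_S, (qderiv_weight_S E4 3) by auto using E4_hol, E4_S.
  change (2 * PI * Ci)%C with c2pi. replace (INR 4) with 4 by (simpl; ring). field. apply c2pi_nz.
Qed.

Lemma E6_T (tau : C) : E6 (tau + 1) = E6 tau.
Proof. unfold E6. now rewrite qpar_T. Qed.

(** Cubing makes the weights 4 and 8 multiples of 12. Then [Phi^3 / Delta^k] has weight 0 and
    vanishes at the cusp, since [Phi^3] has order at least 3 there and [Delta^k] order [k <= 2]. *)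
Lemma cusp_form_zero (Phi g : C -> C) (w k : nat) : (1 <= k <= 2)%nat -> (w * 3 = 12 * k)%nat ->
  (forall tau, 0 < Im tau -> hol Phi tau) ->
  (forall tau, 0 < Im tau -> Phi (tau + 1)%C = Phi tau) ->
  (forall tau, 0 < Im tau -> Phi (- / tau)%C = (tau ^ w * Phi tau)%C) ->
  (forall tau, 0 < Im tau -> Phi tau = g (qpar tau)) -> hol g 0 -> g 0 = 0 ->
  forall tau, 0 < Im tau -> Phi tau = 0.
Proof.
  intros Hk Hw Hh HT HS Hg Hgh Hg0 tau H.
  assert (A : (Phi tau ^ 3 / Defs.Delta tau ^ k)%C = 0).
  { apply (level_one_zero (fun t => Phi t ^ 3 / Defs.Delta t ^ k)%C); [| | | |exact H].
    - intros t Ht. apply hol_div; [now apply hol_pow, Hh|now apply hol_pow, Delta_hol|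
        now apply Cpow_nz, Delta_nz].
    - intros t Ht. now rewrite HT, Delta_T.
    - intros t Ht. rewrite HS, Delta_S by assumption.
      assert (Ht0 : t <> 0) by (apply Im_nz; lra). assert (HD := Delta_nz t Ht).
      rewrite !Cpow_mult_l, <- !Cpow_mult_r, Hw. field. split; apply Cpow_nz; assumption.
    - destruct (zero_linear_bound g Hgh Hg0) as [d1 [K [Hd1 [HK Hb]]]].
      destruct (ccont_away euler 0 0 (hol_ccont _ _ (euler_hol 0 Cmod_0_lt_1))) as [d2 [Hd2 He]].
      { rewrite euler_0. apply C1_nz. }
      apply (cusp_zero_of_nome _ (Rmin d1 d2) (K ^ 3 * (2 ^ 24) ^ k)); [apply Rmin_glb_lt; lra|].
      intros t Ht Hq. assert (Hq1 := Rlt_le_trans _ _ _ Hq (Rmin_l _ _)).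
      assert (Hq2 := Rlt_le_trans _ _ _ Hq (Rmin_r _ _)).
      assert (Hql := Cmod_qpar_lt_1 t Ht).
      assert (HP : / 2 <= Cmod (euler (qpar t))).
      { specialize (He (qpar t)). rewrite euler_0 in He.
        replace (1 - 0)%C with (RtoC 1) in He by ring. rewrite Cmod_1 in He.
        replace (euler (qpar t)) with (euler (qpar t) - 0)%C by ring.
        eapply Rle_trans; [|apply He]; [lra|]. now replace (qpar t - 0)%C with (qpar t) by ring. }
      rewrite Cmod_div by now apply Cpow_nz, Delta_nz.
      rewrite (Hg t Ht), !Cmod_pow, Delta_euler, Cmod_mult, Cmod_pow.
      specialize (Hb _ Hq1). set (x := Cmod (qpar t)) in *. set (P := Cmod (euler (qpar t))) in *.
      assert (HG := Cmod_ge_0 (g (qpar t))). set (G := Cmod (g (qpar t))) in *.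
      assert (HP24 : 0 < P ^ 24) by (apply pow_lt; lra).
      assert (HPi : / P ^ 24 <= 2 ^ 24).
      { rewrite <- pow_inv. apply pow_incr. split; [left; apply Rinv_0_lt_compat; lra|].
        rewrite <- (Rinv_inv 2). apply Rinv_le_contravar; lra. }
      assert (Hx3 : G ^ 3 <= K ^ 3 * x ^ 3).
      { rewrite <- Rpow_mult_distr. apply pow_incr. split; assumption. }
      assert (Hden : / (x * P ^ 24) ^ k = / x ^ k * (/ P ^ 24) ^ k).
      { rewrite Rpow_mult_distr, Rinv_mult, pow_inv. reflexivity. }
      unfold Rdiv. rewrite Hden.
      apply Rle_trans with (K ^ 3 * x ^ 3 * (/ x ^ k * (2 ^ 24) ^ k)).
      + apply Rmult_le_compat; [apply pow_le; exact HG| |exact Hx3|].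
        * apply Rmult_le_pos; [left; apply Rinv_0_lt_compat, pow_lt; lra|].
          apply pow_le. left. now apply Rinv_0_lt_compat.
        * apply Rmult_le_compat_l; [left; apply Rinv_0_lt_compat, pow_lt; lra|].
          apply pow_incr. split; [left; now apply Rinv_0_lt_compat|exact HPi].
      + assert (Hxk : x ^ 3 * / x ^ k <= x).
        { destruct (Nat.eq_dec k 1) as [->|]; [|replace k with 2%nat by lia].
          - replace (x ^ 3 * / x ^ 1) with (x * x) by (field; lra). nra.
          - replace (x ^ 3 * / x ^ 2) with x by (field; lra). lra. }
        assert (0 < K ^ 3) by (apply pow_lt; lra). assert (0 < (2 ^ 24) ^ k) by (apply pow_lt, pow_lt; lra).
        replace (K ^ 3 * x ^ 3 * (/ x ^ k * (2 ^ 24) ^ k)) with (K ^ 3 * (2 ^ 24) ^ k * (x ^ 3 * / x ^ k)) by ring.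
        apply Rmult_le_compat_l; [|exact Hxk]. left. now apply Rmult_lt_0_compat. }
  assert (HD := Delta_nz tau H).
  assert (B : (Phi tau ^ 3)%C = 0).
  { replace (Phi tau ^ 3)%C with (Phi tau ^ 3 / Defs.Delta tau ^ k * Defs.Delta tau ^ k)%C
      by (field; now apply Cpow_nz). rewrite A. ring. }
  apply NNPP. intros Hn. now apply (Cpow_nz _ 3 Hn).
Qed.

Lemma e2_0 : e2 0 = 1.
Proof. unfold e2. rewrite pseries_0. simpl. ring. Qed.

Lemma e4_0 : e4 0 = 1.
Proof. unfold e4. rewrite pseries_0. simpl. ring. Qed.

Lemma e6_0 : e6 0 = 1.
Proof. unfold e6. rewrite e2_0, e4_0. ring. Qed.

(** In [12 D E2 - E2^2 + E4] the anomalous terms of [E2] under [S] cancel and the constant term is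
    zero: a form of weight 4 vanishing at the cusp. *)
Lemma Ramanujan_E2 (tau : C) : 0 < Im tau -> qderiv E2 tau = ((E2 tau ^ 2 - E4 tau) / 12)%C.
Proof.
  intros H.
  assert (A := cusp_form_zero (fun t => 12 * qderiv E2 t - E2 t ^ 2 + E4 t)%C
    (fun q => 12 * (q * C_derive e2 q) - e2 q ^ 2 + e4 q)%C 4 1 ltac:(lia) ltac:(lia)).
  replace (qderiv E2 tau) with ((E2 tau ^ 2 - E4 tau) / 12
    + (12 * qderiv E2 tau - E2 tau ^ 2 + E4 tau) / 12)%C by field.
  rewrite A; [field| | | | | | |exact H].
  - intros t Ht. apply hol_plus; [apply hol_minus|now apply E4_hol].
    + now apply hol_scal, qderiv_hol, E2_hol.
    + now apply (hol_pow E2), E2_hol.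
  - intros t Ht. rewrite qderiv_T, E2_T, E4_T; auto using E2_hol, E2_T.
  - intros t Ht. rewrite qderiv_E2_S, E2_S, E4_S by assumption.
    change (2 * PI * Ci)%C with c2pi. field. apply c2pi_nz.
  - intros t Ht. rewrite qderiv_E2_nome, E4_e4 by assumption. reflexivity.
  - assert (H2 := e2_hol 0 Cmod_0_lt_1). assert (H4 := e4_hol 0 Cmod_0_lt_1).
    apply hol_plus; [apply hol_minus; [now apply hol_scal, hol_q_derive|now apply (hol_pow e2)]|exact H4].
  - rewrite e2_0, e4_0. ring.
Qed.

Lemma Ramanujan_E4 (tau : C) : 0 < Im tau -> qderiv E4 tau = ((E2 tau * E4 tau - E6 tau) / 3)%C.
Proof. intros H. rewrite E6_eq by exact H. field. Qed.

Lemma Ramanujan_E6 (tau : C) : 0 < Im tau -> qderiv E6 tau = ((E2 tau * E6 tau - E4 tau ^ 2) / 2)%C.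
Proof.
  intros H.
  assert (A := cusp_form_zero (fun t => 2 * qderiv E6 t - E2 t * E6 t + E4 t ^ 2)%C
    (fun q => 2 * (q * C_derive e6 q) - e2 q * e6 q + e4 q ^ 2)%C 8 2 ltac:(lia) ltac:(lia)).
  replace (qderiv E6 tau) with ((E2 tau * E6 tau - E4 tau ^ 2) / 2
    + (2 * qderiv E6 tau - E2 tau * E6 tau + E4 tau ^ 2) / 2)%C by field.
  rewrite A; [field| | | | | | |exact H].
  - intros t Ht. apply hol_plus; [apply hol_minus|now apply (hol_pow E4), E4_hol].
    + now apply hol_scal, qderiv_hol, E6_hol.
    + apply hol_mult; [now apply E2_hol|now apply E6_hol].
  - intros t Ht. rewrite qderiv_T, E2_T, E4_T, E6_T; auto using E6_hol, E6_T.
  - intros t Ht. rewrite (qderiv_weight_S E6 5), E2_S, E4_S, E6_S by auto using E6_hol, E6_S.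
    change (2 * PI * Ci)%C with c2pi. replace (INR 6) with 6 by (simpl; ring). field. apply c2pi_nz.
  - intros t Ht. rewrite qderiv_E6_nome, E4_e4 by assumption. reflexivity.
  - assert (H2 := e2_hol 0 Cmod_0_lt_1). assert (H4 := e4_hol 0 Cmod_0_lt_1).
    assert (H6 := e6_hol 0 Cmod_0_lt_1).
    apply hol_plus; [apply hol_minus; [now apply hol_scal, hol_q_derive|now apply hol_mult]|now apply (hol_pow e4)].
  - rewrite e2_0, e4_0, e6_0. ring.
Qed.

Lemma E2_cderiv (tau : C) : 0 < Im tau -> cderiv E2 tau (c2pi * ((E2 tau ^ 2 - E4 tau) / 12))%C.
Proof. intros H. rewrite <- Ramanujan_E2 by exact H. now apply qderiv_cderiv, E2_hol. Qed.

Lemma E4_cderiv (tau : C) : 0 < Im tau -> cderiv E4 tau (c2pi * ((E2 tau * E4 tau - E6 tau) / 3))%C.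
Proof. intros H. rewrite <- Ramanujan_E4 by exact H. now apply qderiv_cderiv, E4_hol. Qed.

Lemma E6_cderiv (tau : C) : 0 < Im tau -> cderiv E6 tau (c2pi * ((E2 tau * E6 tau - E4 tau ^ 2) / 2))%C.
Proof. intros H. rewrite <- Ramanujan_E6 by exact H. now apply qderiv_cderiv, E6_hol. Qed.

Lemma pseries_derive_0 (a : nat -> C) : (exists r K, 0 < r /\ coef_bound a r K) -> cderiv (pseries a) 0 (a 1%nat).
Proof.
  intros [r [K [Hr H]]]. eapply cderiv_eq; [apply (pseries_deriv a r K); auto; now rewrite Cmod_0|].
  rewrite pseries_0. unfold pderiv. simpl. ring.
Qed.

Lemma sigma_pseries_derive_0 (k : nat) : cderiv (pseries (sigma_coef k)) 0 1.
Proof.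
  destruct (sigma_coef_bound k (/ 2) ltac:(lra)) as [K HK].
  eapply cderiv_eq; [apply pseries_derive_0; exists (/ 2), K; split; [lra|exact HK]|].
  unfold sigma_coef, Defs.sigma. simpl. rewrite Nat.pow_1_l. reflexivity.
Qed.

Lemma e2_derive_0 : cderiv e2 0 (- (24))%C.
Proof.
  eapply cderiv_eq; [apply cderiv_minus; [apply cderiv_const|apply cderiv_scal, sigma_pseries_derive_0]|ring].
Qed.

Lemma e4_derive_0 : cderiv e4 0 240.
Proof.
  eapply cderiv_eq; [apply cderiv_plus; [apply cderiv_const|apply cderiv_scal, sigma_pseries_derive_0]|ring].
Qed.

Lemma e6_derive_0 : cderiv e6 0 (- (504))%C.
Proof.
  eapply cderiv_eq.
  - apply cderiv_minus; [apply cderiv_mult; [apply e2_derive_0|apply e4_derive_0]|].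
    apply cderiv_scal, cderiv_mult; [apply cderiv_id|].
    apply hol_cderiv, hol_C_derive, e4_hol, Cmod_0_lt_1.
  - rewrite (cderiv_C_derive _ _ _ e4_derive_0), e2_0, e4_0. ring.
Qed.

(** By Ramanujan's equations both sides have logarithmic derivative [E2], so their ratio is
    constant. It is read off from the coefficient of [q]: [3 * 240 + 2 * 504 = 1728]. *)
Lemma discriminant (tau : C) : 0 < Im tau -> (E4 tau ^ 3 - E6 tau ^ 2)%C = (1728 * Defs.Delta tau)%C.
Proof.
  intros H.
  set (G := fun t => ((E4 t ^ 3 - E6 t ^ 2) / Defs.Delta t)%C).
  assert (HG : forall z, 0 < Im z -> cderiv G z 0).
  { intros z Hz. assert (HD := Delta_nz z Hz). eapply cderiv_eq.
    - apply cderiv_div; [|now apply Delta_cderiv|exact HD].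
      apply cderiv_minus; [apply (cderiv_pow E4 2); now apply E4_cderiv|apply (cderiv_pow E6 1); now apply E6_cderiv].
    - change (2 * PI * Ci)%C with c2pi.
      replace (INR 3) with 3 by (simpl; ring). replace (INR 2) with 2 by (simpl; ring). field. exact HD. }
  assert (Hi : 0 < Im Ci) by (simpl; lra).
  set (K := G Ci).
  assert (HK : forall t, 0 < Im t -> (E4 t ^ 3 - E6 t ^ 2)%C = (K * Defs.Delta t)%C).
  { intros t Ht. unfold K. rewrite (upper_constant G Ci t HG Hi Ht). unfold G. field. now apply Delta_nz. }
  enough (E : K = 1728) by (rewrite HK, E; auto).
  set (g := fun q => (e4 q ^ 3 - e6 q ^ 2 - K * (q * euler q ^ 24))%C).
  assert (Hd : cderiv g 0 (1728 - K)%C).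
  { eapply cderiv_eq.
    - apply cderiv_minus; [apply cderiv_minus; [apply (cderiv_pow e4 2), e4_derive_0|apply (cderiv_pow e6 1), e6_derive_0]|].
      apply cderiv_scal, cderiv_mult; [apply cderiv_id|].
      apply (cderiv_pow euler 23), euler_cderiv, Cmod_0_lt_1.
    - cbv beta. rewrite e4_0, e6_0, euler_0, Cpow_1_l.
      replace (INR 3) with 3 by (simpl; ring). replace (INR 2) with 2 by (simpl; ring). ring. }
  assert (Hg0 : g 0 = 0) by (unfold g; rewrite e4_0, e6_0; ring).
  assert (Hgz : forall t, 0 < Im t -> g (qpar t) = 0).
  { intros t Ht. unfold g. rewrite <- Delta_euler, <- E4_e4 by exact Ht.
    change (e6 (qpar t)) with (E6 t). rewrite HK by exact Ht. ring. }
  (* [g] vanishes at nonzero nomes arbitrarily close to 0, so its derivative at 0 is zero. *)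
  assert (E : (1728 - K)%C = 0).
  { apply Cmod_eq_0, Rle_antisym; [|apply Cmod_ge_0]. apply le_epsilon. intros eps He.
    rewrite Rplus_0_l. destruct (Hd eps He) as [d [Hd0 Hw]].
    destruct (cusp_zero_of_nome qpar 1 1 ltac:(lra) ltac:(intros; lra) d Hd0) as [Y [HY HqY]].
    assert (Ht : Y < Im (RtoC (Y + 1) * Ci)) by (rewrite im_scal_l; simpl (Im Ci); lra).
    specialize (HqY _ Ht). set (q := qpar (RtoC (Y + 1) * Ci)) in *.
    specialize (Hw q). replace (q - 0)%C with q in Hw by ring. specialize (Hw HqY).
    unfold q in Hw at 1. rewrite Hgz, Hg0 in Hw by lra.
    replace (0 - 0 - (1728 - K) * q)%C with (- ((1728 - K) * q))%C in Hw by ring.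
    rewrite Cmod_opp, Cmod_mult in Hw.
    assert (Hq : 0 < Cmod q) by apply Cmod_gt_0, qpar_nz. nra. }
  apply Ceq_minus. replace (K - 1728)%C with (- (1728 - K))%C by ring. rewrite E. ring.
Qed.

(** * Zeros of [E4] and [E6] in the fundamental domain *)

(** On the fundamental domain [Im tau >= 0.866]; with [PI > 3] the exponent [2 PI Im tau] exceeds
    [5.196], and [e^5.196 > 171 > 1 / 0.006]. *)
Definition r_fd : R := 6 / 1000.

(** Eight squarings, starting from [1 + x <= exp x] at [x = 5.196 / 256] and rounding down at each
    stage. *)
Lemma exp_lower_bound : 171 < exp (5196 / 1000).
Proof.
  assert (Hsq : forall x a b, a <= exp x -> 0 < a -> b < a * a -> b <= exp (2 * x)).
  { intros x a b Ha H0 Hb. replace (2 * x) with (x + x) by ring. rewrite exp_plus. nra. }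
  assert (A0 : 102029 / 100000 <= exp (5196 / 256000)).
  { eapply Rle_trans; [|apply exp_ineq1_le]. lra. }
  assert (A1 := Hsq _ _ (104099 / 100000) A0 ltac:(lra) ltac:(lra)).
  assert (A2 := Hsq _ _ (108366 / 100000) A1 ltac:(lra) ltac:(lra)).
  assert (A3 := Hsq _ _ (117431 / 100000) A2 ltac:(lra) ltac:(lra)).
  assert (A4 := Hsq _ _ (137900 / 100000) A3 ltac:(lra) ltac:(lra)).
  assert (A5 := Hsq _ _ (190164 / 100000) A4 ltac:(lra) ltac:(lra)).
  assert (A6 := Hsq _ _ (361623 / 100000) A5 ltac:(lra) ltac:(lra)).
  assert (A7 := Hsq _ _ (1307710 / 100000) A6 ltac:(lra) ltac:(lra)).
  assert (A8 := Hsq _ _ (171001 / 1000) A7 ltac:(lra) ltac:(lra)).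
  replace (2 * (2 * (2 * (2 * (2 * (2 * (2 * (2 * (5196 / 256000))))))))) with (5196 / 1000) in A8 by lra.
  lra.
Qed.

Lemma fund_dom_nome (tau : C) : fund_dom tau -> Cmod (qpar tau) < r_fd.
Proof.
  intros [H [Hr Hm]]. rewrite Cmod_qpar, exp_Ropp. unfold r_fd.
  assert (Hi : 866 / 1000 <= Im tau).
  { assert (A := Cmod2_alt tau). assert (B : 1 <= Cmod tau ^ 2) by (rewrite <- (pow1 2); apply pow_incr; lra).
    nra. }
  assert (Hpi : 3 < PI) by (generalize PI2_3_2; lra).
  assert (E : exp (5196 / 1000) <= exp (2 * PI * Im tau)) by (apply exp_le_mono; nra).
  assert (A := exp_lower_bound).
  apply Rlt_trans with (/ 171); [apply Rinv_lt_contravar; nra|lra].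
Qed.

(** For [x >= 2] the ratio [((x + 1) / x)^p] is at most [(3/2)^6 < 12], and [12 * 0.006 < 1/10]: the
    terms of the divisor series decrease at least tenfold. *)
Lemma ratio_step (p : nat) (x : R) : (p <= 6)%nat -> 2 <= x -> (x + 1) ^ p * r_fd <= x ^ p / 10.
Proof.
  intros Hp Hx.
  assert (A : (x + 1) ^ p <= (3 / 2) ^ p * x ^ p).
  { rewrite <- Rpow_mult_distr. apply pow_incr. lra. }
  assert (B : (3 / 2) ^ p <= (3 / 2) ^ 6) by (apply Rle_pow; [lra|exact Hp]).
  assert (P : 0 < x ^ p) by (apply pow_lt; lra). unfold r_fd in *. simpl in B. nra.
Qed.

Lemma small_nome_term (p n : nat) : (p <= 6)%nat ->
  INR (S (S n)) ^ p * r_fd ^ S n <= 2 ^ p * r_fd * (/ 10) ^ n.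
Proof.
  intros Hp. induction n.
  - rewrite pow_1, pow_O. replace (INR 2) with 2 by (simpl; ring). lra.
  - change (r_fd ^ S (S n)) with (r_fd * r_fd ^ S n).
    assert (A := ratio_step p (INR (S (S n))) Hp).
    assert (H2 : 2 <= INR (S (S n))) by (rewrite !S_INR; generalize (pos_INR n); lra).
    specialize (A H2). rewrite <- S_INR in A.
    assert (P : 0 < r_fd ^ S n) by (apply pow_lt; unfold r_fd; lra).
    apply Rle_trans with ((INR (S (S n)) ^ p / 10) * r_fd ^ S n).
    + rewrite <- Rmult_assoc. apply Rmult_le_compat_r; lra.
    + change ((/ 10) ^ S n) with (/ 10 * (/ 10) ^ n). lra.
Qed.

Lemma pseries_near_1 (b : nat -> C) (p : nat) (w : C) : (p <= 6)%nat -> b 0%nat = 1 ->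
  (forall j, Cmod (b j) <= INR (S j) ^ p) -> Cmod w <= r_fd ->
  Cmod (pseries b w - 1) <= 2 ^ p * r_fd / (9 / 10).
Proof.
  intros Hp Hb0 Hb Hw. assert (H0 := Cmod_ge_0 w).
  destruct (poly_coef_bound b 1 p (1 / 2) ltac:(lra)) as [K HK]; [intros; rewrite Rmult_1_l; apply Hb|].
  assert (A := pseries_csums b (1 / 2) K w ltac:(lra) HK ltac:(unfold r_fd in Hw; lra)).
  apply csums_unshift in A. rewrite Hb0 in A. replace (1 * w ^ 0)%C with (RtoC 1) in A by (simpl; ring).
  replace (2 ^ p * r_fd / (9 / 10)) with (Series (fun n => 2 ^ p * r_fd * (/ 10) ^ n)).
  - apply (csums_norm_le _ _ _) with (3 := A).
    + intros n. rewrite Cmod_mult, Cmod_pow. eapply Rle_trans; [|now apply small_nome_term].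
      apply Rmult_le_compat; [apply Cmod_ge_0|apply pow_le, H0|apply Hb|]. apply pow_incr. lra.
    + apply ex_series_scal_R, ex_series_geom_R. lra.
  - rewrite Series_scal_l, Series_geom by (rewrite Rabs_pos_eq; lra). field.
Qed.

Lemma sigma_coef_poly (k j : nat) : Cmod (sigma_coef k (S j)) <= INR (S j) ^ S k.
Proof. unfold sigma_coef. rewrite Cmod_R, Rabs_pos_eq by apply pos_INR. apply sigma_bound. Qed.

Lemma sigma_coef_1 (k : nat) : sigma_coef k 1 = 1.
Proof. unfold sigma_coef, Defs.sigma. simpl. rewrite Nat.pow_1_l. reflexivity. Qed.

Lemma pderiv_poly (a : nat -> C) (p : nat) : (forall j, Cmod (a (S j)) <= INR (S j) ^ p) ->
  forall j, Cmod (pderiv a j) <= INR (S j) ^ S p.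
Proof.
  intros H j. unfold pderiv. rewrite Cmod_mult, Cmod_R, Rabs_pos_eq by apply pos_INR.
  apply Rmult_le_compat_l; [apply pos_INR|apply H].
Qed.

Definition sig1 (q : C) : C := pseries (sigma_coef 1) q.
Definition sig3 (q : C) : C := pseries (sigma_coef 3) q.
Definition dsig1 (q : C) : C := pseries (pderiv (sigma_coef 1)) q.
Definition dsig3 (q : C) : C := pseries (pderiv (sigma_coef 3)) q.
Definition theta_coef (m : nat) : C := (INR m * sigma_coef 3 m)%C.
Definition ddsig3 (q : C) : C := pseries (pderiv theta_coef) q.

(** Used with p = 2, 4, 5 for the series of [sigma_1(m)], [sigma_3(m)] and [m sigma_3(m)], out of
    which [e4] and [e6] are made. *)
Lemma pseries_zero_head (a : nat -> C) (p : nat) (w : C) : (p <= 5)%nat -> a 0%nat = 0 -> a 1%nat = 1 ->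
  (forall j, Cmod (a (S j)) <= INR (S j) ^ p) -> Cmod w < r_fd ->
  cderiv (pseries a) w (pseries (pderiv a) w) /\
  Cmod (pseries (pderiv a) w - 1) <= 2 ^ S p * r_fd / (9 / 10) /\
  Cmod (pseries a w) <= r_fd * (1 + 2 ^ p * r_fd / (9 / 10)).
Proof.
  intros Hp Ha0 Ha1 Ha Hw. assert (H0 := Cmod_ge_0 w).
  assert (Hw1 : Cmod w < 1 / 2) by (unfold r_fd in Hw; lra).
  assert (Hb : forall j, Cmod (a j) <= 1 * INR (S j) ^ p).
  { intros [|j]; [rewrite Ha0, Cmod_0, INR_1, pow1; lra|].
    rewrite Rmult_1_l. eapply Rle_trans; [apply Ha|]. apply pow_incr.
    split; [apply pos_INR|apply le_INR; lia]. }
  destruct (poly_coef_bound a 1 p (1 / 2) ltac:(lra) Hb) as [K HK].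
  split; [apply pseries_deriv with (1 / 2) K; auto; lra|]. split.
  - apply pseries_near_1; [lia| |now apply pderiv_poly|lra].
    unfold pderiv. rewrite Ha1. simpl. ring.
  - assert (E : pseries a w = (w * pseries (fun j => a (S j)) w)%C).
    { assert (A := pseries_csums a (1 / 2) K w ltac:(lra) HK ltac:(lra)).
      apply csums_unshift in A. rewrite Ha0 in A.
      destruct (poly_coef_bound (fun j => a (S j)) 1 p (1 / 2) ltac:(lra)) as [K' HK'];
        [intros; rewrite Rmult_1_l; apply Ha|].
      assert (B := csums_scal w _ _ (pseries_csums _ (1 / 2) K' w ltac:(lra) HK' ltac:(lra))).
      replace (pseries a w) with (pseries a w - 0 * w ^ 0)%C by ring.
      apply (csums_unique _ _ _ A). eapply csums_ext; [|exact B]. intros n. simpl. ring. }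
    rewrite E, Cmod_mult.
    assert (B := pseries_near_1 (fun j => a (S j)) p w ltac:(lia) Ha1 Ha ltac:(lra)).
    assert (D : Cmod (pseries (fun j => a (S j)) w) <= 1 + 2 ^ p * r_fd / (9 / 10)).
    { replace (pseries (fun j => a (S j)) w) with (1 + (pseries (fun j => a (S j)) w - 1))%C by ring.
      eapply Rle_trans; [apply Cmod_triangle|]. rewrite Cmod_1. lra. }
    apply Rmult_le_compat; try apply Cmod_ge_0; lra.
Qed.

Lemma sig_estimates (w : C) : Cmod w < r_fd ->
  cderiv sig1 w (dsig1 w) /\ Cmod (dsig1 w - 1) <= 54 / 1000 /\ Cmod (sig1 w) <= 62 / 10000 /\
  cderiv sig3 w (dsig3 w) /\ Cmod (dsig3 w - 1) <= 214 / 1000 /\ Cmod (sig3 w) <= 67 / 10000 /\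
  cderiv (pseries theta_coef) w (ddsig3 w) /\ Cmod (ddsig3 w - 1) <= 427 / 1000.
Proof.
  intros Hw.
  destruct (pseries_zero_head (sigma_coef 1) 2 w ltac:(lia) eq_refl (sigma_coef_1 1) (sigma_coef_poly 1) Hw) as [A1 [A2 A3]].
  destruct (pseries_zero_head (sigma_coef 3) 4 w ltac:(lia) eq_refl (sigma_coef_1 3) (sigma_coef_poly 3) Hw) as [B1 [B2 B3]].
  destruct (pseries_zero_head theta_coef 5 w ltac:(lia)) as [D1 [D2 _]]; [| | |exact Hw|].
  - unfold theta_coef. simpl. ring.
  - unfold theta_coef. rewrite sigma_coef_1. simpl. ring.
  - intros j. unfold theta_coef. rewrite Cmod_mult, Cmod_R, Rabs_pos_eq by apply pos_INR.
    apply Rmult_le_compat_l; [apply pos_INR|apply sigma_coef_poly].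
  - unfold r_fd in *. simpl in A2, A3, B2, B3, D2.
    repeat split; try assumption; unfold sig1, sig3, dsig1, dsig3, ddsig3; lra.
Qed.

(** On this disc the derivative of [e4 - 240 q] is at most [240 * 0.214 < 52]. As 52 < 240, the
    linear part decides both injectivity and the sign of real increments. *)
Lemma e4_difference (q1 q2 : C) : Cmod q1 < r_fd -> Cmod q2 < r_fd ->
  Cmod (e4 q1 - e4 q2 - 240 * (q1 - q2)) <= 52 * Cmod (q1 - q2).
Proof.
  intros H1 H2.
  replace (e4 q1 - e4 q2 - 240 * (q1 - q2))%C with ((e4 q1 - 240 * q1) - (e4 q2 - 240 * q2))%C by ring.
  apply (mean_value_disc (fun q => e4 q - 240 * q)%C (fun q => 240 * (dsig3 q - 1))%C 0 q2 q1 r_fd).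
  - intros w Hw. replace (w - 0)%C with w in Hw by ring.
    destruct (sig_estimates w Hw) as [_ [_ [_ [A _]]]].
    eapply cderiv_eq; [apply cderiv_minus; [apply cderiv_plus; [apply cderiv_const|apply cderiv_scal, A]|
      apply cderiv_scal, cderiv_id]|ring].
  - intros w Hw. replace (w - 0)%C with w in Hw by ring.
    destruct (sig_estimates w Hw) as [_ [_ [_ [_ [A _]]]]].
    rewrite Cmod_mult, Cmod_R, Rabs_pos_eq by lra. lra.
  - now replace (q2 - 0)%C with q2 by ring.
  - now replace (q1 - 0)%C with q1 by ring.
Qed.

Lemma e4_inj (q1 q2 : C) : Cmod q1 < r_fd -> Cmod q2 < r_fd -> e4 q1 = e4 q2 -> q1 = q2.
Proof.
  intros H1 H2 E. assert (A := e4_difference q1 q2 H1 H2). rewrite E in A.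
  replace (e4 q2 - e4 q2 - 240 * (q1 - q2))%C with (- (240 * (q1 - q2)))%C in A by ring.
  rewrite Cmod_opp, Cmod_mult, Cmod_R, Rabs_pos_eq in A by lra.
  apply Ceq_minus, Cmod_eq_0. generalize (Cmod_ge_0 (q1 - q2)). lra.
Qed.

Lemma q_derive_e4 (q : C) : Cmod q < r_fd -> (q * C_derive e4 q)%C = (240 * pseries theta_coef q)%C.
Proof.
  intros Hq. destruct (sig_estimates q Hq) as [_ [_ [_ [A _]]]].
  assert (E : C_derive e4 q = (240 * dsig3 q)%C).
  { apply cderiv_C_derive. eapply cderiv_eq; [apply cderiv_plus; [apply cderiv_const|apply cderiv_scal, A]|ring]. }
  rewrite E.
  assert (Hq1 : Cmod q < 1 / 2) by (unfold r_fd in Hq; lra).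
  destruct (sigma_coef_bound 3 (3 / 4) ltac:(lra)) as [K HK].
  destruct (pderiv_bound _ (3 / 4) _ (1 / 2) ltac:(lra) HK) as [K1 HK1]; [lra|].
  assert (B := csums_scal q _ _ (pseries_csums _ (1 / 2) K1 q ltac:(lra) HK1 ltac:(lra))).
  assert (D : csums (fun k => theta_coef k * q ^ k)%C (0 + q * dsig3 q)%C).
  { replace (RtoC 0) with (theta_coef 0 * q ^ 0)%C by (unfold theta_coef; simpl; ring).
    apply csums_shift. eapply csums_ext; [|exact B]. intros n. unfold theta_coef, pderiv.
    simpl (q ^ S n)%C. ring. }
  apply csums_CSeries in D. unfold pseries at 1. rewrite D. ring.
Qed.

(** The linear part is [-504 q]; the errors of the three series and of their product add up to less
    than 460, still below 504. *)
Lemma e6_difference (q1 q2 : C) : Cmod q1 < r_fd -> Cmod q2 < r_fd ->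
  Cmod (e6 q1 - e6 q2 + 504 * (q1 - q2)) <= 460 * Cmod (q1 - q2).
Proof.
  intros H1 H2.
  set (g := fun q => ((1 - 24 * sig1 q) * (1 + 240 * sig3 q) - 720 * pseries theta_coef q + 504 * q)%C).
  assert (Eg : forall q, Cmod q < r_fd -> (e6 q + 504 * q)%C = g q).
  { intros q Hq. unfold e6, g. rewrite q_derive_e4 by exact Hq. unfold e2, e4, sig1, sig3. ring. }
  replace (e6 q1 - e6 q2 + 504 * (q1 - q2))%C with ((e6 q1 + 504 * q1) - (e6 q2 + 504 * q2))%C by ring.
  rewrite !Eg by assumption.
  apply (mean_value_disc g (fun q => - (24) * (dsig1 q - 1) + 240 * (dsig3 q - 1) - 720 * (ddsig3 q - 1)
     - 5760 * (dsig1 q * sig3 q + sig1 q * dsig3 q))%C 0 q2 q1 r_fd).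
  - intros w Hw. replace (w - 0)%C with w in Hw by ring.
    destruct (sig_estimates w Hw) as [A [_ [_ [B [_ [_ [D _]]]]]]].
    eapply cderiv_eq.
    + apply cderiv_plus; [|apply cderiv_scal, cderiv_id]. apply cderiv_minus; [|apply cderiv_scal, D].
      apply cderiv_mult; [apply cderiv_minus; [apply cderiv_const|apply cderiv_scal, A]|
        apply cderiv_plus; [apply cderiv_const|apply cderiv_scal, B]].
    + simpl. ring.
  - intros w Hw. replace (w - 0)%C with w in Hw by ring.
    destruct (sig_estimates w Hw) as [_ [A1 [A2 [_ [B1 [B2 [_ D1]]]]]]].
    eapply Rle_trans; [apply Cmod_minus_le|].
    eapply Rle_trans; [apply Rplus_le_compat_r, Cmod_minus_le|].
    eapply Rle_trans; [apply Rplus_le_compat_r, Rplus_le_compat_r, Cmod_triangle|].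
    rewrite !(Cmod_mult (RtoC _)), Cmod_mult, Cmod_opp, !Cmod_R, !Rabs_pos_eq by lra.
    assert (P1 : Cmod (dsig1 w) <= 1054 / 1000).
    { replace (dsig1 w) with ((dsig1 w - 1) + 1)%C by ring. eapply Rle_trans; [apply Cmod_triangle|].
      rewrite Cmod_1. lra. }
    assert (P3 : Cmod (dsig3 w) <= 1214 / 1000).
    { replace (dsig3 w) with ((dsig3 w - 1) + 1)%C by ring. eapply Rle_trans; [apply Cmod_triangle|].
      rewrite Cmod_1. lra. }
    assert (Q : Cmod (dsig1 w * sig3 w + sig1 w * dsig3 w) <= 1054 / 1000 * (67 / 10000) + 62 / 10000 * (1214 / 1000)).
    { eapply Rle_trans; [apply Cmod_triangle|]. rewrite !Cmod_mult.
      apply Rplus_le_compat; apply Rmult_le_compat; try apply Cmod_ge_0; assumption. }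
    lra.
  - now replace (q2 - 0)%C with q2 by ring.
  - now replace (q1 - 0)%C with q1 by ring.
Qed.

Lemma e6_inj (q1 q2 : C) : Cmod q1 < r_fd -> Cmod q2 < r_fd -> e6 q1 = e6 q2 -> q1 = q2.
Proof.
  intros H1 H2 E. assert (A := e6_difference q1 q2 H1 H2). rewrite E in A.
  replace (e6 q2 - e6 q2 + 504 * (q1 - q2))%C with (504 * (q1 - q2))%C in A by ring.
  rewrite Cmod_mult, Cmod_R, Rabs_pos_eq in A by lra.
  apply Ceq_minus, Cmod_eq_0. generalize (Cmod_ge_0 (q1 - q2)). lra.
Qed.

(** * The elliptic points as the only zeros *)

Definition rho : C := (/ 2, sqrt 3 / 2).

Lemma sqrt3_facts : sqrt 3 * sqrt 3 = 3 /\ 0 < sqrt 3.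
Proof. split; [apply sqrt_sqrt; lra|apply sqrt_lt_R0; lra]. Qed.

Lemma rho_quadratic : (rho * rho)%C = (rho - 1)%C.
Proof.
  destruct sqrt3_facts as [H _]. apply C_ext; simpl; lra.
Qed.

Lemma Im_rho : 0 < Im rho.
Proof. destruct sqrt3_facts as [_ H]. simpl. lra. Qed.

Lemma fund_dom_rho : fund_dom rho.
Proof.
  destruct sqrt3_facts as [H H'].
  split; [apply Im_rho|]. split; [simpl; lra|].
  assert (A := Cmod2_alt rho). simpl in A.
  assert (B : Cmod rho * Cmod rho = 1).
  { replace (Cmod rho * Cmod rho) with (Cmod rho * (Cmod rho * 1)) by ring. rewrite A. lra. }
  generalize (Cmod_ge_0 rho). nra.
Qed.

Lemma fund_dom_Ci : fund_dom Ci.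
Proof. split; [simpl; lra|]. split; [simpl; lra|]. rewrite Cmod_Ci. lra. Qed.

Lemma Cmult_integral (a b : C) : (a * b)%C = 0 -> a = 0 \/ b = 0.
Proof.
  intros H. destruct (classic (a = 0)) as [A|A]; [now left|right].
  apply NNPP. intros B. now apply (Cmult_neq_0 a b).
Qed.

(** Since [-1 / rho = rho - 1], the laws for [S] and [T] give
    [E4 rho = rho^4 E4 rho = - rho E4 rho], and [1 + rho] is not zero. *)
Lemma E4_rho : E4 rho = 0.
Proof.
  assert (H := Im_rho). assert (Hr0 : rho <> 0) by (apply Im_nz; lra).
  assert (Hq := rho_quadratic).
  assert (E : (- / rho)%C = (rho - 1)%C).
  { replace (rho - 1)%C with ((rho * rho - rho) * / rho)%C by (field; exact Hr0).
    rewrite Hq. field. exact Hr0. }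
  assert (A := E4_S rho H). rewrite E in A.
  assert (B := E4_T (rho - 1)). rewrite im_minus, im_RtoC in B.
  replace (rho - 1 + 1)%C with rho in B by ring. rewrite <- B in A by lra.
  replace (rho ^ 4)%C with ((rho * rho) * (rho * rho))%C in A by ring.
  rewrite Hq in A. replace ((rho - 1) * (rho - 1))%C with (rho * rho - 2 * rho + 1)%C in A by ring.
  rewrite Hq in A. replace (rho - 1 - 2 * rho + 1)%C with (- rho)%C in A by ring.
  destruct (Cmult_integral (1 + rho) (E4 rho)) as [D|D]; [|exfalso|exact D].
  - transitivity (E4 rho - - rho * E4 rho)%C; [ring|]. rewrite A at 1. ring.
  - apply (f_equal Im) in D. rewrite im_plus, im_RtoC in D. simpl Im in D at 2. lra.
Qed.

Lemma E6_Ci : E6 Ci = 0.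
Proof.
  assert (H : 0 < Im Ci) by (simpl; lra).
  assert (E : (- / Ci)%C = Ci) by (apply C_ext; simpl; field).
  assert (A := E6_S Ci H). rewrite E in A.
  assert (E6' : (Ci ^ 6)%C = (- (1))%C) by (apply C_ext; simpl; ring).
  rewrite E6' in A. replace (E6 Ci) with ((E6 Ci - - (1) * E6 Ci) / 2)%C by field.
  rewrite <- A. field.
Qed.

Lemma qpar_eq_shift (t1 t2 : C) : qpar t1 = qpar t2 -> exists k : Z, t1 = (t2 + IZR k)%C.
Proof.
  intros H. destruct (qpar_eq_1 (t1 - t2)) as [k Hk].
  - replace (t1 - t2)%C with (t1 + - t2)%C by ring. rewrite qpar_plus, qpar_opp, H.
    apply Cinv_r, qpar_nz.
  - exists k. rewrite <- Hk. ring.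
Qed.

(** Injectivity of [e4] in the nome compares an arbitrary zero with the known one; equal nomes mean
    points that differ by an integer. *)
Lemma fund_dom_E4_zero (tau : C) : fund_dom tau -> E4 tau = 0 -> exists k : Z, tau = (rho + IZR k)%C.
Proof.
  intros H E. apply qpar_eq_shift. assert (Hr := fund_dom_rho).
  apply e4_inj; try now apply fund_dom_nome.
  rewrite <- !E4_e4 by (apply Im_rho || apply H). now rewrite E, E4_rho.
Qed.

Lemma fund_dom_E6_zero (tau : C) : fund_dom tau -> E6 tau = 0 -> exists k : Z, tau = (Ci + IZR k)%C.
Proof.
  intros H E. apply qpar_eq_shift. assert (Hr := fund_dom_Ci).
  apply e6_inj; try now apply fund_dom_nome.
  change (E6 tau = E6 Ci). now rewrite E, E6_Ci.
Qed.

Lemma E4_mobius (g : SL2Z) (tau : C) : 0 < Im tau -> E4 (mobius g tau) = (automorphy g tau ^ 4 * E4 tau)%C.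
Proof. apply modular_of_generators_1; [exact E4_T|exact E4_S]. Qed.

Lemma E6_mobius (g : SL2Z) (tau : C) : 0 < Im tau -> E6 (mobius g tau) = (automorphy g tau ^ 6 * E6 tau)%C.
Proof. apply modular_of_generators_1; [intros; apply E6_T|exact E6_S]. Qed.

Lemma Delta_mobius (g : SL2Z) (tau : C) : 0 < Im tau ->
  Defs.Delta (mobius g tau) = (automorphy g tau ^ 12 * Defs.Delta tau)%C.
Proof. apply modular_of_generators_1; [intros; apply Delta_T|exact Delta_S]. Qed.

Lemma SL2Z_equiv_mobius (g : SL2Z) (tau : C) : 0 < Im tau -> SL2Z_equiv tau (mobius g tau).
Proof. intros H. apply SL2Z_equiv_sym; [exact H|]. now exists g. Qed.

Lemma E6_zero_equiv (tau : C) : 0 < Im tau -> (E6 tau = 0 <-> SL2Z_equiv tau Ci).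
Proof.
  intros H. assert (Hi : 0 < Im Ci) by (simpl; lra). split.
  - intros E. destruct (reduce_to_fund_dom tau H) as [g Hg].
    destruct (fund_dom_E6_zero _ Hg) as [k Hk]; [rewrite E6_mobius, E by exact H; ring|].
    apply SL2Z_equiv_trans with (mobius g tau); [exact Hi|now apply SL2Z_equiv_mobius|].
    exists (SL2Z_T k). now rewrite mobius_T.
  - intros [g ->]. rewrite E6_mobius, E6_Ci by exact Hi. ring.
Qed.

(** * The modular invariant *)

Lemma J_minus_1 (tau : C) : 0 < Im tau -> (J tau - 1)%C = (E6 tau ^ 2 / (1728 * Defs.Delta tau))%C.
Proof.
  intros H. assert (D := discriminant tau H). assert (Hn := Delta_nz tau H). unfold J.
  replace (E6 tau ^ 2)%C with (E4 tau ^ 3 - 1728 * Defs.Delta tau)%C by (rewrite <- D; ring).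
  field. exact Hn.
Qed.

Lemma J_cderiv (tau : C) : 0 < Im tau ->
  cderiv J tau (- (c2pi * (E4 tau ^ 2 * E6 tau / (1728 * Defs.Delta tau))))%C.
Proof.
  intros H. assert (HD := Delta_nz tau H). eapply cderiv_eq.
  - apply cderiv_div; [apply (cderiv_pow E4 2); now apply E4_cderiv| |].
    + now apply cderiv_scal, Delta_cderiv.
    + intros E. now apply Cmult_integral in E as [E|E]; [apply RtoC_inj in E; lra|].
  - change (2 * PI * Ci)%C with c2pi. replace (INR 3) with 3 by (simpl; ring).
    field. exact HD.
Qed.

Lemma J_hol (tau : C) : 0 < Im tau -> hol J tau.
Proof.
  intros H. apply hol_div; [now apply (hol_pow E4), E4_hol|now apply hol_scal, Delta_hol|].
  intros E. apply Cmult_integral in E as [E|E]; [apply RtoC_inj in E; lra|now apply (Delta_nz tau)].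
Qed.

Lemma J_mobius (g : SL2Z) (tau : C) : 0 < Im tau -> J (mobius g tau) = J tau.
Proof.
  intros H. assert (HD := Delta_nz tau H). assert (Ha := automorphy_nz g tau H).
  unfold J. rewrite E4_mobius, Delta_mobius by exact H. field. now split.
Qed.

Lemma J_derivative_nz (tau : C) : 0 < Im tau -> E4 tau <> 0 -> E6 tau <> 0 ->
  (- (c2pi * (E4 tau ^ 2 * E6 tau / (1728 * Defs.Delta tau))))%C <> 0.
Proof.
  intros H H4 H6 E. assert (HD := Delta_nz tau H).
  apply (Cmult_neq_0 c2pi (E4 tau ^ 2 * E6 tau)%C); [apply c2pi_nz|now apply Cmult_neq_0; [apply Cpow_nz|]|].
  replace (c2pi * (E4 tau ^ 2 * E6 tau))%C
    with (- - (c2pi * (E4 tau ^ 2 * E6 tau / (1728 * Defs.Delta tau))) * (1728 * Defs.Delta tau))%C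
    by (field; exact HD).
  rewrite E. ring.
Qed.

(** ** Reality of [J] *)

Lemma CSeries_conj (a : nat -> C) : CSeries (fun n => Cconj (a n)) = Cconj (CSeries a).
Proof. apply C_ext; [reflexivity|]. unfold CSeries, Cconj. simpl. now rewrite Series_opp. Qed.

Lemma CProd_conj (a : nat -> C) : CProd (fun n => Cconj (a n)) = Cconj (CProd a).
Proof.
  assert (E : forall N, Cprod_list (seq 0 N) (fun n => Cconj (a n)) = Cconj (Cprod_list (seq 0 N) a)).
  { intros N. unfold Cprod_list. induction (seq 0 N); simpl.
    - apply C_ext; simpl; ring.
    - now rewrite IHl, Cmult_conj. }
  unfold CProd. apply C_ext.
  - simpl. f_equal. apply Lim_seq_ext. intros N. now rewrite E.
  - unfold Cconj. simpl. rewrite <- Rbar_opp_real, <- Lim_seq_opp. f_equal.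
    apply Lim_seq_ext. intros N. now rewrite E.
Qed.

Lemma Cconj_R (x : R) : Cconj x = x.
Proof. apply C_ext; simpl; ring. Qed.

Lemma pseries_conj (a : nat -> C) (q : C) : (forall k, Cconj (a k) = a k) ->
  pseries a (Cconj q) = Cconj (pseries a q).
Proof.
  intros H. unfold pseries. rewrite <- CSeries_conj. f_equal.
  apply FunctionalExtensionality.functional_extensionality. intros k. now rewrite Cmult_conj, Cpow_conj, H.
Qed.

Lemma sigma_coef_conj (k m : nat) : Cconj (sigma_coef k m) = sigma_coef k m.
Proof. destruct m; apply Cconj_R. Qed.

Lemma e2_conj (q : C) : e2 (Cconj q) = Cconj (e2 q).
Proof. unfold e2. rewrite pseries_conj by apply sigma_coef_conj. now rewrite Cminus_conj, Cmult_conj, !Cconj_R. Qed.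

Lemma e4_conj (q : C) : e4 (Cconj q) = Cconj (e4 q).
Proof. unfold e4. rewrite pseries_conj by apply sigma_coef_conj. now rewrite Cplus_conj, Cmult_conj, !Cconj_R. Qed.

Lemma e6_conj (q : C) : Cmod q < r_fd -> e6 (Cconj q) = Cconj (e6 q).
Proof.
  intros H. unfold e6. rewrite !q_derive_e4 by (rewrite ?Cmod_conj; exact H).
  rewrite pseries_conj.
  - now rewrite e2_conj, e4_conj, Cminus_conj, !Cmult_conj, !Cconj_R.
  - intros k. unfold theta_coef. now rewrite Cmult_conj, Cconj_R, sigma_coef_conj.
Qed.

Lemma euler_conj (q : C) : euler (Cconj q) = Cconj (euler q).
Proof.
  unfold euler. rewrite <- CProd_conj. f_equal.
  apply FunctionalExtensionality.functional_extensionality. intros k.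
  now rewrite Cminus_conj, Cpow_conj, Cconj_R.
Qed.

Lemma real_of_conj (z : C) : Cconj z = z -> z = RtoC (Re z).
Proof. intros H. apply C_ext; [reflexivity|]. apply (f_equal Im) in H. rewrite im_conj in H. simpl in *. lra. Qed.

Lemma im_0_of_conj (z : C) : Cconj z = z -> Im z = 0.
Proof. intros H. apply (f_equal Im) in H. rewrite im_conj in H. lra. Qed.

Lemma qpar_conj (tau : C) : qpar (- Cconj tau) = Cconj (qpar tau).
Proof.
  unfold qpar. rewrite <- Cexp_conj. f_equal. rewrite !Cmult_conj, !Cconj_R.
  apply C_ext; simpl; ring.
Qed.

Lemma im_neg_conj (tau : C) : Im (- Cconj tau) = Im tau.
Proof. rewrite im_opp, im_conj. ring. Qed.

Lemma E4_conj (tau : C) : 0 < Im tau -> E4 (- Cconj tau) = Cconj (E4 tau).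
Proof. intros H. rewrite !E4_e4, qpar_conj by now rewrite ?im_neg_conj. apply e4_conj. Qed.

Lemma Delta_conj (tau : C) : Defs.Delta (- Cconj tau) = Cconj (Defs.Delta tau).
Proof. now rewrite !Delta_euler, qpar_conj, euler_conj, Cmult_conj, Cpow_conj. Qed.

Lemma J_conj (tau : C) : 0 < Im tau -> J (- Cconj tau) = Cconj (J tau).
Proof.
  intros H. unfold J. rewrite E4_conj, Delta_conj by exact H. rewrite Cdiv_conj.
  - now rewrite Cpow_conj, Cmult_conj, Cconj_R.
  - intros E. apply Cmult_integral in E as [E|E]; [apply RtoC_inj in E; lra|now apply (Delta_nz tau)].
Qed.

Lemma J_T (tau : C) (k : Z) : 0 < Im tau -> J (tau + IZR k) = J tau.
Proof. intros H. rewrite <- (mobius_T k). now apply J_mobius. Qed.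

Lemma J_S (tau : C) : 0 < Im tau -> J (- / tau) = J tau.
Proof. intros H. rewrite <- mobius_S by (apply Im_nz; lra). now apply J_mobius. Qed.

(** In the three cases the reflected point [- conj tau] is [tau], [tau - 1] or [-1 / tau], so [J]
    equals its own conjugate. *)
Lemma im_J_boundary (tau : C) : 0 < Im tau -> Re tau = 0 \/ Re tau = / 2 \/ Cmod tau = 1 -> Im (J tau) = 0.
Proof.
  intros H B. apply im_0_of_conj. rewrite <- J_conj by exact H. destruct B as [B|[B|B]].
  - f_equal. apply C_ext; simpl; unfold Re, Im in *; lra.
  - rewrite <- (J_T _ 1) by (now rewrite im_neg_conj). f_equal. apply C_ext; simpl; unfold Re, Im in *; lra.
  - rewrite <- (J_S tau) by exact H. f_equal. f_equal.
    assert (H0 : tau <> 0) by (apply Im_nz; lra).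
    assert (A := Cmod2_conj tau). rewrite B, pow1 in A.
    replace (Cconj tau) with (tau * Cconj tau * / tau)%C by (field; exact H0).
    rewrite <- A. field. exact H0.
Qed.

(** * Sign of the imaginary part of J on the right half of the fundamental domain *)

Lemma hol_lipschitz (f : C -> C) (c : C) : hol f c ->
  exists r L, 0 < r /\ 0 < L /\ forall a b, Cmod (a - c) < r -> Cmod (b - c) < r ->
    Cmod (f b - f a) <= L * Cmod (b - a).
Proof.
  intros H. destruct (hol_open f c H) as [r [Hr Hf]].
  destruct (ccont_bounded (C_derive f) c) as [s [Hs HB]]; [apply hol_ccont, hol_C_derive, H|].
  exists (Rmin r s), (Cmod (C_derive f c) + 1). split; [now apply Rmin_glb_lt|].
  split; [generalize (Cmod_ge_0 (C_derive f c)); lra|]. intros a b Ha Hb.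
  apply (mean_value_disc f (C_derive f) c a b (Rmin r s)); [| |exact Ha|exact Hb];
    intros w Hw; generalize (Rmin_l r s) (Rmin_r r s); intros.
  - apply hol_cderiv, Hf. lra.
  - apply HB. lra.
Qed.

Lemma im_mult_conj (a b : C) : Im (a * Cconj b) = Im a * Re b - Re a * Im b.
Proof. destruct a, b. simpl. ring. Qed.

(** Here [J = G(q) / (1728 q)] with [G] real on the real axis and [G 0 = 1]. The Lipschitz bound
    between [q] and its conjugate gives [|Im G| <= L Im q], so for small [q] the term [- Re G Im q]
    decides the sign of [Im (G conj q)]. *)
Lemma im_J_top : exists Y, 0 < Y /\ forall tau, 0 <= Re tau <= / 2 -> Y <= Im tau -> Im (J tau) <= 0.
Proof.
  set (G := fun q => (e4 q ^ 3 / euler q ^ 24)%C).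
  assert (H1 := Cmod_0_lt_1).
  assert (HG : hol G 0).
  { apply hol_div; [apply (hol_pow e4), e4_hol, H1|apply (hol_pow euler), euler_hol, H1|].
    now apply Cpow_nz, euler_nz. }
  assert (G0 : G 0 = 1).
  { unfold G. rewrite e4_0, euler_0, !Cpow_1_l. field. }
  destruct (hol_lipschitz G 0 HG) as [r [L [Hr [HL Hlip]]]].
  (* The bound [1 / (2 L)] keeps both [L |q|] and [|Re G - 1|] at most 1/2. *)
  set (m := Rmin (Rmin r (/ 2)) (/ (2 * L))).
  assert (Hm : 0 < m).
  { apply Rmin_glb_lt; [apply Rmin_glb_lt; lra|]. apply Rinv_0_lt_compat. lra. }
  assert (Hmr : m <= r /\ m <= / 2 /\ m <= / (2 * L)).
  { unfold m. generalize (Rmin_l (Rmin r (/ 2)) (/ (2 * L))) (Rmin_r (Rmin r (/ 2)) (/ (2 * L)))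
      (Rmin_l r (/ 2)) (Rmin_r r (/ 2)). lra. }
  exists (1 + Rabs (ln m)). assert (Hl := Rabs_pos (ln m)). split; [lra|]. intros tau Hx Hy.
  assert (H : 0 < Im tau) by lra.
  set (q := qpar tau).
  assert (Hq : Cmod q < m).
  { unfold q. rewrite Cmod_qpar. rewrite <- (exp_ln m Hm) at 1. apply exp_increasing.
    assert (Hpi := PI2_3_2). generalize (Rle_abs (- ln m)). rewrite Rabs_Ropp. intros.
    assert (Rabs (ln m) + 1 <= 2 * PI * Im tau) by nra. lra. }
  assert (Hq0 : q <> 0) by apply qpar_nz.
  assert (Hqi : 0 <= Im q).
  { unfold q, qpar, Cexp. simpl. apply Rmult_le_pos; [left; apply exp_pos|].
    apply sin_ge_0; unfold Re, Im in *; generalize PI_RGT_0; nra. }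
  assert (Hq1 : Cmod q < 1) by lra.
  assert (Hc : G (Cconj q) = Cconj (G q)).
  { unfold G. rewrite e4_conj, euler_conj, Cdiv_conj, !Cpow_conj; [reflexivity|].
    now apply Cpow_nz, euler_nz. }
  assert (EJ : J tau = (RtoC (/ (1728 * Cmod q ^ 2)) * (G q * Cconj q))%C).
  { unfold J, G. rewrite E4_e4, Delta_euler by exact H. fold q.
    assert (He : (euler q ^ 24)%C <> 0) by now apply Cpow_nz, euler_nz.
    assert (Hcq : Cconj q <> 0).
    { intros E. apply Hq0. rewrite <- (Cconj_conj q), E. apply Cconj_R. }
    assert (Hp : 0 < Cmod q ^ 2) by (apply pow_lt, Cmod_gt_0, Hq0).
    rewrite RtoC_inv, RtoC_mult, Cmod2_conj by lra.
    field. repeat split; auto. now apply euler_nz. }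
  rewrite EJ.
  assert (Hp : 0 < Cmod q ^ 2) by (apply pow_lt, Cmod_gt_0, Hq0).
  assert (Him : Im (G q * Cconj q)%C <= 0).
  { assert (A1 := Hlip (Cconj q) q). assert (A2 := Hlip 0 q).
    assert (Es : forall z : C, (z - 0)%C = z) by (intros; ring).
    rewrite !Es, Cmod_conj in A1. rewrite !Es, Cmod_0, G0 in A2.
    specialize (A1 ltac:(lra) ltac:(lra)). specialize (A2 ltac:(lra) ltac:(lra)).
    assert (E2i : forall z, Cmod (z - Cconj z) = 2 * Rabs (Im z)).
    { intros z. rewrite im_alt', !Cmod_mult, Cmod_Ci, !Cmod_R, (Rabs_pos_eq 2) by lra. ring. }
    rewrite Hc, !E2i in A1. rewrite (Rabs_pos_eq (Im q)) in A1 by exact Hqi.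
    assert (A3 := re_le_Cmod (G q - 1)). rewrite re_minus in A3. simpl (Re 1) in A3.
    assert (B1 := re_le_Cmod q). assert (Hq00 := Cmod_ge_0 q).
    assert (B2 : L * Cmod q <= / 2).
    { replace (/ 2) with (L * / (2 * L)) by (field; lra). apply Rmult_le_compat_l; lra. }
    apply Rabs_le_between in A3.
    assert (B3 : Im (G q) * Re q <= L * Im q * Cmod q).
    { eapply Rle_trans; [apply Rle_abs|]. rewrite Rabs_mult. apply Rmult_le_compat; try apply Rabs_pos; lra. }
    replace (Im (G q * Cconj q)) with (Im (G q) * Re q - Re (G q) * Im q) by (symmetry; apply im_mult_conj).
    nra. }
  rewrite im_scal_l.
  assert (0 < / (1728 * Cmod q ^ 2)) by (apply Rinv_0_lt_compat; lra). nra.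
Qed.

Definition half_dom (tau : C) : Prop := 0 < Im tau /\ 0 <= Re tau <= / 2 /\ 1 <= Cmod tau.
Definition half_interior (tau : C) : Prop := 0 < Im tau /\ 0 < Re tau < / 2 /\ 1 < Cmod tau.

Lemma half_dom_fund (tau : C) : half_dom tau -> fund_dom tau.
Proof. intros [H [H1 H2]]. repeat split; lra. Qed.

Lemma half_J_derivative_nz (tau : C) : 0 < Im tau -> 0 < Re tau < / 2 -> 1 <= Cmod tau ->
  (- (c2pi * (E4 tau ^ 2 * E6 tau / (1728 * Defs.Delta tau))))%C <> 0.
Proof.
  intros H Hr Hm. assert (F : fund_dom tau) by (repeat split; lra).
  apply J_derivative_nz; [exact H| |]; intros E.
  - destruct (fund_dom_E4_zero tau F E) as [k ->]. rewrite re_plus in Hr. simpl in Hr.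
    assert (A : -1 < IZR k < 0) by lra. destruct A as [A1 A2].
    apply (lt_IZR (-1) k) in A1. apply (lt_IZR k 0) in A2. lia.
  - destruct (fund_dom_E6_zero tau F E) as [k ->]. rewrite re_plus in Hr. simpl in Hr.
    assert (A : 0 < IZR k < 1) by lra. destruct A as [A1 A2].
    apply (lt_IZR 0 k) in A1. apply (lt_IZR k 1) in A2. lia.
Qed.

(** A step in the direction [i conj d] raises the imaginary part by [t |d|^2] to first order, while
    the error is at most half of that. *)
Lemma cderiv_im_increase (f : C -> C) (z d : C) (r : R) : cderiv f z d -> d <> 0 -> 0 < r ->
  exists w, Cmod (w - z) < r /\ Im (f z) < Im (f w).
Proof.
  intros Hf Hd Hr. assert (Hp : 0 < Cmod d) by now apply Cmod_gt_0.
  destruct (Hf (Cmod d / 2)) as [del [Hdel Hw]]; [lra|].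
  set (t := Rmin r del / (2 * Cmod d)).
  assert (Hm : 0 < Rmin r del) by now apply Rmin_glb_lt.
  assert (Ht : 0 < t) by (apply Rdiv_lt_0_compat; lra).
  assert (Etd : t * Cmod d = Rmin r del / 2) by (unfold t; field; lra).
  set (w := (z + RtoC t * (Ci * Cconj d))%C).
  assert (Ew : (w - z)%C = (RtoC t * (Ci * Cconj d))%C) by (unfold w; ring).
  assert (Em : Cmod (w - z) = t * Cmod d).
  { rewrite Ew, !Cmod_mult, Cmod_Ci, Cmod_conj, Cmod_R, Rabs_pos_eq; lra. }
  generalize (Rmin_l r del) (Rmin_r r del). intros.
  exists w. split; [lra|]. specialize (Hw w ltac:(lra)).
  assert (A := Rle_trans _ _ _ (im_le_Cmod _) Hw). rewrite !im_minus, Em in A.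
  replace (Im (d * (w - z))) with (t * Cmod d ^ 2) in A.
  - apply Rabs_le_between in A. assert (0 < t * Cmod d ^ 2) by (apply Rmult_lt_0_compat; [lra|now apply pow_lt]).
    nra.
  - rewrite Ew. replace (d * (RtoC t * (Ci * Cconj d)))%C with (RtoC t * (Ci * (d * Cconj d)))%C by ring.
    rewrite <- Cmod2_conj, im_scal_l. simpl. ring.
Qed.

Lemma half_interior_open (tau : C) : half_interior tau ->
  exists r, 0 < r /\ forall w, Cmod (w - tau) < r -> half_interior w.
Proof.
  intros [H [Hr Hm]]. set (r := Rmin (Rmin (Im tau) (Cmod tau - 1)) (Rmin (Re tau) (/ 2 - Re tau))).
  assert (A : 0 < r) by (repeat apply Rmin_glb_lt; lra).
  assert (B : r <= Im tau /\ r <= Cmod tau - 1 /\ r <= Re tau /\ r <= / 2 - Re tau).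
  { unfold r. set (a := Rmin (Im tau) _). set (b := Rmin (Re tau) _).
    generalize (Rmin_l a b) (Rmin_r a b) (Rmin_l (Im tau) (Cmod tau - 1)) (Rmin_r (Im tau) (Cmod tau - 1))
      (Rmin_l (Re tau) (/ 2 - Re tau)) (Rmin_r (Re tau) (/ 2 - Re tau)). fold a b. lra. }
  exists r. split; [exact A|]. intros w Hw.
  assert (D1 := Rle_lt_trans _ _ _ (re_le_Cmod _) Hw). assert (D2 := Rle_lt_trans _ _ _ (im_le_Cmod _) Hw).
  rewrite re_minus in D1. rewrite im_minus in D2. apply Rabs_def2 in D1, D2.
  assert (D3 := Cmod_triangle (tau - w) w). replace (tau - w + w)%C with tau in D3 by ring.
  replace (tau - w)%C with (- (w - tau))%C in D3 by ring. rewrite Cmod_opp in D3.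
  repeat split; lra.
Qed.

Definition arc_pt (x : R) : R := sqrt (1 - x ^ 2).

Lemma arc_pt_facts (x : R) : 0 <= x <= / 2 -> arc_pt x ^ 2 = 1 - x ^ 2 /\ / 2 < arc_pt x <= 1.
Proof.
  intros H. assert (A : 0 <= 1 - x ^ 2) by nra. unfold arc_pt.
  assert (B := pow2_sqrt _ A). assert (D := sqrt_pos (1 - x ^ 2)). split; [exact B|]. nra.
Qed.

Lemma arc_pt_Cmod (x : R) : 0 <= x <= / 2 -> Cmod (x, arc_pt x) = 1.
Proof.
  intros H. destruct (arc_pt_facts x H) as [A1 A2]. unfold Cmod, fst, snd. rewrite A1.
  replace (x ^ 2 + (1 - x ^ 2)) with 1 by ring. apply sqrt_1.
Qed.

Lemma arc_pt_lipschitz (x u : R) : 0 <= x <= / 2 -> 0 <= u <= / 2 -> Rabs (arc_pt u - arc_pt x) <= Rabs (u - x).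
Proof.
  intros Hx Hu. destruct (arc_pt_facts x Hx) as [A1 A2]. destruct (arc_pt_facts u Hu) as [B1 B2].
  assert (E : (arc_pt u - arc_pt x) * (arc_pt u + arc_pt x) = (x - u) * (x + u)) by nra.
  apply (f_equal Rabs) in E. rewrite !Rabs_mult, (Rabs_minus_sym x u) in E.
  rewrite (Rabs_pos_eq (arc_pt u + arc_pt x)), (Rabs_pos_eq (x + u)) in E by lra.
  assert (P := Rabs_pos (u - x)). assert (Q := Rabs_pos (arc_pt u - arc_pt x)). nra.
Qed.

(** With the height [s] above the unit arc as second coordinate, the truncated half domain is the
    image of a rectangle. *)
Lemma half_dom_max (Y : R) : 0 < Y -> exists z, half_dom z /\
  forall w, half_dom w -> Im w <= Y -> Im (J w) <= Im (J z).
Proof.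
  intros HY. set (z := fun x s => (x, arc_pt x + s) : C).
  assert (Hz : forall x s, 0 <= x <= / 2 -> 0 <= s <= Y -> half_dom (z x s)).
  { intros x s Hx Hs. destruct (arc_pt_facts x Hx) as [A1 A2]. unfold half_dom, z. simpl.
    split; [lra|]. split; [lra|]. assert (B := Cmod2_alt (x, arc_pt x + s)). simpl in B.
    generalize (Cmod_ge_0 (x, arc_pt x + s)). nra. }
  destruct (rectangle_max 0 (/ 2) 0 Y (fun x s => Im (J (z x s)))) as [x [s [Hx [Hs Hmax]]]]; [lra|lra| |].
  - intros x s Hx Hs eps He. destruct (Hz x s Hx Hs) as [Hi _].
    destruct (hol_ccont J _ (J_hol _ Hi) eps He) as [d [Hd Hw]]. exists (d / 3). split; [lra|].
    intros u v Hu Hv Hux Hvs. rewrite <- im_minus. eapply Rle_lt_trans; [apply im_le_Cmod|]. apply Hw.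
    eapply Rle_lt_trans; [apply Cmod_le_re_im|]. rewrite re_minus, im_minus. simpl.
    assert (A := arc_pt_lipschitz x u Hx Hu).
    replace (arc_pt u + v - (arc_pt x + s)) with ((arc_pt u - arc_pt x) + (v - s)) by ring.
    assert (B := Rabs_triang (arc_pt u - arc_pt x) (v - s)). lra.
  - exists (z x s). split; [now apply Hz|]. intros w [Hi [Hr Hm]] HwY.
    destruct (arc_pt_facts (Re w) Hr) as [A1 A2].
    assert (B := Cmod2_alt w). assert (B1 : 1 <= Cmod w ^ 2) by nra.
    assert (C0 : arc_pt (Re w) <= Im w) by nra.
    assert (E : w = z (Re w) (Im w - arc_pt (Re w))) by (apply C_ext; unfold z; simpl; unfold Re, Im; ring).
    rewrite E. apply Hmax; lra.
Qed.

Lemma half_dom_cases (z : C) : half_dom z -> half_interior z \/ (Re z = 0 \/ Re z = / 2 \/ Cmod z = 1).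
Proof.
  intros [H [Hr Hm]]. destruct (Req_dec (Re z) 0); [tauto|]. destruct (Req_dec (Re z) (/ 2)); [tauto|].
  destruct (Req_dec (Cmod z) 1); [tauto|]. left. repeat split; lra.
Qed.

Lemma half_interior_dom (z : C) : half_interior z -> half_dom z.
Proof. intros [H [H1 H2]]. repeat split; lra. Qed.

Lemma half_interior_increase (z : C) (r : R) : half_interior z -> 0 < r -> exists w,
  half_interior w /\ Cmod (w - z) < r /\ Im (J z) < Im (J w).
Proof.
  intros Hz Hr. destruct (half_interior_open z Hz) as [s [Hs Ho]].
  assert (H := Hz). destruct H as [H [H1 H2]].
  destruct (cderiv_im_increase J z _ (Rmin r s) (J_cderiv z H)) as [w [Hw Hi]];
    [apply half_J_derivative_nz; lra|now apply Rmin_glb_lt|].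
  exists w. generalize (Rmin_l r s) (Rmin_r r s). intros. split; [apply Ho; lra|]. split; [lra|exact Hi].
Qed.

(** A maximum of [Im J] over the truncated domain cannot be interior, since [J] has nonzero
    derivative there. It lies on the sides or the arc, where [J] is real, or at the top, which
    [im_J_top] covers. *)
Lemma half_dom_im_J (z : C) : half_dom z -> Im (J z) <= 0.
Proof.
  intros Hz. destruct im_J_top as [Y0 [HY0 Htop]].
  set (Y := Rmax Y0 (Im z)). assert (HY : Y0 <= Y /\ Im z <= Y) by (split; [apply Rmax_l|apply Rmax_r]).
  destruct (half_dom_max Y ltac:(lra)) as [z0 [Hz0 Hmax]].
  apply Rle_trans with (Im (J z0)); [apply Hmax; [exact Hz|lra]|].
  destruct (Rle_lt_dec Y (Im z0)) as [Ht|Ht]; [apply Htop; [apply Hz0|lra]|].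
  destruct (half_dom_cases z0 Hz0) as [Hi|Hb].
  - exfalso. destruct (half_interior_increase z0 (Y - Im z0) Hi) as [w [Hw [Hd Hinc]]]; [lra|].
    assert (A := Rle_lt_trans _ _ _ (im_le_Cmod _) Hd). rewrite im_minus in A. apply Rabs_def2 in A.
    assert (B := Hmax w (half_interior_dom w Hw) ltac:(lra)). lra.
  - right. apply im_J_boundary; [apply Hz0|exact Hb].
Qed.

Lemma half_interior_im_J (z : C) : half_interior z -> Im (J z) < 0.
Proof.
  intros Hz. destruct (half_interior_increase z 1 Hz Rlt_0_1) as [w [Hw [_ Hi]]].
  assert (A := half_dom_im_J w (half_interior_dom w Hw)). lra.
Qed.

(** * Values of J on the vertical sides and injectivity on the arc *)

Lemma qpar_half_line (y : R) : qpar (/ 2, y) = RtoC (- exp (- (2 * PI * y))).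
Proof.
  unfold qpar, Cexp. apply C_ext; simpl.
  - replace (_ - _) with (- (2 * PI * y)) at 1 by ring. match goal with |- _ * cos ?a = _ => replace a with PI by field end.
    rewrite cos_PI. ring.
  - match goal with |- _ * sin ?a = _ => replace a with PI by field end. rewrite sin_PI. ring.
Qed.

Lemma qpar_imag (y : R) : qpar (0, y) = RtoC (exp (- (2 * PI * y))).
Proof.
  unfold qpar, Cexp. apply C_ext; simpl.
  - replace (_ - _) with (- (2 * PI * y)) at 1 by ring. match goal with |- _ * cos ?a = _ => replace a with 0 by ring end.
    rewrite cos_0. ring.
  - match goal with |- _ * sin ?a = _ => replace a with 0 by ring end. rewrite sin_0. ring.
Qed.

Lemma Delta_real_nome (tau : C) (q : R) : 0 < Im tau -> qpar tau = RtoC q -> exists e, 0 < e /\ Defs.Delta tau = RtoC (q * e).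
Proof.
  intros H Hq. assert (N := euler_nz _ (proj2 (Cmod_qpar_lt_1 tau H))). rewrite Delta_euler.
  rewrite Hq in *. assert (E : euler q = RtoC (Re (euler q))).
  { apply real_of_conj. now rewrite <- euler_conj, Cconj_R. }
  exists (Re (euler q) ^ 24). split.
  - assert (Re (euler q) <> 0) by (intros A; apply N; rewrite E, A; reflexivity).
    replace (Re (euler q) ^ 24) with ((Re (euler q) ^ 2) ^ 12) by ring. apply pow_lt.
    assert (0 <= Re (euler q) ^ 2) by apply pow2_ge_0. assert (Re (euler q) ^ 2 <> 0) by now apply pow_nonzero.
    lra.
  - rewrite E at 1. now rewrite <- RtoC_pow, <- RtoC_mult.
Qed.

(** The nome is negative on this line, so [Delta < 0]. Going up from [rho] the nome increases
    towards 0, and by [e4_difference] so does [E4] from its zero at [rho]; hence [E4 >= 0]. *)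
Lemma J_right_side (tau : C) : half_dom tau -> Re tau = / 2 -> Re (J tau) <= 0.
Proof.
  intros Hd Hr. assert (H := Hd). destruct H as [H [_ Hm]].
  assert (Hq : qpar tau = RtoC (- exp (- (2 * PI * Im tau)))).
  { rewrite <- qpar_half_line. f_equal. now apply C_ext. }
  assert (Hqr : qpar rho = RtoC (- exp (- (2 * PI * Im rho)))) by apply qpar_half_line.
  assert (Hi : Im rho <= Im tau).
  { assert (A := Cmod2_alt tau). rewrite Hr in A. destruct sqrt3_facts as [S1 S2]. simpl (Im rho).
    assert (1 <= Cmod tau ^ 2) by nra. nra. }
  assert (Hle : exp (- (2 * PI * Im tau)) <= exp (- (2 * PI * Im rho))).
  { apply exp_le_mono. generalize PI_RGT_0. intros. nra. }
  assert (F := e4_difference (qpar tau) (qpar rho) (fund_dom_nome _ (half_dom_fund _ Hd)) (fund_dom_nome _ fund_dom_rho)).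
  rewrite <- (E4_e4 rho Im_rho), E4_rho, <- (E4_e4 tau H) in F.
  assert (P := exp_pos (- (2 * PI * Im tau))).
  destruct (Delta_real_nome tau _ H Hq) as [e [He ED]].
  assert (ER : E4 tau = RtoC (Re (E4 tau))).
  { apply real_of_conj. rewrite E4_e4, <- e4_conj, Hq, Cconj_R by exact H. reflexivity. }
  rewrite Hq, Hqr in F. set (a := exp (- (2 * PI * Im tau))) in *. set (b := exp (- (2 * PI * Im rho))) in *.
  rewrite <- RtoC_minus, <- RtoC_mult, ER, <- !RtoC_minus, !Cmod_R in F.
  rewrite (Rabs_pos_eq (- a - - b)) in F by lra. apply Rabs_le_between in F.
  set (x := Re (E4 tau)) in *. assert (Hx : 0 <= x) by lra.
  assert (0 < a * e) by now apply Rmult_lt_0_compat.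
  unfold J. rewrite ED, ER, <- RtoC_pow, <- RtoC_mult, <- RtoC_div, re_RtoC by lra.
  assert (0 <= x ^ 3) by now apply pow_le.
  replace (x ^ 3 / (1728 * (- a * e))) with (- (x ^ 3 * / (1728 * (a * e)))) by (field; split; lra).
  assert (0 < / (1728 * (a * e))) by (apply Rinv_0_lt_compat; lra).
  assert (0 <= x ^ 3 * / (1728 * (a * e))) by (apply Rmult_le_pos; lra). lra.
Qed.

(** The nome is positive, so [Delta > 0] and [J - 1] is a real square divided by a positive
    number. *)
Lemma J_left_side (tau : C) : half_dom tau -> Re tau = 0 -> 1 <= Re (J tau).
Proof.
  intros Hd Hr. assert (H := Hd). destruct H as [H [_ Hm]].
  assert (Hq : qpar tau = RtoC (exp (- (2 * PI * Im tau)))).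
  { rewrite <- qpar_imag. f_equal. now apply C_ext. }
  destruct (Delta_real_nome tau _ H Hq) as [e [He ED]]. assert (P := exp_pos (- (2 * PI * Im tau))).
  assert (ER : E6 tau = RtoC (Re (E6 tau))).
  { apply real_of_conj. unfold E6. rewrite <- e6_conj by (now apply fund_dom_nome, half_dom_fund).
    now rewrite Hq, Cconj_R. }
  replace (J tau) with ((J tau - 1) + 1)%C by ring. rewrite J_minus_1 by exact H.
  set (a := exp (- (2 * PI * Im tau))) in *. set (x := Re (E6 tau)) in *.
  assert (0 < a * e) by now apply Rmult_lt_0_compat.
  rewrite ED, ER, <- RtoC_pow, <- RtoC_mult, <- RtoC_div, <- RtoC_plus, re_RtoC by lra.
  assert (0 <= x ^ 2) by apply pow2_ge_0.
  assert (0 < / (1728 * (a * e))) by (apply Rinv_0_lt_compat; lra).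
  assert (0 <= x ^ 2 * / (1728 * (a * e))) by (apply Rmult_le_pos; lra). unfold Rdiv. lra.
Qed.

Lemma J_arc (tau : C) (x : R) : half_dom tau -> J tau = RtoC x -> 0 < x < 1 ->
  0 < Re tau < / 2 /\ tau = (Re tau, arc_pt (Re tau)).
Proof.
  intros Hd HJ Hx. assert (H := Hd). destruct H as [H [Hr Hm]].
  assert (N0 : Re tau <> 0).
  { intros E. assert (A := J_left_side tau Hd E). rewrite HJ in A. simpl in A. lra. }
  assert (N1 : Re tau <> / 2).
  { intros E. assert (A := J_right_side tau Hd E). rewrite HJ in A. simpl in A. lra. }
  assert (N2 : Cmod tau = 1).
  { destruct (half_dom_cases tau Hd) as [Hi|[E|[E|E]]]; [|contradiction|contradiction|exact E].
    assert (A := half_interior_im_J tau Hi). rewrite HJ in A. simpl in A. lra. }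
  split; [lra|]. apply C_ext; [reflexivity|]. simpl.
  destruct (arc_pt_facts (Re tau) Hr) as [A1 A2]. assert (B := Cmod2_alt tau). rewrite N2 in B. nra.
Qed.

(** Along the arc [Im J] is identically 0. A value taken twice would, by Rolle's theorem for [Re J],
    give a point where the whole derivative of [J] along the arc vanishes, against
    [half_J_derivative_nz]. *)
Lemma J_arc_inj (u v : R) : 0 < u < / 2 -> 0 < v < / 2 ->
  J (u, arc_pt u) = J (v, arc_pt v) -> u = v.
Proof.
  set (z := fun s : R => (s, arc_pt s) : C).
  assert (Hz : forall s, 0 < s < / 2 -> 0 < Im (z s) /\ 1 = Cmod (z s)).
  { intros s Hs. destruct (arc_pt_facts s ltac:(lra)) as [A1 A2]. simpl. split; [lra|].
    symmetry. apply arc_pt_Cmod. lra. }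
  assert (Hdz : forall s, 0 < s < / 2 -> rderiv z s (1, - s / arc_pt s)).
  { intros s Hs. destruct (arc_pt_facts s ltac:(lra)) as [A1 A2]. split; simpl; [apply (is_derive_id s)|].
    unfold arc_pt in *. auto_derive; [nra|]. replace (1 + - (s * (s * 1))) with (1 - s ^ 2) by ring. field. lra. }
  set (d := fun s => (- (c2pi * (E4 (z s) ^ 2 * E6 (z s) / (1728 * Defs.Delta (z s)))) * ((1, - s / arc_pt s)%R : C))%C).
  assert (HJ : forall s, 0 < s < / 2 -> rderiv (fun s => J (z s)) s (d s)).
  { intros s Hs. apply (rderiv_comp J z); [now apply Hdz|]. apply J_cderiv. now apply Hz. }
  enough (W : forall u v, 0 < u < / 2 -> 0 < v < / 2 -> u < v -> J (z u) = J (z v) -> False).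
  { intros Hu Hv E. destruct (Rtotal_order u v) as [L|[L|L]]; [exfalso|exact L|exfalso].
    - now apply (W u v).
    - now apply (W v u). }
  intros a b Ha Hb Hab E.
  destruct (MVT_gen (fun s => Re (J (z s))) a b (fun s => Re (d s))) as [c [Hc Em]].
  - rewrite Rmin_left, Rmax_right by lra. intros s Hs. apply HJ. lra.
  - rewrite Rmin_left, Rmax_right by lra. intros s Hs.
    apply continuity_pt_filterlim. apply (ex_derive_continuous (fun s => Re (J (z s)))).
    destruct (HJ s ltac:(lra)) as [D _]. exists (Re (d s)). exact D.
  - rewrite Rmin_left, Rmax_right in Hc by lra. rewrite E in Em.
    assert (Rd : Re (d c) = 0).
    { assert (P : Re (d c) * (b - a) = 0) by lra. apply Rmult_integral in P as [P|P]; [exact P|lra]. }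
    assert (Id : Im (d c) = 0).
    { destruct (HJ c ltac:(lra)) as [_ A]. assert (B : is_derive (fun s => Im (J (z s))) c 0).
      { apply (is_derive_ext_loc (fun _ => 0)); [|apply (is_derive_const 0 c)].
        assert (Hpos : 0 < Rmin c (/ 2 - c)) by (apply Rmin_glb_lt; lra).
        exists (mkposreal _ Hpos). intros s Hs. change (Rabs (s - c) < Rmin c (/ 2 - c)) in Hs.
        generalize (Rmin_l c (/ 2 - c)) (Rmin_r c (/ 2 - c)). intros. apply Rabs_def2 in Hs.
        destruct (Hz s ltac:(lra)) as [Z1 Z2]. symmetry. apply im_J_boundary; auto. }
      apply is_derive_unique in A. apply is_derive_unique in B. congruence. }
    assert (D0 : d c = 0) by now apply C_ext.
    destruct (Hz c ltac:(lra)) as [Z1 Z2].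
    apply Cmult_integral in D0 as [D0|D0].
    + revert D0. apply half_J_derivative_nz; [exact Z1|simpl; lra|lra].
    + apply (f_equal Re) in D0. simpl in D0. lra.
Qed.

(** In the fundamental domain, the values of [J] in (0,1) are taken on the unit circle only,
    once on each half of it. *)
Lemma J_inj (tau w : C) (x : R) : 0 < Im tau -> 0 < Im w -> 0 < x < 1 ->
  J tau = RtoC x -> J w = RtoC x -> SL2Z_equiv tau w.
Proof.
  intros Ht Hw Hx.
  assert (W : forall t, 0 < Im t -> J t = RtoC x ->
    exists u, 0 < u < / 2 /\ J (u, arc_pt u) = RtoC x /\ SL2Z_equiv t (u, arc_pt u)).
  { intros t H E. destruct (reduce_to_fund_dom t H) as [g Hg].
    set (s := mobius g t) in *. assert (Es : J s = RtoC x) by (unfold s; now rewrite J_mobius).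
    assert (Hs := Hg). destruct Hs as [Hs [Hr Hm]].
    assert (Hts : SL2Z_equiv t s) by now apply SL2Z_equiv_mobius.
    destruct (Rle_lt_dec 0 (Re s)) as [L|L].
    - destruct (J_arc s x) as [A B]; [repeat split; lra|exact Es|exact Hx|].
      exists (Re s). rewrite <- B. auto.
    (* The left half is reflected into the right one. The reflected point turns out to lie on the
       unit circle, where reflection coincides with [S], so the orbit is unchanged. *)
    - assert (Hm' : Cmod (- Cconj s) = Cmod s) by now rewrite Cmod_opp, Cmod_conj.
      assert (Hr' : Re (- Cconj s) = - Re s) by now rewrite re_opp, re_conj.
      assert (Hi' := im_neg_conj s).
      assert (Ec : J (- Cconj s) = RtoC x) by (rewrite J_conj, Es, Cconj_R; auto).
      destruct (J_arc (- Cconj s) x) as [A B]; [repeat split; lra|exact Ec|exact Hx|].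
      exists (Re (- Cconj s)). rewrite <- B. split; [exact A|]. split; [exact Ec|].
      apply SL2Z_equiv_trans with s; [lra|exact Hts|]. exists SL2Z_S.
      assert (N : (- Cconj s)%C <> 0) by (apply Im_nz; lra).
      rewrite mobius_S by exact N.
      assert (M1 : Cmod (- Cconj s) = 1).
      { rewrite B. apply arc_pt_Cmod. lra. }
      assert (D := Cmod2_conj s). rewrite <- Hm', M1, pow1 in D.
      assert (N' : Cconj s <> 0) by (intros Z; apply N; rewrite Z; ring).
      replace s with (s * Cconj s * / Cconj s)%C at 1 by (field; exact N').
      rewrite <- D. field. exact N'. }
  intros E1 E2. destruct (W tau Ht E1) as [u [Hu [Ju Su]]]. destruct (W w Hw E2) as [v [Hv [Jv Sv]]].
  rewrite (J_arc_inj u v Hu Hv) in Su by congruence.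
  apply SL2Z_equiv_trans with (v, arc_pt v); [exact Hw|exact Su|].
  destruct (arc_pt_facts v ltac:(lra)) as [_ A]. apply SL2Z_equiv_sym; [simpl; lra|exact Sv].
Qed.

(** * Poles *)

Lemma csums_terms_bounded (a : nat -> C) (l : C) : csums a l -> exists K, forall n, Cmod (a n) <= K.
Proof.
  intros H. destruct (H 1 Rlt_0_1) as [N HN]. exists (rsumn (fun n => Cmod (a n)) N + 2).
  intros n. destruct (le_lt_dec N n) as [L|L].
  - assert (A := HN n L). assert (B := HN (S n) ltac:(lia)). cbn [csumn] in B.
    replace (a n) with ((csumn a n + a n - l) - (csumn a n - l))%C by ring.
    eapply Rle_trans; [apply Cmod_minus_le|].
    assert (D := rsumn_nonneg (fun n => Cmod (a n)) N (fun n => Cmod_ge_0 (a n))). lra.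
  - enough (D : forall m, (n < m)%nat -> Cmod (a n) <= rsumn (fun n => Cmod (a n)) m) by (generalize (D N L); lra).
    induction m; intros Hm; [lia|]. cbn [rsumn].
    assert (P := Cmod_ge_0 (a m)).
    assert (Q := rsumn_nonneg (fun n => Cmod (a n)) m (fun n => Cmod_ge_0 (a n))).
    destruct (Nat.eq_dec n m) as [->|Hn]; [lra|]. generalize (IHm ltac:(lia)). lra.
Qed.

Lemma Cmod_point (p : C) (t : R) : 0 <= t -> Cmod ((p + RtoC t) - p) = t.
Proof. intros H. replace (p + RtoC t - p)%C with (RtoC t) by ring. rewrite Cmod_R. now apply Rabs_pos_eq. Qed.

Lemma laurent_pseries (f : C -> C) (p : C) (m : nat) (a : nat -> C) : has_laurent f p m a ->
  exists r K, 0 < r /\ coef_bound a r K /\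
    forall z, 0 < Cmod (z - p) < r -> ((z - p) ^ m * f z)%C = pseries a (z - p).
Proof.
  intros [r [Hr H]].
  assert (A := H (p + RtoC (r / 2))%C). rewrite Cmod_point in A by lra. specialize (A ltac:(lra)).
  apply csums_is_series, csums_terms_bounded in A as [K HK].
  replace (p + RtoC (r / 2) - p)%C with (RtoC (r / 2)) in HK by ring.
  exists (r / 2), K. split; [lra|]. split.
  - intros k. specialize (HK k). rewrite Cmod_mult, Cmod_pow, Cmod_R, Rabs_pos_eq in HK by lra. exact HK.
  - intros z Hz. symmetry. apply csums_CSeries, csums_is_series, H. lra.
Qed.

(** At [p + t] the Laurent series is within [|a 0| / 2] of [a 0], whereas [t^m f] is at most [t M];
    a small [t] makes the two incompatible. *)
Lemma bounded_not_pole (f : C -> C) (p : C) (r M : R) : 0 < r ->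
  (forall z, Cmod (z - p) < r -> Cmod (f z) <= M) -> ~ is_pole f p.
Proof.
  intros Hr HM [m [Hm [a [Ha Ha0]]]]. apply laurent_pseries in Ha as [s [K [Hs [HK Hz]]]].
  assert (P : 0 < Cmod (a 0%nat)) by now apply Cmod_gt_0.
  destruct (pseries_ccont a s K 0 Hs HK ltac:(rewrite Cmod_0; lra) (Cmod (a 0%nat) / 2)) as [d [Hd Hw]]; [lra|].
  assert (HM0 : 0 <= M).
  { eapply Rle_trans; [apply Cmod_ge_0|]. apply (HM p). rewrite Cmod_sub_self. exact Hr. }
  set (t := Rmin (Rmin r s) (Rmin d (Rmin 1 (Cmod (a 0%nat) / (2 * (M + 1)))))  / 2).
  assert (Ht : 0 < t /\ t < r /\ t < s /\ t < d /\ t < 1 /\ t < Cmod (a 0%nat) / (2 * (M + 1))).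
  { unfold t. set (e := Cmod (a 0%nat) / (2 * (M + 1))). assert (0 < e) by (apply Rdiv_lt_0_compat; lra).
    set (x := Rmin r s). set (y := Rmin 1 e). set (v := Rmin d y).
    assert (0 < Rmin x v) by (repeat apply Rmin_glb_lt; lra).
    generalize (Rmin_l x v) (Rmin_r x v) (Rmin_l r s) (Rmin_r r s) (Rmin_l d y) (Rmin_r d y)
      (Rmin_l 1 e) (Rmin_r 1 e). fold x y v. lra. }
  destruct Ht as [T0 [T1 [T2 [T3 [T4 T5]]]]].
  assert (Et := Cmod_point p t ltac:(lra)).
  assert (A := Hz (p + RtoC t)%C ltac:(lra)). assert (B := HM (p + RtoC t)%C ltac:(lra)).
  replace (p + RtoC t - p)%C with (RtoC t) in A by ring.
  specialize (Hw (RtoC t)). replace (RtoC t - 0)%C with (RtoC t) in Hw by ring.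
  rewrite Cmod_R, Rabs_pos_eq, pseries_0, <- A in Hw by lra. specialize (Hw T3).
  assert (D : Cmod (a 0%nat) <= Cmod (RtoC t ^ m * f (p + RtoC t)%C - a 0%nat) + Cmod (RtoC t ^ m * f (p + RtoC t)%C)).
  { rewrite <- (Cmod_opp (_ - _)).
    replace (a 0%nat) with (- (RtoC t ^ m * f (p + RtoC t)%C - a 0%nat) + RtoC t ^ m * f (p + RtoC t)%C)%C at 1 by ring.
    apply Cmod_triangle. }
  rewrite (Cmod_mult (RtoC t ^ m)), Cmod_pow, Cmod_R, Rabs_pos_eq in D by lra.
  assert (F : t ^ m * Cmod (f (p + RtoC t)%C) <= t * M).
  { apply Rmult_le_compat; [apply pow_le; lra|apply Cmod_ge_0| |exact B].
    destruct m; [lia|]. simpl. assert (t ^ m <= 1) by (rewrite <- (pow1 m); apply pow_incr; lra).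
    assert (0 <= t ^ m) by (apply pow_le; lra). nra. }
  assert (G : t * (2 * (M + 1)) < Cmod (a 0%nat)).
  { apply (Rmult_lt_compat_r (2 * (M + 1))) in T5; [|lra].
    replace (Cmod (a 0%nat) / (2 * (M + 1)) * (2 * (M + 1))) with (Cmod (a 0%nat)) in T5 by (field; lra). exact T5. }
  nra.
Qed.

Lemma ccont_not_pole (f : C -> C) (p : C) : ccont f p -> ~ is_pole f p.
Proof. intros H. destruct (ccont_bounded f p H) as [r [Hr Hb]]. now apply bounded_not_pole with r (Cmod (f p) + 1). Qed.

Lemma holomorphic_at_cderiv (f : C -> C) (p : C) : holomorphic_at f p ->
  exists r, 0 < r /\ forall z, Cmod (z - p) < r -> cderiv f z (C_derive f z).
Proof.
  intros [r [Hr H]]. exists r. split; [exact Hr|]. intros z Hz. destruct (H z Hz) as [d Hd].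
  apply cderiv_is_derive in Hd. now rewrite (cderiv_C_derive _ _ _ Hd).
Qed.

Lemma holomorphic_at_not_pole (f : C -> C) (p : C) : holomorphic_at f p -> ~ is_pole f p.
Proof.
  intros H. destruct (holomorphic_at_cderiv f p H) as [r [Hr Hd]].
  apply ccont_not_pole. eapply cderiv_cont, Hd. rewrite Cmod_sub_self. exact Hr.
Qed.

Lemma hol_holomorphic_at (f : C -> C) (p : C) : hol f p -> holomorphic_at f p.
Proof.
  intros [r [Hr [f' H]]]. exists r. split; [exact Hr|]. intros z Hz. exists (f' z).
  apply cderiv_is_derive, H, Hz.
Qed.

(** Zero residue is built in: the residue of [f = g / (z - p)^2] is the derivative of [g] at [p]. *)
Definition double_pole (f : C -> C) (p : C) : Prop :=
  exists g r, 0 < r /\ hol g p /\ g p <> 0 /\ cderiv g p 0 /\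
    forall z, 0 < Cmod (z - p) < r -> ((z - p) ^ 2 * f z)%C = g z.

Lemma double_pole_order (f : C -> C) (p : C) : double_pole f p ->
  pole_of_order f p 2 /\ is_residue f p 0.
Proof.
  intros [g [r [Hr [Hg [Hg0 [Hd Hf]]]]]]. destruct (hol_open g p Hg) as [s [Hs Ho]].
  destruct (hol_Taylor g p s (s / 2)) as [a [K [HK Ha]]]; [lra|exact Ho|].
  assert (Hp : Cmod (p - p) < s / 2) by (rewrite Cmod_sub_self; lra).
  assert (E0 : a 0%nat = g p).
  { rewrite (Ha p Hp). replace (p - p)%C with (RtoC 0) by ring. now rewrite pseries_0. }
  assert (E1 : a 1%nat = 0).
  { assert (A := cderiv_unique _ _ _ _ Hd (cderiv_ext_loc _ _ _ _ (s / 2) ltac:(lra)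
      (fun w Hw => eq_sym (Ha w Hw)) (pseries_cderiv_at a (s / 2) K p p ltac:(lra) HK Hp))).
    replace (p - p)%C with (RtoC 0) in A by ring. rewrite pseries_0 in A. rewrite A.
    unfold pderiv. simpl. ring. }
  assert (HL : has_laurent f p 2 a).
  { exists (Rmin r (s / 2)). split; [apply Rmin_glb_lt; lra|]. intros z Hz.
    generalize (Rmin_l r (s / 2)) (Rmin_r r (s / 2)). intros.
    rewrite Hf, Ha by lra. apply csums_is_series. apply pseries_csums with (s / 2) K; [lra|exact HK|lra]. }
  split; [split; [lia|]; exists a; split; [exact HL|congruence]|].
  exists 2%nat, a. split; [exact HL|now symmetry].
Qed.

Lemma double_pole_is_pole (f : C -> C) (p : C) : double_pole f p -> is_pole f p.
Proof. intros H. exists 2%nat. now apply double_pole_order. Qed.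

(** A primitive of a function with a double pole is unbounded: by the mean value theorem it grows
    by at least [c / s] between [p + s / 2] and [p + s]. *)
Lemma double_pole_no_primitive (f h : C -> C) (p : C) (r : R) : 0 < r -> double_pole f p ->
  (forall z, Cmod (z - p) < r -> cderiv h z (f z)) -> False.
Proof.
  intros Hr [g [r0 [Hr0 [Hg [Hg0 [_ Hf]]]]]] Hh.
  assert (Hp : Cmod (p - p) < r) by (rewrite Cmod_sub_self; lra).
  assert (P : 0 < Cmod (g p)) by now apply Cmod_gt_0.
  destruct (hol_ccont g p Hg (Cmod (g p) / 2)) as [d1 [Hd1 Hw1]]; [lra|].
  destruct (cderiv_cont _ _ _ (Hh p Hp) 1 Rlt_0_1) as [d2 [Hd2 Hw2]].
  (* The estimates below force [s >= |g p| / 8], so any [s] below this bound is contradictory. *)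
  set (e := Cmod (g p) / 16).
  set (s := Rmin (Rmin r r0) (Rmin d1 (Rmin d2 e)) / 2).
  assert (Ht : 0 < s /\ s < r /\ s < r0 /\ s < d1 /\ s < d2 /\ s < e).
  { unfold s. assert (0 < e) by (unfold e; lra).
    set (x := Rmin r r0). set (y := Rmin d2 e). set (v := Rmin d1 y).
    assert (0 < Rmin x v) by (repeat apply Rmin_glb_lt; lra).
    generalize (Rmin_l x v) (Rmin_r x v) (Rmin_l r r0) (Rmin_r r r0) (Rmin_l d1 y) (Rmin_r d1 y)
      (Rmin_l d2 e) (Rmin_r d2 e). fold x y v. lra. }
  destruct Ht as [T0 [T1 [T2 [T3 [T4 T5]]]]].
  set (psi := fun t : R => (Cconj (g p) * h (p + RtoC t * 1))%C).
  set (df := fun t : R => (Cconj (g p) * f (p + RtoC t * 1) * 1)%C).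
  assert (Hpt : forall t, 0 <= t -> Cmod (p + RtoC t * 1 - p) = t).
  { intros t H0. rewrite Cmult_1_r. now apply Cmod_point. }
  assert (D : forall t, 0 < t <= s -> rderiv psi t (df t)).
  { intros t H0. apply (rderiv_comp (fun z => Cconj (g p) * h z)%C (fun t => p + RtoC t * 1)%C t
      (Cconj (g p) * f (p + RtoC t * 1))%C 1); [apply rderiv_segment|].
    apply cderiv_scal, Hh. rewrite Hpt; lra. }
  destruct (MVT_gen (fun t => Re (psi t)) (s / 2) s (fun t => Re (df t))) as [c [Hc Em]].
  - rewrite Rmin_left, Rmax_right by lra. intros t H0. destruct (D t ltac:(lra)) as [A _]. exact A.
  - rewrite Rmin_left, Rmax_right by lra. intros t H0.
    apply continuity_pt_filterlim. apply (ex_derive_continuous (fun s => Re (psi s))).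
    destruct (D t ltac:(lra)) as [A _]. exists (Re (df t)). exact A.
  - rewrite Rmin_left, Rmax_right in Hc by lra.
    assert (Up : forall t, 0 < t <= s -> Cmod (h (p + RtoC t * 1)%C - h p) < 1).
    { intros t H0. apply Hw2. rewrite Hpt; lra. }
    assert (Hcc := Hpt c ltac:(lra)).
    assert (Ef := Hf (p + RtoC c * 1)%C ltac:(lra)).
    replace (p + RtoC c * 1 - p)%C with (RtoC c) in Ef by ring.
    assert (Hg1 := Hw1 (p + RtoC c * 1)%C ltac:(lra)).
    set (G := g (p + RtoC c * 1)%C) in *. set (u := g p) in *.
    assert (Lo : c ^ 2 * Re (df c) = Cmod u ^ 2 + Re (Cconj u * (G - u))%C).
    { rewrite <- (re_RtoC (Cmod u ^ 2)), <- re_plus, Cmod2_conj.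
      replace (u * Cconj u + Cconj u * (G - u))%C with (RtoC (c ^ 2) * df c)%C; [apply eq_sym, re_scal_l|].
      unfold df. fold u. rewrite RtoC_pow.
      replace (RtoC c ^ 2 * (Cconj u * f (p + RtoC c * 1) * 1))%C
        with (Cconj u * (RtoC c ^ 2 * f (p + RtoC c * 1)))%C by ring.
      rewrite Ef. ring. }
    assert (A := re_le_Cmod (Cconj u * (G - u))%C). rewrite Cmod_mult, Cmod_conj in A.
    apply Rabs_le_between in A.
    assert (B : Re (psi s) - Re (psi (s / 2)) <= 2 * Cmod u).
    { unfold psi. fold u. rewrite <- re_minus.
      eapply Rle_trans; [apply Rle_abs|]. eapply Rle_trans; [apply re_le_Cmod|].
      replace (Cconj u * h (p + RtoC s * 1) - Cconj u * h (p + RtoC (s / 2) * 1))%C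
        with (Cconj u * ((h (p + RtoC s * 1) - h p) - (h (p + RtoC (s / 2) * 1) - h p)))%C by ring.
      rewrite Cmod_mult, Cmod_conj. rewrite Rmult_comm. apply Rmult_le_compat_r; [lra|].
      eapply Rle_trans; [apply Cmod_minus_le|].
      generalize (Up s ltac:(lra)) (Up (s / 2) ltac:(lra)). lra. }
    rewrite Em in B. unfold e in T5.
    assert (Lo2 : Cmod u ^ 2 / 2 <= c ^ 2 * Re (df c)) by nra.
    assert (Rp : 0 < Re (df c)) by nra.
    assert (Q : c ^ 2 * Re (df c) <= s ^ 2 * Re (df c)) by (apply Rmult_le_compat_r; nra).
    assert (Q2 : Re (df c) * s <= 4 * Cmod u) by lra.
    assert (Q3 : s * (Re (df c) * s) <= s * (4 * Cmod u)) by (apply Rmult_le_compat_l; lra).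
    nra.
Qed.

(** [U] is the Taylor series of [V] shifted by one index; its first two coefficients are [V' p] and
    [V'' p / 2]. *)
Lemma simple_zero_factor (V V1 : C -> C) (p d2 : C) (r : R) : 0 < r -> hol V p -> V p = 0 ->
  (forall z, Cmod (z - p) < r -> cderiv V z (V1 z)) -> cderiv V1 p d2 ->
  exists U s, 0 < s /\ hol U p /\ U p = V1 p /\ cderiv U p (d2 / 2)%C /\
    forall z, Cmod (z - p) < s -> V z = ((z - p) * U z)%C.
Proof.
  intros Hr HV H0 H1 H2. destruct (hol_open V p HV) as [s [Hs Ho]].
  destruct (hol_Taylor V p s (s / 2)) as [a [K [HK Ha]]]; [lra|exact Ho|].
  assert (Hs2 : 0 < s / 2) by lra.
  assert (Hp : Cmod (p - p) < s / 2) by (rewrite Cmod_sub_self; lra).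
  assert (E : (p - p)%C = 0) by ring.
  assert (E0 : a 0%nat = 0) by (rewrite <- H0, (Ha p Hp), E; now rewrite pseries_0).
  set (b := fun k => a (S k)).
  assert (HKb : coef_bound b (s / 2) (K / (s / 2))).
  { intros k. apply Rmult_le_reg_r with (s / 2); [exact Hs2|]. unfold b.
    replace (K / (s / 2) * (s / 2)) with K by (field; lra).
    replace (Cmod (a (S k)) * (s / 2) ^ k * (s / 2)) with (Cmod (a (S k)) * (s / 2) ^ S k) by (simpl; ring).
    apply HK. }
  assert (HU : forall z, Cmod (z - p) < s / 2 -> V z = ((z - p) * pseries b (z - p))%C).
  { intros z Hz. rewrite (Ha z Hz).
    assert (A := csums_unshift _ _ (pseries_csums a (s / 2) K (z - p) Hs2 HK Hz)).
    cbv beta in A. rewrite E0 in A.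
    assert (B := csums_scal (z - p) _ _ (pseries_csums b (s / 2) _ (z - p) Hs2 HKb Hz)).
    replace (pseries a (z - p)) with (pseries a (z - p) - 0 * (z - p) ^ 0)%C by ring.
    apply (csums_unique _ _ _ A). eapply csums_ext; [|exact B]. intros n. unfold b. simpl. ring. }
  assert (HV1 : forall z, Cmod (z - p) < Rmin r (s / 2) -> V1 z = pseries (pderiv a) (z - p)).
  { intros z Hz. generalize (Rmin_l r (s / 2)) (Rmin_r r (s / 2)). intros.
    apply (cderiv_unique V z); [apply H1; lra|].
    apply (cderiv_ext_loc (fun z => pseries a (z - p)) V z _ (s / 2 - Cmod (z - p))); [lra| |].
    - intros w Hw. symmetry. apply Ha. now apply near_trans with z.
    - apply pseries_cderiv_at with (s / 2) K; [exact Hs2|exact HK|lra]. }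
  destruct (pderiv_bound a (s / 2) K (s / 4) Hs2 HK) as [K' HK']; [lra|].
  assert (Hm : 0 < Rmin r (s / 2)) by (apply Rmin_glb_lt; lra).
  exists (fun z => pseries b (z - p)), (s / 2). split; [exact Hs2|].
  split; [now apply pseries_hol with (s / 2) (K / (s / 2))|].
  split; [|split; [|exact HU]].
  - rewrite HV1 by (rewrite Cmod_sub_self; exact Hm). rewrite E, !pseries_0.
    unfold b, pderiv. simpl. ring.
  - eapply cderiv_eq; [now apply (pseries_cderiv_at b (s / 2) (K / (s / 2)))|].
    rewrite E, pseries_0.
    rewrite (cderiv_unique V1 p d2 (pseries (pderiv (pderiv a)) (p - p)) H2).
    + rewrite E, pseries_0. unfold pderiv, b. rewrite !INR_IZR_INZ. simpl Z.of_nat. field.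
    + apply (cderiv_ext_loc (fun z => pseries (pderiv a) (z - p)) V1 p _ (Rmin r (s / 2)) Hm).
      * intros w Hw. symmetry. now apply HV1.
      * apply pseries_cderiv_at with (s / 4) K'; [lra|exact HK'|rewrite Cmod_sub_self; lra].
Qed.

(** Logarithmic derivative with respect to [2 i pi tau]. *)
Definition dlog (f : C -> C) (z L : C) : Prop := cderiv f z (c2pi * (f z * L))%C.

Lemma dlog_mult (f g : C -> C) (z L M : C) : dlog f z L -> dlog g z M -> dlog (fun w => f w * g w)%C z (L + M)%C.
Proof. intros Hf Hg. eapply cderiv_eq; [apply cderiv_mult; [exact Hf|exact Hg]|cbv beta; ring]. Qed.

Lemma dlog_inv (f : C -> C) (z L : C) : dlog f z L -> f z <> 0 -> dlog (fun w => / f w)%C z (- L)%C.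
Proof. intros Hf Hz. eapply cderiv_eq; [apply cderiv_inv; [exact Hf|exact Hz]|cbv beta; field; exact Hz]. Qed.

Lemma dlog_div (f g : C -> C) (z L M : C) : dlog f z L -> dlog g z M -> g z <> 0 ->
  dlog (fun w => f w / g w)%C z (L - M)%C.
Proof. intros Hf Hg Hz. apply dlog_mult; [exact Hf|now apply dlog_inv]. Qed.

Lemma dlog_square (f : C -> C) (z L : C) : dlog f z L -> dlog (fun w => f w ^ 2)%C z (2 * L)%C.
Proof.
  intros Hf. eapply cderiv_eq; [apply (cderiv_pow f 1), Hf|].
  replace (INR 2) with 2 by (simpl; ring). cbv beta. ring.
Qed.

Lemma dlog_of_cderiv (f : C -> C) (z d : C) : cderiv f z (c2pi * d)%C -> f z <> 0 -> dlog f z (d / f z)%C.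
Proof. intros H Hz. eapply cderiv_eq; [exact H|]. field. exact Hz. Qed.

Lemma dlog_const (k z : C) : dlog (fun _ => k) z 0.
Proof. eapply cderiv_eq; [apply cderiv_const|ring]. Qed.

(** Writing [V = (z - p) U], the residue is the derivative of [A / U^2]. It vanishes when the
    logarithmic derivative of [A] is twice that of [U], that is [V'' / V'], which is the hypothesis
    on [V1]. *)
Lemma double_pole_of_quotient (f A V V1 : C -> C) (p LA : C) (r : R) : 0 < r ->
  hol A p -> A p <> 0 -> dlog A p LA ->
  hol V p -> V p = 0 -> (forall z, Cmod (z - p) < r -> cderiv V z (V1 z)) -> V1 p <> 0 ->
  cderiv V1 p (c2pi * (LA * V1 p))%C ->
  (forall z, 0 < Cmod (z - p) < r -> f z = (A z / V z ^ 2)%C) -> double_pole f p.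
Proof.
  intros Hr HA HA0 HLA HV HV0 HV1 H1 H2 Hf.
  destruct (simple_zero_factor V V1 p _ r Hr HV HV0 HV1 H2) as [U [s [Hs [HU [HU0 [HU1 HVU]]]]]].
  assert (N : U p <> 0) by now rewrite HU0.
  destruct (ccont_nonzero U p (hol_ccont _ _ HU) N) as [t [Ht HN]].
  assert (HUL : dlog U p (LA / 2)%C) by (eapply cderiv_eq; [exact HU1|rewrite HU0; field]).
  exists (fun z => A z / U z ^ 2)%C, (Rmin r (Rmin s t)).
  split; [repeat apply Rmin_glb_lt; lra|]. split; [|split; [|split]].
  - apply hol_div; [exact HA|now apply (hol_pow U)|now apply Cpow_nz].
  - intros E. apply HA0. replace (A p) with (A p / U p ^ 2 * U p ^ 2)%C by (field; exact N). rewrite E. ring.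
  - eapply cderiv_eq; [apply (dlog_div A (fun z => U z ^ 2)%C p LA _ HLA (dlog_square _ _ _ HUL))|].
    + now apply Cpow_nz.
    + cbv beta. field. exact N.
  - intros z Hz. generalize (Rmin_l r (Rmin s t)) (Rmin_r r (Rmin s t)) (Rmin_l s t) (Rmin_r s t). intros.
    destruct (HN z ltac:(lra)) as [_ HUz]. rewrite Hf, HVU by lra. field. split; [exact HUz|].
    apply Cmod_gt_0. lra.
Qed.

(** * The algebraic system *)

(** Replacing entry [i] by a neutral element keeps sums and products over [k <> i] on the full range
    of indices, where induction on the length works. *)
Definition omit {T : Type} (d : T) (i : nat) (a : nat -> T) (k : nat) : T :=
  if Nat.eq_dec i k then d else a k.

Lemma omit_same {T : Type} (d : T) (i : nat) (a : nat -> T) : omit d i a i = d.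
Proof. unfold omit. now destruct (Nat.eq_dec i i). Qed.

Lemma omit_other {T : Type} (d : T) (i k : nat) (a : nat -> T) : i <> k -> omit d i a k = a k.
Proof. unfold omit. now destruct (Nat.eq_dec i k). Qed.

Lemma Rsum_list_app (l l' : list nat) (a : nat -> R) : Rsum_list (l ++ l') a = Rsum_list l a + Rsum_list l' a.
Proof. unfold Rsum_list. induction l; simpl; [ring|]. rewrite IHl. ring. Qed.

Lemma Rsum_list_remove (n i : nat) (a : nat -> R) :
  Rsum_list (remove Nat.eq_dec i (seq 0 n)) a = rsumn (omit 0 i a) n.
Proof.
  induction n; [reflexivity|]. rewrite seq_S, remove_app, Rsum_list_app, IHn. cbn [rsumn].
  f_equal. simpl. unfold omit. destruct (Nat.eq_dec i n); unfold Rsum_list; simpl; ring.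
Qed.

Definition recip_diff (x : nat -> R) (i : nat) : nat -> R := omit 0 i (fun k => / (x i - x k)).

Definition residue_system (n : nat) (x : nat -> R) : Prop :=
  forall i, (i < n)%nat -> 4 / x i + 9 / (x i - 1) + 12 * rsumn (recip_diff x i) n = 0.

Lemma rsumn_ext (a b : nat -> R) (N : nat) : (forall n, (n < N)%nat -> a n = b n) -> rsumn a N = rsumn b N.
Proof.
  intros H. induction N; [reflexivity|]. simpl. rewrite IHN, H; auto.
Qed.

Lemma rsumn_scal (k : R) (a : nat -> R) (N : nat) : rsumn (fun n => k * a n) N = k * rsumn a N.
Proof. induction N; simpl; [ring|]. rewrite IHN. ring. Qed.

Lemma rsumn_pos (a : nat -> R) (N j : nat) : (forall n, (n < N)%nat -> 0 <= a n) -> (j < N)%nat -> 0 < a j ->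
  0 < rsumn a N.
Proof.
  intros H Hj Ha. assert (W : forall m, (m <= N)%nat -> 0 <= rsumn a m).
  { induction m; intros; simpl; [lra|]. generalize (IHm ltac:(lia)) (H m ltac:(lia)). lra. }
  assert (A : forall m, (m <= N)%nat -> (j < m)%nat -> 0 < rsumn a m).
  { induction m; intros Hm Hjm; [lia|]. simpl. destruct (Nat.eq_dec j m) as [->|E].
    - generalize (W m ltac:(lia)). lra.
    - generalize (IHm ltac:(lia) ltac:(lia)) (H m ltac:(lia)). lra. }
  now apply A.
Qed.

(** With [c = 12] the smallest unknown exceeds [4/13] and the largest is below it. *)
Lemma repulsive_system_size (n : nat) (x : nat -> R) : (forall i, (i < n)%nat -> 0 < x i < 1) ->
  algebraic_system 4 9 12 n x -> (n <= 1)%nat.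
Proof.
  intros Hx [_ [Hd He]]. destruct (le_lt_dec n 1) as [L|L]; [exact L|exfalso].
  assert (Hne : seq 0 n <> nil) by (destruct n; [lia|discriminate]).
  assert (Hin : forall k, In k (seq 0 n) <-> (k < n)%nat) by (intros; rewrite in_seq; lia).
  destruct (list_argmin (seq 0 n) x Hne) as [i [Hi Hmin]].
  destruct (list_argmin (seq 0 n) (fun k => - x k) Hne) as [j [Hj Hmax]].
  apply Hin in Hi, Hj.
  assert (Other : forall k, exists m, (m < n)%nat /\ m <> k).
  { intros [|k]; [exists 1%nat|exists 0%nat]; split; lia || discriminate. }
  assert (P : forall a, 0 < a < 1 -> 4 / a + 9 / (a - 1) = (4 - 13 * a) / (a * (1 - a))).
  { intros a Ha. field. lra. }
  assert (Q : forall a, 0 < a < 1 -> 0 < / (a * (1 - a))).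
  { intros a Ha. apply Rinv_0_lt_compat. nra. }
  assert (A : 4 < 13 * x i).
  { assert (E := He i Hi). rewrite Rsum_list_remove, P in E by now apply Hx.
    destruct (Other i) as [m [Hm Hmi]].
    assert (S : 0 < rsumn (omit 0 i (fun k => 12 / (x k - x i))) n).
    { assert (W : forall k, (k < n)%nat -> i <> k -> 0 < 12 / (x k - x i)).
      { intros k Hk Hik. apply Rdiv_lt_0_compat; [lra|].
        assert (x i <= x k) by now apply Hmin, Hin. generalize (Hd i k Hi Hk Hik). lra. }
      apply rsumn_pos with m; [|exact Hm|].
      - intros k Hk. unfold omit. destruct (Nat.eq_dec i k); [lra|]. left. now apply W.
      - rewrite omit_other by auto. apply W; auto. }
    specialize (Q (x i) (Hx i Hi)). unfold Rdiv in E. nra. }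
  assert (B : 13 * x j < 4).
  { assert (E := He j Hj). rewrite Rsum_list_remove, P in E by now apply Hx.
    destruct (Other j) as [m [Hm Hmj]].
    assert (S : 0 < rsumn (fun k => - (1) * omit 0 j (fun k => 12 / (x k - x j)) k) n).
    { assert (W : forall k, (k < n)%nat -> j <> k -> 0 < - (1) * (12 / (x k - x j))).
      { intros k Hk Hjk. replace (- (1) * (12 / (x k - x j))) with (12 / (x j - x k)).
        - apply Rdiv_lt_0_compat; [lra|]. assert (- x j <= - x k) by now apply Hmax, Hin.
          generalize (Hd j k Hj Hk Hjk). lra.
        - generalize (Hd j k Hj Hk Hjk). intros. field. lra. }
      apply rsumn_pos with m; [|exact Hm|].
      - intros k Hk. unfold omit. destruct (Nat.eq_dec j k); [lra|]. left. now apply W.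
      - rewrite omit_other by auto. apply W; auto. }
    rewrite rsumn_scal in S. specialize (Q (x j) (Hx j Hj)). unfold Rdiv in E. nra. }
  assert (x i <= x j) by now apply Hmin, Hin. lra.
Qed.

(** For the sign [c = 12], [repulsive_system_size] leaves at most one unknown, and then the
    interaction sum is empty. *)
Lemma solves_residue_system (n : nat) (x : nat -> R) : (forall i, (i < n)%nat -> 0 < x i < 1) ->
  solves_E_4_9_12 n x -> residue_system n x /\
  (forall i j, (i < n)%nat -> (j < n)%nat -> i <> j -> x i <> x j).
Proof.
  intros Hx H. assert (Hd : forall i j, (i < n)%nat -> (j < n)%nat -> i <> j -> x i <> x j).
  { destruct H as [H|H]; apply H. }
  split; [|exact Hd]. intros i Hi. destruct H as [H|H].
  - assert (Hn := repulsive_system_size n x Hx H). destruct H as [_ [_ H]]. specialize (H i Hi).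
    assert (n = 1)%nat as -> by lia. assert (i = 0)%nat as -> by lia.
    rewrite Rsum_list_remove in H. simpl rsumn in *. unfold recip_diff. rewrite omit_same in *. lra.
  - destruct H as [_ [_ H]]. specialize (H i Hi). rewrite Rsum_list_remove in H. rewrite <- H.
    f_equal. rewrite <- rsumn_scal. apply rsumn_ext. intros k Hk. unfold recip_diff, omit.
    destruct (Nat.eq_dec i k); [ring|]. generalize (Hd i k Hi Hk n0). intros. field. lra.
Qed.

(** * Poles of [fn] *)

(** The total inverse sends 0 to 0, so factors of a denominator can be separated without checking
    that they are nonzero. *)
Lemma Cinv_mult_gen (a b : C) : (/ (a * b))%C = (/ a * / b)%C.
Proof.
  assert (Z : (/ 0)%C = 0) by (apply C_ext; unfold Cinv; simpl; unfold Rdiv; ring).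
  destruct (classic (a = 0)) as [->|Ha]; [rewrite Cmult_0_l, Z; ring|].
  destruct (classic (b = 0)) as [->|Hb]; [rewrite Cmult_0_r, Z; ring|].
  field. now split.
Qed.

Lemma Cprod_S (n : nat) (a : nat -> C) : Cprod_list (seq 0 (S n)) a = (Cprod_list (seq 0 n) a * a n)%C.
Proof. rewrite seq_S, Cprod_list_app. unfold Cprod_list at 2. simpl. ring. Qed.

Lemma Cprod_nz (n : nat) (a : nat -> C) : (forall i, (i < n)%nat -> a i <> 0) -> Cprod_list (seq 0 n) a <> 0.
Proof.
  intros H. induction n; [apply C1_nz|]. rewrite Cprod_S. apply Cmult_neq_0; auto.
Qed.

Lemma Cprod_hol (n : nat) (F : nat -> C -> C) (z : C) : (forall i, (i < n)%nat -> hol (F i) z) ->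
  hol (fun w => Cprod_list (seq 0 n) (fun i => F i w)) z.
Proof.
  intros H. induction n; [exact (hol_const 1 z)|].
  apply hol_ext with (fun w => Cprod_list (seq 0 n) (fun i => F i w) * F n w)%C;
    [intros; symmetry; apply Cprod_S|]. apply hol_mult; auto.
Qed.

Lemma dlog_ext (f g : C -> C) (z L : C) : (forall w, f w = g w) -> dlog f z L -> dlog g z L.
Proof. intros E H. unfold dlog. rewrite <- E. exact (cderiv_ext f g z _ E H). Qed.

Lemma Cprod_dlog (n : nat) (F : nat -> C -> C) (L : nat -> C) (z : C) :
  (forall i, (i < n)%nat -> dlog (F i) z (L i)) ->
  dlog (fun w => Cprod_list (seq 0 n) (fun i => F i w)) z (csumn L n).
Proof.
  intros H. induction n; [exact (dlog_const 1 z)|].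
  apply dlog_ext with (fun w => Cprod_list (seq 0 n) (fun i => F i w) * F n w)%C;
    [intros; symmetry; apply Cprod_S|]. apply dlog_mult; auto.
Qed.

Lemma Cprod_omit (n i : nat) (a : nat -> C) : (i < n)%nat ->
  Cprod_list (seq 0 n) a = (a i * Cprod_list (seq 0 n) (omit (RtoC 1) i a))%C.
Proof.
  intros Hi. induction n; [lia|]. rewrite !Cprod_S. destruct (Nat.eq_dec i n) as [->|E].
  - rewrite omit_same. enough (W : forall m, (m <= n)%nat -> Cprod_list (seq 0 m) (omit (RtoC 1) n a) = Cprod_list (seq 0 m) a).
    { rewrite W by lia. ring. }
    induction m; intros Hm; [reflexivity|]. rewrite !Cprod_S, IHm, omit_other by lia. reflexivity.
  - rewrite IHn, omit_other by lia. ring.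
Qed.

(** * The derivatives of J and the logarithmic derivative of the form *)

Definition J1 (tau : C) : C := (- (E4 tau ^ 2 * E6 tau / (1728 * Defs.Delta tau)))%C.
(** [D^2 J], in a shape where [E6] and [Delta] enter only through [J] and [J1]; together with
    [J1_square] this makes the later identities rational in [J], [J1], [E2], [E4]. *)
Definition J2 (tau : C) : C := (E4 tau * (J tau / 2 + 2 * (J tau - 1) / 3) + E2 tau * J1 tau / 6)%C.

Lemma J_J1_cderiv (tau : C) : 0 < Im tau -> cderiv J tau (c2pi * J1 tau)%C.
Proof. intros H. eapply cderiv_eq; [now apply J_cderiv|]. unfold J1. ring. Qed.

Lemma J1_square (tau : C) : 0 < Im tau -> (J1 tau ^ 2)%C = (E4 tau * J tau * (J tau - 1))%C.
Proof.
  intros H. assert (HD := Delta_nz tau H). rewrite J_minus_1 by exact H. unfold J1, J. field. exact HD.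
Qed.

Lemma J1_cderiv (tau : C) : 0 < Im tau -> cderiv J1 tau (c2pi * J2 tau)%C.
Proof.
  intros H. assert (HD := Delta_nz tau H). eapply cderiv_eq.
  - apply cderiv_opp, cderiv_div; [apply cderiv_mult; [apply (cderiv_pow E4 1); now apply E4_cderiv|now apply E6_cderiv]| |].
    + now apply cderiv_scal, Delta_cderiv.
    + intros E. now apply Cmult_integral in E as [E|E]; [apply RtoC_inj in E; lra|].
  - unfold J2. rewrite J_minus_1 by exact H. unfold J1, J. change (2 * PI * Ci)%C with c2pi.
    replace (INR 2) with 2 by (simpl; ring). field. exact HD.
Qed.

Lemma eta_dlog (tau : C) : 0 < Im tau -> dlog (fun t => eta t ^ 4)%C tau (E2 tau / 6)%C.
Proof.
  intros H. eapply cderiv_eq; [apply (cderiv_pow eta 3), eta_cderiv, H|].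
  replace (INR 4) with 4 by (simpl; ring). unfold c2pi. field.
Qed.

Lemma J_dlog (tau c : C) : 0 < Im tau -> J tau <> c -> dlog (fun t => J t - c)%C tau (J1 tau / (J tau - c))%C.
Proof.
  intros H Hc. apply (dlog_of_cderiv (fun t => J t - c)%C).
  - eapply cderiv_eq; [apply cderiv_minus; [now apply J_J1_cderiv|apply cderiv_const]|ring].
  - intros E. apply Hc. replace (J tau) with ((J tau - c) + c)%C by ring. rewrite E. ring.
Qed.

Definition regular_pt (n : nat) (x : nat -> R) (tau : C) : Prop :=
  J tau <> 1 /\ forall i, (i < n)%nat -> J tau <> x i.

Lemma Cminus_nz (a b : C) : a <> b -> (a - b)%C <> 0.
Proof. intros H E. apply H. replace a with ((a - b) + b)%C by ring. rewrite E. ring. Qed.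

Section Fn.
Context (n : nat) (x : nat -> R).

Let Q (i : nat) (t : C) : C := ((J t - x i) ^ 2)%C.

Lemma fn_denominator_nz (tau : C) : regular_pt n x tau ->
  ((J tau - 1) * Cprod_list (seq 0 n) (fun i => Q i tau))%C <> 0.
Proof.
  intros [H1 H2]. apply Cmult_neq_0; [now apply Cminus_nz|].
  apply Cprod_nz. intros i Hi. now apply Cpow_nz, Cminus_nz, H2.
Qed.

Lemma fn_hol (tau : C) : 0 < Im tau -> regular_pt n x tau -> hol (fn n x) tau.
Proof.
  intros H R. apply hol_div; [now apply (hol_pow eta), eta_hol| |now apply fn_denominator_nz].
  apply hol_mult; [apply hol_minus; [now apply J_hol|apply hol_const]|].
  apply (Cprod_hol n Q). intros i Hi. apply (hol_pow (fun t => J t - x i)%C).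
  apply hol_minus; [now apply J_hol|apply hol_const].
Qed.

Lemma fn_nz (tau : C) : 0 < Im tau -> regular_pt n x tau -> fn n x tau <> 0.
Proof.
  intros H R E. assert (N := fn_denominator_nz tau R). unfold Q in N.
  apply (Cpow_nz (eta tau) 4 (eta_nz tau H)). unfold fn in E.
  replace (eta tau ^ 4)%C with (eta tau ^ 4 / ((J tau - 1) * Cprod_list (seq 0 n) (fun i => (J tau - x i) ^ 2))
    * ((J tau - 1) * Cprod_list (seq 0 n) (fun i => (J tau - x i) ^ 2)))%C.
  - rewrite E. ring.
  - unfold Cdiv. rewrite <- Cmult_assoc, Cinv_l by exact N. ring.
Qed.

Definition fn_log (tau : C) : C :=
  (E2 tau / 6 - (J1 tau / (J tau - 1) + csumn (fun i => 2 * (J1 tau / (J tau - x i))) n))%C.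

Lemma fn_dlog (tau : C) : 0 < Im tau -> regular_pt n x tau -> dlog (fn n x) tau (fn_log tau).
Proof.
  intros H R. apply (dlog_div (fun t => eta t ^ 4)%C); [now apply eta_dlog| |now apply fn_denominator_nz].
  destruct R as [R1 R2]. apply dlog_mult; [now apply J_dlog|].
  apply (Cprod_dlog n Q). intros i Hi. apply (dlog_square (fun t => J t - x i)%C). now apply J_dlog, R2.
Qed.

(** The pole comes from [J - 1 = E6^2 / (1728 Delta)], with [V = E6]. At a zero of [E6] both
    [DA / A] and [D(DV) / DV] equal [7 E2 / 6]; the factors [J - x_i] contribute nothing, because
    [D J] vanishes with [E6]. *)
Lemma fn_pole_at_i (tau : C) : 0 < Im tau -> (forall i, (i < n)%nat -> 0 < x i < 1) -> J tau = 1 ->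
  double_pole (fn n x) tau.
Proof.
  intros H Hx HJ. assert (HD := Delta_nz tau H).
  assert (H6 : E6 tau = 0).
  { assert (A := J_minus_1 tau H). rewrite HJ in A.
    apply NNPP. intros N. apply (Cpow_nz (E6 tau) 2 N).
    replace (E6 tau ^ 2)%C with (E6 tau ^ 2 / (1728 * Defs.Delta tau) * (1728 * Defs.Delta tau))%C by (field; exact HD).
    rewrite <- A. ring. }
  assert (HJx : forall i, (i < n)%nat -> J tau <> x i).
  { intros i Hi E. rewrite HJ in E. apply RtoC_inj in E. generalize (Hx i Hi). lra. }
  assert (H4 : E4 tau <> 0).
  { intros E. unfold J in HJ. rewrite E in HJ. apply (C1_nz). rewrite <- HJ. unfold Cdiv. ring. }
  assert (HP : Cprod_list (seq 0 n) (fun i => Q i tau) <> 0).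
  { apply Cprod_nz. intros i Hi. now apply Cpow_nz, Cminus_nz, HJx. }
  assert (H17 : (1728 * Defs.Delta tau)%C <> 0).
  { apply Cmult_neq_0; [|exact HD]. intros E. apply RtoC_inj in E. lra. }
  assert (D0 : dlog (fun t => 1728 * Defs.Delta t)%C tau (E2 tau)).
  { eapply cderiv_eq; [apply cderiv_scal, Delta_cderiv, H|]. change (2 * PI * Ci)%C with c2pi. ring. }
  assert (S0 : csumn (fun i => 2 * (J1 tau / (J tau - x i)))%C n = 0).
  { rewrite (csumn_ext _ (fun _ => 0 * 0)%C), csumn_scal; [ring|].
    intros i Hi. unfold J1. rewrite H6. unfold Cdiv. ring. }
  apply (double_pole_of_quotient (fn n x)
    (fun t => eta t ^ 4 * (1728 * Defs.Delta t) / Cprod_list (seq 0 n) (fun i => Q i t))%C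
    E6 (fun t => c2pi * ((E2 t * E6 t - E4 t ^ 2) / 2))%C tau
    (E2 tau / 6 + E2 tau - csumn (fun i => 2 * (J1 tau / (J tau - x i))) n)%C (Im tau) H).
  - apply hol_div; [|apply (Cprod_hol n Q)|exact HP].
    + apply hol_mult; [now apply (hol_pow eta), eta_hol|now apply hol_scal, Delta_hol].
    + intros i Hi. apply (hol_pow (fun t => J t - x i)%C). apply hol_minus; [now apply J_hol|apply hol_const].
  - intros E. apply (Cmult_neq_0 (eta tau ^ 4) (1728 * Defs.Delta tau)); [now apply Cpow_nz, eta_nz|exact H17|].
    replace (eta tau ^ 4 * (1728 * Defs.Delta tau))%C
      with (eta tau ^ 4 * (1728 * Defs.Delta tau) / Cprod_list (seq 0 n) (fun i => Q i tau)
        * Cprod_list (seq 0 n) (fun i => Q i tau))%C by (field; exact HP).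
    rewrite E. ring.
  - apply (dlog_div (fun t => eta t ^ 4 * (1728 * Defs.Delta t))%C);
      [apply dlog_mult; [now apply eta_dlog|exact D0]| |exact HP].
    apply (Cprod_dlog n Q). intros i Hi. apply (dlog_square (fun t => J t - x i)%C). now apply J_dlog, HJx.
  - now apply E6_hol.
  - exact H6.
  - intros z Hz. apply E6_cderiv. now apply (upper_near tau).
  - rewrite H6. replace ((E2 tau * 0 - E4 tau ^ 2) / 2)%C with (- / 2 * E4 tau ^ 2)%C by field.
    apply Cmult_neq_0; [apply c2pi_nz|]. apply Cmult_neq_0; [|now apply Cpow_nz].
    intros E. apply (f_equal Re) in E. simpl in E. lra.
  - rewrite S0. eapply cderiv_eq.
    + apply cderiv_scal. apply (cderiv_div (fun t => E2 t * E6 t - E4 t ^ 2)%C (fun _ => 2)%C); [|apply cderiv_const|].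
      * apply cderiv_minus; [apply cderiv_mult; [now apply E2_cderiv|now apply E6_cderiv]|].
        apply (cderiv_pow E4 1). now apply E4_cderiv.
      * intros E. apply RtoC_inj in E. lra.
    + cbv beta. rewrite H6. replace (INR 2) with 2 by (simpl; ring). field.
  - intros z [_ Hz]. assert (Hi := upper_near tau H z Hz). assert (HDz := Delta_nz z Hi).
    unfold fn, Cdiv. rewrite J_minus_1 by exact Hi. unfold Cdiv. rewrite !Cinv_mult_gen.
    fold (Q). change (fun i => ((J z - x i) ^ 2)%C) with (fun i => Q i z).
    replace (/ / 1728 * / / Defs.Delta z)%C with (1728 * Defs.Delta z)%C by (field; exact HDz). ring.
Qed.

(** For [V = J - x_i], the identity [J1^2 = E4 J (J - 1)] gives [D(DV) / DV = E2 / 6 + J1 (1 / (2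
    (x_i - 1)) + 2 / (3 x_i))]. The term [E2 / 6] is matched by [eta^4], and what remains is the
    i-th equation times a multiple of [J1]. *)
Lemma fn_pole_at_w (tau : C) (i : nat) : 0 < Im tau -> (forall i, (i < n)%nat -> 0 < x i < 1) ->
  residue_system n x -> (forall i j, (i < n)%nat -> (j < n)%nat -> i <> j -> x i <> x j) ->
  (i < n)%nat -> J tau = x i -> double_pole (fn n x) tau.
Proof.
  intros H Hx Hs Hd Hi HJ. assert (HD := Delta_nz tau H). assert (Hxi := Hx i Hi).
  assert (HJ1 : J tau <> 1) by (intros E; rewrite HJ in E; apply RtoC_inj in E; lra).
  assert (HJx : forall k, (k < n)%nat -> i <> k -> J tau <> x k).
  { intros k Hk Hik E. rewrite HJ in E. apply RtoC_inj in E. now apply (Hd i k). }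
  assert (NJ1 : J1 tau <> 0).
  { intros E. assert (A := J1_square tau H). rewrite E, HJ in A.
    assert (E4 tau <> 0).
    { intros Z. unfold J in HJ. rewrite Z in HJ. assert (B : RtoC 0 = x i) by (rewrite <- HJ; unfold Cdiv; ring).
      apply RtoC_inj in B. lra. }
    apply (Cmult_neq_0 (E4 tau * x i) (x i - 1)); [apply Cmult_neq_0; [assumption|]| |rewrite <- A; ring].
    - intros B. apply RtoC_inj in B. lra.
    - rewrite <- RtoC_minus. intros B. apply RtoC_inj in B. lra. }
  set (P := fun k => fun t => omit (RtoC 1) i (fun k => Q k t) k).
  assert (HP : Cprod_list (seq 0 n) (fun k => P k tau) <> 0).
  { apply Cprod_nz. intros k Hk. unfold P. destruct (Nat.eq_dec i k) as [<-|E].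
    - rewrite omit_same. apply C1_nz.
    - rewrite omit_other by exact E. now apply Cpow_nz, Cminus_nz, HJx. }
  assert (HA : ((J tau - 1) * Cprod_list (seq 0 n) (fun k => P k tau))%C <> 0).
  { apply Cmult_neq_0; [now apply Cminus_nz|exact HP]. }
  assert (S0 : csumn (omit (RtoC 0) i (fun k => 2 * (J1 tau / (J tau - x k))))%C n
    = (2 * J1 tau * RtoC (rsumn (recip_diff x i) n))%C).
  { rewrite HJ. clear - Hd Hi. enough (W : forall m, (m <= n)%nat ->
      csumn (omit (RtoC 0) i (fun k => 2 * (J1 tau / (x i - x k))))%C m
        = (2 * J1 tau * RtoC (rsumn (recip_diff x i) m))%C) by (apply W; lia).
    induction m; intros Hm; [simpl; ring|]. cbn [csumn rsumn]. rewrite IHm, RtoC_plus by lia.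
    change (recip_diff x i m) with (omit 0 i (fun k => / (x i - x k)) m). destruct (Nat.eq_dec i m) as [<-|E].
    - rewrite !omit_same. ring.
    - assert (N := Hd i m Hi ltac:(lia) E). rewrite !omit_other, RtoC_inv, RtoC_minus by (exact E || lra).
      unfold Cdiv. ring. }
  apply (double_pole_of_quotient (fn n x)
    (fun t => eta t ^ 4 / ((J t - 1) * Cprod_list (seq 0 n) (fun k => P k t)))%C
    (fun t => J t - x i)%C (fun t => c2pi * J1 t)%C tau
    (E2 tau / 6 - (J1 tau / (J tau - 1) + csumn (omit (RtoC 0) i (fun k => 2 * (J1 tau / (J tau - x k)))) n))%C (Im tau) H).
  - apply hol_div; [now apply (hol_pow eta), eta_hol| |exact HA].
    apply hol_mult; [apply hol_minus; [now apply J_hol|apply hol_const]|].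
    apply (Cprod_hol n P). intros k Hk. unfold P, omit. destruct (Nat.eq_dec i k); [apply hol_const|].
    apply (hol_pow (fun t => J t - x k)%C). apply hol_minus; [now apply J_hol|apply hol_const].
  - intros E. apply (Cpow_nz (eta tau) 4 (eta_nz tau H)).
    replace (eta tau ^ 4)%C with (eta tau ^ 4 / ((J tau - 1) * Cprod_list (seq 0 n) (fun k => P k tau))
      * ((J tau - 1) * Cprod_list (seq 0 n) (fun k => P k tau)))%C.
    + rewrite E. ring.
    + unfold Cdiv. rewrite <- Cmult_assoc, Cinv_l by exact HA. ring.
  - apply (dlog_div (fun t => eta t ^ 4)%C); [now apply eta_dlog| |exact HA].
    apply dlog_mult; [now apply J_dlog|]. apply (Cprod_dlog n P). intros k Hk. unfold P, omit.
    destruct (Nat.eq_dec i k); [apply dlog_const|].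
    apply (dlog_square (fun t => J t - x k)%C). now apply J_dlog, HJx.
  - apply hol_minus; [now apply J_hol|apply hol_const].
  - rewrite HJ. ring.
  - intros z Hz. eapply cderiv_eq; [apply cderiv_minus; [apply J_J1_cderiv; now apply (upper_near tau)|apply cderiv_const]|ring].
  - apply Cmult_neq_0; [apply c2pi_nz|exact NJ1].
  - rewrite S0. eapply cderiv_eq; [now apply cderiv_scal, J1_cderiv|].
    assert (A := J1_square tau H). assert (T := Hs i Hi).
    assert (ET : rsumn (recip_diff x i) n = - (4 / x i + 9 / (x i - 1)) / 12) by lra.
    rewrite ET. unfold J2. rewrite HJ in *.
    set (a := x i) in *. set (u := J1 tau) in *.
    replace (E2 tau / 6 - (u / (a - 1) + 2 * u * RtoC (- (4 / a + 9 / (a - 1)) / 12)))%C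
      with (E2 tau / 6 + u * ((a / 2 + 2 * (a - 1) / 3) / (a * (a - 1))))%C.
    + f_equal. assert (Na : RtoC a <> 0) by (intros B; apply RtoC_inj in B; lra).
      assert (Na1 : (a - 1)%C <> 0) by (rewrite <- RtoC_minus; intros B; apply RtoC_inj in B; lra).
      transitivity (c2pi * (E2 tau * u / 6 + (u ^ 2) * ((a / 2 + 2 * (a - 1) / 3) / (a * (a - 1)))))%C.
      * rewrite A. field. split; assumption.
      * set (W := ((a / 2 + 2 * (a - 1) / 3) / (a * (a - 1)))%C). field.
    + rewrite !RtoC_div, !RtoC_opp, !RtoC_plus, !RtoC_div, !RtoC_minus by lra. field.
      cbv beta. rewrite <- RtoC_minus. split; intros B; apply RtoC_inj in B; lra.
  - intros z _. unfold fn. change (fun i => ((J z - x i) ^ 2)%C) with (fun i => Q i z).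
    rewrite (Cprod_omit n i _ Hi). unfold Cdiv. rewrite !Cinv_mult_gen.
    fold (P). change (omit (RtoC 1) i (fun i0 => Q i0 z)) with (fun k => P k z). unfold Q. ring.
Qed.
End Fn.

(** * Symmetric sums over a solution of the system *)

Lemma csumn_exchange (F : nat -> nat -> C) (n m : nat) :
  csumn (fun i => csumn (F i) m) n = csumn (fun k => csumn (fun i => F i k) n) m.
Proof.
  induction n; cbn [csumn].
  - rewrite (csumn_ext _ (fun _ => 0 * 0)%C), csumn_scal by (intros; ring). ring.
  - rewrite IHn, <- csumn_plus. reflexivity.
Qed.

Lemma csumn_const (c : C) (n : nat) : csumn (fun _ => c) n = (INR n * c)%C.
Proof. induction n; [simpl; ring|]. rewrite S_INR, RtoC_plus. cbn [csumn]. rewrite IHn. ring. Qed.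

Lemma csumn_minus (a b : nat -> C) (n : nat) : csumn (fun i => a i - b i)%C n = (csumn a n - csumn b n)%C.
Proof.
  rewrite (csumn_ext _ (fun i => a i + - (1) * b i)%C), csumn_plus, csumn_scal by (intros; ring). ring.
Qed.

Lemma csumn_omit (n i : nat) (a : nat -> C) : (i < n)%nat ->
  csumn (omit (RtoC 0) i a) n = (csumn a n - a i)%C.
Proof.
  intros Hi. induction n; [lia|]. cbn [csumn]. destruct (Nat.eq_dec i n) as [->|E].
  - rewrite omit_same, (csumn_ext (omit (RtoC 0) n a) a) by (intros; apply omit_other; lia). ring.
  - rewrite IHn, omit_other by lia. ring.
Qed.

Lemma csumn_RtoC (a : nat -> R) (n : nat) : csumn (fun i => RtoC (a i)) n = RtoC (rsumn a n).
Proof. induction n; [reflexivity|]. cbn [csumn rsumn]. now rewrite IHn, RtoC_plus. Qed.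

(** The double sum is added to the one with the two indices exchanged; antisymmetry turns the second
    coefficient into [- b k]. *)
Lemma csumn_antisymmetric (n : nat) (r : nat -> nat -> C) (b : nat -> C) :
  (forall i k, (i < n)%nat -> (k < n)%nat -> r i k = (- r k i)%C) ->
  (2 * csumn (fun i => b i * csumn (r i) n) n)%C = csumn (fun i => csumn (fun k => r i k * (b i - b k))%C n) n.
Proof.
  intros H.
  transitivity (csumn (fun i => csumn (fun k => b i * r i k)%C n) n
    - csumn (fun i => csumn (fun k => b k * r i k)%C n) n)%C.
  - rewrite (csumn_exchange (fun i k => b k * r i k)%C).
    rewrite (csumn_ext (fun k => csumn (fun i => b k * r i k)%C n) (fun k => - (1) * (b k * csumn (r k) n))%C).
    + rewrite csumn_scal. rewrite (csumn_ext (fun i => csumn (fun k => b i * r i k)%C n) (fun i => b i * csumn (r i) n)%C).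
      * ring.
      * intros. apply csumn_scal.
    + intros k Hk. rewrite csumn_scal.
      rewrite (csumn_ext (fun i => r i k) (fun i => - (1) * r k i)%C), csumn_scal; [ring|].
      intros i Hi. rewrite (H i k Hi Hk). ring.
  - rewrite <- csumn_minus. apply csumn_ext. intros i Hi. rewrite <- csumn_minus.
    apply csumn_ext. intros k Hk. ring.
Qed.

Section System.
Context (n : nat) (x : nat -> R).
Context (Hx : forall i, (i < n)%nat -> 0 < x i < 1).
Context (Hd : forall i j, (i < n)%nat -> (j < n)%nat -> i <> j -> x i <> x j).
Context (Hs : residue_system n x).

Let r (i k : nat) : C := RtoC (recip_diff x i k).

Lemma recip_diff_antisymmetric (i k : nat) : (i < n)%nat -> (k < n)%nat -> r i k = (- r k i)%C.
Proof.
  intros Hi Hk. unfold r, recip_diff. rewrite <- RtoC_opp. f_equal.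
  destruct (Nat.eq_dec i k) as [<-|E]; [rewrite omit_same; ring|].
  rewrite !omit_other by auto. assert (A := Hd i k Hi Hk E). field. split; lra.
Qed.

Lemma recip_diff_product (i k : nat) (b : nat -> C) (c : C) : (i < n)%nat -> (k < n)%nat ->
  (i <> k -> (b i - b k)%C = ((x i - x k) * c)%C) ->
  (r i k * (b i - b k))%C = omit (RtoC 0) i (fun _ => c) k.
Proof.
  intros Hi Hk H. unfold r, recip_diff. destruct (Nat.eq_dec i k) as [<-|E]; [rewrite !omit_same; ring|].
  rewrite !omit_other, H by exact E. assert (A := Hd i k Hi Hk E).
  rewrite RtoC_inv, RtoC_minus by lra. field. rewrite <- RtoC_minus.
  intros B. apply RtoC_inj in B. lra.
Qed.

Let T (i : nat) : C := csumn (r i) n.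

Lemma T_eq (i : nat) : (i < n)%nat -> T i = (- (/ (3 * x i)) - 3 / (4 * (x i - 1)))%C.
Proof.
  intros Hi. unfold T, r. rewrite csumn_RtoC.
  assert (E : rsumn (recip_diff x i) n = - (4 / x i + 9 / (x i - 1)) / 12) by (generalize (Hs i Hi); lra).
  assert (H := Hx i Hi). rewrite E.
  rewrite !RtoC_div, !RtoC_opp, !RtoC_plus, !RtoC_div, !RtoC_minus by lra. field.
  split; [rewrite <- RtoC_minus|]; intros B; apply RtoC_inj in B; lra.
Qed.

(** After symmetrisation each ordered pair of distinct indices contributes
    [(x_i - x_k) / (x_i - x_k) = 1], whatever the shift [c]. *)
Lemma moment_sum (c : R) : csumn (fun i => (x i - c) * T i)%C n = (INR n * (INR n - 1) / 2)%C.
Proof.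
  assert (A := csumn_antisymmetric n r (fun i => (x i - c)%C) recip_diff_antisymmetric).
  assert (B : csumn (fun i => csumn (fun k => r i k * ((x i - c) - (x k - c)))%C n) n = (INR n * (INR n * 1 - 1))%C).
  { rewrite <- csumn_const. apply csumn_ext. intros i Hi.
    rewrite <- csumn_const, <- (csumn_omit n i (fun _ => RtoC 1) Hi).
    apply csumn_ext. intros k Hk. apply (recip_diff_product i k (fun i => (x i - c)%C)); auto. intros _. ring. }
  cbv beta in A. rewrite B in A. fold (T) in A.
  replace (csumn (fun i => (x i - c) * T i) n)%C with (2 * csumn (fun i => (x i - c) * T i) n / 2)%C by field.
  unfold T. rewrite A. field.
Qed.

(** The origin of the constant in the theorem: [(12 n + 7)^2 = 24 K + 49]. *)
Let K : C := (6 * INR n ^ 2 + 7 * INR n)%C.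

(** By the system, [(x_i - 1) T_i = 1 / (3 x_i) - 13 / 12]: the shift [c = 1] in [moment_sum]
    isolates the reciprocals of the [x_i], as [c = 0] isolates those of the [x_i - 1]. *)
Lemma sum_recip : csumn (fun i => / x i)%C n = (K / 4)%C.
Proof.
  assert (A := moment_sum 1).
  rewrite (csumn_ext _ (fun i => / 3 * / x i + - (13 / 12))%C), csumn_plus, csumn_scal, csumn_const in A.
  - replace (csumn (fun i => / x i)%C n) with (3 * (/ 3 * csumn (fun i => / x i)%C n + INR n * - (13 / 12)) + 13 / 4 * INR n)%C by field.
    rewrite A. unfold K. field.
  - intros i Hi. rewrite T_eq by exact Hi. assert (H := Hx i Hi). field.
    repeat split; cbv beta; rewrite <- ?RtoC_minus; intros B; apply RtoC_inj in B; lra.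
Qed.

Lemma sum_recip_1 : csumn (fun i => / (x i - 1))%C n = (- (K / 9))%C.
Proof.
  assert (A := moment_sum 0).
  rewrite (csumn_ext _ (fun i => - (3 / 4) * / (x i - 1) + - (13 / 12))%C), csumn_plus, csumn_scal, csumn_const in A.
  - replace (csumn (fun i => / (x i - 1))%C n) with (- (4 / 3) * (- (3 / 4) * csumn (fun i => / (x i - 1))%C n + INR n * - (13 / 12)) - 13 / 9 * INR n)%C by field.
    rewrite A. unfold K. field.
  - intros i Hi. rewrite T_eq by exact Hi. assert (H := Hx i Hi). field.
    repeat split; cbv beta; rewrite <- ?RtoC_minus; intros B; apply RtoC_inj in B; lra.
Qed.

(** The partial fraction identity [a_i a_k = (a_i - a_k) / (x_i - x_k)] for [a_i = 1 / (z - x_i)]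
    makes the quadratic terms linear, and the system evaluates the resulting sums. *)
Lemma resolvent_identity (z : C) : (forall i, (i < n)%nat -> z <> x i) ->
  let S := csumn (fun i => / (z - x i))%C n in
  (z * (z - 1) * (S ^ 2 - csumn (fun i => (/ (z - x i)) ^ 2) n))%C
    = (K / 6 - 2 * S * ((z - 1) / 3 + 3 * z / 4))%C.
Proof.
  intros Hz S. set (a := fun i => (/ (z - x i))%C).
  assert (Hza : forall i, (i < n)%nat -> (z - x i)%C <> 0) by (intros; now apply Cminus_nz, Hz).
  assert (E : (S ^ 2 - csumn (fun i => a i ^ 2) n)%C = (2 * csumn (fun i => a i * T i) n)%C).
  { unfold T. rewrite (csumn_antisymmetric n r a recip_diff_antisymmetric).
    rewrite (csumn_ext (fun i => csumn (fun k => r i k * (a i - a k))%C n) (fun i => S * a i - a i ^ 2)%C).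
    - rewrite csumn_minus, csumn_scal. unfold S. fold a. ring.
    - intros i Hi. transitivity (csumn (omit (RtoC 0) i (fun k => a i * a k)%C) n).
      + apply csumn_ext. intros k Hk.
        rewrite (recip_diff_product i k a (a i * a k)%C Hi Hk); [unfold omit; reflexivity|].
        intros _. unfold a. field. split; now apply Hza.
      + rewrite csumn_omit, csumn_scal by exact Hi. unfold S. fold a. ring. }
  change (csumn (fun i => (/ (z - x i)) ^ 2)%C n) with (csumn (fun i => a i ^ 2)%C n).
  rewrite E.
  assert (F : (z * (z - 1) * csumn (fun i => a i * T i) n)%C
    = csumn (fun i => (- ((z - 1) / 3)) * / x i + ((- (3 / 4) * z) * / (x i - 1) + (- ((z - 1) / 3) - 3 / 4 * z) * a i))%C n).
  { rewrite <- csumn_scal. apply csumn_ext. intros i Hi. rewrite T_eq by exact Hi. unfold a.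
    assert (H := Hx i Hi). assert (N := Hza i Hi). field.
    repeat split; try exact N; cbv beta; rewrite <- ?RtoC_minus; intros B; apply RtoC_inj in B; lra. }
  rewrite !csumn_plus, !csumn_scal, sum_recip, sum_recip_1 in F. fold S in F.
  transitivity (2 * (z * (z - 1) * csumn (fun i => a i * T i) n))%C; [ring|].
  rewrite F. change (csumn a n) with S. field.
Qed.

(** Once [J1^2] is replaced by [E4 J (J - 1)], [E2] drops out and [S^2 - S2] is the only quadratic
    quantity. [resolvent_identity] makes it linear, the terms in [S] cancel, and
    [- (49 / 72 + K / 3) E4] is left. *)
Lemma fn_log_cderiv (tau : C) : 0 < Im tau -> regular_pt n x tau ->
  exists d, cderiv (fn_log n x) tau (c2pi * d)%C /\
    (d - fn_log n x tau ^ 2 / 2)%C = (- ((12 * INR n + 7) ^ 2 / 72) * E4 tau)%C.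
Proof.
  intros H [R1 R2]. assert (N1 := Cminus_nz _ _ R1).
  set (S := csumn (fun i => / (J tau - x i))%C n).
  set (S2 := csumn (fun i => (/ (J tau - x i)) ^ 2)%C n).
  exists ((E2 tau ^ 2 - E4 tau) / 72 - (J2 tau / (J tau - 1) - (J1 tau / (J tau - 1)) ^ 2)
    - 2 * (J2 tau * S - J1 tau ^ 2 * S2))%C. split.
  - assert (W : forall m, (m <= n)%nat ->
      cderiv (fun t => csumn (fun i => 2 * (J1 t / (J t - x i)))%C m) tau
        (c2pi * (2 * (J2 tau * csumn (fun i => / (J tau - x i)) m - J1 tau ^ 2 * csumn (fun i => (/ (J tau - x i)) ^ 2) m)))%C).
    { induction m; intros Hm; cbn [csumn].
      - eapply cderiv_eq; [apply cderiv_const|ring].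
      - assert (N := Cminus_nz _ _ (R2 m ltac:(lia))).
        eapply cderiv_eq; [apply cderiv_plus; [apply IHm; lia|]|].
        + apply cderiv_scal, cderiv_div; [now apply J1_cderiv| |exact N].
          apply cderiv_minus; [now apply J_J1_cderiv|apply cderiv_const].
        + cbv beta. set (A := csumn _ m). set (B := csumn _ m). field. exact N. }
    unfold fn_log. eapply cderiv_eq.
    + apply cderiv_minus; [apply (cderiv_div E2 (fun _ => 6)%C); [now apply E2_cderiv|apply cderiv_const|]|].
      * intros E. apply RtoC_inj in E. lra.
      * apply cderiv_plus; [|apply (W n); lia]. apply cderiv_div; [now apply J1_cderiv| |exact N1].
        apply cderiv_minus; [now apply J_J1_cderiv|apply cderiv_const].
    + cbv beta. fold S S2. field. exact N1.
  - assert (EL : fn_log n x tau = (E2 tau / 6 - J1 tau / (J tau - 1) - 2 * J1 tau * S)%C).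
    { unfold fn_log. rewrite (csumn_ext _ (fun i => 2 * J1 tau * / (J tau - x i))%C) by (intros; unfold Cdiv; ring).
      rewrite csumn_scal. fold S. ring. }
    assert (Q := resolvent_identity (J tau) R2). cbv zeta in Q. fold S S2 in Q.
    assert (P := J1_square tau H). rewrite EL. unfold J2.
    set (j := J tau) in *. set (u := J1 tau) in *. set (e := E4 tau) in *. set (b := E2 tau) in *.
    transitivity (- (49 / 72) * e + (2 * e / 3 - e * (j / 2 + 2 * (j - 1) / 3) / (j - 1)) + u ^ 2 / (j - 1) ^ 2 / 2
      - 2 * S * (e * (j / 2 + 2 * (j - 1) / 3)) - 2 * (u ^ 2 / (j - 1)) * S - 2 * u ^ 2 * (S ^ 2 - S2))%C.
    + field. exact N1.
    + rewrite P. transitivity (- (49 / 72) * e - S * e * (3 * j + 4 * (j - 1) / 3) - 2 * e * (j * (j - 1) * (S ^ 2 - S2)))%C.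
      * field. exact N1.
      * rewrite Q. unfold K. field.
Qed.
End System.

(** * Modularity of [fn] *)

(** A multiplier is chosen for each [g]. Multiplicativity follows from the cocycle rule for
    [automorphy], evaluated at [i], where everything can be cancelled because [eta] has no zero. *)
Lemma eta4_character : exists chi : SL2Z -> C, is_character chi /\
  forall g tau, 0 < Im tau -> (eta (mobius g tau) ^ 4)%C = (chi g * automorphy g tau ^ 2 * eta tau ^ 4)%C.
Proof.
  assert (M : forall g, exists c : C, c <> 0 /\
    forall tau, 0 < Im tau -> (eta (mobius g tau) ^ 4)%C = (c * automorphy g tau ^ 2 * eta tau ^ 4)%C).
  { apply (modular_of_generators (fun t => eta t ^ 4)%C 2 (Cexp (2 * PI * Ci / 24) ^ 4)%C (- (1))%C).
    - apply Cpow_nz, Cexp_nz.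
    - intros E. apply (f_equal Re) in E. simpl in E. lra.
    - intros tau H. rewrite eta_T. apply Cpow_mult_l.
    - intros tau H. rewrite eta_S by exact H. ring. }
  assert (M' : exists chi : SL2Z -> C, forall g, chi g <> 0 /\
    forall tau, 0 < Im tau -> (eta (mobius g tau) ^ 4)%C = (chi g * automorphy g tau ^ 2 * eta tau ^ 4)%C).
  { exists (fun g => proj1_sig (constructive_indefinite_description _ (M g))).
    intros g. apply (proj2_sig (constructive_indefinite_description _ (M g))). }
  destruct M' as [chi Hchi]. exists chi.
  split; [split|].
  - intros g. apply Hchi.
  - intros g h. destruct (Hchi g) as [Hc Ec]. destruct (Hchi h) as [Hd Ed].
    destruct (Hchi (SL2Z_mul g h)) as [He Ee].
    set (c := chi g) in *. set (d := chi h) in *. set (e := chi (SL2Z_mul g h)) in *.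
    assert (H : 0 < Im Ci) by (simpl; lra).
    assert (A := Ee Ci H). rewrite mobius_mul, automorphy_mul, Ec, Ed in A by (try apply Im_mobius_pos; exact H).
    assert (N : (automorphy g (mobius h Ci) ^ 2 * automorphy h Ci ^ 2 * eta Ci ^ 4)%C <> 0).
    { apply Cmult_neq_0; [apply Cmult_neq_0|]; apply Cpow_nz; auto using automorphy_nz, Im_mobius_pos, eta_nz. }
    set (W := (automorphy g (mobius h Ci) ^ 2 * automorphy h Ci ^ 2 * eta Ci ^ 4)%C) in *.
    replace e with (e * W * / W)%C by (field; exact N).
    replace (e * W)%C with (c * d * W)%C.
    { field. exact N. }
    transitivity (c * automorphy g (mobius h Ci) ^ 2 * (d * automorphy h Ci ^ 2 * eta Ci ^ 4))%C; [unfold W; ring|].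
    rewrite A. unfold W. ring.
  - apply Hchi.
Qed.

Lemma fn_mobius (n : nat) (x : nat -> R) (g : SL2Z) (tau c : C) : 0 < Im tau ->
  (eta (mobius g tau) ^ 4)%C = (c * eta tau ^ 4)%C -> fn n x (mobius g tau) = (c * fn n x tau)%C.
Proof. intros H E. unfold fn. rewrite J_mobius, E by exact H. unfold Cdiv. ring. Qed.

(** As [eta^4 = q^(1/6) euler(q)^4], the local parameter is the sixth root [t] of the nome. [G]
    copies the formula of [fn]; [G1] has the pole of [J] cleared and is holomorphic at 0. They agree
    even at [t = 0], where both carry the factor [t]. *)
Lemma fn_meromorphic_at_cusp (n : nat) (x : nat -> R) : meromorphic_at_cusp (fn n x).
Proof.
  set (A := fun t => (e4 (t ^ 6) ^ 3)%C). set (B := fun t => (1728 * (t ^ 6 * euler (t ^ 6) ^ 24))%C).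
  set (den := fun (c : R) (t : C) => (A t / B t - c)%C).
  set (G := fun t => (t * euler (t ^ 6) ^ 4 / (den 1 t * Cprod_list (seq 0 n) (fun i => den (x i) t ^ 2)))%C).
  set (inv_den := fun (c : R) (t : C) => (B t / (A t - c * B t))%C).
  set (G1 := fun t => (t * euler (t ^ 6) ^ 4 * (inv_den 1 t * Cprod_list (seq 0 n) (fun i => inv_den (x i) t ^ 2)))%C).
  assert (Hpow6 : forall t : C, Cmod t < 1 -> Cmod (t ^ 6) < 1).
  { intros t Ht. rewrite Cmod_pow.
    assert (H0 := Cmod_ge_0 t). assert (Cmod t ^ 5 <= 1) by (rewrite <- (pow1 5); apply pow_incr; lra).
    assert (0 <= Cmod t ^ 5) by now apply pow_le. simpl in *. nra. }
  exists 6%nat, G, 0. split; [lia|]. split.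
  - left. apply hol_holomorphic_at.
    assert (H0 : Cmod 0 < 1) by (rewrite Cmod_0; lra).
    assert (Z6 : (0 ^ 6)%C = 0) by ring.
    assert (Hs : hol (fun t => t ^ 6)%C 0) by apply (hol_pow (fun t => t)), hol_id.
    assert (HA : hol A 0) by (apply (hol_pow (fun t => e4 (t ^ 6))%C), (hol_comp e4); [exact Hs|apply e4_hol; now rewrite Z6]).
    assert (He : hol (fun t => euler (t ^ 6))%C 0) by (apply (hol_comp euler); [exact Hs|apply euler_hol; now rewrite Z6]).
    assert (HB : hol B 0) by (apply hol_scal, hol_mult; [exact Hs|now apply (hol_pow (fun t => euler (t ^ 6))%C)]).
    assert (HI : forall c : R, hol (inv_den c) 0).
    { intros c. apply hol_div; [exact HB|apply hol_minus; [exact HA|now apply hol_scal]|].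
      unfold A, B. rewrite Z6, e4_0. replace (1 ^ 3 - c * (1728 * (0 * euler 0 ^ 24)))%C with (RtoC 1) by ring.
      apply C1_nz. }
    apply (hol_ext_loc G1 G 0 1 Rlt_0_1).
    + intros t Ht. replace (t - 0)%C with t in Ht by ring. unfold G, G1.
      destruct (classic (t = 0)) as [->|N]; [unfold Cdiv; ring|].
      assert (NB : B t <> 0).
      { unfold B. apply Cmult_neq_0; [intros E; apply RtoC_inj in E; lra|].
        apply Cmult_neq_0; [now apply Cpow_nz|apply Cpow_nz, euler_nz; now apply Hpow6]. }
      assert (D : forall c : R, (/ den c t)%C = inv_den c t).
      { intros c. unfold den, inv_den. replace (A t / B t - c)%C with ((A t - c * B t) * / B t)%C by (field; exact NB).
        rewrite Cinv_mult_gen. replace (/ / B t)%C with (B t) by (field; exact NB). unfold Cdiv. ring. }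
      assert (DP : forall m, (/ Cprod_list (seq 0 m) (fun i => den (x i) t ^ 2))%C = Cprod_list (seq 0 m) (fun i => inv_den (x i) t ^ 2)%C).
      { induction m; [unfold Cprod_list; simpl; field|]. rewrite !Cprod_S, Cinv_mult_gen, IHm, <- D.
        f_equal. replace (den (x m) t ^ 2)%C with (den (x m) t * den (x m) t)%C by ring. rewrite Cinv_mult_gen. ring. }
      unfold Cdiv. rewrite Cinv_mult_gen, D, DP. ring.
    + apply hol_mult; [apply hol_mult; [apply hol_id|now apply (hol_pow (fun t => euler (t ^ 6))%C)]|].
      apply hol_mult; [apply HI|]. apply (Cprod_hol n (fun i t => inv_den (x i) t ^ 2)%C).
      intros i Hi. apply (hol_pow (inv_den (x i))), HI.
  - intros tau H _. set (t := Cexp (2 * PI * Ci * tau / INR 6)).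
    assert (Et : (t ^ 6)%C = qpar tau).
    { unfold t, qpar. rewrite <- Cexp_INR_mult. f_equal. rewrite INR_IZR_INZ. simpl Z.of_nat. field. }
    assert (Ee : (eta tau ^ 4)%C = (t * euler (t ^ 6) ^ 4)%C).
    { rewrite eta_euler, Et, Cpow_mult_l. f_equal. unfold eta_root, t. rewrite <- Cexp_INR_mult. f_equal.
      rewrite !INR_IZR_INZ. simpl Z.of_nat. field. }
    assert (EJ : (A t / B t)%C = J tau) by (unfold A, B, J; now rewrite Et, Delta_euler, E4_e4).
    unfold G, fn, den. now rewrite EJ, Ee.
Qed.

(** * The Schwarz derivative *)

Lemma cderiv_C_derive_ext (f g : C -> C) (z d : C) (r : R) : 0 < r ->
  (forall w, Cmod (w - z) < r -> cderiv f w (g w)) -> cderiv g z d -> C_derive (C_derive f) z = d.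
Proof.
  intros Hr Hf Hg. apply cderiv_C_derive. apply (cderiv_ext_loc g (C_derive f) z d r Hr); [|exact Hg].
  intros w Hw. symmetry. now apply cderiv_C_derive, Hf.
Qed.

(** With [h' = f], the quotient [h'' / h'] is the logarithmic derivative of [f], that is [c2pi L];
    so the third derivative of [h] is never computed. *)
Lemma schwarzian_of_dlog (h f L : C -> C) (tau d : C) (r : R) : 0 < r ->
  (forall z, Cmod (z - tau) < r -> cderiv h z (f z) /\ dlog f z (L z) /\ f z <> 0) ->
  cderiv L tau (c2pi * d)%C -> schwarzian h tau = (c2pi ^ 2 * (d - L tau ^ 2 / 2))%C.
Proof.
  intros Hr H HL. set (g := fun z => (C_derive (C_derive h) z / C_derive h z)%C).
  change (schwarzian h tau) with (C_derive g tau - / 2 * g tau ^ 2)%C.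
  assert (Hg : forall z, Cmod (z - tau) < r -> g z = (c2pi * L z)%C).
  { intros z Hz. destruct (H z Hz) as [H1 [H2 H3]]. unfold g.
    rewrite (cderiv_C_derive _ _ _ H1).
    rewrite (cderiv_C_derive_ext h f z (c2pi * (f z * L z))%C (r - Cmod (z - tau))); [field; exact H3|lra| |exact H2].
    intros w Hw. apply H. now apply near_trans with z. }
  rewrite (cderiv_C_derive g tau (c2pi * (c2pi * d))%C).
  - rewrite Hg by (rewrite Cmod_sub_self; exact Hr). field.
  - apply (cderiv_ext_loc (fun z => c2pi * L z)%C g tau _ r Hr); [intros w Hw; symmetry; now apply Hg|].
    now apply cderiv_scal.
Qed.

Lemma regular_pt_open (n : nat) (x : nat -> R) (tau : C) : 0 < Im tau -> regular_pt n x tau ->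
  exists r, 0 < r /\ forall z, Cmod (z - tau) < r -> 0 < Im z /\ regular_pt n x z.
Proof.
  intros H [R1 R2]. assert (HC := hol_ccont J tau (J_hol tau H)).
  assert (W : forall c, J tau <> c -> exists r, 0 < r /\ forall z, Cmod (z - tau) < r -> J z <> c).
  { intros c Hc. destruct (ccont_away J tau c HC Hc) as [r [Hr Hz]]. exists r. split; [exact Hr|].
    intros z Hzr E. specialize (Hz z Hzr). rewrite E, Cmod_sub_self in Hz.
    assert (0 < Cmod (J tau - c)) by now apply Cmod_gt_0, Cminus_nz. lra. }
  induction n.
  - destruct (W 1 R1) as [r [Hr Hz]]. exists (Rmin r (Im tau)). split; [now apply Rmin_glb_lt|].
    intros z Hzr. generalize (Rmin_l r (Im tau)) (Rmin_r r (Im tau)). intros.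
    split; [apply (upper_near tau); [exact H|lra]|]. split; [apply Hz; lra|]. intros i Hi. lia.
  - destruct IHn as [r [Hr Hz]]; [intros i Hi; apply R2; lia|].
    destruct (W (x n) (R2 n ltac:(lia))) as [s [Hs Hzs]].
    exists (Rmin r s). split; [now apply Rmin_glb_lt|].
    intros z Hzr. generalize (Rmin_l r s) (Rmin_r r s). intros.
    destruct (Hz z ltac:(lra)) as [Z1 [Z2 Z3]]. split; [exact Z1|]. split; [exact Z2|].
    intros i Hi. destruct (Nat.eq_dec i n) as [->|E]; [apply Hzs; lra|apply Z3; lia].
Qed.

(** * Poles and primitives of the form for a solution of the system *)

Section Main.
Context (n : nat) (x : nat -> R).
Context (Hx : forall i, (i < n)%nat -> 0 < x i < 1).
Context (HE : solves_E_4_9_12 n x).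

Lemma fn_double_pole (tau : C) : 0 < Im tau -> ~ regular_pt n x tau -> double_pole (fn n x) tau.
Proof.
  intros H R. destruct (solves_residue_system n x Hx HE) as [Hs Hd].
  destruct (classic (J tau = 1)) as [E|E]; [exact (fn_pole_at_i n x tau H Hx E)|].
  destruct (classic (exists i, (i < n)%nat /\ J tau = x i)) as [[i [Hi Ei]]|N]; [exact (fn_pole_at_w n x tau i H Hx Hs Hd Hi Ei)|].
  exfalso. apply R. split; [exact E|]. intros i Hi Ei. apply N. exists i. exact (conj Hi Ei).
Qed.

Lemma fn_pole_iff (tau : C) : 0 < Im tau -> (is_pole (fn n x) tau <-> ~ regular_pt n x tau).
Proof.
  intros H. split.
  - intros P R. revert P. apply ccont_not_pole, hol_ccont. now apply fn_hol.
  - intros R. now apply double_pole_is_pole, fn_double_pole.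
Qed.

Lemma fn_not_pole (tau : C) : 0 < Im tau -> ~ is_pole (fn n x) tau -> regular_pt n x tau.
Proof. intros H P. apply NNPP. intros R. now apply P, fn_pole_iff. Qed.

Lemma fn_meromorphic_on_H : meromorphic_on_H (fn n x).
Proof.
  intros tau H. destruct (classic (regular_pt n x tau)) as [R|R].
  - left. now apply hol_holomorphic_at, fn_hol.
  - right. now apply fn_pole_iff.
Qed.

(** Off its own poles [h] is holomorphic with derivative [fn] on a whole disc. By
    [double_pole_no_primitive] the centre cannot be a pole of [fn], so it is a regular point, where
    [fn_log] is available. *)
Lemma primitive_schwarzian (h : C -> C) (tau : C) : is_primitive_on_H h (fn n x) -> 0 < Im tau ->
  ~ is_pole h tau ->
  schwarzian h tau = (RtoC (2 * PI ^ 2 * ((12 * INR n + 7) ^ 2 / 6 ^ 2)) * E4 tau)%C.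
Proof.
  intros [Hm Hp] H Hn. destruct (Hm tau H) as [Hh|Hh]; [|contradiction].
  destruct Hh as [r0 [Hr0 Hh]].
  assert (D : forall z, Cmod (z - tau) < Rmin r0 (Im tau) -> cderiv h z (fn n x z)).
  { intros z Hz. generalize (Rmin_l r0 (Im tau)) (Rmin_r r0 (Im tau)). intros.
    apply cderiv_is_derive, Hp; [apply (upper_near tau); [exact H|lra]|].
    apply holomorphic_at_not_pole. exists (r0 - Cmod (z - tau)). split; [lra|].
    intros w Hw. apply Hh. apply near_trans with z; lra. }
  assert (Hmin : 0 < Rmin r0 (Im tau)) by now apply Rmin_glb_lt.
  assert (R : regular_pt n x tau).
  { apply NNPP. intros R. apply (double_pole_no_primitive (fn n x) h tau _ Hmin); [now apply fn_double_pole|exact D]. }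
  destruct (regular_pt_open n x tau H R) as [r1 [Hr1 Ho]].
  destruct (solves_residue_system n x Hx HE) as [Hs Hd].
  destruct (fn_log_cderiv n x Hx Hd Hs tau H R) as [d [Hd1 Hd2]].
  rewrite (schwarzian_of_dlog h (fn n x) (fn_log n x) tau d (Rmin (Rmin r0 (Im tau)) r1)); [| | |exact Hd1].
  - rewrite Hd2. unfold c2pi.
    replace ((2 * PI * Ci) ^ 2)%C with (- (4) * PI ^ 2 * (- (1) * (Ci * Ci)) * - (1) * - (1))%C by ring.
    replace (Ci * Ci)%C with (- (1))%C by (apply C_ext; simpl; ring).
    rewrite RtoC_mult, RtoC_mult, RtoC_div, !RtoC_pow, RtoC_plus, RtoC_mult by (apply pow_nonzero; lra).
    field.
  - now apply Rmin_glb_lt.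
  - intros z Hz. generalize (Rmin_l (Rmin r0 (Im tau)) r1) (Rmin_r (Rmin r0 (Im tau)) r1). intros.
    destruct (Ho z ltac:(lra)) as [Z1 Z2]. split; [apply D; lra|]. split; [now apply fn_dlog|now apply fn_nz].
Qed.

(** The fibre of [J] over 1 is the zero set of [E6], one orbit; the fibre over [x_i] is a single
    orbit by [J_inj], which is where [x_i] in (0,1) enters. *)
Lemma regular_pt_orbits (w : nat -> C) (tau : C) : (forall i, (i < n)%nat -> 0 < Im (w i)) ->
  (forall i, (i < n)%nat -> J (w i) = RtoC (x i)) -> 0 < Im tau ->
  (~ regular_pt n x tau <-> SL2Z_equiv tau Ci \/ exists i, (i < n)%nat /\ SL2Z_equiv tau (w i)).
Proof.
  intros Hw HJ H. split.
  - intros R. destruct (classic (J tau = 1)) as [E|E].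
    + left. apply E6_zero_equiv; [exact H|].
      assert (A := J_minus_1 tau H). assert (HD := Delta_nz tau H). rewrite E in A.
      apply NNPP. intros N. apply (Cpow_nz (E6 tau) 2 N).
      replace (E6 tau ^ 2)%C with (E6 tau ^ 2 / (1728 * Defs.Delta tau) * (1728 * Defs.Delta tau))%C by (field; exact HD).
      rewrite <- A. ring.
    + right. apply NNPP. intros N. apply R. split; [exact E|]. intros i Hi Ei. apply N. exists i.
      split; [exact Hi|]. apply J_inj with (x i); auto.
  - intros [E|[i [Hi [g ->]]]] [R1 R2].
    + apply R1. apply E6_zero_equiv in E; [|exact H].
      replace (J tau) with ((J tau - 1) + 1)%C by ring. rewrite J_minus_1, E by exact H. unfold Cdiv. ring.
    + apply (R2 i Hi). rewrite J_mobius by now apply Hw. now apply HJ.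
Qed.
End Main.

Theorem theorem3p1 (n : nat) (x : nat -> R) (w : nat -> C)
    (hx : forall i, (i < n)%nat -> 0 < x i < 1)
    (hE : solves_E_4_9_12 n x)
    (hw : forall i, (i < n)%nat -> upper_half_plane (w i))
    (hJ : forall i, (i < n)%nat -> J (w i) = RtoC (x i)) :
  (exists chi : SL2Z -> C,
     is_character chi /\ meromorphic_modular_form 2 chi (fn n x)) /\
  (forall tau, upper_half_plane tau -> ~ is_pole (fn n x) tau ->
     fn n x tau <> RtoC 0) /\
  (forall tau, upper_half_plane tau ->
     (is_pole (fn n x) tau <->
      SL2Z_equiv tau Ci \/
      exists i, (i < n)%nat /\ SL2Z_equiv tau (w i))) /\
  (forall tau, upper_half_plane tau -> is_pole (fn n x) tau ->
     pole_of_order (fn n x) tau 2 /\ is_residue (fn n x) tau (RtoC 0)) /\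
  (forall h : C -> C, is_primitive_on_H h (fn n x) ->
     forall tau, upper_half_plane tau -> ~ is_pole h tau ->
       schwarzian h tau =
       (RtoC (2 * PI ^ 2 * ((12 * INR n + 7) ^ 2 / 6 ^ 2)) * E4 tau)%C).
Proof.
  split; [|split; [|split; [|split]]].
  - destruct eta4_character as [chi [Hchi Heta]]. exists chi. split; [exact Hchi|].
    split; [now apply fn_meromorphic_on_H|]. split; [|apply fn_meromorphic_at_cusp].
    intros g tau H _. apply fn_mobius; [exact H|now apply Heta].
  - intros tau H P. apply fn_nz; [exact H|]. exact (fn_not_pole n x hx hE tau H P).
  - intros tau H. rewrite (fn_pole_iff n x hx hE tau H). exact (regular_pt_orbits n x hx w tau hw hJ H).
  - intros tau H P. apply double_pole_order, (fn_double_pole n x hx hE tau H).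
    now apply (fn_pole_iff n x hx hE tau H).
  - intros h Hh tau H P. exact (primitive_schwarzian n x hx hE h tau Hh H P).
Qed.
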